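(* Let $0<s<1$, $1<p<\infty$, and let $\Omega\subset\mathbb{R}^n$ be a bounded open set. If $sp<n$ put $p^*=\frac{np}{n-sp}$. Let $W:\mathbb{R}^n\times\mathbb{R}^n\times\mathbb{R}^{n\times n}\to\mathbb{R}$ be a function, written $W(x,u,F)$, satisfying: (a) $W(\cdot,u,F)$ is measurable for every $(u,F)\in\mathbb{R}^n\times\mathbb{R}^{n\times n}$ and $W(x,\cdot,\cdot)$ is of class $C^1$ for a.e. $x\in\mathbb{R}^n$. (b) There exist $a\in L^1(\mathbb{R}^n)$, a real number $\alpha$ with $\alpha\in[p,p^*]$ if $sp<n$ and $\alpha\in[p,\infty)$ if $sp\ge n$, and $c>0$ such that $$|W(x,u,F)|+\left|\frac{\partial W}{\partial u}(x,u,F)\right|+\left|\frac{\partial W}{\partial F}(x,u,F)\right|\le a(x)+c\left(|u|^\alpha+|F|^p\right)$$ for a.e. $x\in\mathbb{R}^n$ and all $(u,F)\in\mathbb{R}^n\times\mathbb{R}^{n\times n}$. Let $g\in H^{s,p}(\mathbb{R}^n,\mathbb{R}^n)$, define $I(u)=\int_{\mathbb{R}^n}W(x,u(x),D^su(x))\,dx$, and let $u$ be a minimizer of $I$ in $H^{s,p}_g(\Omega,\mathbb{R}^n)$. Then $u$ is a weak solution of the fractional system $$\begin{cases}\operatorname{div}^s\left(\frac{\partial W}{\partial F}(x,u,D^su)\right)=\frac{\partial W}{\partial u}(x,u,D^su)&\text{in }\Omega,\\ u=g&\text{in }\Omega^c,\end{cases}$$ that is, $u\in H^{s,p}_g(\Omega,\mathbb{R}^n)$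 and $$\int_{\mathbb{R}^n}\left[\frac{\partial W}{\partial F}(x,u,D^su)\cdot D^sv+\frac{\partial W}{\partial u}(x,u,D^su)\cdot v\right]dx=0$$ for all $v\in C_c^\infty(\mathbb{R}^n,\mathbb{R}^n)$ with $v=0$ in $\Omega^c$.
   Context: Principal value: $\operatorname{pv}_x\int f=\lim_{r\to0}\int_{B(x,r)^c}f$; integrals without domain are over $\mathbb{R}^n$. Constant: $c_{n,s}=-(n+s-1)\dfrac{\Gamma\left(\frac{n+s-1}{2}\right)}{\pi^{n/2}\,2^{1-s}\,\Gamma\left(\frac{1-s}{2}\right)}$. Fractional gradient of $u:\mathbb{R}^n\to\mathbb{R}^m$: $D^su(x)=c_{n,s}\operatorname{pv}_x\int\frac{u(x)-u(y)}{|x-y|^{n+s}}\otimes\frac{x-y}{|x-y|}\,dy\in\mathbb{R}^{m\times n}$ (rows indexed by components of $u$). For $1<p<\infty$, $H^{s,p}(\mathbb{R}^n,\mathbb{R}^m)=\{u\in L^p:\ D^su\in L^p\}$, normed by $\|u\|_{L^p}+\|D^su\|_{L^p}$. It is identified, with equivalent norms, with the Bessel potential space $\{u\in L^p:\mathcal{F}^{-1}((1+|\xi|^2)^{s/2}\hat u)\in L^p\}$; in particular $C_c^\infty$ is dense, and $D^su$ for general $u\in H^{s,p}$ is the $L^p$-limit of $D^su_j$ for $u_j\in C_c^\infty$ converging to $u$ in this space. $H^{s,p}_g(\Omega,\mathbb{R}^n)=\{u\in H^{s,p}(\mathbb{R}^n,\mathbb{R}^n): u=g\text{ a.e. in }\Omega^c\}$.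 The fractional divergence $\operatorname{div}^s\phi(x)=-c_{n,s}\operatorname{pv}_x\int\frac{\phi(x)+\phi(y)}{|x-y|^{n+s}}\cdot\frac{x-y}{|x-y|}\,dy$ is applied row by row to matrix fields; the system is understood only in the weak sense given in the claim. The dot between matrices is the Frobenius inner product. *)

(* Defs.v *)
From HB Require Import structures.
From mathcomp Require Import all_boot all_order all_algebra.
From mathcomp Require Import all_classical all_reals all_analysis.

Set Implicit Arguments.
Unset Strict Implicit.
Unset Printing Implicit Defensive.

Import Order.TTheory GRing.Theory Num.Theory.
Import numFieldNormedType.Exports.

Local Open Scope classical_set_scope.
Local Open Scope ring_scope.

Section borel_rV.
Context (R : realType) (n : nat).

Definition coord_rV (i : 'I_n) (x : 'rV[R]_n) : R := x 0 i.

Let rV_set0 : g_sigma_preimage coord_rV set0.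
Proof. exact: sigma_algebra0. Qed.

Let rV_setC A : g_sigma_preimage coord_rV A -> g_sigma_preimage coord_rV (~` A).
Proof. exact: sigma_algebraC. Qed.

Let rV_bigcup (F : _^nat) : (forall i, g_sigma_preimage coord_rV (F i)) ->
  g_sigma_preimage coord_rV (\bigcup_i (F i)).
Proof. exact: sigma_algebra_bigcup. Qed.

HB.instance Definition _ := @isMeasurable.Build default_measure_display
  'rV[R]_n (g_sigma_preimage coord_rV) rV_set0 rV_setC rV_bigcup.

Lemma measurable_coord_rV i : measurable_fun [set: 'rV[R]_n] (coord_rV i).
Proof.
move=> _ Y mY; rewrite setTI; apply: sub_sigma_algebra => /=.
rewrite -bigcup_seq/=; exists i => /=; first by rewrite mem_index_enum.
by exists Y => //; rewrite setTI.
Qed.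

Lemma measurable_fun_rV d (T : measurableType d) (f : T -> 'rV[R]_n) :
  (forall i, measurable_fun [set: T] (coord_rV i \o f)) ->
  measurable_fun [set: T] f.
Proof.
move=> mf _ A mA; rewrite setTI.
suff : g_sigma_preimage coord_rV `<=` [set B | measurable (f @^-1` B)].
  exact.
apply: smallest_sub => [|B].
  split => /=; first by rewrite preimage_set0.
    by move=> B mB; rewrite setTD preimage_setC; exact: measurableC.
  by move=> F mF; rewrite preimage_bigcup; exact: bigcup_measurable.
rewrite -bigcup_seq/= => -[i _ [C mC <-]]; rewrite setTI /=.
by have := mf i measurableT C mC; rewrite setTI.
Qed.

End borel_rV.

Section lebesgue_rV.
Context (R : realType).

Definition cons_rV n (z : R * 'rV[R]_n) : 'rV[R]_n.+1 :=
  row_mx (z.1%:M : 'rV[R]_1) z.2.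

Definition uncons_rV n (x : 'rV[R]_n.+1) : R * 'rV[R]_n :=
  (x 0 0, rsubmx (x : 'rV[R]_(1 + n))).

Lemma cons_rVK n : cancel (@cons_rV n) (@uncons_rV n).
Proof.
case=> a x; rewrite /uncons_rV /cons_rV /= row_mxKr; congr (_, _).
transitivity ((row_mx (a%:M : 'rV[R]_1) x) 0 (lshift n 0)).
  by congr (fun_of_matrix _ _ _); exact: val_inj.
by rewrite row_mxEl mxE eqxx mulr1n.
Qed.

Lemma measurable_cons_rV n : measurable_fun setT (@cons_rV n).
Proof.
apply: measurable_fun_rV => i.
rewrite -(splitK (i : 'I_(1 + n))); case: (fintype.split _) => j /=.
  have -> : @coord_rV R n.+1 (lshift n j) \o @cons_rV n = fst.
    apply/funext => -[a x] /=.
    by rewrite /coord_rV /cons_rV [LHS]row_mxEl !ord1 mxE eqxx mulr1n.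
  exact: measurable_fst.
have -> : @coord_rV R n.+1 (rshift 1 j) \o @cons_rV n = @coord_rV R n j \o snd.
  by apply/funext => -[a x]; rewrite /coord_rV /cons_rV /= [LHS]row_mxEr.
by apply: measurableT_comp => //; exact: measurable_coord_rV.
Qed.

Lemma measurable_uncons_rV n : measurable_fun setT (@uncons_rV n).
Proof.
apply/measurable_fun_pairP; split; first exact: (measurable_coord_rV 0).
apply: measurable_fun_rV => i.
have -> : coord_rV i \o (snd \o @uncons_rV n) = @coord_rV R n.+1 (rshift 1 i).
  by apply/funext => x; rewrite /coord_rV /= mxE.
exact: measurable_coord_rV.
Qed.

Lemma product_sigma_finite d1 d2 (T1 : measurableType d1)
    (T2 : measurableType d2)
    (m1 : {sigma_finite_measure set T1 -> \bar R})
    (m2 : {sigma_finite_measure set T2 -> \bar R}) :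
  sigma_finite setT (m1 \x m2)%E.
Proof.
have /sigma_finiteP[F [TF ndF Foo]] := sigma_finiteT m1.
have /sigma_finiteP[G [TG ndG Goo]] := sigma_finiteT m2.
exists (fun n => F n `*` G n).
  rewrite -setXTT TF TG predeqE => -[x y]; split.
    move=> [/= [n _ Fnx] [k _ Gky]]; exists (maxn n k) => //; split.
    - by move: x Fnx; exact/subsetPset/ndF/leq_maxl.
    - by move: y Gky; exact/subsetPset/ndG/leq_maxr.
  by move=> [n _ []/= ? ?]; split; exists n.
move=> k; have [? ?] := Foo k; have [? ?] := Goo k.
split; first exact: measurableX.
by rewrite product_measure1E// lte_mul_pinfty// ge0_fin_numE.
Qed.

Section step.
Context (n : nat) (mu : {sigma_finite_measure set 'rV[R]_n -> \bar R}).
Local Open Scope ereal_scope.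

Definition lebesgue_step : set 'rV[R]_n.+1 -> \bar R :=
  pushforward (@lebesgue_measure R \x mu) (@cons_rV n).

Let mcons := @measurable_cons_rV n.

Let step0 : lebesgue_step set0 = 0.
Proof. by rewrite /lebesgue_step /pushforward preimage_set0 measure0. Qed.

Let step_ge0 A : 0 <= lebesgue_step A.
Proof. exact: measure_ge0. Qed.

Let step_sigma_additive : semi_sigma_additive lebesgue_step.
Proof.
move=> F mF tF mUF; rewrite /lebesgue_step /pushforward preimage_bigcup.
apply: measure_semi_sigma_additive.
- by move=> i; rewrite -[X in measurable X]setTI; exact: mcons.
- apply/trivIsetP => /= i j _ _ ij; rewrite -preimage_setI.
  by move/trivIsetP : tF => /(_ _ _ _ _ ij) ->//; rewrite preimage_set0.
- by rewrite -preimage_bigcup -[X in measurable X]setTI; exact: mcons.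
Qed.

HB.instance Definition _ := isMeasure.Build _ _ _ lebesgue_step
  step0 step_ge0 step_sigma_additive.

Let step_sigma_finite : sigma_finite setT lebesgue_step.
Proof.
have [F FT mF] := product_sigma_finite (@lebesgue_measure R) mu.
exists (fun i => @uncons_rV n @^-1` F i).
  by rewrite -preimage_bigcup -FT preimage_setT.
move=> i; have [mFi Foo] := mF i; split.
  by rewrite -[X in measurable X]setTI; exact: measurable_uncons_rV.
rewrite /lebesgue_step /pushforward -comp_preimage.
by rewrite (_ : _ \o _ = id) //; apply/funext => z /=; rewrite cons_rVK.
Qed.

HB.instance Definition _ := Measure_isSigmaFinite.Build _ _ _ lebesgue_step
  step_sigma_finite.

End step.

(* lebesgue_measure \x ... \x lebesgue_measure, on the Borel sets of 'rV[R]_n *)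
Fixpoint borel_lebesgue n : {sigma_finite_measure set 'rV[R]_n -> \bar R} :=
  if n is k.+1 then lebesgue_step (borel_lebesgue k) else \d_(0 : 'rV[R]_0).

End lebesgue_rV.

(* R^n with the Lebesgue (completed Borel) sigma-algebra; as a type it is
   'rV[R]_n *)
Definition Leb_space (R : realType) (n : nat) : measurableType _ :=
  caratheodory_type ((borel_lebesgue R n)^*)%mu.

Definition leb (R : realType) (n : nat) :
    {measure set (Leb_space R n) -> \bar R} :=
  @completed_measure_extension _ _ _ (borel_lebesgue R n).

Section norms.
Context {R : realType}.

(* The library norm on matrices is the sup norm; these are the Euclidean
   (Frobenius) norm and inner product. *)
Definition fnorm m n (A : 'M[R]_(m, n)) : R :=
  Num.sqrt (\sum_i \sum_j A i j ^+ 2).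

Definition fdot m n (A B : 'M[R]_(m, n)) : R := \sum_i \sum_j A i j * B i j.

Definition gradient m n (f : 'M[R]_(m, n) -> R) (A : 'M[R]_(m, n)) :
    'M[R]_(m, n) :=
  \matrix_(i, j) 'D_(delta_mx i j) f A.

(* For finite-dimensional V, continuity of all the 'D_v f is continuity of the
   derivative. *)
Definition C1 (V : normedModType R) (f : V -> R) : Prop :=
  (forall z, differentiable f z) /\ forall v, continuous ('D_v f).

Definition Lp_norm n (p : R) m k (f : 'rV[R]_n -> 'M[R]_(m, k)) : \bar R :=
  Lnorm (leb R n) p%:E (fun x => (fnorm (f x))%:E).

Definition in_Lp n (p : R) m k (f : 'rV[R]_n -> 'M[R]_(m, k)) : Prop :=
  (forall i j, measurable_fun [set: Leb_space R n] (fun x => f x i j)) /\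
  (Lp_norm p f < +oo)%E.

End norms.

Section smooth.
Context {R : realType} {n m : nat}.

Definition iter_partial (l : seq 'I_n) (f : 'rV[R]_n -> 'rV[R]_m) :
    'rV[R]_n -> 'rV[R]_m :=
  foldr (fun i h => 'D_(delta_mx 0 i : 'rV[R]_n) h) f l.

Definition smooth (f : 'rV[R]_n -> 'rV[R]_m) : Prop :=
  forall l : seq 'I_n, continuous (iter_partial l f) /\
    forall i x, derivable (iter_partial l f) x (delta_mx 0 i).

Definition Cc_infty : set ('rV[R]_n -> 'rV[R]_m) :=
  [set f | smooth f /\ compact (closure [set x | f x != 0])].

End smooth.

Section fractional_gradient.
Context {R : realType}.

Definition Gamma (t : R) : R :=
  \int[lebesgue_measure]_(x in `]0, +oo[) (x `^ (t - 1) * expR (- x)).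

Definition c_frac (n : nat) (s : R) : R :=
  - (n%:R + s - 1) * (Gamma ((n%:R + s - 1) / 2) /
      (pi `^ (n%:R / 2) * 2 `^ (1 - s) * Gamma ((1 - s) / 2))).

Definition eball n (x : 'rV[R]_n) (r : R) : set 'rV[R]_n :=
  [set y | fnorm (y - x) < r].

Definition pv n (x : 'rV[R]_n) (f : 'rV[R]_n -> R) : R :=
  lim ((\int[leb R n]_(y in ~` eball x r) f y) @[r --> 0^'+]).

(* D^s u by the pointwise formula; only used for u in C_c^infty, where the
   integrals converge absolutely and the limit exists. *)
Definition frac_grad n m (s : R) (u : 'rV[R]_n -> 'rV[R]_m) (x : 'rV[R]_n) :
    'M[R]_(m, n) :=
  c_frac n s *: \matrix_(i, j) pv x (fun y =>
    (u x - u y) 0 i / fnorm (x - y) `^ (n%:R + s) *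
    ((x - y) 0 j / fnorm (x - y))).

(* G is the L^p limit of D^s u_j for some u_j in C_c^infty with u_j --> u in
   L^p; such a G is unique up to a.e. equality. *)
Definition is_frac_grad n m (s p : R) (u : 'rV[R]_n -> 'rV[R]_m)
    (G : 'rV[R]_n -> 'M[R]_(m, n)) : Prop :=
  in_Lp p G /\
  exists2 u_ : nat -> 'rV[R]_n -> 'rV[R]_m,
    forall j, Cc_infty (u_ j) &
    (Lp_norm p (fun x => u_ j x - u x) @[j --> \oo] --> 0%E) /\
    (Lp_norm p (fun x => frac_grad s (u_ j) x - G x) @[j --> \oo] --> 0%E).

Definition Hsp n m (s p : R) : set ('rV[R]_n -> 'rV[R]_m) :=
  [set u | in_Lp p u /\ exists G, is_frac_grad s p u G].

(* D^s u for u in H^{s,p}, as a chosen representative of its a.e. class. *)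
Definition Hsp_grad n m (s p : R) (u : 'rV[R]_n -> 'rV[R]_m) :
    'rV[R]_n -> 'M[R]_(m, n) :=
  xget (fun=> 0) [set G | is_frac_grad s p u G].

Definition Hsp_g n m (s p : R) (Omega : set 'rV[R]_n)
    (g : 'rV[R]_n -> 'rV[R]_m) : set ('rV[R]_n -> 'rV[R]_m) :=
  [set u | Hsp s p u /\ {ae leb R n, forall x, (~` Omega) x -> u x = g x}].

End fractional_gradient.

Section variational.
Context {R : realType} {n : nat}.
Implicit Types (W : 'rV[R]_n -> 'rV[R]_n -> 'M[R]_n -> R)
  (u v g : 'rV[R]_n -> 'rV[R]_n).

Definition dW_du W (x z : 'rV[R]_n) (F : 'M[R]_n) : 'rV[R]_n :=
  gradient (fun z' => W x z' F) z.

Definition dW_dF W (x z : 'rV[R]_n) (F : 'M[R]_n) : 'M[R]_n :=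
  gradient (W x z) F.

Definition energy (s p : R) W u : \bar R :=
  (\int[leb R n]_x (W x (u x) (Hsp_grad s p u x))%:E)%E.

Definition minimizer (s p : R) Omega g W u : Prop :=
  Hsp_g s p Omega g u /\
  forall w, Hsp_g s p Omega g w -> (energy s p W u <= energy s p W w)%E.

Definition weak_solution (s p : R) Omega g W u : Prop :=
  Hsp_g s p Omega g u /\
  forall v, Cc_infty v -> (forall x, (~` Omega) x -> v x = 0) ->
    (\int[leb R n]_x
       (fdot (dW_dF W x (u x) (Hsp_grad s p u x)) (frac_grad s v x) +
        fdot (dW_du W x (u x) (Hsp_grad s p u x)) (v x))%:E = 0)%E.

End variational.

(* Main.v *)
(** For real t, [u + t v] is admissible and its fractional gradient is
    [D^s u + t D^s v], so t |-> I(u + t v) is minimal at t = 0; its difference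
    quotients converge to the weak form by dominated convergence, since [v] and
    [D^s v] are bounded.

    Two facts about H^{s,p} enter.  The L^p limit of [D^s u_j] depends only on
    the limit of [u_j]: if [w_j] tends to 0, so does the pairing of [D^s w_j]
    with any Lipschitz function of compact support, because [D^s] is
    antisymmetric.  And [u] lies in L^alpha, by a fractional Sobolev inequality.
    The Riesz potential of the gradient of [f] is (n + s - 1) times the singular
    integral of [f]; the Riesz potential of the field z 1_{annulus}(z) is, by
    symmetry under reflections, a radial field [bump y * y] with [0 <= bump].
    Averaging [f x - f (x - y)], integrated along segments, against [bump]
    therefore bounds |f| by the convolution of |f| + |D^s f| with |y|^{s' - n},
    0 < s' <= s, and the Hardy-Littlewood-Sobolev inequality applies. *)

Require Import Defs.
From mathcomp Require Import all_boot all_order all_algebra.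
From mathcomp Require Import all_classical all_reals all_analysis.
From mathcomp Require Import measurable_realfun ring lra.

Set Implicit Arguments.
Unset Strict Implicit.
Unset Printing Implicit Defensive.

Import Order.TTheory GRing.Theory Num.Theory.
Import numFieldNormedType.Exports.

Local Open Scope classical_set_scope.
Local Open Scope ring_scope.

(** On test functions [D^s] is defined by a principal value, but for Lipschitz [f] the difference
    [f x - f (x - w)] already makes the integral converge absolutely. Every estimate is therefore
    carried by the ordinary integral [Dop]. Fubini arguments ask for a product measure, which the
    completed measure is not, so they run on Borel sets, and Lebesgue measurable functions are
    reached through Borel representatives.

    [Hsp_grad] is a choice among limits that agree almost everywhere. Without their uniqueness the
    energy at [u + t v] could not be written through the gradient chosen at [u]. The exponent
    [alpha] matters because the derivatives of [W] are controlled only by the bound on [W] itself: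
    the direction has to be bounded, and the bound has to be integrable along the segment from [u].

    In the Sobolev inequality the scale [t] produces the kernel: [pot] is homogeneous of degree
    [1 - n - s], so the contribution of scale [t] carries the weight [t ^ (s - 1)], and summing over
    scales gives [|y| ^ (s - n)]. Since [t <= 1], the exponent may be lowered to any [s' <= s],
    which makes every power between [p] and the critical one accessible. *)

(** * Affine changes of variables for the Borel-Lebesgue measure *)

Section affine_change.
Context {R : realType}.

Lemma measurable_affine1 (a c : R) : measurable_fun setT (fun x : R => a + c * x).
Proof. by apply: measurable_funD => //; apply: measurable_funM. Qed.

(** Both sides are measures in [A], so agreement on half-open intervals suffices. For [c < 0] the
    preimage of such an interval is half-open at the other end, which leaves its length
    unchanged. *)
Lemma lebesgue_measure_affine (a c : R) (A : set R) : c != 0 -> measurable A ->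
  (`|c|%:E * lebesgue_measure ((fun x : R => (a + c * x)%R) @^-1` A) = lebesgue_measure A)%E.
Proof.
move=> c0 mA; have mf := measurable_affine1 a c.
pose m' := mscale (NngNum (normr_ge0 c))
  (pushforward (@lebesgue_measure R) (fun x : measurableTypeR R => a + c * x : measurableTypeR R)).
symmetry; apply: (@lebesgue_measure_unique R (m' mf)) => // _ [[x y] _ <-] /=.
rewrite /m' /mscale /= /pushforward.
have [cp|cn] : 0 < c \/ c < 0 by move: c0; rewrite neq_lt => /orP[]; auto.
  have -> : (fun z => a + c * z) @^-1` `]x, y]%classic = `](x - a) / c, (y - a) / c]%classic.
    by apply/seteqP; split => z /=; rewrite !in_itv /= ltr_pdivrMr // ler_pdivlMr // ltrBlDl lerBrDl (mulrC z).
  rewrite !lebesgue_measure_itv /= !lte_fin ltr_pM2r ?invr_gt0 // ltrBlDr subrK.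
  case: ifP => _; last by rewrite mule0.
  by rewrite -EFinD -EFinM gtr0_norm // -mulrBl mulrC -mulrA mulVf // mulr1; congr (_%:E); ring.
have -> : (fun z => a + c * z) @^-1` `]x, y]%classic = `[(y - a) / c, (x - a) / c[%classic.
  apply/seteqP; split => z /=; rewrite !in_itv /= ltr_ndivlMr // ler_ndivrMr // ltrBlDl lerBrDl (mulrC z).
    by move=> /andP[-> ->].
  by move=> /andP[-> ->].
rewrite !lebesgue_measure_itv /= !lte_fin ltr_nM2r ?invr_lt0 // ltrBlDr subrK.
case: ifP => _; last by rewrite mule0.
by rewrite -EFinD -EFinM ltr0_norm // -mulrBl mulNr mulrC -mulrA mulVf // mulr1; congr (_%:E); ring.
Qed.

Lemma ge0_integral_affine1 (a c : R) (f : R -> \bar R) : c != 0 ->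
  measurable_fun setT f -> (forall x, 0 <= f x)%E ->
  (\int[lebesgue_measure]_x f (a + c * x)%R =
   `|c|^-1%:E * \int[lebesgue_measure]_x f x)%E.
Proof.
move=> c0 mf f0; have mh := measurable_affine1 a c.
have Hk : (0 <= `|c|^-1)%R by rewrite invr_ge0.
have <- := @ge0_integral_mscale _ (measurableTypeR R) R (@lebesgue_measure R) setT measurableT (NngNum Hk) f mf (fun x _ => f0 x).
transitivity (\int[pushforward (@lebesgue_measure R)
    (fun x : measurableTypeR R => (a + c * x)%R : measurableTypeR R)]_y f y)%E.
  by rewrite ge0_integral_pushforward // ?preimage_setT // => x _; exact: f0.
apply: eq_measure_integral => A mA _; rewrite /mscale /= /pushforward.
transitivity (`|c|^-1%:E * lebesgue_measure A)%E => //.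
rewrite -(lebesgue_measure_affine a c0 mA) muleA -EFinM mulVf ?mul1e //.
by rewrite normr_eq0.
Qed.

Lemma measurable_rV_comb n (a : 'rV[R]_n) (c : R) :
  measurable_fun setT (fun x : 'rV[R]_n => a + c *: x).
Proof.
apply: measurable_fun_rV => i.
have -> : coord_rV i \o (fun x : 'rV[R]_n => a + c *: x) =
   (fun x => a 0 i + c * coord_rV i x) by apply/funext => x; rewrite /coord_rV /= !mxE.
by apply: measurable_funD => //; apply: measurable_funM => //; exact: measurable_coord_rV.
Qed.

Lemma ge0_integral_rVS n (f : 'rV[R]_n.+1 -> \bar R) :
  measurable_fun setT f -> (forall x, 0 <= f x)%E ->
  (\int[borel_lebesgue R n.+1]_x f x =
   \int[lebesgue_measure]_t \int[borel_lebesgue R n]_x f (cons_rV (t, x)))%E.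
Proof.
move=> mf f0.
transitivity (\int[pushforward (@lebesgue_measure R \x borel_lebesgue R n) (@cons_rV R n)]_x f x)%E => //.
rewrite ge0_integral_pushforward //; last exact: measurable_cons_rV.
rewrite preimage_setT fubini_tonelli1 //.
  by apply: measurableT_comp => //; exact: measurable_cons_rV.
by move=> x; exact: f0.
Qed.

Lemma cons_rV_l n t (x : 'rV[R]_n) (j : 'I_1) : cons_rV (t, x) 0 (lshift n j) = t.
Proof. by rewrite /cons_rV [LHS]row_mxEl !ord1 mxE eqxx mulr1n. Qed.

Lemma cons_rV_r n t (x : 'rV[R]_n) j : cons_rV (t, x) 0 (rshift 1 j) = x 0 j.
Proof. by rewrite /cons_rV [LHS]row_mxEr. Qed.

Lemma cons_rV_comb n (a : 'rV[R]_n.+1) c t (x : 'rV[R]_n) :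
  a + c *: cons_rV (t, x) =
  cons_rV (a 0 0 + c * t, rsubmx (a : 'rV[R]_(1 + n)) + c *: x).
Proof.
apply/rowP => i; rewrite -(splitK (i : 'I_(1 + n))); case: (fintype.split _) => j.
  transitivity (a 0 0 + c * t); last by symmetry; exact: cons_rV_l.
  rewrite mxE [X in _ + X]mxE; congr (_ + _ * _); last exact: cons_rV_l.
  by congr (a _ _); apply: val_inj; rewrite /= ord1.
transitivity ((rsubmx (a : 'rV[R]_(1 + n)) + c *: x) 0 j); last by symmetry; exact: cons_rV_r.
have := cons_rV_r t x j; move: (cons_rV (t, x)) => v hv.
by rewrite /= !mxE hv.
Qed.

(** Induction on the dimension: Tonelli splits off the first coordinate, where the one-dimensional
    formula contributes one factor [|c|^-1]. *)
Lemma ge0_integral_rV_comb n (a : 'rV[R]_n) (c : R) (f : 'rV[R]_n -> \bar R) :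
  c != 0 -> measurable_fun setT f -> (forall x, 0 <= f x)%E ->
  (\int[borel_lebesgue R n]_x f (a + c *: x)%R =
   (`|c|^-1 ^+ n)%:E * \int[borel_lebesgue R n]_x f x)%E.
Proof.
move=> c0; elim: n a f => [|n IH] a f mf f0.
  by rewrite expr0 mul1e; apply: eq_integral => x _; rewrite [RHS](_ : _ = f (a + c *: x)) // [x]thinmx0 [_ + _]thinmx0.
rewrite !ge0_integral_rVS //; last first.
  by apply: measurableT_comp => //; exact: measurable_rV_comb.
pose g t := (\int[borel_lebesgue R n]_x f (cons_rV (t, x)))%E.
have mg : measurable_fun setT g.
  apply: (@measurable_fun_fubini_tonelli_F _ _ _ _ _ (borel_lebesgue R n) (fun z => f (cons_rV z))) => //.
  by apply: measurableT_comp => //; exact: measurable_cons_rV.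
have g0 t : (0 <= g t)%E by apply: integral_ge0.
under eq_integral => t _.
  under eq_integral do rewrite cons_rV_comb.
  rewrite (IH _ (fun x => f (cons_rV ((a 0 0 + c * t)%R, x)))) //; last first.
    apply: measurableT_comp => //; apply: measurableT_comp; first exact: measurable_cons_rV.
    exact: measurable_pair1.
  rewrite -/(g _).
over.
have mga : measurable_fun setT (fun t => g (a 0 0 + c * t)%R).
  by apply: measurableT_comp => //; exact: measurable_affine1.
have := @ge0_integralZl _ (measurableTypeR R) R (@lebesgue_measure R) setT measurableT
  (fun t => g (a 0 0 + c * t)%R) mga (`|c|^-1 ^+ n)%:E (fun t _ => g0 _).
have kk : (0 <= (`|c|^-1 ^+ n)%:E)%E by rewrite lee_fin exprn_ge0 // invr_ge0.
move=> /(_ kk) ->.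
by rewrite (ge0_integral_affine1 _ c0 mg g0) muleA -EFinM exprSr.
Qed.

End affine_change.

(** * Volumes of cubes and the sup norm *)

Section box_volume.
Context {R : realType}.

Definition box_rV n (a b : R) : set 'rV[R]_n := [set x | forall i, a < x 0 i < b].

Lemma measurable_box n a b : measurable (@box_rV n a b).
Proof.
have -> : @box_rV n a b = \bigcap_(i in [set: 'I_n]) (@coord_rV R n i @^-1` `]a, b[).
  apply/seteqP; split => x /= h i; first by move=> _ /=; rewrite in_itv; exact: h.
  by have := h i Logic.I; rewrite /= in_itv.
apply: fin_bigcap_measurable => // i _.
by rewrite -[X in measurable X]setTI; exact: measurable_coord_rV.
Qed.

Lemma borel_lebesgue_box n (a b : R) : a <= b ->
  borel_lebesgue R n (@box_rV n a b) = ((b - a) ^+ n)%:E.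
Proof.
move=> ab; elim: n => [|n IH].
  have -> : @box_rV 0 a b = setT by apply/seteqP; split => x //= _ [].
  by rewrite /= diracT expr0.
have -> : borel_lebesgue R n.+1 (@box_rV n.+1 a b) =
    (@lebesgue_measure R \x borel_lebesgue R n)%E (`]a, b[ `*` @box_rV n a b).
  rewrite [LHS]/= /lebesgue_step /pushforward; congr (_ _).
  apply/seteqP; split => -[t x] /=.
    move=> h; split; first by have := h (lshift n (ord0 : 'I_1)); rewrite in_itv cons_rV_l.
    by move=> i; have := h (rshift 1 i); rewrite cons_rV_r.
  rewrite in_itv => -[h1 h2] i; rewrite -(splitK (i : 'I_(1 + n))).
  by case: (fintype.split _) => j /=; [rewrite cons_rV_l | rewrite cons_rV_r; exact: h2].
rewrite product_measure1E //; last exact: measurable_box.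
transitivity (@lebesgue_measure R `]a, b[%classic * ((b - a) ^+ n)%:E)%E; first by congr (_ * _)%E; exact: IH.
rewrite lebesgue_measure_itv /= lte_fin.
case: ltP => [_|ba]; first by rewrite -EFinD -EFinM exprS.
by rewrite (_ : b - a = 0) ?exprS ?mul0r ?mul0e //; apply/eqP; rewrite subr_eq0 eq_le ab ba.
Qed.

Lemma rV_norm_lt n (x : 'rV[R]_n) (r : R) : 0 < r -> (`|x| < r) <-> (forall i, `|x 0 i| < r).
Proof.
move=> r0; have -> : `|x| = mx_norm x by []. rewrite mx_normrE; split.
  by move=> /bigmax_ltP[_ h] i; exact: (h (0, i)).
by move=> h; apply/bigmax_ltP; split => // -[i j] _ /=; rewrite ord1; exact: h.
Qed.

Lemma rV_coord_le n (x : 'rV[R]_n) i : `|x 0 i| <= `|x|.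
Proof.
have -> : `|x| = mx_norm x by []. rewrite mx_normrE.
by apply: (bigmax_sup (0, i)).
Qed.

Lemma rV_norm_le n (x : 'rV[R]_n) (r : R) : 0 <= r -> (forall i, `|x 0 i| <= r) -> `|x| <= r.
Proof.
move=> r0 h; have -> : `|x| = mx_norm x by []. rewrite mx_normrE; apply/bigmax_leP; split => // -[i j] _ /=.
by rewrite ord1.
Qed.

Lemma norm_ball_box n (r : R) : 0 < r -> [set x : 'rV[R]_n | `|x| < r] = @box_rV n (- r) r.
Proof.
move=> r0; apply/seteqP; split => x /=.
  by move=> /(rV_norm_lt _ r0) h i; rewrite -ltr_norml.
by move=> h; apply/(rV_norm_lt _ r0) => i; rewrite ltr_norml.
Qed.

End box_volume.

(** * Measurability of Caratheodory functions *)

Section caratheodory_functions.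
Context {R : realType}.

Lemma measurable_floor_nat (m : int) (k : R) : measurable [set t : R | Num.floor (k * t) = m].
Proof.
rewrite (_ : [set _ | _] = (fun t => k * t) @^-1` `[m%:~R, m%:~R + 1[%classic).
  by rewrite -[X in measurable X]setTI; apply: mulrl_measurable.
apply/seteqP; split => t /=; rewrite in_itv /=.
  by move=> <-; rewrite floor_le_tmp -[1]/(1%:~R) -intrD floorD1_gt.
by move=> /andP[h1 h2]; apply: floor_def; rewrite h1 intrD.
Qed.

(* F(x, .) is sampled at the lattice points of mesh 1/k, where g takes only
   countably many values. *)
Lemma measurable_caratheodory d (T : measurableType d) n (F : T -> 'rV[R]_n -> R)
    (g : T -> 'rV[R]_n) :
  (forall v, measurable_fun setT (F^~ v)) -> (forall x, continuous (F x)) ->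
  (forall i, measurable_fun setT (fun x => g x 0 i)) ->
  measurable_fun setT (fun x => F x (g x)).
Proof.
move=> mF cF mg.
pose h (k : nat) x : 'rV[int]_n := \row_i Num.floor (k.+1%:R * g x 0 i).
pose q (k : nat) (v : 'rV[int]_n) : 'rV[R]_n := \row_i ((v 0 i)%:~R / k.+1%:R).
apply: (@measurable_fun_cvg _ _ _ _ (fun k x => F x (q k (h k x)))).
  move=> k _ B mB; rewrite setTI.
  have -> : (fun x => F x (q k (h k x))) @^-1` B =
      \bigcup_(v : 'rV[int]_n) ([set x | h k x = v] `&` ((F^~ (q k v)) @^-1` B)).
    apply/seteqP; split => x /=; first by move=> ?; exists (h k x).
    by move=> [v _ [/= <-]].
  apply: countable_bigcupT_measurable => [|v]; first exact: countableP.
  apply: measurableI; last by rewrite -[X in measurable X]setTI; exact: mF.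
  have -> : [set x | h k x = v] = \bigcap_(i in [set: 'I_n])
      ((fun x => g x 0 i) @^-1` [set t | Num.floor (k.+1%:R * t) = v 0 i]).
    apply/seteqP; split => x /=; first by move=> <- i _ /=; rewrite mxE.
    by move=> hi; apply/rowP => i; rewrite mxE; exact: hi.
  apply: fin_bigcap_measurable => // i _.
  by rewrite -[X in measurable X]setTI; apply: mg => //; exact: measurable_floor_nat.
(* For fixed [x] the sample points converge to [g x]: each coordinate is off by less than
   [1 / (k + 1)]. *)
move=> x _; apply: (cvg_comp (fun k => q k (h k x)) (F x)); last exact: cF.
apply/cvgrPdist_lt => e e0; near=> k.
apply/(rV_norm_lt _ e0) => i; rewrite !mxE.
have k0 : 0 < k.+1%:R :> R by [].
have -> : g x 0 i - (Num.floor (k.+1%:R * g x 0 i))%:~R / k.+1%:R =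
    (k.+1%:R * g x 0 i - (Num.floor (k.+1%:R * g x 0 i))%:~R) / k.+1%:R.
  by rewrite mulrBl mulrAC divff ?mul1r.
rewrite normrM (ger0_norm (_ : 0 <= k.+1%:R^-1)) // ltr_pdivrMr // ger0_norm; last first.
  by rewrite subr_ge0 floor_le_tmp.
apply: (@lt_trans _ _ 1).
  by rewrite ltrBlDl -[1]/(1%:~R) -intrD floorD1_gt.
rewrite -ltr_pdivrMl // mulr1.
near: k; exists (Num.truncn e^-1) => // m /= hm.
by rewrite (lt_le_trans (truncnS_gt _)) // ler_nat ltnS.
Unshelve. all: by end_near. Qed.

Lemma continuous_rV_measurable n (f : 'rV[R]_n -> R) : continuous f -> measurable_fun setT f.
Proof.
move=> cf; apply: (@measurable_caratheodory _ _ n (fun _ => f) id) => //.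
by move=> i; exact: measurable_coord_rV.
Qed.

Lemma measurable_rV_norm n : measurable_fun setT (fun x : 'rV[R]_n => `|x|).
Proof. by apply: continuous_rV_measurable => x; exact: norm_continuous. Qed.

End caratheodory_functions.

(** * Transfer between Borel sets and the Lebesgue completion *)

Section lebesgue_completion.
Context {R : realType} {n : nat}.

Lemma measurable_Leb_of_borel (A : set 'rV[R]_n) : measurable A ->
  measurable (A : set (Leb_space R n)).
Proof. exact: caratheodory_measurable_mu_ext. Qed.

Lemma leb_borel (A : set 'rV[R]_n) : measurable A -> leb R n A = borel_lebesgue R n A.
Proof. move=> mA; transitivity ((borel_lebesgue R n)^* A)%mu => //; exact: measurable_mu_extE. Qed.

Lemma measurable_fun_Leb d (T : measurableType d) (f : 'rV[R]_n -> T) : measurable_fun setT f ->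
  measurable_fun [set: Leb_space R n] f.
Proof.
move=> mf _ A mA; rewrite setTI; apply: measurable_Leb_of_borel.
by rewrite -[X in measurable X]setTI; exact: mf.
Qed.

Let measurable_idL : measurable_fun [set: Leb_space R n] (id : Leb_space R n -> 'rV[R]_n).
Proof. by apply: (@measurable_fun_Leb _ _ id). Qed.

(** The identity map from the completed space to the Borel space is measurable and pushes [leb]
    forward to [borel_lebesgue]. *)
Lemma ge0_integral_leb (f : 'rV[R]_n -> \bar R) : measurable_fun setT f ->
  (forall x, 0 <= f x)%E -> (\int[leb R n]_x f x = \int[borel_lebesgue R n]_x f x)%E.
Proof.
move=> mf f0.
have := @ge0_integral_pushforward _ _ _ _ R _ measurable_idL (leb R n) setT f measurableT mf (fun x _ => f0 x).
rewrite preimage_setT => <-.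
by apply: eq_measure_integral => A mA _; exact: leb_borel.
Qed.

Lemma integral_leb (f : 'rV[R]_n -> \bar R) : (borel_lebesgue R n).-integrable setT f ->
  (\int[leb R n]_x f x = \int[borel_lebesgue R n]_x f x)%E.
Proof.
move=> fi; have [mf _] := integrableP _ _ _ fi.
rewrite integralE [RHS]integralE !ge0_integral_leb //.
  exact: measurable_funeneg.
exact: measurable_funepos.
Qed.

Lemma leb_negligible (A : set 'rV[R]_n) : (leb R n).-negligible A ->
  measurable (A : set (Leb_space R n)).
Proof. exact: measure_is_complete_caratheodory. Qed.

(** Completeness of the measure: every subset of the exceptional null set is measurable. *)
Lemma ae_eq_measurable_Leb d (T : measurableType d) (f g : 'rV[R]_n -> T) :
  {ae leb R n, forall x, f x = g x} -> measurable_fun [set: Leb_space R n] f ->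
  measurable_fun [set: Leb_space R n] g.
Proof.
move=> fg mf _ A mA; rewrite setTI.
have mN (B : set (Leb_space R n)) : B `<=` [set x | f x <> g x] -> measurable B.
  move=> hB; apply: leb_negligible; exact: negligibleS hB fg.
have -> : g @^-1` A = ((f @^-1` A) `\` [set x | f x <> g x]) `|` ((g @^-1` A) `&` [set x | f x <> g x]).
  apply/seteqP; split => x /=.
    by move=> gA; case: (pselect (f x = g x)) => [e|ne]; [left; rewrite e; split => // | right].
  by case=> [[fA /contrapT <-]|[]].
apply: measurableU; last by apply: mN => x [].
apply: measurableD; last exact: mN.
by rewrite -[X in measurable X]setTI; exact: mf.
Qed.

Lemma ae_borel_leb (P : 'rV[R]_n -> Prop) : {ae borel_lebesgue R n, forall x, P x} ->
  {ae leb R n, forall x, P x}.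
Proof.
move=> [N [mN N0 hN]]; exists N; split => //; first exact: measurable_Leb_of_borel.
by rewrite leb_borel.
Qed.

End lebesgue_completion.

(** Real-valued and applied to a boolean, so that cut-offs can stand inside products and [mfun] can
    find their measurability. *)
Definition ind {R : realType} (b : bool) : R := if b then 1 else 0.

(** * The Euclidean norm, its comparison with the sup norm, and measurability of vector
    operations *)

Section euclidean_norm.
Context {R : realType}.

Lemma ind_ge0 (b : bool) : 0 <= ind b :> R.
Proof. by case: b. Qed.

Lemma ind_le1 (b : bool) : ind b <= 1 :> R.
Proof. by case: b => /=. Qed.

Lemma measurable_ind d (T : measurableType d) (b : T -> bool) :
  measurable_fun setT b -> measurable_fun setT (fun x => ind (b x) : R).
Proof. by move=> mb; exact: (measurableT_comp (_ : measurable_fun setT (fun b : bool => ind b : R)) mb). Qed.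

Lemma measurable_ltR d (T : measurableType d) (f g : T -> R) :
  measurable_fun setT f -> measurable_fun setT g ->
  measurable_fun setT (fun x => ind (f x < g x) : R).
Proof. by move=> mf mg; apply: measurable_ind; exact: measurable_fun_ltr. Qed.

Lemma measurable_leR d (T : measurableType d) (f g : T -> R) :
  measurable_fun setT f -> measurable_fun setT g ->
  measurable_fun setT (fun x => ind (f x <= g x) : R).
Proof. by move=> mf mg; apply: measurable_ind; exact: measurable_fun_ler. Qed.

Lemma measurable_norm_ball n r : measurable_fun setT (fun x : 'rV[R]_n => ind (`|x| < r) : R).
Proof. by apply: measurable_ltR => //; exact: measurable_rV_norm. Qed.

Lemma integral_norm_ball n (r : R) : 0 < r ->
  (\int[borel_lebesgue R n]_x (ind (`|x| < r)%R)%:E = ((r *+ 2) ^+ n)%:E)%E.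
Proof.
move=> r0.
rewrite (_ : (fun x => _) = (fun x => (\1_[set x : 'rV[R]_n | `|x| < r] x)%:E)); last first.
  apply/funext => x; rewrite indicE /ind; case: ifP => hx; first by rewrite mem_set.
  by rewrite memNset //= hx.
rewrite norm_ball_box // integral_indic //; last exact: measurable_box.
rewrite setIT [LHS](_ : _ = borel_lebesgue R n (@box_rV R n (- r) r)) // borel_lebesgue_box ?opprK ?mulr2n //.
by rewrite (@le_trans _ _ 0) // ?oppr_le0 ltW.
Qed.

Lemma tonelli d1 d2 (T1 : measurableType d1) (T2 : measurableType d2)
    (m1 : {sigma_finite_measure set T1 -> \bar R})
    (m2 : {sigma_finite_measure set T2 -> \bar R}) (f : T1 -> T2 -> \bar R) :
  measurable_fun setT (fun z : T1 * T2 => f z.1 z.2) -> (forall x y, 0 <= f x y)%E ->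
  (\int[m1]_x \int[m2]_y f x y = \int[m2]_y \int[m1]_x f x y)%E.
Proof.
move=> mf f0.
exact: (@fubini_tonelli _ _ _ _ _ m1 m2 (fun z => f z.1 z.2) mf (fun z => f0 _ _)).
Qed.

Lemma measurable_subrV d (T : measurableType d) n (f g : T -> 'rV[R]_n) :
  measurable_fun setT f -> measurable_fun setT g -> measurable_fun setT (fun x => f x - g x).
Proof.
move=> mf mg; apply: measurable_fun_rV => i.
rewrite (_ : _ \o _ = (fun z => coord_rV i (f z) - coord_rV i (g z))); last first.
  by apply/funext => z; rewrite /coord_rV /= !mxE.
by apply: measurable_funB; apply: measurableT_comp => //; exact: measurable_coord_rV.
Qed.

Lemma fnorm_ge0 m n (A : 'M[R]_(m, n)) : 0 <= fnorm A.
Proof. exact: sqrtr_ge0. Qed.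

Lemma fnorm_sq n (x : 'rV[R]_n) : fnorm x ^+ 2 = \sum_j x 0 j ^+ 2.
Proof.
rewrite /fnorm sqr_sqrtr big_ord1 //.
by apply: sumr_ge0 => j _; exact: sqr_ge0.
Qed.

Lemma fnorm_le_sq m n (x y : 'M[R]_(m, n)) :
  fnorm x ^+ 2 <= fnorm y ^+ 2 -> fnorm x <= fnorm y.
Proof. by rewrite ler_sqr // nnegrE fnorm_ge0. Qed.

Lemma coord_le_fnorm n (x : 'rV[R]_n) i : `|x 0 i| <= fnorm x.
Proof.
rewrite -ler_sqr ?nnegrE ?fnorm_ge0 ?normr_ge0 // fnorm_sq -normrX ger0_norm ?sqr_ge0 //.
by rewrite (bigD1 i) //= lerDl sumr_ge0 // => j _; exact: sqr_ge0.
Qed.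

Lemma norm_le_fnorm n (x : 'rV[R]_n) : `|x| <= fnorm x.
Proof. by apply: rV_norm_le => [|i]; [exact: fnorm_ge0 | exact: coord_le_fnorm]. Qed.

Lemma fnorm_le_norm n (x : 'rV[R]_n) : fnorm x <= Num.sqrt n%:R * `|x|.
Proof.
rewrite -ler_sqr ?nnegrE ?fnorm_ge0 ?mulr_ge0 ?sqrtr_ge0 //.
rewrite fnorm_sq exprMn sqr_sqrtr //.
have -> : n%:R * `|x| ^+ 2 = \sum_(j < n) `|x| ^+ 2.
  by rewrite sumr_const card_ord mulr_natl.
apply: ler_sum => j _; rewrite -[X in X <= _]ger0_norm ?sqr_ge0 // normrX.
by apply: lerXn2r; rewrite ?nnegrE //; exact: rV_coord_le.
Qed.

Lemma fnormN n (x : 'rV[R]_n) : fnorm (- x) = fnorm x.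
Proof.
by congr Num.sqrt; apply: eq_bigr => i _; apply: eq_bigr => j _; rewrite mxE sqrrN.
Qed.

Lemma fnorm0 m n : fnorm (0 : 'M[R]_(m, n)) = 0.
Proof.
rewrite /fnorm big1 ?sqrtr0 // => i _; rewrite big1 // => j _.
by rewrite mxE expr0n.
Qed.

Lemma fnorm_eq0 n (x : 'rV[R]_n) : fnorm x = 0 -> x = 0.
Proof.
move=> h; apply/eqP; rewrite -normr_eq0 eq_le normr_ge0 andbT -h.
exact: norm_le_fnorm.
Qed.

Lemma fnormZ n (c : R) (x : 'rV[R]_n) : fnorm (c *: x) = `|c| * fnorm x.
Proof.
apply/eqP; rewrite -(@eqrXn2 _ 2) ?fnorm_ge0 ?mulr_ge0 ?fnorm_ge0 //.
rewrite exprMn !fnorm_sq mulr_sumr; apply/eqP; apply: eq_bigr => j _.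
by rewrite mxE exprMn -normrX ger0_norm // sqr_ge0.
Qed.

Lemma measurable_fnorm d (T : measurableType d) m n (g : T -> 'M[R]_(m, n)) :
  (forall i j, measurable_fun setT (fun x => g x i j)) ->
  measurable_fun setT (fun x => fnorm (g x)).
Proof.
move=> mg; apply: (measurableT_comp (f := fun t : R => Num.sqrt t)).
  by apply: continuous_measurable_fun => t; exact: sqrt_continuous.
apply: measurable_sum => i; apply: measurable_sum => j.
exact: measurable_funX.
Qed.

Lemma measurable_fnorm_rV n : measurable_fun setT (@fnorm R 1 n).
Proof.
apply: measurable_fnorm => i j; rewrite ord1; exact: measurable_coord_rV.
Qed.

Lemma measurable_normrV d (T : measurableType d) n (g : T -> 'rV[R]_n) :
  measurable_fun setT g -> measurable_fun setT (fun x => `|g x|).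
Proof.
by move=> mg; apply: (@measurableT_comp _ _ _ _ _ _ (fun x : 'rV[R]_n => `|x|) _ g _ mg); exact: measurable_rV_norm.
Qed.

Lemma measurable_addrV d (T : measurableType d) n (f g : T -> 'rV[R]_n) :
  measurable_fun setT f -> measurable_fun setT g -> measurable_fun setT (fun x => f x + g x).
Proof.
move=> mf mg; apply: measurable_fun_rV => i.
rewrite (_ : _ \o _ = (fun z => coord_rV i (f z) + coord_rV i (g z))); last first.
  by apply/funext => z; rewrite /coord_rV /= !mxE.
by apply: measurable_funD; apply: measurableT_comp => //; exact: measurable_coord_rV.
Qed.

Lemma measurable_opprV d (T : measurableType d) n (f : T -> 'rV[R]_n) :
  measurable_fun setT f -> measurable_fun setT (fun x => - f x).
Proof.
by move=> mf; under eq_fun do rewrite -sub0r; apply: measurable_subrV.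
Qed.

End euclidean_norm.

(** Syntax-directed measurability. A hypothesis [measurable_fun _ f] is used at any argument of [f],
    so [mfun] succeeds once the opaque factors are known to be measurable. *)
Ltac mfun1 := first
 [ assumption | exact: measurable_cst | exact: measurable_id
 | exact: measurable_fst | exact: measurable_snd
 | exact: measurable_rV_norm | exact: measurable_fnorm_rV | exact: measurable_coord_rV
 | exact: measurable_norm_ball
 | match goal with
   | |- measurable_fun _ (fun x => EFin _) => apply/measurable_EFinP
   | |- measurable_fun _ (fun x => mule _ _) => apply: emeasurable_funM
   | |- measurable_fun _ (fun x => adde _ _) => apply: emeasurable_funD
   | |- measurable_fun _ (fun x => ind (_ < _)) => apply: measurable_ltR
   | |- measurable_fun _ (fun x => ind (_ <= _)) => apply: measurable_leR
   | |- measurable_fun _ (fun x => powR (@?g x) ?c) =>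
       apply: (@measurableT_comp _ _ _ _ _ _ (fun t => powR t c) _ g (measurable_powR c))
   | H : measurable_fun _ ?f |- measurable_fun _ (fun x => ?f (@?g x)) =>
       apply: (@measurableT_comp _ _ _ _ _ _ f _ g H)
   | |- measurable_fun _ (fun x => fnorm (@?g x)) =>
       apply: (@measurableT_comp _ _ _ _ _ _ (@fnorm _ 1 _) _ g (@measurable_fnorm_rV _ _))
   | |- measurable_fun _ (fun x => fun_of_matrix (@?g x) _ ?i) =>
       apply: (@measurableT_comp _ _ _ _ _ _ (coord_rV i) _ g (measurable_coord_rV i))
   | |- measurable_fun _ (fun x => GRing.mul _ _) => apply: measurable_funM
   | |- measurable_fun _ (fun x => GRing.add _ (GRing.opp _)) =>
       first [apply: measurable_subrV | apply: measurable_funB]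
   | |- measurable_fun _ (fun x => GRing.add _ _) =>
       first [apply: measurable_addrV | apply: emeasurable_funD | apply: measurable_funD]
   | |- measurable_fun _ (fun x => GRing.exp _ _) => apply: measurable_funX
   | |- measurable_fun _ (fun x => GRing.opp _) =>
       first [apply: measurable_opprV | apply: measurable_funN]
   | |- measurable_fun _ (fun x => Num.norm (@?g x)) => first
       [ apply: measurable_normrV
       | apply: (@measurableT_comp _ _ _ _ _ _ (@Num.norm _ _) _ g (@normr_measurable _ setT)) ]
   end ].
Ltac mfun := repeat mfun1.

(** * Invariance of the measure under translations and isometric involutions *)

Section isometries.
Context {R : realType}.

Lemma ge0_integral_subl n (h : 'rV[R]_n -> \bar R) a : measurable_fun setT h -> (forall x, 0 <= h x)%E ->
  (\int[borel_lebesgue R n]_x h (a - x)%R = \int[borel_lebesgue R n]_x h x)%E.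
Proof.
move=> mh h0; under eq_integral do rewrite -scaleN1r.
by rewrite ge0_integral_rV_comb // ?oppr_eq0 ?oner_eq0 // normrN1 invr1 expr1n mul1e.
Qed.

Lemma ge0_integral_subr n (h : 'rV[R]_n -> \bar R) a : measurable_fun setT h -> (forall x, 0 <= h x)%E ->
  (\int[borel_lebesgue R n]_x h (x - a)%R = \int[borel_lebesgue R n]_x h x)%E.
Proof.
move=> mh h0; have := ge0_integral_rV_comb (- a) (oner_neq0 R) mh h0.
rewrite normr1 invr1 expr1n mul1e => <-.
by apply: eq_integral => x _; rewrite scale1r addrC.
Qed.

(* Both sides of the computation are the integral of 1_B(x) 1_A(T x + y) over
   (x, y), where B is the unit ball. *)
Lemma isometry_lebesgue n (T : 'rV[R]_n -> 'rV[R]_n) (f : 'rV[R]_n -> \bar R) :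
  measurable_fun setT T -> (forall x y, T (x - y) = T x - T y) -> involutive T ->
  (forall x, fnorm (T x) = fnorm x) ->
  measurable_fun setT f -> (forall x, 0 <= f x)%E ->
  (\int[borel_lebesgue R n]_x f (T x) = \int[borel_lebesgue R n]_x f x)%E.
Proof.
move=> mT TB TK TN mf f0.
pose mu := borel_lebesgue R n.
have mfT : measurable_fun setT (fun x => f (T x)) by exact: measurableT_comp.
pose b (x : 'rV[R]_n) : R := ind (fnorm x < 1).
have mb : measurable_fun setT b by apply: measurable_ltR => //; exact: measurable_fnorm_rV.
have mbE : measurable_fun setT (fun x => (b x)%:E) by exact/measurable_EFinP.
pose Ib := (\int[mu]_x (b x)%:E)%E.
have Ib_fin : (Ib < +oo)%E.
  apply: (@le_lt_trans _ _ (\int[mu]_x (ind (`|x| < 1)%R)%:E)%E); last first.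
    by rewrite integral_norm_ball ?ltry.
  apply: ge0_le_integral => //; first by move=> x _; rewrite lee_fin ind_ge0.
    by apply/measurable_EFinP; exact: measurable_norm_ball.
  move=> x _; rewrite lee_fin /b /ind; case: ltP => // h; case: ltP => // h'.
  by have := le_lt_trans (le_trans h' (norm_le_fnorm x)) h; rewrite ltxx.
have Ib_gt : (0 < Ib)%E.
  (* Since [sqrt n <= n + 1], the sup-norm ball of radius [1 / (n + 1)] lies in the Euclidean unit
     ball. This gives a positive lower bound for [Ib], by which [key] is divided at the end. *)
  pose r := (n.+1%:R)^-1 : R.
  have r0 : 0 < r by rewrite invr_gt0.
  apply: (@lt_le_trans _ _ (\int[mu]_x (ind (`|x| < r)%R)%:E)%E).
    by rewrite integral_norm_ball // lte_fin exprn_gt0 // mulrn_wgt0.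
  apply: ge0_le_integral => //; first by move=> x _; rewrite lee_fin ind_ge0.
    by apply/measurable_EFinP; exact: measurable_norm_ball.
  move=> x _; rewrite lee_fin /b /ind; case: ltP => // h; case: ltP => // h'.
  have := le_trans h' (fnorm_le_norm x); rewrite leNgt => /negP []. 
  apply: (@le_lt_trans _ _ (n.+1%:R * `|x|)).
    apply: ler_wpM2r => //; rewrite -ler_sqr ?nnegrE ?sqrtr_ge0 // sqr_sqrtr //.
    by rewrite -natrX ler_nat (leq_trans (leqnSn n)) // leq_pmulr.
  by rewrite mulrC -ltr_pdivlMr // div1r.
have T0 : T 0 = 0 by have := TB 0 0; rewrite !subrr.
have TN' x : T (- x) = - T x by rewrite -sub0r TB T0 sub0r.
(* [T] moves from [y] to [x] because it preserves the norm and is its own inverse. *)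
have bT x y : b (T y - x) = b (T x - y).
  by rewrite /b -[fnorm (T y - x)]TN TB TK -fnormN opprB.
have key : (\int[mu]_x f (T x) * Ib = \int[mu]_x f x * Ib)%E.
  transitivity (\int[mu]_x \int[mu]_y ((b x)%:E * f (T x - y)%R))%E; last first.
    under eq_integral => x _.
      rewrite ge0_integralZl //; last first.
      - by rewrite lee_fin ind_ge0.
      - by mfun.
      rewrite ge0_integral_subl // muleC.
    over.
    by rewrite ge0_integralZl // ?integral_ge0 // => x _; rewrite lee_fin ind_ge0.
  rewrite tonelli; last first.
  - by move=> x y; rewrite mule_ge0 // lee_fin ind_ge0.
  - by mfun.
  transitivity (\int[mu]_y \int[mu]_x ((b (T y - x)%R)%:E * f (- T x)%R))%E; last first.
    apply: eq_integral => y _.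
    rewrite -[RHS](@ge0_integral_subl _ _ (T y)); last first.
    - by move=> x; rewrite mule_ge0 // lee_fin ind_ge0.
    - by mfun.
    by apply: eq_integral => x _; rewrite TB TK addrAC subrr sub0r.
  have mfN : measurable_fun setT (fun x => f (- T x)%R).
    by mfun.
  rewrite tonelli; last first.
  - by move=> x y; rewrite mule_ge0 // lee_fin ind_ge0.
  - by mfun.
  have -> : (\int[mu]_x f (T x) = \int[mu]_x f (- T x)%R)%E.
    rewrite -[LHS](@ge0_integral_subl _ (fun x => f (T x)) 0) //.
    by apply: eq_integral => x _; rewrite sub0r TN'.
  rewrite -ge0_integralZr //; last by apply: integral_ge0 => x _; rewrite lee_fin ind_ge0.
  apply: eq_integral => x _.
  under [RHS]eq_integral do rewrite bT muleC.
  rewrite ge0_integralZl //; last first.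
  - by move=> y _; rewrite lee_fin ind_ge0.
  - by mfun.
  congr (_ * _)%E; rewrite (@ge0_integral_subl _ (fun y => (b y)%:E)) // => y.
  by rewrite lee_fin ind_ge0.
have Ibf : Ib \is a fin_num by rewrite ge0_fin_numE // ltW.
apply/eqP; move/eqP: key; rewrite -(fineK Ibf).
have c0 : 0 < fine Ib by rewrite fine_gt0 // Ib_gt Ib_fin.
move=> /eqP h; apply/eqP.
have := congr1 (fun z => z * (fine Ib)^-1%:E)%E h.
by rewrite -!muleA -EFinM divff ?gt_eqF // !mule1.
Qed.

End isometries.

(** * Integrability of powers at the origin and at infinity *)

Section power_kernels.
Context {R : realType}.

Lemma integral_power_tail (b g : R) : 0 < b -> 0 < g ->
  (\int[lebesgue_measure]_t (ind (b <= t)%R * t `^ (- g - 1))%:E = (b `^ (- g) / g)%:E)%E.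
Proof.
move=> b0 g0.
transitivity (\int[lebesgue_measure]_(t in `[b, +oo[) (t `^ (- g - 1))%:E)%E.
  rewrite [RHS]integral_mkcond; apply: eq_integral => t _; rewrite patchE.
  by rewrite mem_setE in_itv /= andbT /ind; case: leP => _; rewrite ?mul1r ?mul0r.
pose F := (- g^-1) \*: (@powR R ^~ (- g)).
have dp x : 0 < x -> derivable (@powR R ^~ (- g)) x 1.
  by move=> x0; apply: derivable_powR; rewrite in_itv /= andbT.
have dF x : 0 < x -> derivable F x 1.
  by move=> x0; apply: derivableZ; exact: dp.
rewrite (@ge0_continuous_FTC2y _ _ F _ 0).
- by rewrite /F /= -EFinB sub0r scaleNr opprK mulrC.
- by move=> x _; exact: powR_ge0.
- apply: continuous_in_subspaceT => x; rewrite inE /= in_itv /= andbT => bx.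
  apply: differentiable_continuous; apply/derivable1_diffP; apply: derivable_powR.
  by rewrite in_itv /= andbT (lt_le_trans b0).
- rewrite -(scaler0 _ (- g^-1)); apply: cvgZr.
  apply/cvgr0Pnorm_lt => e e0; near=> t.
  have t0 : 0 < t by near: t; exact: nbhs_pinfty_gt.
  rewrite ger0_norm ?powR_ge0 // powRN -[ltRHS]invrK ltf_pV2 ?posrE ?invr_gt0 ?powR_gt0 //.
  have -> : e^-1 = ((e^-1) `^ g^-1) `^ g.
    by rewrite -powRrM mulVf ?gt_eqF // powRr1 // invr_ge0 ltW.
  apply: gt0_ltr_powR => //; rewrite ?nnegrE ?powR_ge0 ?(ltW t0) //.
- by move=> x bx; apply: dF; exact: lt_trans bx.
- apply: cvg_at_right_filter; apply: differentiable_continuous.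
  by apply/derivable1_diffP; exact: dF.
- move=> x; rewrite in_itv /= andbT => bx.
  have x0 : 0 < x by exact: lt_trans bx.
  rewrite derive1E deriveZ //; last exact: dp.
  rewrite -derive1E powR_derive1 ?in_itv /= ?andbT //.
  by rewrite /GRing.scale /= mulrA mulNr mulrN opprK mulVf ?gt_eqF // mul1r.
Unshelve. all: by end_near. Qed.

(** Replaces polar coordinates. At each point [f] is bounded by one term of a series of multiples of
    indicators of cubes, and the integrals of these terms form a geometric series. *)
Lemma dyadic_integral_lt_pinfty n (f : 'rV[R]_n -> R) (c r : nat -> R) (M th : R) :
  measurable_fun setT f -> (forall y, 0 <= f y) -> (forall k, 0 <= c k) ->
  (forall k, 0 < r k) ->
  0 <= M -> 0 < th < 1 -> (forall k, c k * (r k *+ 2) ^+ n = M * th ^+ k) ->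
  (forall y, f y = 0 \/ exists2 k, `|y| < r k & f y <= c k) ->
  (\int[borel_lebesgue R n]_y (f y)%:E < +oo)%E.
Proof.
move=> mf f0 c0 r0 M0 /andP[th0 th1] cr hk.
pose g k (y : 'rV[R]_n) := (c k * ind (`|y| < r k)%R)%:E.
have mg k : measurable_fun setT (g k).
  apply/measurable_EFinP; apply: measurable_funM => //; apply: measurable_ltR => //.
  exact: measurable_rV_norm.
have g0 k y : (0 <= g k y)%E by rewrite lee_fin mulr_ge0 // ind_ge0.
apply: (@le_lt_trans _ _ (\int[borel_lebesgue R n]_y (\sum_(0 <= k <oo) g k y))%E).
  apply: ge0_le_integral => //.
  - by move=> y _; rewrite lee_fin.
  - by mfun.
  - by apply: (@ge0_emeasurable_sum _ _ _ _ g xpredT).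
  - move=> y _; case: (hk y) => [->|[k yk fk]]; first by apply: nneseries_ge0.
    apply: (@le_trans _ _ (g k y)); first by rewrite /g yk mulr1 lee_fin.
    apply: le_trans (nneseries_lim_ge k.+1 _) => //.
    by rewrite big_nat_recr //= leeDr // sume_ge0.
rewrite integral_nneseries //.
have gi k : (\int[borel_lebesgue R n]_y g k y = (M * th ^+ k)%:E)%E.
  rewrite /g -cr EFinM.
  under eq_integral do rewrite EFinM.
  rewrite ge0_integralZl_EFin //; last first.
  - by mfun.
  - by move=> y _; rewrite lee_fin ind_ge0.
  congr (_ * _)%E.
  exact: integral_norm_ball.
under eq_eseriesr do rewrite gi.
apply: (@le_lt_trans _ _ (M / (1 - th))%:E); last exact: ltry.
apply: lime_le; first by apply: is_cvg_nneseries => k _ _; rewrite lee_fin mulr_ge0 // exprn_ge0 // ltW.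
apply: nearW => N; rewrite sumEFin lee_fin.
have th1' : `|th| < 1 by rewrite gtr0_norm.
have := geometric_le_lim N M0 th0 th1'.
by rewrite /series/= /geometric.
Qed.

Lemma kernel_head_lt_pinfty n (a : R) : 0 < a -> a < n%:R ->
  (\int[borel_lebesgue R n]_y (ind (`|y| < 1)%R * `|y| `^ (- a))%:E < +oo)%E.
Proof.
move=> a0 an.
have two x : 2 `^ x = expR (x * ln 2) :> R by rewrite /powR pnatr_eq0.
have l2 : 0 < ln 2 :> R by rewrite ln_gt0 // ltr1n.
have pM x y : 2 `^ x * 2 `^ y = 2 `^ (x + y) :> R by rewrite !two -expRD mulrDl.
have pX x k : (2 `^ x) ^+ k = 2 `^ (x * k%:R) :> R.
  by rewrite -powR_mulrn ?powR_ge0 // -powRrM.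
(* If [2 ^ - (k + 1) < |y| <= 2 ^ - k], then [|y| ^ - a <= 2 ^ (a (k + 1))] and [|y| < r k]; the
   extra factor 2 in [r k] makes this inequality strict. The integrals then have ratio
   [2 ^ (a - n) < 1]. *)
apply: (@dyadic_integral_lt_pinfty _ _ (fun k => 2 `^ (a * (k.+1)%:R)) (fun k => 2 * 2 `^ (- k%:R))
  (4 ^+ n * 2 `^ a) (2 `^ (a - n%:R))).
- by mfun.
- by move=> y; rewrite mulr_ge0 ?ind_ge0 ?powR_ge0.
- by move=> k; exact: powR_ge0.
- by move=> k; rewrite mulr_gt0 // powR_gt0.
- by rewrite mulr_ge0 ?exprn_ge0 ?powR_ge0.
- rewrite powR_gt0 //= two -[X in _ < X]expR0 ltr_expR.
  by rewrite pmulr_llt0 // subr_lt0.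
- move=> k; have e z : 2 * z *+ 2 = 4 * z :> R by ring.
  rewrite e exprMn mulrCA -mulrA; congr (_ * _).
  by rewrite !pX !pM; congr (_ `^ _); rewrite -natr1; ring.
- move=> y; rewrite /ind; case: ifP => y1; last by left; rewrite mul0r.
  (* The origin lies in no dyadic shell; there the integrand is 0, because 0 raised to a nonzero
     power is 0. *)
  have [->|y0] := eqVneq y 0.
    by left; rewrite normr0 powR0 ?mulr0 // oppr_eq0 gt_eqF.
  right; have yp : 0 < `|y| by rewrite normr_gt0.
  pose t := - ln `|y| / ln 2.
  have t0 : 0 <= t by rewrite divr_ge0 ?(ltW l2) // oppr_ge0 ln_le0 // ltW.
  have yt : `|y| = 2 `^ (- t).
    by rewrite two /t !mulNr opprK divfK ?gt_eqF // lnK.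
  have /andP[k1 k2] := truncn_itv t0.
  exists (Num.truncn t).
    rewrite yt; apply: (@le_lt_trans _ _ (2 `^ (- (Num.truncn t)%:R))).
      by apply: ler_powR; rewrite ?ler1n // lerN2.
    by rewrite ltr_pMl ?powR_gt0 // ltr1n.
  rewrite mul1r yt -powRrM mulrN mulNr opprK mulrC.
  by apply: ler_powR; rewrite ?ler1n // ler_pM2l // ltW.
Qed.

Lemma kernel_tail_lt_pinfty n (b : R) : n%:R < b ->
  (\int[borel_lebesgue R n]_y (ind (1 <= `|y|)%R * `|y| `^ (- b))%:E < +oo)%E.
Proof.
move=> nb; have b0 : 0 < b by exact: le_lt_trans nb.
have two x : 2 `^ x = expR (x * ln 2) :> R by rewrite /powR pnatr_eq0.
have l2 : 0 < ln 2 :> R by rewrite ln_gt0 // ltr1n.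
have pM x y : 2 `^ x * 2 `^ y = 2 `^ (x + y) :> R by rewrite !two -expRD mulrDl.
have pX x k : (2 `^ x) ^+ k = 2 `^ (x * k%:R) :> R.
  by rewrite -powR_mulrn ?powR_ge0 // -powRrM.
apply: (@dyadic_integral_lt_pinfty _ _ (fun k => 2 `^ (- b * k%:R)) (fun k => 2 * 2 `^ k.+1%:R)
  (8 ^+ n) (2 `^ (n%:R - b))).
- by mfun.
- by move=> y; rewrite mulr_ge0 ?ind_ge0 ?powR_ge0.
- by move=> k; exact: powR_ge0.
- by move=> k; rewrite mulr_gt0 // powR_gt0.
- by rewrite exprn_ge0.
- rewrite powR_gt0 //= two -[X in _ < X]expR0 ltr_expR.
  by rewrite pmulr_llt0 // subr_lt0.
- move=> k; have e z : 2 * (2 * z) *+ 2 = 8 * z :> R by ring.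
  have -> : 2 `^ k.+1%:R = 2 * 2 `^ k%:R :> R.
    by rewrite -[X in X * _](@powRr1 _ 2) // pM nat1r.
  rewrite e exprMn mulrCA; congr (_ * _).
  by rewrite !pX !pM; congr (_ `^ _); ring.
- move=> y; rewrite /ind; case: ifP => y1; last by left; rewrite mul0r.
  right; have yp : 0 < `|y| by exact: lt_le_trans y1.
  pose t := ln `|y| / ln 2.
  have t0 : 0 <= t by rewrite divr_ge0 ?(ltW l2) // ln_ge0.
  have yt : `|y| = 2 `^ t by rewrite two /t divfK ?gt_eqF // lnK.
  have /andP[k1 k2] := truncn_itv t0.
  exists (Num.truncn t).
    rewrite yt; apply: (@le_lt_trans _ _ (2 `^ (Num.truncn t).+1%:R)).
      by apply: ler_powR; rewrite ?ler1n // ltW.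
    by rewrite ltr_pMl ?powR_gt0 // ltr1n.
  rewrite mul1r yt -powRrM; apply: ler_powR; first by rewrite ler1n.
  by rewrite mulrC !mulNr lerN2 ler_pM2l.
Qed.

End power_kernels.

(** * Scaling of the power kernels, and Tonelli for convolutions *)

Section scaled_kernels.
Context {R : realType}.

Lemma powRV (x r : R) : 0 < x -> x^-1 `^ r = x `^ (- r).
Proof. by move=> x0; rewrite -(powR_inv1 (ltW x0)) -powRrM mulN1r. Qed.

Lemma integral_scale_norm n (phi : R -> R) (r : R) : 0 < r -> measurable_fun setT phi ->
  (forall t, 0 <= phi t) ->
  (\int[borel_lebesgue R n]_y (phi `|y|)%:E =
   (r ^+ n)%:E * \int[borel_lebesgue R n]_y (phi (r * `|y|))%:E)%E.
Proof.
move=> r0 mphi phi0.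
have mf : measurable_fun setT (fun y : 'rV[R]_n => (phi `|y|)%:E) by mfun.
have h := ge0_integral_rV_comb 0 (lt0r_neq0 r0) mf (fun y => phi0 _).
have -> : (\int[borel_lebesgue R n]_y (phi (r * `|y|))%:E = \int[borel_lebesgue R n]_y (phi `|(0 + r *: y)%R|)%:E)%E.
  by apply: eq_integral => y _; rewrite add0r normrZ gtr0_norm.
by rewrite h muleA -EFinM gtr0_norm // -exprMn divff ?gt_eqF // expr1n mul1e.
Qed.

Lemma measurable_integral_section d1 d2 (T1 : measurableType d1) (T2 : measurableType d2)
    (m2 : {sigma_finite_measure set T2 -> \bar R}) (f : T1 -> T2 -> \bar R) :
  measurable_fun setT (fun z : T1 * T2 => f z.1 z.2) -> (forall x y, 0 <= f x y)%E ->
  measurable_fun setT (fun x => \int[m2]_y f x y)%E.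
Proof.
move=> mf f0.
exact: (@measurable_fun_fubini_tonelli_F _ _ _ _ _ m2 (fun z => f z.1 z.2) mf (fun z => f0 _ _)).
Qed.

(** The dilation [y -> r y] reduces the integral to the case [r = 1]; the 1 added to its value makes
    the constant positive. *)
Lemma kernel_head_le n (a : R) : 0 < a -> a < n%:R -> exists2 C : R, 0 < C & forall r, 0 < r ->
  (\int[borel_lebesgue R n]_y (ind (`|y| < r)%R * `|y| `^ (- a))%:E <= (C * r `^ (n%:R - a))%:E)%E.
Proof.
move=> a0 an; have := kernel_head_lt_pinfty a0 an.
set I := (X in (X < _)%E) => I_fin.
have I0 : (0 <= I)%E by apply: integral_ge0 => y _; rewrite lee_fin mulr_ge0 ?ind_ge0 ?powR_ge0.
have If : I \is a fin_num by rewrite ge0_fin_numE.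
exists (fine I + 1); first by rewrite ltr_wpDl // fine_ge0.
move=> r r0.
rewrite (@integral_scale_norm n (fun t => ind (t < r) * t `^ (- a)) r) //; last first.
- by move=> t; rewrite mulr_ge0 ?ind_ge0 ?powR_ge0.
- by mfun.
have e z : 0 <= z -> ind (r * z < r) * (r * z) `^ (- a) = r `^ (- a) * (ind (z < 1) * z `^ (- a)).
  move=> z0; rewrite powRM ?(ltW r0) // (_ : (r * z < r) = (z < 1)); first by rewrite mulrCA.
  by rewrite -ltr_pdivlMl // mulVf ?gt_eqF.
under eq_integral do rewrite e // EFinM.
rewrite ge0_integralZl_EFin ?powR_ge0 //; last first.
- by mfun.
- by move=> y _; rewrite lee_fin mulr_ge0 ?ind_ge0 ?powR_ge0.
rewrite -/I -(fineK If) -!EFinM lee_fin mulrA -powR_mulrn ?(ltW r0) // -powRD; last by rewrite (gt_eqF r0) implybT.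
by rewrite mulrC ler_wpM2r ?powR_ge0 // lerDl.
Qed.

Lemma kernel_tail_le n (b : R) : n%:R < b -> exists2 C : R, 0 < C & forall r, 0 < r ->
  (\int[borel_lebesgue R n]_y (ind (r <= `|y|)%R * `|y| `^ (- b))%:E <= (C * r `^ (n%:R - b))%:E)%E.
Proof.
move=> nb; have := kernel_tail_lt_pinfty nb.
set I := (X in (X < _)%E) => I_fin.
have I0 : (0 <= I)%E by apply: integral_ge0 => y _; rewrite lee_fin mulr_ge0 ?ind_ge0 ?powR_ge0.
have If : I \is a fin_num by rewrite ge0_fin_numE.
exists (fine I + 1); first by rewrite ltr_wpDl // fine_ge0.
move=> r r0.
rewrite (@integral_scale_norm n (fun t => ind (r <= t) * t `^ (- b)) r) //; last first.
- by move=> t; rewrite mulr_ge0 ?ind_ge0 ?powR_ge0.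
- by mfun.
have e z : 0 <= z -> ind (r <= r * z) * (r * z) `^ (- b) = r `^ (- b) * (ind (1 <= z) * z `^ (- b)).
  move=> z0; rewrite powRM ?(ltW r0) // (_ : (r <= r * z) = (1 <= z)); first by rewrite mulrCA.
  by rewrite -ler_pdivrMl // mulVf ?gt_eqF.
under eq_integral do rewrite e // EFinM.
rewrite ge0_integralZl_EFin ?powR_ge0 //; last first.
- by mfun.
- by move=> y _; rewrite lee_fin mulr_ge0 ?ind_ge0 ?powR_ge0.
rewrite -/I -(fineK If) -!EFinM lee_fin mulrA -powR_mulrn ?(ltW r0) // -powRD; last by rewrite (gt_eqF r0) implybT.
by rewrite mulrC ler_wpM2r ?powR_ge0 // lerDl.
Qed.

Lemma integral_convolution n (K g : 'rV[R]_n -> \bar R) :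
  measurable_fun setT K -> measurable_fun setT g ->
  (forall x, 0 <= K x)%E -> (forall x, 0 <= g x)%E ->
  (\int[borel_lebesgue R n]_x \int[borel_lebesgue R n]_y (K y * g (x - y)%R) =
   \int[borel_lebesgue R n]_y K y * \int[borel_lebesgue R n]_x g x)%E.
Proof.
move=> mK mg K0 g0; rewrite tonelli; last first.
- by move=> x y; rewrite mule_ge0.
- by mfun.
rewrite -ge0_integralZr //; last by apply: integral_ge0.
apply: eq_integral => y _.
rewrite ge0_integralZl //; last by mfun.
by rewrite ge0_integral_subr.
Qed.

End scaled_kernels.

(** * The Hardy-Littlewood-Sobolev inequality *)

Section hardy_littlewood_sobolev.
Context {R : realType} (n : nat) (p q a : R).
Hypotheses (a0 : 0 < a) (an : a < n%:R) (p1 : 1 < p) (q0 : 0 < q)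
  (qE : q^-1 = p^-1 - 1 + a / n%:R).
Let mu := borel_lebesgue R n.

Let n0 : 0 < n%:R :> R. Proof. exact: lt_trans an. Qed.
Let p0 : 0 < p. Proof. exact: lt_trans p1. Qed.
Let p' := p / (p - 1).
Let p'0 : 0 < p'. Proof. by rewrite divr_gt0 // subr_gt0. Qed.
Let p'E : p^-1 + p'^-1 = 1.
Proof. by rewrite /p' invf_div mulrBl divff ?gt_eqF // mul1r addrCA subrr addr0. Qed.
Let qn : n%:R / q = n%:R / p - n%:R + a.
Proof. by rewrite qE mulrDr mulrBr mulr1 mulrCA divff ?gt_eqF // mulr1. Qed.

(** Young's inequality with a weight [e]. The choice [e = rho ^ (n / (p q))] is the one for which
    the kernel term [e ^ p' * rho ^ (n - a p')] and the term [e ^ - p * A] both scale as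
    [rho ^ (- n / q)]. The condition [a p' > n], which makes the kernel tail [p']-integrable, is
    [n / q > 0] rewritten. The bound [A] is absorbed in the constant: later only uniformity over the
    functions that obey it is used. *)
Let far_part A : 0 <= A -> exists2 C : R, 0 < C & forall (f : 'rV[R]_n -> R) x rho,
  measurable_fun setT f -> (forall y, 0 <= f y) -> 0 < rho ->
  (\int[mu]_y (f y `^ p)%:E <= A%:E)%E ->
  (\int[mu]_y (ind (rho <= `|y|)%R * `|y| `^ (- a) * f (x - y)%R)%:E <= (C * rho `^ (- (n%:R / q)))%:E)%E.
Proof.
move=> A0.
have nb : n%:R < a * p'.
  have : 0 < n%:R / q by rewrite divr_gt0.
  rewrite qn -(ltr_pM2r p'0) mul0r mulrDl mulrBl.
  have -> : n%:R / p * p' = n%:R * p' - n%:R.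
    have := p'E; rewrite -mulrA => /(congr1 (fun z => n%:R * (z * p'))).
    by rewrite mulrDl mulVf ?gt_eqF // mul1r mulrDr mulr1 => <-; rewrite addrK.
  by move=> ?; lra.
have [C C0 hC] := kernel_tail_le nb.
exists (C + A); first by rewrite ltr_wpDr.
move=> f x rho mf f0 r0 fA.
have [e e0 eE] : exists2 e, 0 < e & e = rho `^ (n%:R / q / p) by exists (rho `^ (n%:R / q / p)); rewrite ?powR_gt0.
apply: (@le_trans _ _ (\int[mu]_y ((e `^ p')%:E * (ind (rho <= `|y|)%R * `|y| `^ (- (a * p')))%:E +
    (e `^ (- p))%:E * (f (x - y) `^ p)%:E)%E)%E).
  apply: ge0_le_integral => //.
  - by move=> y _; rewrite lee_fin !mulr_ge0 ?ind_ge0 ?powR_ge0.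
  - by mfun.
  - by mfun.
  move=> y _; rewrite -!EFinM -EFinD lee_fin.
  have [ry|yr] := leP rho `|y|; last first.
    by rewrite /ind !(mul0r, mulr0) add0r mulr_ge0 ?powR_ge0.
  rewrite /ind !mul1r.
  have yp : 0 < `|y| by exact: lt_le_trans ry.
  have -> : `|y| `^ (- a) * f (x - y) = (e^-1 * f (x - y)) * (e * `|y| `^ (- a)).
    by rewrite mulrACA mulVf ?gt_eqF // mul1r mulrC.
  apply: le_trans (conjugate_powR _ _ p0 p'0 p'E) _.
  - by rewrite mulr_ge0 // invr_ge0 ltW.
  - by rewrite mulr_ge0 ?powR_ge0 // ltW.
  rewrite addrC; apply: lerD.
    rewrite powRM ?powR_ge0 ?(ltW e0) // -powRrM mulNr ler_pdivrMr //.
    rewrite ler_peMr ?mulr_ge0 ?powR_ge0 //.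
    by rewrite /p' ler_pdivlMr ?subr_gt0 // mul1r gerBl.
  rewrite powRM ?invr_ge0 ?(ltW e0) // -powR_inv1 ?(ltW e0) // -powRrM mulN1r ler_pdivrMr //.
  by rewrite ler_peMr ?mulr_ge0 ?powR_ge0 // ltW.
rewrite ge0_integralD //; last first.
- by mfun.
- by move=> y _; rewrite -EFinM lee_fin mulr_ge0 ?powR_ge0.
- by mfun.
- by move=> y _; rewrite -EFinM lee_fin !mulr_ge0 ?ind_ge0 ?powR_ge0.
rewrite !ge0_integralZl_EFin ?powR_ge0 //; last first.
- by mfun.
- by move=> y _; rewrite lee_fin ?mulr_ge0 ?ind_ge0 ?powR_ge0.
- by mfun.
- by move=> y _; rewrite lee_fin ?mulr_ge0 ?ind_ge0 ?powR_ge0.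
rewrite (@ge0_integral_subl _ _ (fun z => (f z `^ p)%:E)); last first.
- by move=> z; rewrite lee_fin powR_ge0.
- by mfun.
have rr u v : rho `^ u * rho `^ v = rho `^ (u + v).
  by rewrite powRD // (gt_eqF r0) implybT.
apply: (@le_trans _ _ ((e `^ p')%:E * (C * rho `^ (n%:R - a * p'))%:E + (e `^ (- p))%:E * A%:E)%E).
  by apply: leeD; apply: lee_wpmul2l; rewrite ?lee_fin ?powR_ge0 // hC.
rewrite -!EFinM -EFinD lee_fin mulrDl; apply: lerD.
  rewrite mulrCA ler_wpM2l ?(ltW C0) // eE -powRrM rr.
  rewrite le_eqVlt; apply/orP; left; apply/eqP; congr (_ `^ _).
  rewrite /p'; have := qn; move: (n%:R / q) => z.
  have pp : p - 1 != 0 by rewrite subr_eq0 gt_eqF.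
  have pn0 : p != 0 by rewrite gt_eqF.
  move=> zE; have -> : a = z - n%:R / p + n%:R by rewrite zE; ring.
  by field; rewrite pp pn0.
rewrite mulrC ler_wpM2l // eE -powRrM.
by rewrite mulrN divfK ?gt_eqF.
Qed.

(** A weak-type estimate. Where [h] is at least [1 / t], the convolution of the near kernel with the
    high values of [f] is at least [1 / (2 t)], so Chebyshev's inequality and [integral_convolution]
    apply to it. The exponent [q / p] arises as [1 + q (n - a) / n]. *)
Let level_bound A : 0 <= A -> exists2 c : R, 0 < c & forall (f h : 'rV[R]_n -> R) t,
  measurable_fun setT f -> (forall y, 0 <= f y) -> measurable_fun setT h -> (forall y, 0 <= h y) -> 0 < t ->
  (\int[mu]_y (f y `^ p)%:E <= A%:E)%E ->
  (forall x, (h x)%:E <= \int[mu]_y (`|y| `^ (- a) * f (x - y)%R)%:E)%E ->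
  (\int[mu]_x (ind (1 <= t * h x)%R)%:E <=
   \int[mu]_x (c * t `^ (q / p) * (f x * ind (1 < 2 * c * t `^ (q / p) * f x)%R))%:E)%E.
Proof.
move=> A0; have [C2 C20 hC2] := far_part A0.
have [C1 C10 hC1] := kernel_head_le a0 an.
exists (2 * C1 * (4 * C2) `^ (q * (n%:R - a) / n%:R)).
  by rewrite !mulr_gt0 // powR_gt0 // mulr_gt0.
set c := 2 * C1 * _.
move=> f h t mf f0 mh h0 t0 fA hh.
(* [C2 * rho ^ (- n / q) = 1 / (4 t)]: the far part of the kernel takes a quarter of the level
   [1 / t]. *)
pose rho := (4 * C2 * t) `^ (q / n%:R).
have r0 : 0 < rho by rewrite powR_gt0 // !mulr_gt0.
(* The low values of [f] contribute at most [tau * C1 * rho ^ (n - a) = 1 / (4 t)], a second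
   quarter. In terms of [c], [1 / tau = 2 c t ^ (q / p)]. *)
pose tau := (4 * C1 * t * rho `^ (n%:R - a))^-1.
have D0 : 0 < 4 * C1 * t * rho `^ (n%:R - a) by rewrite !mulr_gt0 // powR_gt0.
have tau0 : 0 < tau by rewrite invr_gt0.
have cE : c * t `^ (q / p) = 2 * C1 * t * rho `^ (n%:R - a).
  rewrite /c /rho -powRrM (_ : q / n%:R * (n%:R - a) = q * (n%:R - a) / n%:R); last by rewrite mulrAC.
  rewrite [in RHS]powRM ?mulr_ge0 ?ltW //.
  have -> : t `^ (q / p) = t * t `^ (q * (n%:R - a) / n%:R).
    rewrite -[X in _ = X * _]powRr1 ?ltW // -powRD ?(gt_eqF t0) ?implybT //; congr (_ `^ _).
    have qi : q * q^-1 = 1 by rewrite divff // gt_eqF.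
    by rewrite -[X in _ = X + _]qi qE; field; rewrite !gt_eqF.
  ring.
have tauE x : (1 < 2 * c * t `^ (q / p) * f x) = (tau < f x).
  have -> : 2 * c * t `^ (q / p) * f x = 2 * (c * t `^ (q / p)) * f x by ring.
  rewrite /tau cE.
  rewrite -[X in _ = (X < _)]mul1r ltr_pdivrMr // mulrC; congr (_ < _ * _); ring.
pose K1 (y : 'rV[R]_n) := ind (`|y| < rho) * `|y| `^ (- a).
have K10 y : 0 <= K1 y by rewrite mulr_ge0 ?ind_ge0 ?powR_ge0.
have mK1 : measurable_fun setT K1 by rewrite /K1; mfun.
pose g x := f x * ind (tau < f x).
have g0 x : 0 <= g x by rewrite mulr_ge0 ?ind_ge0.
have mg : measurable_fun setT g by rewrite /g; mfun.
have key x : ((ind (1 <= t * h x)%R)%:E <= (2 * t)%:E * \int[mu]_y ((K1 y)%:E * (g (x - y)%R)%:E))%E.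
  have I0 : (0 <= \int[mu]_y ((K1 y)%:E * (g (x - y)%R)%:E))%E.
    by apply: integral_ge0 => y _; rewrite -EFinM lee_fin mulr_ge0.
  rewrite {1}/ind; case: ifP => th; last by apply: mule_ge0 => //; rewrite lee_fin mulr_ge0 // ltW.
  have split : ((h x)%:E <= (C2 * rho `^ (- (n%:R / q)))%:E +
      ((tau * (C1 * rho `^ (n%:R - a)))%:E + \int[mu]_y ((K1 y)%:E * (g (x - y)%R)%:E)))%E.
    apply: (le_trans (hh x)).
    apply: (@le_trans _ _ (\int[mu]_y ((ind (rho <= `|y|)%R * `|y| `^ (- a) * f (x - y)%R)%:E +
       (tau%:E * (K1 y)%:E + (K1 y)%:E * (g (x - y)%R)%:E)))%E).
      apply: ge0_le_integral => //.
      - by move=> y _; rewrite lee_fin mulr_ge0 ?powR_ge0.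
      - by mfun.
      - by mfun.
      move=> y _; rewrite -!EFinM -!EFinD lee_fin /K1 /g /ind.
      have ya0 : 0 <= `|y| `^ (- a) by exact: powR_ge0.
      case: (leP rho `|y|) => ry; first by rewrite !(mul0r, mul1r, mulr0, addr0).
      rewrite !(mul0r, mul1r, add0r); case: (ltP tau (f (x - y))) => ft.
        by rewrite mulr1 lerDr mulr_ge0 // ltW.
      by rewrite !mulr0 addr0 mulrC ler_wpM2r.
    rewrite ge0_integralD //; last first.
    - by mfun.
    - by move=> y _; rewrite -!EFinM -EFinD lee_fin addr_ge0 // mulr_ge0 // ltW.
    - by mfun.
    - by move=> y _; rewrite lee_fin !mulr_ge0 ?ind_ge0 ?powR_ge0.
    apply: leeD; first exact: hC2.
    rewrite ge0_integralD //; last first.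
    - by mfun.
    - by move=> y _; rewrite -!EFinM lee_fin mulr_ge0 // ltW.
    - by mfun.
    - by move=> y _; rewrite -!EFinM lee_fin mulr_ge0 // ltW.
    apply: leeD => //; rewrite ge0_integralZl_EFin ?(ltW tau0) //; last first.
    - by mfun.
    - by move=> y _; rewrite lee_fin.
    by rewrite EFinM lee_pmul2l // ?lte_fin // hC1.
  have e1 : C2 * rho `^ (- (n%:R / q)) = (4 * t)^-1.
    rewrite /rho -powRrM mulrN mulrA divfK ?gt_eqF // divff ?gt_eqF // powR_inv1 ?mulr_ge0 ?ltW //.
    by field; rewrite !gt_eqF.
  have e2 : tau * (C1 * rho `^ (n%:R - a)) = (4 * t)^-1.
    by rewrite /tau; field; rewrite !gt_eqF // powR_gt0.
  move: split I0; rewrite e1 e2; case: (\int[mu]_y ((K1 y)%:E * (g (x - y)%R)%:E))%E => [r| |] //; last first.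
    by move=> _ _; rewrite mulry gtr0_sg ?mul1e ?leey // mulr_gt0.
  rewrite -!EFinD -EFinM !lee_fin => hx _.
  have : 1 <= t * ((4 * t)^-1 + ((4 * t)^-1 + r)).
    by apply: (le_trans th); rewrite ler_pM2l.
  have -> : t * ((4 * t)^-1 + ((4 * t)^-1 + r)) = 2^-1 + t * r by field; rewrite gt_eqF.
  by lra.
have mconv : measurable_fun setT (fun x : 'rV[R]_n => \int[mu]_y ((K1 y)%:E * (g (x - y)%R)%:E))%E.
  by apply: measurable_integral_section; [mfun | move=> x y; rewrite -EFinM lee_fin mulr_ge0].
apply: (@le_trans _ _ (\int[mu]_x ((2 * t)%:E * \int[mu]_y ((K1 y)%:E * (g (x - y)%R)%:E)))%E).
  apply: ge0_le_integral => //.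
  - by move=> x _; rewrite lee_fin ind_ge0.
  - by mfun.
  - by mfun.
have cv0 x : (0 <= \int[mu]_y ((K1 y)%:E * (g (x - y)%R)%:E))%E.
  by apply: integral_ge0 => y _; rewrite -EFinM lee_fin mulr_ge0.
rewrite ge0_integralZl_EFin //; last first.
- by rewrite mulr_ge0 // ltW.
rewrite (@integral_convolution _ _ (fun y => (K1 y)%:E) (fun y => (g y)%:E)) //; last first.
- by mfun.
- by mfun.
under [leRHS]eq_integral => x _ do rewrite tauE -/(g x) EFinM.
rewrite ge0_integralZl_EFin //; last first.
- by rewrite cE !mulr_ge0 ?powR_ge0 // ltW.
- by mfun.
- by move=> x _; rewrite lee_fin.
rewrite muleA; apply: lee_wpmul2r; first by apply: integral_ge0 => x _; rewrite lee_fin.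
rewrite cE (_ : 2 * C1 * t * _ = (2 * t) * (C1 * rho `^ (n%:R - a))); last by ring.
by rewrite [leRHS]EFinM lee_pmul2l ?lte_fin ?mulr_gt0 // hC1.
Qed.

(* Layer cake in t = 1 / h: at level t the kernel is cut at a radius of order
   t `^ (q / n) and f at a height of order t `^ (- q / p), so that the far part of
   the kernel and the low values of f contribute at most half of the level. *)
Lemma hardy_littlewood_sobolev A : 0 <= A -> exists C : R, forall f h : 'rV[R]_n -> R,
  measurable_fun setT f -> (forall y, 0 <= f y) -> measurable_fun setT h -> (forall y, 0 <= h y) ->
  (\int[mu]_y (f y `^ p)%:E <= A%:E)%E ->
  (forall x, (h x)%:E <= \int[mu]_y (`|y| `^ (- a) * f (x - y)%R)%:E)%E ->
  (\int[mu]_x (h x `^ q)%:E <= C%:E)%E.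
Proof.
move=> A0; have [c c0 hc] := level_bound A0.
pose gg := q - q / p.
have g0 : 0 < gg by rewrite subr_gt0 -[ltRHS]mulr1 ltr_pM2l // invf_lt1.
exists (q * (c * ((2 * c) `^ (p - 1) / gg) * A)).
move=> f h mf f0 mh h0 fA hh.
pose lam : {sigma_finite_measure set (measurableTypeR R) -> \bar R} := @lebesgue_measure R.
(* [h ^ q] is [q] times the tail integral of [t ^ (- q - 1)] from [1 / h] on. *)
have tailE x : (h x `^ q)%:E = (q%:E * \int[lam]_t (t `^ (- q - 1) * ind (1 <= t * h x)%R)%:E)%E.
  have := h0 x; rewrite le_eqVlt => /predU1P[<-|hx0].
    rewrite powR0 ?gt_eqF // integral0_eq ?mule0 // => t _.
    by rewrite mulr0 /ind ler10 mulr0.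
  have hi : 0 < (h x)^-1 by rewrite invr_gt0.
  under eq_integral => t _ do rewrite -ler_pdivrMr // mul1r mulrC.
  rewrite integral_power_tail // -EFinM mulrCA divff ?gt_eqF // mulr1 powRN.
  by rewrite -powRN -[(h x)^-1]powR_inv1 ?ltW // -powRrM mulN1r opprK.
under eq_integral do rewrite tailE.
have mtx : measurable_fun setT (fun z : 'rV[R]_n * measurableTypeR R =>
    (z.2 `^ (- q - 1) * ind (1 <= z.2 * h z.1)%R)%:E).
  by mfun.
rewrite ge0_integralZl_EFin ?(ltW q0) //; last first.
- apply: measurable_integral_section; [exact: mtx | move=> x t].
  by rewrite lee_fin mulr_ge0 ?ind_ge0 ?powR_ge0.
- by move=> x _; apply: integral_ge0 => t _; rewrite lee_fin mulr_ge0 ?ind_ge0 ?powR_ge0.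
rewrite EFinM lee_pmul2l ?lte_fin //.
rewrite (@tonelli _ _ _ _ _ mu lam (fun x t => (t `^ (- q - 1) * ind (1 <= t * h x)%R)%:E)) //; last first.
  by move=> x t; rewrite lee_fin mulr_ge0 ?ind_ge0 ?powR_ge0.
pose F t x : R := ind (0 < t) * (t `^ (- q - 1) * (c * t `^ (q / p) * (f x * ind (1 < 2 * c * t `^ (q / p) * f x)))).
have F0 t x : 0 <= F t x by rewrite /F !mulr_ge0 ?ind_ge0 ?powR_ge0 // ltW.
have mF : measurable_fun setT (fun z : measurableTypeR R * 'rV[R]_n => (F z.1 z.2)%:E) by rewrite /F; mfun.
apply: (@le_trans _ _ (\int[lam]_t \int[mu]_x (F t x)%:E)%E).
  apply: ge0_le_integral => //.
  - by move=> t _; apply: integral_ge0 => x _; rewrite lee_fin mulr_ge0 ?ind_ge0 ?powR_ge0.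
  - apply: (@measurable_fun_fubini_tonelli_F _ _ _ _ _ mu (fun z : measurableTypeR R * 'rV[R]_n => (z.1 `^ (- q - 1) * ind (1 <= z.1 * h z.2)%R)%:E)).
      by mfun.
    by move=> z; rewrite lee_fin mulr_ge0 ?ind_ge0 ?powR_ge0.
  - by apply: measurable_integral_section; [exact: mF | move=> t x; rewrite lee_fin].
  move=> t _; have [t0|t0] := leP t 0.
    rewrite integral0_eq; first by apply: integral_ge0 => x _; rewrite lee_fin.
    move=> x _; rewrite /ind leNgt (le_lt_trans _ (@ltr01 R)) ?mulr0 //.
    by rewrite mulr_le0_ge0.
  have it : ind (0 < t) = 1 :> R by rewrite /ind t0.
  rewrite /F it.
  under eq_integral do rewrite EFinM.
  under [leRHS]eq_integral do rewrite mul1r EFinM.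
  rewrite !ge0_integralZl_EFin ?powR_ge0 //; last first.
  - by mfun.
  - by move=> x _; rewrite lee_fin ind_ge0.
  - by mfun.
  - by move=> x _; rewrite lee_fin !mulr_ge0 ?ind_ge0 ?powR_ge0 // ltW.
  by rewrite lee_pmul2l ?lte_fin ?powR_gt0 //; exact: hc.
rewrite (@tonelli _ _ _ _ _ lam mu (fun t x => (F t x)%:E)) //.
apply: (@le_trans _ _ (\int[mu]_x ((c * ((2 * c) `^ (p - 1) / gg))%:E * (f x `^ p)%:E))%E); last first.
  rewrite ge0_integralZl_EFin //; last first.
  - by rewrite !mulr_ge0 ?invr_ge0 ?powR_ge0 // ltW.
  - by mfun.
  - by move=> x _; rewrite lee_fin powR_ge0.
  rewrite [leRHS]EFinM; apply: lee_wpmul2l => //; rewrite lee_fin.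
  by rewrite !mulr_ge0 ?invr_ge0 ?powR_ge0 // ltW.
apply: ge0_le_integral => //.
- by move=> x _; apply: integral_ge0 => t _; rewrite lee_fin.
- apply: (@measurable_fun_fubini_tonelli_F _ _ _ _ _ lam (fun z : 'rV[R]_n * measurableTypeR R => (F z.2 z.1)%:E)).
    by rewrite /F; mfun.
  by move=> z; rewrite lee_fin.
- by mfun.
move=> x _; have := f0 x; rewrite le_eqVlt => /predU1P[fx|fx0].
  rewrite integral0_eq; last by move=> t _; rewrite /F -fx !(mul0r, mulr0).
  by rewrite -EFinM lee_fin !mulr_ge0 ?invr_ge0 ?powR_ge0 // ltW.
(* The threshold in [t] of the condition [1 < 2 c t ^ (q / p) f x]. The tail from [b] on contributes
   [b ^ (- gg) = (2 c f x) ^ (p - 1)], which together with the factor [f x] restores [f x ^ p]. *)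
pose b := (2 * c * f x) `^ (- (p / q)).
have cf0 : 0 < 2 * c * f x by rewrite !mulr_gt0.
have b0 : 0 < b by rewrite powR_gt0.
apply: (@le_trans _ _ (\int[lam]_t ((c * f x)%:E * (ind (b <= t)%R * t `^ (- gg - 1))%:E))%E).
  apply: ge0_le_integral => //.
  - by move=> t _; rewrite lee_fin.
  - by rewrite /F; mfun.
  - by mfun.
  move=> t _; rewrite -EFinM lee_fin /F {1}/ind; case: ifP => t0; last first.
    by rewrite mul0r !mulr_ge0 ?ind_ge0 ?powR_ge0 // ltW.
  rewrite mul1r {1}/ind; case: ifP => h1; last first.
    by rewrite !mulr0 !mulr_ge0 ?ind_ge0 ?powR_ge0 // ltW.
  have bt : b <= t.
    have tp : t = (t `^ (q / p)) `^ (p / q).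
      by rewrite -powRrM mulf_div (mulrC p) divff ?powRr1 ?ltW // mulf_neq0 ?gt_eqF.
    have -> : b = ((2 * c * f x)^-1) `^ (p / q) by rewrite powRV.
    rewrite tp; apply: ge0_ler_powR.
    - by rewrite divr_ge0 // ltW.
    - by rewrite nnegrE invr_ge0 ltW.
    - by rewrite nnegrE powR_ge0.
    rewrite -[leLHS]mul1r ler_pdivrMr //; apply: ltW; apply: (lt_le_trans h1).
    by rewrite le_eqVlt; apply/orP; left; apply/eqP; ring.
  rewrite /ind bt !mul1r mulr1.
  have -> : - gg - 1 = (- q - 1) + q / p by rewrite /gg; ring.
  rewrite (@powRD _ t (- q - 1) (q / p)) ?(gt_eqF t0) ?implybT //.
  by rewrite le_eqVlt; apply/orP; left; apply/eqP; ring.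
rewrite ge0_integralZl_EFin ?mulr_ge0 ?(ltW c0) //; last first.
- by mfun.
- by move=> t _; rewrite lee_fin mulr_ge0 ?ind_ge0 ?powR_ge0.
rewrite integral_power_tail // -!EFinM lee_fin /b -powRrM.
have -> : - (p / q) * - gg = p - 1 by rewrite /gg; field; rewrite !gt_eqF.
rewrite powRM ?mulr_ge0 ?(ltW c0) ?f0 //.
have -> : f x `^ p = f x * f x `^ (p - 1).
  rewrite -[X in X * _]powRr1 ?(ltW fx0) // -powRD ?(gt_eqF fx0) ?implybT //.
  by congr (_ `^ _); ring.
by rewrite le_eqVlt; apply/orP; left; apply/eqP; ring.
Qed.

End hardy_littlewood_sobolev.

Lemma continuous_distP {R : realType} (T : topologicalType) (V : normedModType R) (f : T -> V) :
  (forall x e, 0 < e -> \forall y \near x, `|f x - f y| < e) <-> continuous f.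
Proof.
split=> [h x|cf x e e0].
  by apply/(@cvgrPdist_lt _ _ _ (nbhs x) (nbhs_filter x)) => e e0; exact: h.
by have /(@cvgrPdist_lt _ _ _ (nbhs x) (nbhs_filter x)) := cf x; exact.
Qed.

(** * Mean value theorem and chain rule from continuous partial derivatives *)

Section partial_derivatives.
Context {R : realType} {n : nat}.
Implicit Types (f : 'rV[R]_n -> R) (df : 'I_n -> 'rV[R]_n -> R).

Definition edir (j : 'I_n) : 'rV[R]_n := delta_mx 0 j.

Lemma is_derive_line {V : normedModType R} (f : V -> R) (z v : V) (s d : R) :
  is_derive (z + s *: v) v f d -> is_derive s 1 (fun t => f (z + t *: v)) d.
Proof.
move=> [dv <-].
have E : (fun h : R => h^-1 *: ((fun t => f (z + t *: v)) (h *: (1 : R) + s) - f (z + s *: v))) =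
   (fun h => h^-1 *: (f (h *: v + (z + s *: v)) - f (z + s *: v))).
  apply/funext => h; congr (_ *: (f _ - _)).
  by rewrite [h%:A]mulr1 scalerDl addrCA.
by split; rewrite /derivable /derive /= E.
Qed.

(** The coordinates of [x] are replaced by those of [y] one at a time, with the one-dimensional mean
    value theorem at each replacement. In the sup norm no intermediate point is farther from [x]
    than [y] is, so the [xi k] tend to [x] when [y] does. *)
Lemma partials_mvt f df (x y : 'rV[R]_n) :
  (forall j z, is_derive z (edir j) f (df j z)) ->
  exists2 xi : 'I_n -> 'rV[R]_n, forall k, `|xi k - x| <= `|y - x| &
    f y - f x = \sum_k (y 0 k - x 0 k) * df k (xi k).
Proof.
move=> hd.
pose P (k : nat) : 'rV[R]_n := \row_i (if (i < k)%N then y 0 i else x 0 i).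
have P0 : P 0%N = x by apply/rowP => i; rewrite mxE.
have Pn : P n = y by apply/rowP => i; rewrite mxE ltn_ord.
have step (k : 'I_n) : exists2 c, `|c - x| <= `|y - x| & f (P k.+1) - f (P k) = (y 0 k - x 0 k) * df k c.
  pose d := y 0 k - x 0 k.
  pose g (t : R) := f (P k + t *: edir k).
  have dg t : is_derive t (1 : R) g (df k (P k + t *: edir k)) by exact: is_derive_line.
  have cg t : {for t, continuous g}.
    by apply: differentiable_continuous; apply/derivable1_diffP; have [] := dg t.
  have -> : f (P k.+1) = g d.
    congr f; apply/rowP => i; rewrite !mxE eqxx /= ltnS leq_eqVlt.
    case: (altP (i =P k)) => [->|ne]; first by rewrite eqxx ltnn /= mulr1 addrC subrK.
    by rewrite (_ : (i == k :> nat) = false) ?mulr0 ?addr0 //; apply/negbTE.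
  have -> : f (P k) = g 0 by congr f; rewrite scale0r addr0.
  have fin c : `|c| <= `|d| -> `|P k + c *: edir k - x| <= `|y - x|.
    move=> cd; apply: rV_norm_le => // i; rewrite !mxE eqxx /=.
    apply: le_trans (rV_coord_le (y - x) i); rewrite !mxE.
    case: (altP (i =P k)) => [->|ne]; first by rewrite ltnn mulr1 addrAC subrr add0r.
    by rewrite mulr0 addr0; case: ifP => // _; rewrite subrr normr0.
  have [d0|d0] := leP 0 d.
    have [c] := MVT_segment d0 (fun t _ => dg t) (continuous_subspaceT cg).
    rewrite in_itv /= => /andP[c0 cd] ->; exists (P k + c *: edir k); last by rewrite subr0 mulrC.
    by apply: fin; rewrite !ger0_norm.
  have [c] := MVT_segment (ltW d0) (fun t _ => dg t) (continuous_subspaceT cg).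
  rewrite in_itv /= => /andP[cd c0] e; exists (P k + c *: edir k).
    by apply: fin; rewrite !ler0_norm // ?lerN2 // ltW.
  by rewrite -[LHS]opprB e sub0r mulrN opprK mulrC.
have /choice[xi hxi] : forall k : 'I_n, exists c, `|c - x| <= `|y - x| /\
   f (P k.+1) - f (P k) = (y 0 k - x 0 k) * df k c.
  by move=> k; have [c] := step k; exists c.
exists xi => [k|]; first by have [] := hxi k.
under eq_bigr => k _ do rewrite -(proj2 (hxi k)).
rewrite -(big_mkord xpredT (fun k => f (P k.+1) - f (P k))) telescope_sumr //.
by rewrite P0 Pn.
Qed.

(** Derivatives, bound and support radius are data, so that the estimates can name them. This is all
    the regularity of test functions on which the potential estimates rest. *)
Definition C1c f df (M rho : R) : Prop :=
  [/\ 0 < rho, forall j, continuous (df j), forall j z, is_derive z (edir j) f (df j z),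
      forall x, rho <= `|x| -> f x = 0 /\ forall j, df j x = 0 &
      forall x, `|f x| <= M /\ forall j, `|df j x| <= M].

Lemma C1c_lipschitz f df M rho x y : C1c f df M rho -> `|f y - f x| <= n%:R * M * `|y - x|.
Proof.
move=> [_ _ hd _ hM]; have [xi _ ->] := partials_mvt x y hd.
rewrite (le_trans (ler_norm_sum _ _ _)) //.
have -> : n%:R * M * `|y - x| = \sum_(k < n) (M * `|y - x|).
  by rewrite sumr_const card_ord -mulrA mulr_natl.
apply: ler_sum => k _; rewrite normrM mulrC ler_pM //; first by have [_ ->] := hM (xi k).
by have := rV_coord_le (y - x) k; rewrite !mxE.
Qed.

(** Continuous partial derivatives yield all directional ones: [partials_mvt] expresses the
    increment by partials at points that converge to [x + s *: v]. *)
Lemma C1c_is_derive_line f df M rho (x v : 'rV[R]_n) (s : R) : C1c f df M rho ->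
  is_derive s 1 (fun t => f (x + t *: v)) (\sum_k v 0 k * df k (x + s *: v)).
Proof.
move=> [_ cdf hd _ _]; set z := x + s *: v.
suff L : (fun h : R => h^-1 *: ((fun t => f (x + t *: v)) (h *: (1 : R) + s) - f z)) @ 0^' -->
    (\sum_k v 0 k * df k z : R).
  split; first by apply/cvg_ex; exists (\sum_k v 0 k * df k z : R).
  exact: cvg_lim L.
apply/cvgrPdist_lt => e e0.
pose V := \sum_k `|v 0 k| + 1.
have V0 : 0 < V by rewrite ltr_wpDl // sumr_ge0.
have : \forall y \near z, forall k, `|df k z - df k y| < e / V.
  apply: (@filter_forall _ _ _ (nbhs z) (nbhs_filter z)) => k.
  by have /(@continuous_distP _ 'rV[R]_n R^o) := cdf k; apply; rewrite divr_gt0.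
move=> /nbhs_ballP[del /= del0 hdel].
have v1 : 0 < `|v| + 1 by rewrite ltr_wpDl.
near=> h; rewrite /= /GRing.scale /= mulr1.
have h0 : h != 0 by near: h; exact: nbhs_dnbhs_neq.
have hs : `|h| < del / (`|v| + 1).
  near: h; apply: dnbhs0_lt; by rewrite divr_gt0.
have [xi hxi ->] := partials_mvt z (x + (h + s) *: v) hd.
have E : x + (h + s) *: v - z = h *: v by rewrite /z scalerDl opprD addrACA subrr add0r addrK.
have hk k : `|df k z - df k (xi k)| < e / V.
  apply: hdel; rewrite -ball_normE /= distrC; apply: (le_lt_trans (hxi k)).
  rewrite E normrZ; apply: (@le_lt_trans _ _ (`|h| * (`|v| + 1))).
    by rewrite ler_wpM2l // lerDl.
  by rewrite -ltr_pdivlMr.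
have -> : \sum_k v 0 k * df k z - h^-1 * (\sum_k ((x + (h + s) *: v) 0 k - z 0 k) * df k (xi k)) =
   \sum_k v 0 k * (df k z - df k (xi k)).
  rewrite mulr_sumr -sumrB; apply: eq_bigr => k _.
  have -> : (x + (h + s) *: v) 0 k - z 0 k = h * v 0 k.
    by have := congr1 (fun w : 'rV[R]_n => w 0 k) E; rewrite !mxE.
  by rewrite mulrA mulrA mulVf // mul1r mulrBr.
apply: (le_lt_trans (ler_norm_sum _ _ _)).
apply: (@le_lt_trans _ _ (\sum_k `|v 0 k| * (e / V))).
  by apply: ler_sum => k _; rewrite normrM ler_wpM2l // ltW.
rewrite -mulr_suml; apply: (@lt_le_trans _ _ (V * (e / V))).
  by rewrite ltr_pM2r ?divr_gt0 // ltrDl.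
by rewrite mulrC divfK // gt_eqF.
Unshelve. all: by end_near. Qed.

End partial_derivatives.

(** * Components of test functions *)

Section smooth_components.
Context {R : realType} {n m : nat}.

Lemma continuous_coord (f : 'rV[R]_n -> 'rV[R]_m) i : continuous f -> continuous (fun x => f x 0 i).
Proof.
move=> cf; apply/(@continuous_distP _ 'rV[R]_n R^o) => x e e0; near=> y.
apply: (@le_lt_trans _ _ `|f x - f y|).
  by have := rV_coord_le (f x - f y) i; rewrite !mxE.
by near: y; move/continuous_distP : cf; exact.
Unshelve. all: by end_near. Qed.

Lemma is_derive_coord (f : 'rV[R]_n -> 'rV[R]_m) (x v : 'rV[R]_n) i : derivable f x v ->
  is_derive x v (fun x => f x 0 i) ('D_v f x 0 i).
Proof.
move=> df.
suff L : (fun h : R => h^-1 *: (f (h *: v + x) 0 i - f x 0 i)) @ 0^' --> ('D_v f x 0 i : R).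
  split; first by apply/cvg_ex; exists ('D_v f x 0 i : R).
  exact: cvg_lim L.
have {}df : (fun h : R => h^-1 *: (f (h *: v + x) - f x)) @ 0^' --> 'D_v f x by exact: df.
apply/cvgrPdist_lt => e e0; near=> h.
apply: (@le_lt_trans _ _ `|'D_v f x - h^-1 *: (f (h *: v + x) - f x)|).
  by have := rV_coord_le ('D_v f x - h^-1 *: (f (h *: v + x) - f x)) i; rewrite !mxE.
by near: h; move/cvgrPdist_lt : df; exact.
Unshelve. all: by end_near. Qed.

Lemma Cc_infty_C1c (f : 'rV[R]_n -> 'rV[R]_m) i : Cc_infty f ->
  exists M rho, C1c (fun x => f x 0 i) (fun j x => 'D_(edir j) f x 0 i) M rho.
Proof.
move=> [sf cK]; set K := closure _ in cK.
have [cf df] := sf [::].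
have cd j : continuous ('D_(edir j) f) by have [] := sf [:: j].
have out x : ~ K x -> \forall y \near x, f y = 0.
  move=> nK; have : open (~` K) by apply: closed_openC; exact: closed_closure.
  rewrite openE => /(_ x nK); apply: filterS => y nKy.
  by apply: contra_notP nKy => /eqP ne; apply: subset_closure.
(* Off the closed support the function vanishes in a whole neighbourhood, so its derivatives vanish
   there too. *)
have dout j x : ~ K x -> 'D_(edir j) f x = 0.
  move=> nK; rewrite -(derive_cst (0 : 'rV[R]_m) x (edir j)).
  by apply: near_eq_derive; exact: out.
have fout x : ~ K x -> f x = 0 by move=> /out /nbhs_singleton.
have bnd (h : 'rV[R]_n -> R) : continuous h -> (forall x, ~ K x -> h x = 0) -> exists M, forall x, `|h x| <= M.
  move=> ch hout.
  have /compact_bounded [M [_ hM]] := continuous_compact (continuous_subspaceT ch) cK.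
  exists (Num.max (M + 1) 0) => x; have [Kx|nK] := pselect (K x).
    rewrite le_max; apply/orP; left; apply: (hM (M + 1)); first by rewrite ltrDl.
    by exists x.
  by rewrite hout // normr0 le_max lexx orbT.
have [M0 hM0] : exists M, forall x, `|f x 0 i| <= M.
  by apply: bnd => [|x nK]; [exact: continuous_coord | rewrite fout // mxE].
have /choice[MD hMD] : forall j, exists M, forall x, `|'D_(edir j) f x 0 i| <= M.
  move=> j; apply: bnd; first exact: continuous_coord.
  by move=> x nK; rewrite dout // mxE.
have [rho [_ hrho]] := compact_bounded cK.
have Kr x : Num.max (rho + 1) 0 + 1 <= `|x| -> ~ K x.
  move=> hx Kx; have /= := hrho (rho + 1) _ x Kx; rewrite ltrDl => /(_ ltr01) h.
  have := le_trans hx h; apply/negP; rewrite -ltNge (@le_lt_trans _ _ (Num.max (rho + 1) 0)) ?ltrDl //.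
  by rewrite le_max lexx.
pose M := \big[Num.max/M0]_j MD j.
exists M, (Num.max (rho + 1) 0 + 1); split.
- by rewrite ltr_wpDl // le_max lexx orbT.
- by move=> j; exact: continuous_coord.
- by move=> j z; apply: is_derive_coord; exact: df.
- by move=> x /Kr nK; split => [|j]; rewrite ?fout ?dout // mxE.
- move=> x; split; first by apply: (le_trans (hM0 x)); exact: bigmax_ge_id.
  by move=> j; apply: (le_trans (hMD j x)); exact: le_bigmax.
Qed.

End smooth_components.

(** * Real-valued integrals: domination, Fubini, translations *)

Section real_integrals.
Context {R : realType}.

Lemma ge0_fin_integrable d (T : measurableType d) (mu : {measure set T -> \bar R}) (f : T -> R) :
  measurable_fun setT f -> (forall x, 0 <= f x) -> (\int[mu]_x (f x)%:E < +oo)%E ->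
  mu.-integrable setT (EFin \o f).
Proof.
move=> mf f0 fi; apply/integrableP; split; first by apply/measurable_EFinP.
by under eq_integral do rewrite /= ger0_norm //.
Qed.

Lemma integrable_le d (T : measurableType d) (mu : {measure set T -> \bar R}) (f g : T -> R) :
  measurable_fun setT f -> mu.-integrable setT (EFin \o g) -> (forall x, `|f x| <= g x) ->
  mu.-integrable setT (EFin \o f).
Proof.
move=> mf ig fg; apply: le_integrable ig => //; first exact/measurable_EFinP.
by move=> x _ /=; rewrite lee_fin (le_trans (fg x)) // ler_norm.
Qed.

Lemma ler_norm_Rintegral d (T : measurableType d) (mu : {measure set T -> \bar R}) (f g : T -> R) :
  measurable_fun setT f -> mu.-integrable setT (EFin \o g) -> (forall x, `|f x| <= g x) ->
  `|\int[mu]_x f x| <= \int[mu]_x g x.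
Proof.
move=> mf ig fg; have fi := integrable_le mf ig fg.
apply: (le_trans (le_normr_Rintegral measurableT fi)).
apply: le_Rintegral => //; exact: (integrable_norm fi).
Qed.

Lemma Rintegral_cvg d (T : measurableType d) (mu : {measure set T -> \bar R})
    (f_ : nat -> T -> R) (f g : T -> R) :
  (forall m, measurable_fun setT (f_ m)) -> measurable_fun setT f ->
  {ae mu, forall x, (f_ ^~ x) @ \oo --> f x} -> mu.-integrable setT (EFin \o g) ->
  {ae mu, forall x, forall m, `|f_ m x| <= g x} ->
  \int[mu]_x f_ m x @[m --> \oo] --> \int[mu]_x f x.
Proof.
move=> mf_ mf ff ig fg.
have mf_E m : measurable_fun setT (fun x => (f_ m x)%:E) by apply/measurable_EFinP.
have mfE : measurable_fun setT (fun x => (f x)%:E) by apply/measurable_EFinP.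
have ffE : {ae mu, forall x, setT x -> (fun m => (f_ m x)%:E) @ \oo --> (f x)%:E}.
  by apply: filterS ff => x ffx _; apply: cvg_EFin; [exact: nearW | exact: ffx].
have fgE : {ae mu, forall x m, setT x -> (`|(f_ m x)%:E| <= (EFin \o g) x)%E}.
  by apply: filterS fg => x fgx m _; rewrite lee_fin.
have [fi _ h] := dominated_convergence measurableT mf_E mfE ffE ig fgE.
apply: fine_cvg; rewrite fineK //; exact: integrable_fin_num.
Qed.

(** Positive and negative parts are treated separately as extended integrals, so the argument also
    covers sections whose integral diverges. *)
Lemma measurable_Rintegral_section d1 d2 (T1 : measurableType d1) (T2 : measurableType d2)
    (m2 : {sigma_finite_measure set T2 -> \bar R}) (f : T1 -> T2 -> R) :
  measurable_fun setT (fun z : T1 * T2 => f z.1 z.2) ->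
  measurable_fun setT (fun x => \int[m2]_y f x y).
Proof.
move=> mf; apply: (measurableT_comp (fine_measurable measurableT)).
have -> : (fun x => \int[m2]_y (f x y)%:E)%E =
  (fun x => \int[m2]_y (Num.max (f x y) 0)%:E - \int[m2]_y (Num.max (- f x y) 0)%:E)%E.
  apply/funext => x; rewrite integralE; congr (_ - _)%E; apply: eq_integral => y _.
    by rewrite funeposE EFin_max.
  by rewrite funenegE EFin_max EFinN.
apply: emeasurable_funB; apply: measurable_integral_section.
- by apply/measurable_EFinP; apply: measurable_maxr.
- by move=> x y; rewrite lee_fin le_max lexx orbT.
- by apply/measurable_EFinP; apply: measurable_maxr => //; exact: measurable_funN.
- by move=> x y; rewrite lee_fin le_max lexx orbT.
Qed.

(** The real integral is [fine] of the extended one, hence 0 where that is infinite. Integrability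
    of every section, and not just of almost every one, lets [fine] be removed from all inner
    integrals. *)
Lemma Rfubini_sections d1 d2 (T1 : measurableType d1) (T2 : measurableType d2)
    (m1 : {sigma_finite_measure set T1 -> \bar R})
    (m2 : {sigma_finite_measure set T2 -> \bar R}) (f : T1 -> T2 -> R) :
  measurable_fun setT (fun z : T1 * T2 => f z.1 z.2) ->
  (forall x, m2.-integrable setT (EFin \o f x)) -> (forall y, m1.-integrable setT (EFin \o f^~ y)) ->
  (\int[m1]_x \int[m2]_y (`|f x y|)%:E < +oo)%E ->
  \int[m1]_x \int[m2]_y f x y = \int[m2]_y \int[m1]_x f x y.
Proof.
move=> mf fx fy fin.
have prod : (m1 \x m2)%E.-integrable setT (fun z => (f z.1 z.2)%:E).
  by apply/integrable12ltyP; first exact/measurable_EFinP.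
have := Fubini prod => /= F.
rewrite /Rintegral; congr fine.
transitivity (\int[m1]_x \int[m2]_y (f x y)%:E)%E.
  by apply: eq_integral => x _; rewrite fineK //; exact: integrable_fin_num (fx x).
by rewrite F; apply: eq_integral => y _; rewrite fineK //; exact: integrable_fin_num (fy y).
Qed.

Lemma Rfubini d1 d2 (T1 : measurableType d1) (T2 : measurableType d2)
    (m1 : {sigma_finite_measure set T1 -> \bar R})
    (m2 : {sigma_finite_measure set T2 -> \bar R}) (f : T1 -> T2 -> R) (a : T1 -> R) (b : T2 -> R) :
  measurable_fun setT (fun z : T1 * T2 => f z.1 z.2) ->
  m1.-integrable setT (EFin \o a) -> m2.-integrable setT (EFin \o b) ->
  (forall x y, `|f x y| <= a x * b y) ->
  \int[m1]_x \int[m2]_y f x y = \int[m2]_y \int[m1]_x f x y.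
Proof.
move=> mf ia ib fab.
have [ma _] := integrableP _ _ _ ia; have [mb _] := integrableP _ _ _ ib.
have {}ma : measurable_fun setT a by exact/measurable_EFinP.
have {}mb : measurable_fun setT b by exact/measurable_EFinP.
have fx x : m2.-integrable setT (EFin \o f x).
  apply: (@integrable_le _ _ m2 _ (fun y => a x * b y)) => //.
    exact: (measurableT_comp mf (measurable_pair1 x)).
  have := integrableZl measurableT (a x) ib; apply: eq_integrable => // y _.
have fy y : m1.-integrable setT (EFin \o f^~ y).
  apply: (@integrable_le _ _ m1 _ (fun x => b y * a x)) => //.
  - exact: (measurableT_comp mf (measurable_pair2 y)).
  - have := integrableZl measurableT (b y) ia; apply: eq_integrable => // x _.
  - by move=> x; rewrite mulrC.
apply: Rfubini_sections => //.
  apply: (@le_lt_trans _ _ (\int[m1]_x ((`|a x|)%:E * \int[m2]_y (`|b y|)%:E))%E).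
    apply: ge0_le_integral => //.
    - by move=> x _; exact: integral_ge0.
    - apply: (@measurable_integral_section _ _ _ _ _ m2 (fun x y => (`|f x y|)%:E)) => //.
      apply/measurable_EFinP; exact: (measurableT_comp (@normr_measurable _ setT)).
    - apply: emeasurable_funM => //; apply/measurable_EFinP.
      exact: (measurableT_comp (@normr_measurable _ setT)).
    move=> x _; rewrite -ge0_integralZl //; last first.
    - by apply/measurable_EFinP; exact: (measurableT_comp (@normr_measurable _ setT)).
    apply: ge0_le_integral => //.
    - apply/measurable_EFinP; apply: (measurableT_comp (@normr_measurable _ setT)).
      exact: (measurableT_comp mf (measurable_pair1 x)).
    - apply/measurable_EFinP; apply: measurable_funM => //.
      exact: (measurableT_comp (@normr_measurable _ setT)).
    by move=> y _; rewrite lee_fin -normrM (le_trans (fab x y)) // ler_norm.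
  have /integrableP[_ ha] := ia; have /integrableP[_ hb] := ib.
  have e : (\int[m2]_y (`|b y|)%:E = (fine (\int[m2]_y (`|b y|)%:E))%:E)%E.
    by rewrite fineK // ge0_fin_numE //; exact: integral_ge0.
  rewrite e; under eq_integral do rewrite muleC.
  rewrite ge0_integralZl_EFin //; last first.
  - by rewrite fine_ge0 //; exact: integral_ge0.
  - by apply/measurable_EFinP; exact: (measurableT_comp (@normr_measurable _ setT)).
  by rewrite lte_mul_pinfty // ?lee_fin ?fine_ge0 //; exact: integral_ge0.
Qed.

Lemma integral_subl n (h : 'rV[R]_n -> \bar R) a : measurable_fun setT h ->
  (\int[borel_lebesgue R n]_x h (a - x)%R = \int[borel_lebesgue R n]_x h x)%E.
Proof.
move=> mh; rewrite integralE [RHS]integralE; congr (_ - _)%E.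
  rewrite -(ge0_integral_subl a (measurable_funepos mh)) //.
  by apply: eq_integral => x _; rewrite !funeposE.
rewrite -(ge0_integral_subl a (measurable_funeneg mh)) //.
by apply: eq_integral => x _; rewrite !funenegE.
Qed.

Lemma Rintegral_subl n (h : 'rV[R]_n -> R) a : measurable_fun setT h ->
  \int[borel_lebesgue R n]_x h (a - x) = \int[borel_lebesgue R n]_x h x.
Proof. by move=> mh; congr fine; apply: (@integral_subl n (EFin \o h)); apply/measurable_EFinP. Qed.

Lemma Rintegral_opp n (h : 'rV[R]_n -> R) : measurable_fun setT h ->
  \int[borel_lebesgue R n]_x h (- x) = \int[borel_lebesgue R n]_x h x.
Proof.
by move=> mh; rewrite -(Rintegral_subl 0 mh); apply: eq_Rintegral => x _; rewrite sub0r.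
Qed.

Lemma Rintegral_subr n (h : 'rV[R]_n -> R) a : measurable_fun setT h ->
  \int[borel_lebesgue R n]_x h (x - a) = \int[borel_lebesgue R n]_x h x.
Proof.
move=> mh; rewrite -[RHS](Rintegral_opp mh) -(@Rintegral_subl _ (fun x => h (- x)) a).
  by apply: eq_Rintegral => x _; rewrite opprB.
by mfun.
Qed.

(** The majorant [a x * c (y - x)] is not a product of functions of [x] and [y]. Tonelli in [y]
    evaluates its integral as that of [a] times that of [c], and the bound on [a] makes the sections
    in [x] integrable. *)
Lemma Rfubini_convolution n (f : 'rV[R]_n -> 'rV[R]_n -> R) (a c : 'rV[R]_n -> R) A :
  measurable_fun setT (fun z : 'rV[R]_n * 'rV[R]_n => f z.1 z.2) ->
  (borel_lebesgue R n).-integrable setT (EFin \o a) -> (borel_lebesgue R n).-integrable setT (EFin \o c) ->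
  (forall x, 0 <= a x <= A) -> (forall x, 0 <= c x) ->
  (forall x y, `|f x y| <= a x * c (y - x)) ->
  \int[borel_lebesgue R n]_x \int[borel_lebesgue R n]_y f x y =
  \int[borel_lebesgue R n]_y \int[borel_lebesgue R n]_x f x y.
Proof.
move=> mf ia ic hA c0 fac; set mu := borel_lebesgue R n.
have [ma _] := integrableP _ _ _ ia; have [mc _] := integrableP _ _ _ ic.
have {}ma : measurable_fun setT a by exact/measurable_EFinP.
have {}mc : measurable_fun setT c by exact/measurable_EFinP.
have Ic : (\int[mu]_y (c y)%:E < +oo)%E.
  have /integrableP[_] := ic; under eq_integral do rewrite /= ger0_norm //; exact.
have Ia : (\int[mu]_y (a y)%:E < +oo)%E.
  have /integrableP[_] := ia; have a0 x : 0 <= a x by have /andP[] := hA x.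
  under eq_integral do rewrite /= ger0_norm //; exact.
have a0 x : 0 <= a x by have /andP[] := hA x.
have aA x : a x <= A by have /andP[] := hA x.
have cl x : (\int[mu]_y (c (y - x)%R)%:E = \int[mu]_y (c y)%:E)%E.
  by apply: (@ge0_integral_subr R n (fun y => (c y)%:E) x) => //; mfun.
have cr y : (\int[mu]_x (c (y - x)%R)%:E = \int[mu]_x (c x)%:E)%E.
  by apply: (@ge0_integral_subl R n (fun y => (c y)%:E) y) => //; mfun.
apply: Rfubini_sections => //.
- move=> x; apply: (@integrable_le _ _ mu _ (fun y => a x * c (y - x))) => //.
    exact: (measurableT_comp mf (measurable_pair1 x)).
  apply: (integrableZl measurableT (a x) (f := EFin \o (fun y => c (y - x)))).
  by apply: ge0_fin_integrable; [mfun | move=> y | rewrite cl].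
- move=> y; apply: (@integrable_le _ _ mu _ (fun x => A * c (y - x))) => //.
  + exact: (measurableT_comp mf (measurable_pair2 y)).
  + apply: (integrableZl measurableT A (f := EFin \o (fun x => c (y - x)))).
    by apply: ge0_fin_integrable; [mfun | move=> x | rewrite cr].
  + by move=> x; apply: (le_trans (fac x y)); rewrite ler_wpM2r.
apply: (@le_lt_trans _ _ (\int[mu]_x \int[mu]_y ((a x)%:E * (c (y - x)%R)%:E))%E).
  apply: ge0_le_integral => //.
  - by move=> x _; exact: integral_ge0.
  - apply: (@measurable_integral_section _ _ _ _ _ mu (fun x y => (`|f x y|)%:E)) => //.
    apply/measurable_EFinP; exact: (measurableT_comp (@normr_measurable _ setT)).
  - apply: (@measurable_integral_section _ _ _ _ _ mu (fun x y => ((a x)%:E * (c (y - x)%R)%:E)%E)).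
      by mfun.
    by move=> x y; rewrite -EFinM lee_fin mulr_ge0.
  move=> x _; apply: ge0_le_integral => //.
  - apply/measurable_EFinP; apply: (measurableT_comp (@normr_measurable _ setT)).
    exact: (measurableT_comp mf (measurable_pair1 x)).
  - by mfun.
  - by move=> y _; rewrite -EFinM lee_fin.
have inner x : (\int[mu]_y ((a x)%:E * (c (y - x)%R)%:E) = \int[mu]_y (c y)%:E * (a x)%:E)%E.
  by rewrite ge0_integralZl_EFin ?cl 1?muleC //; [move=> y _; rewrite lee_fin | mfun].
under eq_integral do rewrite inner.
have e : (\int[mu]_y (c y)%:E = (fine (\int[mu]_y (c y)%:E))%:E)%E.
  by rewrite fineK // ge0_fin_numE //; apply: integral_ge0 => y _; rewrite lee_fin.
have e0 : 0 <= fine (\int[mu]_y (c y)%:E).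
  by rewrite fine_ge0 //; apply: integral_ge0 => y _; rewrite lee_fin.
rewrite e ge0_integralZl_EFin //; last by mfun.
  by rewrite lte_mul_pinfty.
by move=> x _; rewrite lee_fin.
Qed.

End real_integrals.

(** * Singular integrals of Lipschitz functions *)

Section singular_operators.
Context {R : realType} (n : nat) (s : R).
Hypotheses (n0 : (0 < n)%N) (s0 : 0 < s) (s1 : s < 1).
Let mu := borel_lebesgue R n.

(** Lipschitz rather than smooth: the class is stable under minima, which provides the pi-system of
    the closability argument, and it is regular enough for [Dop] to converge absolutely. *)
Definition lipc (f : 'rV[R]_n -> R) (M rho : R) : Prop :=
  [/\ 0 < rho, forall x, `|f x| <= M, forall x y, `|f x - f y| <= M * `|x - y| &
      forall x, rho <= `|x| -> f x = 0].

Lemma lipc_continuous f M rho : lipc f M rho -> continuous f.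
Proof.
move=> [_ hM hL _]; apply/(@continuous_distP _ 'rV[R]_n R^o) => x e e0.
have M0 : 0 <= M by exact: le_trans (hM x).
have c0 : 0 < M + 1 by rewrite ltr_wpDl.
apply/nbhs_ballP; exists (e / (M + 1)); first exact: divr_gt0.
move=> y; rewrite -ball_normE /= => h; apply: (le_lt_trans (hL x y)).
apply: (@le_lt_trans _ _ ((M + 1) * `|x - y|)); first by rewrite ler_wpM2r // lerDl.
by rewrite mulrC -ltr_pdivlMr.
Qed.

Lemma lipc_measurable f M rho : lipc f M rho -> measurable_fun setT f.
Proof. by move=> h; apply: continuous_rV_measurable; exact: lipc_continuous h. Qed.

Lemma lipc_integrable f M rho : lipc f M rho -> mu.-integrable setT (EFin \o f).
Proof.
move=> h; have mf := lipc_measurable h; case: h => r0 hM _ hz.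
have M0 : 0 <= M by exact: le_trans (hM 0).
apply: (@integrable_le _ _ _ mu f (fun x => M * ind (`|x| < rho))) => //.
  apply: ge0_fin_integrable; first by mfun.
  - by move=> x; rewrite mulr_ge0 // ind_ge0.
  under eq_integral do rewrite EFinM.
  rewrite ge0_integralZl_EFin //; last first.
  - by mfun.
  - by move=> x _; rewrite lee_fin ind_ge0.
  by rewrite integral_norm_ball // -EFinM ltry.
move=> x; rewrite /ind; case: ltP => hx; first by rewrite mulr1.
by rewrite hz // normr0 mulr0.
Qed.

Lemma C1c_lipc f df M rho : C1c f df M rho -> lipc f (n%:R * M + M) rho.
Proof.
move=> h; have L x y := C1c_lipschitz y x h; case: h => r0 _ _ hz hM.
have M0 : 0 <= M by have [h _] := hM 0; exact: le_trans h.
have nM : 0 <= n%:R * M by rewrite mulr_ge0.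
split => //.
- by move=> x; have [h _] := hM x; rewrite (le_trans h) // lerDr.
- by move=> x y; rewrite (le_trans (L x y)) // ler_wpM2r // lerDl.
- by move=> x /hz[].
Qed.

(** Near the origin the Lipschitz bound removes one power of [|w|] from the kernel; far away the
    bound on the function suffices. Both exponents lie on the integrable side of [n], since
    [0 < s < 1]. *)
Definition majorant (w : 'rV[R]_n) : R :=
  ind (`|w| < 1) * `|w| `^ (- (n%:R + s - 1)) + ind (1 <= `|w|) * `|w| `^ (- (n%:R + s)).

Lemma majorant_ge0 w : 0 <= majorant w.
Proof. by rewrite addr_ge0 // mulr_ge0 ?ind_ge0 ?powR_ge0. Qed.

Lemma measurable_majorant : measurable_fun setT majorant.
Proof. by rewrite /majorant; mfun. Qed.

Let kap_gt0 : 0 < n%:R + s - 1.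
Proof. by rewrite addrAC ltr_wpDl // subr_ge0 ler1n. Qed.
Let kap_lt : n%:R + s - 1 < n%:R.
Proof. by rewrite -addrA gtrDl subr_lt0. Qed.
Let ns_lt : n%:R < n%:R + s. Proof. by rewrite ltrDl. Qed.
Let ns_gt0 : 0 < n%:R + s. Proof. by rewrite ltr_wpDl. Qed.
Let ns_ge0 := ltW ns_gt0.

Lemma majorant_integrable : mu.-integrable setT (EFin \o majorant).
Proof.
apply: ge0_fin_integrable; [exact: measurable_majorant | exact: majorant_ge0 |].
under eq_integral do rewrite /majorant EFinD.
rewrite ge0_integralD //; last first.
- by mfun.
- by move=> w _; rewrite lee_fin mulr_ge0 ?ind_ge0 ?powR_ge0.
- by mfun.
- by move=> w _; rewrite lee_fin mulr_ge0 ?ind_ge0 ?powR_ge0.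
rewrite lte_add_pinfty //.
  exact: kernel_head_lt_pinfty.
exact: kernel_tail_lt_pinfty.
Qed.

(** At [w = 0] the power on the right is 0 by convention, so the bound is asked only elsewhere; the
    integrand of [Dop] vanishes at that point. *)
Definition odd_kernel (K : 'rV[R]_n -> R) : Prop :=
  [/\ measurable_fun setT K, forall w, K (- w) = - K w &
      forall w, w != 0 -> `|K w| <= `|w| `^ (- (n%:R + s))].

Definition Dop (K f : 'rV[R]_n -> R) (x : 'rV[R]_n) : R := \int[mu]_w ((f x - f (x - w)) * K w).

Lemma Dop_integrand_le K f M rho x w : odd_kernel K -> lipc f M rho ->
  `|(f x - f (x - w)) * K w| <= 2 * M * majorant w.
Proof.
move=> [_ _ hK] [_ hM hL _].
have M0 : 0 <= M by exact: le_trans (hM x).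
have [->|w0] := eqVneq w 0.
  by rewrite subr0 subrr mul0r normr0 !mulr_ge0 // majorant_ge0.
have wp : 0 < `|w| by rewrite normr_gt0.
rewrite normrM; apply: (le_trans (ler_wpM2l (normr_ge0 _) (hK w w0))).
rewrite /majorant /ind; case: (ltP `|w| 1) => h.
  rewrite mul1r mul0r addr0.
  have -> : `|w| `^ (- (n%:R + s - 1)) = `|w| * `|w| `^ (- (n%:R + s)).
    rewrite -[X in _ = X * _]powRr1 // -powRD ?(gt_eqF wp) ?implybT //.
    by congr (_ `^ _); ring.
  rewrite mulrA ler_wpM2r ?powR_ge0 //; apply: (le_trans (hL _ _)).
  by rewrite opprB addrCA subrr addr0 ler_wpM2r // ler_peMl // ler1n.
rewrite mul0r add0r mul1r ler_wpM2r ?powR_ge0 //.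
by rewrite (le_trans (ler_normB _ _)) // mulr_natl mulr2n lerD.
Qed.

Let measurable_integrand (K f : 'rV[R]_n -> R) : measurable_fun setT K -> measurable_fun setT f ->
  measurable_fun setT (fun z : 'rV[R]_n * 'rV[R]_n => (f z.1 - f (z.1 - z.2)) * K z.2).
Proof. by move=> mK mf; mfun. Qed.

Lemma measurable_Dop_integrand (K f : 'rV[R]_n -> R) x : measurable_fun setT K -> measurable_fun setT f ->
  measurable_fun setT (fun w : 'rV[R]_n => (f x - f (x - w)) * K w).
Proof. by move=> mK mf; mfun. Qed.

Lemma Dop_integrable K f M rho x : odd_kernel K -> lipc f M rho ->
  mu.-integrable setT (fun w => ((f x - f (x - w)) * K w)%:E).
Proof.
move=> hK hf; have [mK _ _] := hK.
apply: (@integrable_le _ _ _ mu _ (fun w => 2 * M * majorant w)) => //.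
- exact: measurable_Dop_integrand (lipc_measurable hf).
- exact: (integrableZl measurableT (2 * M) majorant_integrable).
- by move=> w; exact: Dop_integrand_le hf.
Qed.

Lemma measurable_Dop (K f : 'rV[R]_n -> R) : measurable_fun setT K -> measurable_fun setT f ->
  measurable_fun setT (Dop K f).
Proof.
by move=> mK mf; apply: (@measurable_Rintegral_section _ _ _ _ _ mu (fun x w => (f x - f (x - w)) * K w)); exact: measurable_integrand.
Qed.

Lemma DopD K f g M rho M' rho' x : odd_kernel K -> lipc f M rho -> lipc g M' rho' ->
  Dop K (fun z => f z + g z) x = Dop K f x + Dop K g x.
Proof.
move=> hK hf hg; rewrite -RintegralD //; [|exact: Dop_integrable hf|exact: Dop_integrable hg].
by apply: eq_Rintegral => w _; ring.
Qed.

Lemma DopZ K f M rho c x : odd_kernel K -> lipc f M rho ->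
  Dop K (fun z => c * f z) x = c * Dop K f x.
Proof.
move=> hK hf; rewrite -RintegralZl //; last exact: Dop_integrable hf.
by apply: eq_Rintegral => w _; ring.
Qed.

(** The rate at which [Dop K f] decays for compactly supported [f], cut at 1 so as to be bounded and
    integrable. Domination by a multiple of it gives membership in every L^q with [q >= 1]. *)
Definition decay (x : 'rV[R]_n) : R := ind (`|x| < 1) + ind (1 <= `|x|) * `|x| `^ (- (n%:R + s)).

Lemma decay_ge0 x : 0 <= decay x.
Proof. by rewrite addr_ge0 ?mulr_ge0 ?ind_ge0 ?powR_ge0. Qed.

Lemma decay_le1 x : decay x <= 1.
Proof.
rewrite /decay /ind; case: ltP => h; first by rewrite mul0r addr0.
rewrite add0r mul1r powRN invf_le1 ?powR_gt0 ?(lt_le_trans ltr01) //.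
by rewrite -[leLHS](powRr0 `|x|); apply: ler_powR.
Qed.

Lemma decay_integrable : mu.-integrable setT (EFin \o decay).
Proof.
apply: ge0_fin_integrable; [by rewrite /decay; mfun | exact: decay_ge0 |].
under eq_integral do rewrite /decay EFinD.
rewrite ge0_integralD //; last first.
- by mfun.
- by move=> w _; rewrite lee_fin mulr_ge0 ?ind_ge0 ?powR_ge0.
- by mfun.
- by move=> w _; rewrite lee_fin ind_ge0.
rewrite lte_add_pinfty //; first by rewrite integral_norm_ball ?ltry.
exact: kernel_tail_lt_pinfty.
Qed.

(** Far from the support [f x] vanishes and only the [w] with [|x - w| < rho] contribute; for these
    [|w| >= |x| / 2]. In the remaining bounded region [majorant] gives a uniform bound. *)
Lemma Dop_decay K f M rho : odd_kernel K -> lipc f M rho ->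
  exists C, forall x, `|Dop K f x| <= C * decay x.
Proof.
move=> hK hf; have [mK _ Kb] := hK; have mf := lipc_measurable hf; have [r0 hM hL hz] := hf.
have M0 : 0 <= M by exact: le_trans (hM 0).
have bnd x : `|Dop K f x| <= \int[mu]_w (2 * M * majorant w).
  apply: ler_norm_Rintegral; first exact: measurable_Dop_integrand.
    exact: (integrableZl measurableT (2 * M) majorant_integrable).
  by move=> w; exact: Dop_integrand_le hf.
pose C1 := \int[mu]_w (2 * M * majorant w).
have C10 : 0 <= C1 by exact: le_trans (bnd 0).
(* The kernel at distance [|x| / 2], times the bound on [f] and the volume of the cube of half-side
   [rho]. *)
pose C2 := 2 `^ (n%:R + s) * (M * (rho *+ 2) ^+ n).
have C20 : 0 <= C2 by rewrite !mulr_ge0 ?powR_ge0 // exprn_ge0 // mulrn_wge0 // ltW.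
(* Beyond [Q] both sides are explicit: [2 rho <= |x|] gives the far estimate, and [1 <= |x|] makes
   [decay] a pure power. *)
pose Q := Num.max 1 (2 * rho).
have Q1 : 1 <= Q by rewrite le_max lexx.
have Q0 : 0 < Q by exact: lt_le_trans Q1.
have far (x : 'rV[R]_n) : Q <= `|x| -> `|Dop K f x| <= C2 * `|x| `^ (- (n%:R + s)).
  move=> Qx; have x1 : 0 < `|x| by exact: lt_le_trans Qx.
  have x2 : 2 * rho <= `|x| by rewrite (le_trans _ Qx) // le_max lexx orbT.
  have pt w : `|(f x - f (x - w)) * K w| <= M * (`|x| / 2) `^ (- (n%:R + s)) * ind (`|x - w| < rho).
    rewrite hz; last lra.
    rewrite sub0r mulNr normrN normrM /ind; case: ltP => h; last by rewrite hz // normr0 mul0r mulr0.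
    have w2 : `|x| / 2 <= `|w|.
      have := ler_normD (x - w) w; rewrite subrK => h'; lra.
    have w0 : w != 0 by rewrite -normr_gt0; apply: lt_le_trans w2; rewrite divr_gt0.
    rewrite mulr1 ler_pM //; apply: (le_trans (Kb w w0)).
    rewrite !powRN lef_pV2 ?posrE ?powR_gt0 ?normr_gt0 ?divr_gt0 //.
    by apply: ge0_ler_powR; rewrite ?nnegrE ?divr_ge0.
  have cD : C2 * `|x| `^ (- (n%:R + s)) = M * (`|x| / 2) `^ (- (n%:R + s)) * (rho *+ 2) ^+ n.
    rewrite /C2 powRM ?invr_ge0 // powRV // opprK; ring.
  have int1 : (\int[mu]_w (ind (`|x - w| < rho)%R)%:E = ((rho *+ 2) ^+ n)%:E)%E.
    rewrite (@ge0_integral_subl _ _ (fun w => (ind (`|w| < rho)%R)%:E)); last first.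
    - by move=> w; rewrite lee_fin ind_ge0.
    - by mfun.
    exact: integral_norm_ball.
  have ii : mu.-integrable setT (EFin \o (fun w : 'rV[R]_n => ind (`|x - w| < rho))).
    apply: ge0_fin_integrable.
    - mfun.
    - move=> w; exact: ind_ge0.
    - by rewrite int1 ltry.
  rewrite cD; apply: (@le_trans _ _ (\int[mu]_w (M * (`|x| / 2) `^ (- (n%:R + s)) * ind (`|x - w| < rho)))).
    apply: ler_norm_Rintegral => //; first exact: measurable_Dop_integrand.
    exact: (integrableZl measurableT (M * (`|x| / 2) `^ (- (n%:R + s))) ii).
  rewrite RintegralZl //.
  by rewrite ler_wpM2l ?mulr_ge0 ?powR_ge0 // /Rintegral int1.
exists (C1 * Q `^ (n%:R + s) + C2) => x.
have [xQ|Qx] := ltP `|x| Q; last first.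
  apply: (le_trans (far x Qx)); rewrite mulrDl.
  have -> : decay x = `|x| `^ (- (n%:R + s)).
    by rewrite /decay /ind leNgt ltNge (le_trans Q1 Qx) /= add0r mul1r.
  by rewrite lerDr !mulr_ge0 ?powR_ge0.
apply: (le_trans (bnd x)); rewrite -/C1 [leRHS]mulrDl.
apply: (@le_trans _ _ (C1 * Q `^ (n%:R + s) * decay x)); last by rewrite lerDl mulr_ge0 // decay_ge0.
rewrite -[leLHS]mulr1 -mulrA ler_wpM2l // /decay /ind; case: ltP => h.
  by rewrite mul0r addr0 mulr1 -[leLHS](powRr0 Q); apply: ler_powR.
rewrite add0r mul1r powRN ler_pdivlMr ?mul1r ?powR_gt0 ?(lt_le_trans ltr01) //.
by apply: ge0_ler_powR; rewrite ?nnegrE ?(ltW Q0) ?(ltW xQ).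
Qed.

(* Fubini in (x, w), then x -> x + w and w -> - w. *)
Lemma Dop_duality K f g M rho M' rho' : odd_kernel K -> lipc f M rho -> lipc g M' rho' ->
  \int[mu]_x (Dop K f x * g x) = - \int[mu]_x (f x * Dop K g x).
Proof.
move=> hK hf hg; have [mK oK _] := hK.
have mf := lipc_measurable hf; have mg := lipc_measurable hg.
have fi := lipc_integrable hf; have gi := lipc_integrable hg.
have [_ fM _ _] := hf; have [_ gM _ _] := hg.
have M0 : 0 <= M by exact: le_trans (fM 0).
have M'0 : 0 <= M' by exact: le_trans (gM 0).
(* The pairing of an increment of [u] with [v]. It satisfies [J g f (- w) = J f g w], and the
   oddness of [K] turns this symmetry into the sign of the conclusion. *)
pose J (u v : 'rV[R]_n -> R) (w : 'rV[R]_n) := \int[mu]_x ((u x - u (x - w)) * v x).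
have swap (u v : 'rV[R]_n -> R) m r : lipc u m r -> measurable_fun setT v -> mu.-integrable setT (EFin \o v) ->
    \int[mu]_x (Dop K u x * v x) = \int[mu]_w (J u v w * K w).
  move=> hu mv vi; have mu' := lipc_measurable hu.
  have [_ uM _ _] := hu.
  have m0 : 0 <= m by exact: le_trans (uM 0).
  transitivity (\int[mu]_x \int[mu]_w ((u x - u (x - w)) * K w * v x)).
    apply: eq_Rintegral => x _; rewrite /Dop mulrC -RintegralZl //; last exact: Dop_integrable hu.
    by apply: eq_Rintegral => w _; rewrite mulrC.
  rewrite (@Rfubini _ _ _ _ _ mu mu _ (fun x => `|v x|) (fun w => 2 * m * majorant w)); last first.
  - move=> x w; rewrite normrM mulrC ler_wpM2l //; exact: Dop_integrand_le hu.
  - exact: (integrableZl measurableT (2 * m) majorant_integrable).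
  - exact: (integrable_norm vi).
  - by mfun.
  apply: eq_Rintegral => w _; rewrite /J mulrC -RintegralZl //.
    by apply: eq_Rintegral => x _; ring.
  apply: (@integrable_le _ _ _ mu _ (fun x => 2 * m * `|v x|)).
  - by mfun.
  - exact: (integrableZl measurableT (2 * m) (integrable_norm vi)).
  - move=> x; rewrite normrM ler_wpM2r // (le_trans (ler_normB _ _)) //.
    by rewrite mulr_natl mulr2n lerD.
rewrite (swap _ _ _ _ hf mg gi).
have -> : \int[mu]_x (f x * Dop K g x) = \int[mu]_x (Dop K g x * f x).
  by apply: eq_Rintegral => x _; rewrite mulrC.
rewrite (swap _ _ _ _ hg mf fi).
have prodi (u v : 'rV[R]_n -> R) m : measurable_fun setT u -> (forall x, `|u x| <= m) ->
    mu.-integrable setT (EFin \o v) -> mu.-integrable setT (EFin \o (fun x => u x * v x)).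
  move=> mu' um vi; have [mv _] := integrableP _ _ _ vi.
  have {}mv : measurable_fun setT v by exact/measurable_EFinP.
  apply: (@integrable_le _ _ _ mu _ (fun x => m * `|v x|)).
  - by mfun.
  - exact: (integrableZl measurableT m (integrable_norm vi)).
  - by move=> x; rewrite normrM ler_wpM2r.
have JJ w : J g f (- w) = J f g w.
  rewrite /J.
  transitivity (\int[mu]_x (g x * f x) - \int[mu]_x (g (x + w) * f x)).
    rewrite -RintegralB //; last first.
    - by apply: (@prodi (fun x => g (x + w)) _ M') => //; mfun.
    - exact: (prodi _ _ M').
    by apply: eq_Rintegral => x _; rewrite opprK mulrBl.
  transitivity (\int[mu]_x (f x * g x) - \int[mu]_x (f (x - w) * g x)); last first.
    rewrite -RintegralB //; last first.
    - by apply: (@prodi (fun x => f (x - w)) _ M) => //; mfun.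
    - exact: (prodi _ _ M).
    by apply: eq_Rintegral => x _; rewrite mulrBl.
  congr (_ - _); first by apply: eq_Rintegral => x _; rewrite mulrC.
  rewrite -[LHS](@Rintegral_subr _ _ (fun x => g (x + w) * f x) w); last first.
    by mfun.
  by apply: eq_Rintegral => x _; rewrite subrK mulrC.
have mJ : measurable_fun setT (J g f).
  rewrite /J.
  apply: measurable_Rintegral_section.
  by mfun.
rewrite -[X in _ = - X]Rintegral_opp; last by mfun.
under [X in _ = - X]eq_Rintegral => w _ do rewrite JJ oK mulrN -mulN1r.
rewrite RintegralZl // ?mulN1r ?opprK //.
have mJf : measurable_fun setT (J f g).
  rewrite /J.
  apply: measurable_Rintegral_section.
  by mfun.
have A0 : 0 <= \int[mu]_x `|g x| by apply: Rintegral_ge0 => x _.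
apply: (@integrable_le _ _ _ mu _ (fun w => 2 * M * \int[mu]_x `|g x| * majorant w)).
- by mfun.
- exact: (integrableZl measurableT (2 * M * \int[mu]_x `|g x|) majorant_integrable).
move=> w.
have -> : J f g w * K w = \int[mu]_x (K w * ((f x - f (x - w)) * g x)).
  rewrite mulrC /J -RintegralZl //.
  apply: (@integrable_le _ _ _ mu _ (fun x => 2 * M * `|g x|)).
  - by mfun.
  - exact: (integrableZl measurableT (2 * M) (integrable_norm gi)).
  - move=> x; rewrite normrM ler_wpM2r // (le_trans (ler_normB _ _)) //.
    by rewrite mulr_natl mulr2n lerD.
have -> : 2 * M * \int[mu]_x `|g x| * majorant w = \int[mu]_x (2 * M * majorant w * `|g x|).
  rewrite RintegralZl //; last exact: (integrable_norm gi).
  by rewrite mulrAC.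
apply: ler_norm_Rintegral.
- by mfun.
- exact: (integrableZl measurableT (2 * M * majorant w) (integrable_norm gi)).
move=> x; rewrite mulrA normrM ler_wpM2r // mulrC; exact: Dop_integrand_le hf.
Qed.

End singular_operators.

(** * Integrals of partial derivatives, and negligibility of the origin *)

Section line_integration.
Context {R : realType} (n : nat).
Let mu := borel_lebesgue R n.

Lemma is_derive_of_line (f : 'rV[R]_n -> R) (z v : 'rV[R]_n) (d : R) :
  is_derive (0 : R) (1 : R) (fun t => f (z + t *: v)) d -> is_derive z v f d.
Proof.
move=> [dv <-].
have E : (fun h : R => h^-1 *: ((fun t => f (z + t *: v)) (h *: (1 : R) + 0) - f (z + 0 *: v))) =
   (fun h => h^-1 *: (f (h *: v + z) - f z)).
  by apply/funext => h; rewrite [h%:A]mulr1 addr0 scale0r addr0 [h *: v + z]addrC.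
by move: dv; rewrite /derivable /derive /= E => dv; split.
Qed.

Lemma norm_edir (j : 'I_n) : `|edir j : 'rV[R]_n| <= 1.
Proof.
apply: rV_norm_le => // i; rewrite mxE eqxx /=.
by case: (i == j); rewrite ?normr1 ?normr0.
Qed.

(* The difference quotients have integral 0 by translation invariance. *)
Lemma integral_partial_eq0 (G dG : 'rV[R]_n -> R) j (B r : R) :
  measurable_fun setT G -> (forall z, is_derive z (edir j) G (dG z)) -> 0 < r ->
  (forall z, `|G z| <= B) -> (forall z, `|dG z| <= B) -> (forall z, r <= `|z| -> G z = 0) ->
  \int[mu]_z dG z = 0.
Proof.
move=> mG hd r0 hG hB hz.
have B0 : 0 <= B by exact: le_trans (hG 0).
pose h (m : nat) : R := m.+1%:R^-1.
have h0 m : 0 < h m by rewrite invr_gt0.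
have h1 m : h m <= 1 by rewrite invf_le1 // ler1n.
pose f_ m (z : 'rV[R]_n) := (h m)^-1 * (G (z + h m *: edir j) - G z).
have mf_ m : measurable_fun setT (f_ m) by rewrite /f_; mfun.
have cv z : (f_ ^~ z) @ \oo --> dG z.
  have [dv <-] := hd z.
  have := (cvgr_dnbhsP (fun t => t^-1 *: (G (t *: edir j + z) - G z)) 0 _).1 dv h.
  move=> H.
  have -> : (f_ ^~ z) = (fun m => (h m)^-1 *: (G (h m *: edir j + z) - G z)).
    by apply/funext => m; rewrite /f_ [z + _]addrC.
  apply: H; split; last exact: cvg_harmonic.
  by move=> m; rewrite gt_eqF.
(* As [h m <= 1], the quotients are supported in the ball of radius [r + 1]; the mean value theorem
   bounds them by [B]. *)
have bnd z m : `|f_ m z| <= B * ind (`|z| < r + 1).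
  have far : r + 1 <= `|z| -> f_ m z = 0.
    move=> rz; rewrite /f_ (hz z); last by rewrite (le_trans _ rz) // lerDl.
    rewrite (hz (z + _)) ?subrr ?mulr0 //.
    have := ler_normB (z + h m *: edir j) (h m *: edir j); rewrite addrK normrZ gtr0_norm // => hh.
    have : h m * `|edir j : 'rV[R]_n| <= 1 by rewrite mulr_ile1 // ?norm_edir // ltW.
    by move=> ?; lra.
  rewrite /ind; case: ltP => zr; last by rewrite far // normr0 mulr0.
  rewrite mulr1 /f_.
  pose g (t : R) := G (z + t *: edir j).
  have dg t : is_derive t (1 : R) g (dG (z + t *: edir j)) by exact: is_derive_line.
  have cg t : {for t, continuous g}.
    by apply: differentiable_continuous; apply/derivable1_diffP; have [] := dg t.
  have [c _] := MVT_segment (ltW (h0 m)) (fun t _ => dg t) (continuous_subspaceT cg).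
  rewrite /g scale0r addr0 subr0 => ->.
  by rewrite mulrCA mulVf ?mulr1 // gt_eqF.
have mdG : measurable_fun setT dG.
  by apply: (measurable_fun_cvg mf_) => z _; exact: cv.
have ib : mu.-integrable setT (EFin \o (fun z : 'rV[R]_n => B * ind (`|z| < r + 1))).
  apply: (integrableZl measurableT B (f := EFin \o (fun z : 'rV[R]_n => ind (`|z| < r + 1)))).
  apply: ge0_fin_integrable; [by mfun | by move=> z; exact: ind_ge0 |].
  by rewrite integral_norm_ball ?ltry // addr_gt0.
have iG : mu.-integrable setT (EFin \o G).
  apply: integrable_le mG ib _ => z; rewrite /ind; case: ltP => zr; first by rewrite mulr1.
  by rewrite hz ?normr0 ?mulr0 // (le_trans _ zr) // lerDl.
have := Rintegral_cvg mf_ mdG (aeW _ cv) ib (aeW _ bnd).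
have I0 m : \int[mu]_z f_ m z = 0.
  rewrite /f_.
  have iGh : mu.-integrable setT (EFin \o (fun z => G (z + h m *: edir j))).
    have -> : EFin \o (fun z => G (z + h m *: edir j)) = (EFin \o G) \o (fun z => h m *: edir j + 1 *: z).
      by apply/funext => z /=; rewrite scale1r addrC.
    apply/integrableP; split.
      by apply: measurableT_comp; [exact/measurable_EFinP | exact: measurable_rV_comb].
    rewrite (@ge0_integral_rV_comb _ _ _ 1 (fun z => `|(G z)%:E|%E)) ?oner_eq0 //.
      rewrite normr1 invr1 expr1n mul1e.
      by have /integrableP[] := iG.
    by apply: measurableT_comp => //; exact/measurable_EFinP.
  rewrite RintegralZl //; last first.
    have := integrableB measurableT iGh iG; apply: eq_integrable => // z _.
  rewrite RintegralB //.
  have -> : \int[mu]_z G (z + h m *: edir j) = \int[mu]_z G z.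
    rewrite -[RHS](Rintegral_subr (- (h m *: edir j)) mG).
    by apply: eq_Rintegral => z _; rewrite opprK.
  by rewrite subrr mulr0.
under eq_fun do rewrite I0.
by move=> hl; apply/esym; apply: (cvg_unique _ (cvg_cst _) hl).
Unshelve. all: by end_near. Qed.

Lemma ae_neq0 : (0 < n)%N -> {ae mu, forall w : 'rV[R]_n, w != 0}.
Proof.
move=> n0.
have m0 : measurable [set 0 : 'rV[R]_n].
  have -> : [set 0 : 'rV[R]_n] = \bigcap_(i in [set: 'I_n]) (@coord_rV R n i @^-1` [set 0]).
    apply/seteqP; split => x /=; first by move=> -> i _ /=; rewrite /coord_rV mxE.
    by move=> h; apply/rowP => i; rewrite mxE; exact: (h i).
  apply: fin_bigcap_measurable => // i _.
  by rewrite -[X in measurable X]setTI; apply: measurable_coord_rV => //; exact: measurable_set1.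
exists [set 0]; split => //.
- apply/eqP; rewrite eq_le measure_ge0 andbT; apply/lee_addgt0Pr => e e0; rewrite add0e.
  (* [2 r <= 1] gives [(2 r) ^ n <= 2 r <= e], as [n] is positive. *)
  pose r := Num.min (e / 2) (2^-1).
  have r0 : 0 < r by rewrite lt_min; apply/andP; split; [exact: divr_gt0 | rewrite invr_gt0].
  have mb : measurable [set x : 'rV[R]_n | `|x| < r] by rewrite norm_ball_box //; exact: measurable_box.
  apply: (@le_trans _ _ (mu [set x : 'rV[R]_n | `|x| < r])).
    apply: (@le_measure _ _ _ mu); [exact: mem_set m0 | exact: mem_set mb |].
    by move=> x /= ->; rewrite normr0.
  rewrite norm_ball_box // [leLHS]borel_lebesgue_box; last by rewrite (@le_trans _ _ 0) // ?oppr_le0 ltW.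
  rewrite opprK -mulr2n lee_fin.
  apply: (@le_trans _ _ (r *+ 2)).
    rewrite -[leRHS]expr1; apply: ler_wiXn2l => //.
    - by rewrite mulrn_wge0 // ltW.
    - by rewrite -mulr_natr -ler_pdivlMr // mul1r ge_min lexx orbT.
  by rewrite -mulr_natr -ler_pdivlMr // ge_min lexx.
- by move=> x /= /negP; rewrite negbK => /eqP.
Qed.

End line_integration.

(** * Riesz potentials and their gradients *)

Section riesz_kernels.
Context {R : realType} (n : nat) (s : R).
Hypotheses (n0 : (0 < n)%N) (s0 : 0 < s) (s1 : s < 1).
Let mu := borel_lebesgue R n.
Let kap := n%:R + s - 1.
Let kap_gt0 : 0 < kap.
Proof. by rewrite /kap addrAC ltr_wpDl // subr_ge0 ler1n. Qed.
Let kap_lt : kap < n%:R.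
Proof. by rewrite /kap -addrA gtrDl subr_lt0. Qed.

(* The Riesz potential kernel and (minus) its gradient divided by n + s - 1,
   smoothed at the origin when e <> 0. *)
Definition pot (e : R) (w : 'rV[R]_n) : R := (fnorm w ^+ 2 + e ^+ 2) `^ (- ((n%:R + s - 1) / 2)).

Definition rkern (e : R) (j : 'I_n) (w : 'rV[R]_n) : R :=
  w 0 j * (fnorm w ^+ 2 + e ^+ 2) `^ (- ((n%:R + s + 1) / 2)).

Lemma measurable_pot e : measurable_fun setT (pot e).
Proof. by rewrite /pot; mfun. Qed.

Lemma measurable_rkern e j : measurable_fun setT (rkern e j).
Proof. by rewrite /rkern; mfun. Qed.

Lemma pot_ge0 e w : 0 <= pot e w. Proof. exact: powR_ge0. Qed.

Lemma fnorm_gt0 (w : 'rV[R]_n) : w != 0 -> 0 < fnorm w.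
Proof. by move=> w0; rewrite (lt_le_trans _ (norm_le_fnorm w)) // normr_gt0. Qed.

Lemma reg_powR_le (e a : R) (w : 'rV[R]_n) : w != 0 -> 0 < a ->
  (fnorm w ^+ 2 + e ^+ 2) `^ (- (a / 2)) <= fnorm w `^ (- a).
Proof.
move=> w0 a0; have f0 := fnorm_gt0 w0.
have -> : fnorm w `^ (- a) = (fnorm w ^+ 2) `^ (- (a / 2)).
  by rewrite -powR_mulrn ?fnorm_ge0 // -powRrM; congr (_ `^ _); field.
rewrite !powRN lef_pV2 ?posrE ?powR_gt0 ?ltr_wpDr ?sqr_ge0 ?exprn_gt0 //.
apply: ge0_ler_powR; rewrite ?nnegrE ?addr_ge0 ?sqr_ge0 ?lerDl ?sqr_ge0 //.
by rewrite divr_ge0 // ltW.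
Qed.

Lemma fnorm_powR_le (a : R) (w : 'rV[R]_n) : w != 0 -> 0 <= a -> fnorm w `^ (- a) <= `|w| `^ (- a).
Proof.
move=> w0 a0; have f0 := fnorm_gt0 w0.
have w1 : 0 < `|w| by rewrite normr_gt0.
rewrite !powRN lef_pV2 ?posrE ?powR_gt0 //.
by apply: ge0_ler_powR => //; rewrite ?nnegrE ?fnorm_ge0 // norm_le_fnorm.
Qed.

Lemma pot_le e w : w != 0 -> pot e w <= `|w| `^ (- (n%:R + s - 1)).
Proof.
move=> w0; apply: (le_trans (reg_powR_le e w0 kap_gt0)).
by apply: fnorm_powR_le => //; exact: ltW.
Qed.

Lemma pot0_le w : pot 0 w <= `|w| `^ (- (n%:R + s - 1)).
Proof.
(* At the origin the left side is 0, by the convention for powers of 0. *)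
have [->|w0] := eqVneq w 0; last exact: pot_le.
rewrite /pot fnorm0 normr0 !expr0n addr0 powR0 ?powR_ge0 //.
by rewrite oppr_eq0 mulf_neq0 // gt_eqF.
Qed.

Lemma rkern_odd_kernel e j : odd_kernel s (rkern e j).
Proof.
split; first exact: measurable_rkern.
  by move=> w; rewrite /rkern fnormN mxE mulNr.
move=> w w0; have f0 := fnorm_gt0 w0.
rewrite /rkern normrM [X in _ * X]ger0_norm ?powR_ge0 //.
have a0 : 0 < n%:R + s + 1 by rewrite addr_gt0 // ltr_wpDl.
apply: (@le_trans _ _ (fnorm w * fnorm w `^ (- (n%:R + s + 1)))).
  by apply: ler_pM; rewrite ?powR_ge0 // ?coord_le_fnorm // reg_powR_le.
rewrite -[X in X * _]powRr1 ?fnorm_ge0 // -powRD ?(gt_eqF f0) ?implybT //.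
have -> : 1 - (n%:R + s + 1) = - (n%:R + s) by ring.
by apply: fnorm_powR_le => //; rewrite addr_ge0 // ltW.
Qed.

(** Along a coordinate direction the base of the power is a quadratic polynomial in [t], positive at
    0 because [e > 0], and the one-variable chain rule applies. *)
Lemma is_derive_pot e j z : 0 < e -> is_derive z (edir j) (pot e) (- (n%:R + s - 1) * rkern e j z).
Proof.
move=> e0; apply: is_derive_of_line.
pose A := fnorm z ^+ 2 + e ^+ 2.
have A0 : 0 < A by rewrite ltr_wpDl ?sqr_ge0 // exprn_gt0.
pose g (t : R) := A + 2 * z 0 j * t + t ^+ 2.
have E : (fun t => pot e (z + t *: edir j)) = (fun y => y `^ (- ((n%:R + s - 1) / 2))) \o g.
  apply/funext => t; rewrite /pot /g /A /=; congr (_ `^ _).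
  rewrite !fnorm_sq (bigD1 j) //= [in RHS](bigD1 j) //= !mxE !eqxx /=.
  rewrite (eq_bigr (fun i => z 0 i ^+ 2)); first by ring.
  by move=> i ij; rewrite !mxE eqxx (negbTE ij) /= mulr0 addr0.
rewrite E.
have dg : is_derive (0 : R) (1 : R) g (2 * z 0 j).
  pose P : {poly R} := A%:P + (2 * z 0 j) *: 'X + 'X^2.
  have -> : g = horner P by apply/funext => t; rewrite /g /P !hornerE.
  apply: (is_derive_eq (is_derive_poly P 0)).
  by rewrite /P !(derivD, derivC, derivZ, derivX, derivXn) !hornerE /=; ring.
have g0 : g 0 = A by rewrite /g mulr0 expr0n !addr0.
have dp : is_derive (g 0) (1 : R) (fun y => y `^ (- ((n%:R + s - 1) / 2)))
   (- ((n%:R + s - 1) / 2) * A `^ (- ((n%:R + s - 1) / 2) - 1)).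
  by rewrite g0; exact: is_derive1_powR.
apply: (is_derive_eq (is_derive1_comp dp dg)).
rewrite /rkern -/A.
have -> : - ((n%:R + s - 1) / 2) - 1 = - ((n%:R + s + 1) / 2) :> R by field.
by field.
Qed.

(** The smoothing bounds the kernel near the origin. It is therefore integrable and, being odd, has
    integral 0; this is why [f x] may be inserted into its convolution with [f], which turns the
    convolution into [Dop]. *)
Lemma rkern_le_decay e j : 0 < e -> exists C, forall w, `|rkern e j w| <= C * decay s w.
Proof.
move=> e0; have [_ _ hK] := rkern_odd_kernel e j.
pose C := Num.sqrt n%:R * (e ^+ 2) `^ (- ((n%:R + s + 1) / 2)) + 1.
have C1 : 1 <= C by rewrite lerDr mulr_ge0 ?powR_ge0 ?sqrtr_ge0.
exists C => w; rewrite /decay /ind; case: ltP => w1.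
  rewrite mul0r addr0 mulr1 /rkern normrM [X in _ * X]ger0_norm ?powR_ge0 //.
  apply: (@le_trans _ _ (Num.sqrt n%:R * (e ^+ 2) `^ (- ((n%:R + s + 1) / 2)))); last by rewrite lerDl.
  apply: ler_pM; rewrite ?powR_ge0 //.
    apply: (le_trans (coord_le_fnorm w j)); apply: (le_trans (fnorm_le_norm w)).
    by rewrite ler_piMr ?sqrtr_ge0 // ltW.
  rewrite !powRN lef_pV2 ?posrE ?powR_gt0 ?ltr_wpDl ?sqr_ge0 ?exprn_gt0 //.
  apply: ge0_ler_powR; rewrite ?nnegrE ?addr_ge0 ?sqr_ge0 ?lerDr ?sqr_ge0 //.
  by rewrite divr_ge0 // !addr_ge0 // ltW.
rewrite add0r mul1r; have w0 : w != 0 by rewrite -normr_gt0 (lt_le_trans ltr01).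
by apply: (le_trans (hK w w0)); rewrite ler_peMl ?powR_ge0.
Qed.

Lemma rkern_integrable e j : 0 < e -> mu.-integrable setT (EFin \o rkern e j).
Proof.
move=> e0; have [C hC] := rkern_le_decay j e0.
apply: integrable_le (measurable_rkern e j) _ hC.
exact: (integrableZl measurableT C (decay_integrable n s0)).
Qed.

Lemma Rintegral_odd (K : 'rV[R]_n -> R) : mu.-integrable setT (EFin \o K) -> (forall w, K (- w) = - K w) ->
  \int[mu]_w K w = 0.
Proof.
move=> iK oK; have [mK _] := integrableP _ _ _ iK.
have {}mK : measurable_fun setT K by exact/measurable_EFinP.
have h : \int[mu]_w K w = - \int[mu]_w K w.
  rewrite -[LHS](Rintegral_opp mK) -mulN1r -RintegralZl //.
  by apply: eq_Rintegral => w _; rewrite oK mulN1r.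
lra.
Qed.

(* Integration by parts for the smoothed kernels, then e -> 0. *)
Lemma riesz_gradient f df M rho j x : C1c f df M rho ->
  \int[mu]_w (df j (x - w) * pot 0 w) = (n%:R + s - 1) * Dop (rkern 0 j) f x.
Proof.
move=> hf; have hl := C1c_lipc hf.
have cf := lipc_continuous hl; have mf := lipc_measurable hl.
have [r0 cdf hd hz hM] := hf.
have M0 : 0 <= M by have [h _] := hM 0; exact: le_trans h.
have mdf : measurable_fun setT (df j) by exact: continuous_rV_measurable.
have mpot e := measurable_pot e; have mrk e := measurable_rkern e j.
have zero w : rho <= `|x - w| -> f (x - w) = 0 /\ df j (x - w) = 0.
  by move=> /hz[-> /(_ j)].
have big w : rho + `|x| <= `|w| -> rho <= `|x - w|.
  by move=> h; have := ler_normB x (x - w); rewrite opprB addrC subrK => h'; lra.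
have iball (c r : R) : 0 < r -> mu.-integrable setT (EFin \o (fun w : 'rV[R]_n => c * ind (`|w| < r))).
  move=> rp; apply: (integrableZl measurableT c (f := EFin \o (fun w : 'rV[R]_n => ind (`|w| < r)))).
  apply: ge0_fin_integrable; [by mfun | by move=> w; exact: ind_ge0 |].
  by rewrite integral_norm_ball ?ltry.
have rx : 0 < rho + `|x| by rewrite ltr_wpDr.
have reg e : 0 < e -> \int[mu]_w (df j (x - w) * pot e w) = (n%:R + s - 1) * Dop (rkern e j) f x.
  move=> e0; have [C hC] := rkern_le_decay j e0.
  have C0 : 0 <= C.
    have d0 : decay s (0 : 'rV[R]_n) = 1.
      rewrite /decay normr0 /ind ltr01 (_ : (1 <= 0 :> R) = false) ?mul0r ?addr0 //.
      by apply/negbTE; rewrite -ltNge.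
    by have := le_trans (normr_ge0 _) (hC 0); rewrite d0 mulr1.
  have rkC w : `|rkern e j w| <= C.
    by apply: (le_trans (hC w)); rewrite ler_piMr // decay_le1 // ltW.
  pose Pe := (e ^+ 2) `^ (- ((n%:R + s - 1) / 2)).
  have potP w : `|pot e w| <= Pe.
    rewrite ger0_norm ?pot_ge0 // /pot /Pe !powRN lef_pV2 ?posrE ?powR_gt0 ?ltr_wpDl ?sqr_ge0 ?exprn_gt0 //.
    apply: ge0_ler_powR; rewrite ?nnegrE ?addr_ge0 ?sqr_ge0 ?lerDr ?sqr_ge0 //.
    by rewrite divr_ge0 // ltW.
  have Pe0 : 0 <= Pe by exact: powR_ge0.
  pose G w := f (x - w) * pot e w.
  (* The derivative of [G] in direction [j]. That its integral vanishes is the integration by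
     parts. *)
  pose dG w := f (x - w) * (- (n%:R + s - 1) * rkern e j w) + pot e w * - df j (x - w).
  have hdG z : is_derive z (edir j) G (dG z).
    have d1 : is_derive z (edir j) (fun w => f (x - w)) (- df j (x - z)).
      apply: is_derive_of_line.
      have -> : (fun t : R => f (x - (z + t *: edir j))) = (fun t => f (x - z + t *: edir j)) \o -%R.
        by apply/funext => t /=; rewrite opprD addrA scaleNr.
      have dd : is_derive (- 0 : R) (1 : R) (fun t => f (x - z + t *: edir j)) (df j (x - z)).
        by rewrite oppr0; apply: is_derive_line; rewrite scale0r addr0.
      apply: (is_derive_eq (@is_derive1_comp R _ _ 0 _ _ dd (is_deriveNid (0 : R) (1 : R)))).
      by rewrite mulrN1.
    have d2 := is_derive_pot j z e0.
    apply: (is_derive_eq (is_deriveM d1 d2)).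
    by rewrite /dG /GRing.scale /=.
  have mG : measurable_fun setT G by rewrite /G; mfun.
  have I1 : mu.-integrable setT (EFin \o (fun w => f (x - w) * rkern e j w)).
    apply: (@integrable_le _ _ _ mu _ (fun w => (M * C) * ind (`|w| < rho + `|x|))).
    - by mfun.
    - exact: iball.
    - move=> w; rewrite /ind; case: ltP => h.
        by rewrite mulr1 normrM ler_pM //; have [] := hM (x - w).
      by have [-> _] := zero w (big w h); rewrite mul0r normr0 mulr0.
  have I2 : mu.-integrable setT (EFin \o (fun w => df j (x - w) * pot e w)).
    apply: (@integrable_le _ _ _ mu _ (fun w => (M * Pe) * ind (`|w| < rho + `|x|))).
    - by mfun.
    - exact: iball.
    - move=> w; rewrite /ind; case: ltP => h.
        by rewrite mulr1 normrM ler_pM //; have [_] := hM (x - w); exact.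
      by have [_ ->] := zero w (big w h); rewrite mul0r normr0 mulr0.
  have dG0 : \int[mu]_w dG w = 0.
    apply: (@integral_partial_eq0 _ _ G dG j (M * Pe + M * ((n%:R + s - 1) * C)) (rho + `|x|)) => //.
    - move=> z; apply: (@le_trans _ _ (M * Pe)).
        by rewrite normrM ler_pM //; have [] := hM (x - z).
      by rewrite lerDl !mulr_ge0 // ltW.
    - move=> z; rewrite /dG addrC (le_trans (ler_normD _ _)) // lerD //.
        by rewrite mulrC normrM normrN ler_pM //; have [_] := hM (x - z); exact.
      rewrite normrM ler_pM //; first by have [] := hM (x - z).
      by rewrite normrM normrN (ger0_norm (ltW kap_gt0)) ler_wpM2l // ltW.
    - by move=> z /big /zero[h _]; rewrite /G h mul0r.
  have E1 : \int[mu]_w (df j (x - w) * pot e w) = - (n%:R + s - 1) * \int[mu]_w (f (x - w) * rkern e j w).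
    have I3 := integrableZl measurableT (- (n%:R + s - 1)) I1.
    have I4 : mu.-integrable setT (EFin \o (fun w => - (n%:R + s - 1) * (f (x - w) * rkern e j w))) by exact: I3.
    have := RintegralB measurableT I4 I2.
    have -> : \int[mu]_w (- (n%:R + s - 1) * (f (x - w) * rkern e j w) - df j (x - w) * pot e w) = 0.
      by rewrite -[RHS]dG0; apply: eq_Rintegral => w _; rewrite /dG; ring.
    by rewrite RintegralZl // => /esym /eqP; rewrite subr_eq0 => /eqP ->.
  have E2 : Dop (rkern e j) f x = - \int[mu]_w (f (x - w) * rkern e j w).
    have I5 : mu.-integrable setT (EFin \o (fun w => f x * rkern e j w)).
      exact: (integrableZl measurableT (f x) (rkern_integrable j e0)).
    rewrite /Dop; transitivity (\int[mu]_w (f x * rkern e j w - f (x - w) * rkern e j w)).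
      by apply: eq_Rintegral => w _; rewrite mulrBl.
    rewrite RintegralB // RintegralZl //; last exact: rkern_integrable.
    rewrite Rintegral_odd ?mulr0 ?sub0r //; first exact: rkern_integrable.
    by move=> w; have [_] := rkern_odd_kernel e j; exact.
  by rewrite E1 E2; ring.
pose h (m : nat) : R := m.+1%:R^-1.
have h0 m : 0 < h m by rewrite invr_gt0.
have hcv : h @ \oo --> (0 : R) by exact: cvg_harmonic.
(* Away from [w = 0], a null set, the smoothed kernels converge pointwise. Their bounds by [pot_le]
   and [rkern_odd_kernel] do not depend on [e], which gives the dominated limits [L1] and [L2]. *)
have pcv (c : R) (w : 'rV[R]_n) : w != 0 ->
    (fun m => (fnorm w ^+ 2 + h m ^+ 2) `^ c) @ \oo --> (fnorm w ^+ 2 + 0 ^+ 2) `^ c.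
  move=> w0.
  have A0 : 0 < fnorm w ^+ 2 + 0 ^+ 2 by rewrite expr0n addr0 exprn_gt0 // fnorm_gt0.
  have lim : (fun m => fnorm w ^+ 2 + h m ^+ 2) @ \oo --> fnorm w ^+ 2 + 0 ^+ 2.
    by apply: cvgD; [exact: cvg_cst | exact: (cvgM hcv hcv)].
  have cc : {for fnorm w ^+ 2 + 0 ^+ 2, continuous (fun y : R => y `^ c)}.
    apply: differentiable_continuous; apply/derivable1_diffP; apply: derivable_powR.
    by rewrite in_itv /= andbT.
  exact: (cvg_comp _ _ lim cc).
have n00 := @ae_neq0 R n n0.
have L1 : \int[mu]_w (df j (x - w) * pot (h m) w) @[m --> \oo] --> \int[mu]_w (df j (x - w) * pot 0 w).
  apply: (@Rintegral_cvg _ _ _ _ _ _ (fun w : 'rV[R]_n => M * (ind (`|w| < rho + `|x|) * `|w| `^ (- (n%:R + s - 1))))).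
  - by move=> m; mfun.
  - by mfun.
  - by apply: filterS n00 => w w0; apply: cvgMr; exact: pcv.
  - apply: (integrableZl measurableT M (f := EFin \o (fun w : 'rV[R]_n => ind (`|w| < rho + `|x|) * `|w| `^ (- (n%:R + s - 1))))).
    apply: ge0_fin_integrable; [by mfun | by move=> w; rewrite mulr_ge0 ?ind_ge0 ?powR_ge0 |].
    have [C _ hC] := kernel_head_le kap_gt0 kap_lt.
    by apply: le_lt_trans (hC _ rx) _; rewrite ltry.
  - apply: filterS n00 => w w0 m; rewrite /ind; case: ltP => hw.
      rewrite mul1r normrM (ger0_norm (pot_ge0 _ _)) ler_pM ?pot_ge0 //; last exact: pot_le.
      by have [_] := hM (x - w); exact.
    by have [_ ->] := zero w (big w hw); rewrite mul0r normr0 mul0r mulr0.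
have L2 : Dop (rkern (h m) j) f x @[m --> \oo] --> Dop (rkern 0 j) f x.
  apply: (@Rintegral_cvg _ _ _ _ _ _ (fun w : 'rV[R]_n => 2 * (n%:R * M + M) * majorant s w)).
  - by move=> m; mfun.
  - by mfun.
  - by apply: filterS n00 => w w0; apply: cvgMr; apply: cvgMr; exact: pcv.
  - exact: (integrableZl measurableT (2 * (n%:R * M + M)) (majorant_integrable n0 s0 s1)).
  - by apply: aeW => w m; apply: (Dop_integrand_le _ _ (rkern_odd_kernel _ _) hl).
have L3 : (n%:R + s - 1) * Dop (rkern (h m) j) f x @[m --> \oo] --> (n%:R + s - 1) * Dop (rkern 0 j) f x.
  by apply: cvgMr.
rewrite -(cvg_lim (@Rhausdorff R) L1) -(cvg_lim (@Rhausdorff R) L3).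
rewrite (_ : (fun m => \int[mu]_w (df j (x - w) * pot (h m) w)) =
  (fun m => (n%:R + s - 1) * Dop (rkern (h m) j) f x)) //.
by apply/funext => m; exact: reg.
Qed.

End riesz_kernels.

(** * Positivity and symmetry of integrals, monotonicity of powers *)

Section integral_tools.
Context {R : realType}.

Lemma Rintegral_sum d (T : measurableType d) (mu : {measure set T -> \bar R}) (I : Type) (r : seq I)
    (f : I -> T -> R) : (forall i, mu.-integrable setT (EFin \o f i)) ->
  mu.-integrable setT (EFin \o (fun x => \sum_(i <- r) f i x)) /\
  \int[mu]_x (\sum_(i <- r) f i x) = \sum_(i <- r) \int[mu]_x f i x.
Proof.
move=> fi; elim: r => [|i r [IH1 IH2]].
  split; last by rewrite big_nil /Rintegral; under eq_integral do rewrite big_nil; rewrite integral0.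
  rewrite (_ : _ \o _ = cst 0%E); first exact: integrable0.
  by apply/funext => x /=; rewrite big_nil.
have e : (fun x => \sum_(j <- i :: r) f j x) = (fun x => f i x + \sum_(j <- r) f j x).
  by apply/funext => x; rewrite big_cons.
rewrite e big_cons -IH2; split; last exact: RintegralD.
exact: (integrableD measurableT (fi i) IH1).
Qed.

Lemma ae_Rintegral_norm d (T : measurableType d) (mu : {measure set T -> \bar R}) (f : T -> R) :
  measurable_fun setT f -> {ae mu, forall x, 0 <= f x} -> \int[mu]_x f x = \int[mu]_x `|f x|.
Proof.
move=> mf f0; congr fine; apply: ae_eq_integral => //.
- exact/measurable_EFinP.
- by apply/measurable_EFinP; apply: (measurableT_comp (@normr_measurable _ setT)).
- by apply: filterS f0 => x h _; rewrite ger0_norm.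
Qed.

Lemma Rintegral_gt0 d (T : measurableType d) (mu : {measure set T -> \bar R}) (f : T -> R) (A : set T) :
  mu.-integrable setT (EFin \o f) -> {ae mu, forall x, 0 <= f x} ->
  measurable A -> (0 < mu A)%E -> (forall x, A x -> 0 < f x) -> 0 < \int[mu]_x f x.
Proof.
move=> fi f0 mA A0 fA; have [mf _] := integrableP _ _ _ fi.
rewrite ae_Rintegral_norm //; last exact/measurable_EFinP.
rewrite lt_def Rintegral_ge0 // andbT; apply/eqP => e.
have fin : (\int[mu]_x `|(EFin \o f) x| < +oo)%E by have /integrableP[] := fi.
have z : (\int[mu]_x `|(EFin \o f) x| = 0)%E.
  rewrite -(@fineK _ (\int[mu]_x _)%E) ?ge0_fin_numE //; last exact: integral_ge0.
  by congr EFin.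
have [N [mN N0 sN]] := (ae_eq_integral_abs mu measurableT mf).1 z.
have : (mu A <= mu N)%E.
  apply: le_measure; rewrite ?inE // => x Ax; apply: sN => /= h.
  by have := fA x Ax; rewrite (_ : f x = 0) ?ltxx //; have [] := h I.
by rewrite N0 leNgt A0.
Qed.

Lemma integrable_subl n (h : 'rV[R]_n -> R) a : (borel_lebesgue R n).-integrable setT (EFin \o h) ->
  (borel_lebesgue R n).-integrable setT (EFin \o (fun x => h (a - x))).
Proof.
move=> hi; have [mh hf] := integrableP _ _ _ hi; have {}mh : measurable_fun setT h by exact/measurable_EFinP.
apply/integrableP; split; first by apply/measurable_EFinP; mfun.
rewrite (@ge0_integral_subl R n (fun x => (`|h x|)%:E) a) //; mfun.
exact: (measurableT_comp (@normr_measurable _ setT)).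
Qed.

Lemma isometry_Rintegral n (T : 'rV[R]_n -> 'rV[R]_n) (f : 'rV[R]_n -> R) :
  measurable_fun setT T -> (forall x y, T (x - y) = T x - T y) -> involutive T ->
  (forall x, fnorm (T x) = fnorm x) -> measurable_fun setT f ->
  \int[borel_lebesgue R n]_x f (T x) = \int[borel_lebesgue R n]_x f x.
Proof.
move=> mT Tl Ti Tn mf; congr fine; have mE : measurable_fun setT (EFin \o f) by exact/measurable_EFinP.
rewrite integralE [RHS]integralE; congr (_ - _)%E.
  rewrite -(isometry_lebesgue mT Tl Ti Tn (measurable_funepos mE)) //.
  by apply: eq_integral => x _; rewrite !funeposE.
rewrite -(isometry_lebesgue mT Tl Ti Tn (measurable_funeneg mE)) //.
by apply: eq_integral => x _; rewrite !funenegE.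
Qed.

Lemma powR_lipschitz (k m a b : R) : 0 < k -> 0 < m -> m <= a -> m <= b ->
  `|a `^ (- k) - b `^ (- k)| <= k * m `^ (- k - 1) * `|a - b|.
Proof.
move=> k0 m0; wlog ab : a b / a < b.
  move=> h ma mb; have [|ba|->] := ltgtP a b; first by move=> ab; exact: h.
  - by rewrite distrC (distrC a); exact: h.
  - by rewrite !subrr normr0 mulr0.
move=> ma mb; have dpow x : a <= x -> is_derive x 1 (fun t => t `^ (- k)) (- k * x `^ (- k - 1)).
  by move=> ax; apply: is_derive1_powR; apply: lt_le_trans (le_trans ma ax).
have [||c cab] := @MVT R (fun t => t `^ (- k)) (fun x => - k * x `^ (- k - 1)) a b ab.
- by move=> x; rewrite in_itv /= => /andP[ax _]; exact: dpow (ltW ax).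
- apply: derivable_within_continuous => x; rewrite in_itv /= => /andP[ax _].
  by have d := dpow x ax; exact: ex_derive.
move=> e; rewrite distrC e normrM (distrC a) ler_wpM2r // normrM normrN (gtr0_norm k0).
rewrite ler_wpM2l ?(ltW k0) // ger0_norm ?powR_ge0 //.
move: cab; rewrite in_itv /= => /andP[ac _]; have mc : m <= c by exact: le_trans (ltW ac).
have k1 : 0 <= k + 1 by rewrite addr_ge0 // ltW.
rewrite -opprD -!powRV ?(lt_le_trans m0 mc) //; apply: ge0_ler_powR => //; rewrite ?nnegrE ?invr_ge0.
- exact: ltW (lt_le_trans m0 mc).
- exact: ltW.
- by rewrite lef_pV2 ?posrE // (lt_le_trans m0 mc).
Qed.

Lemma powRN_anti (a b c : R) : 0 < a -> a <= b -> 0 <= c -> b `^ (- c) <= a `^ (- c).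
Proof.
move=> a0 ab c0; have b0 := lt_le_trans a0 ab.
rewrite !powRN lef_pV2 ?posrE ?powR_gt0 //.
by apply: ge0_ler_powR; rewrite // nnegrE ltW.
Qed.

End integral_tools.

(** * Euclidean inner product and reflections *)

Section inner_product.
Context {R : realType} {n : nat}.
Implicit Types (x y z : 'rV[R]_n).

Definition dotr x y : R := \sum_j x 0 j * y 0 j.

Lemma dotrC x y : dotr x y = dotr y x.
Proof. by apply: eq_bigr => j _; rewrite mulrC. Qed.

Lemma dotrDr x y z : dotr x (y + z) = dotr x y + dotr x z.
Proof. by rewrite /dotr -big_split; apply: eq_bigr => j _; rewrite !mxE mulrDr. Qed.

Lemma dotrZr c x y : dotr x (c *: y) = c * dotr x y.
Proof. by rewrite /dotr mulr_sumr; apply: eq_bigr => j _; rewrite !mxE mulrCA. Qed.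

Lemma dotrNr x y : dotr x (- y) = - dotr x y.
Proof. by rewrite -scaleN1r dotrZr mulN1r. Qed.

Lemma dotrDl x y z : dotr (x + y) z = dotr x z + dotr y z.
Proof. by rewrite ![dotr _ z]dotrC dotrDr. Qed.

Lemma dotrZl c x y : dotr (c *: x) y = c * dotr x y.
Proof. by rewrite dotrC dotrZr dotrC. Qed.

Lemma dotrNl x y : dotr (- x) y = - dotr x y.
Proof. by rewrite dotrC dotrNr dotrC. Qed.

Lemma dotrr x : dotr x x = fnorm x ^+ 2.
Proof. by rewrite fnorm_sq; apply: eq_bigr => j _; rewrite expr2. Qed.

Lemma fnorm_sqD x y : fnorm (x + y) ^+ 2 = fnorm x ^+ 2 + 2 * dotr x y + fnorm y ^+ 2.
Proof. by rewrite -!dotrr dotrDl !dotrDr (dotrC y x); ring. Qed.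

Lemma fnorm_sqB x y : fnorm (x - y) ^+ 2 = fnorm x ^+ 2 - 2 * dotr x y + fnorm y ^+ 2.
Proof. by rewrite fnorm_sqD dotrNr fnormN; ring. Qed.

Lemma dotr_le x y : dotr x y <= fnorm x * fnorm y.
Proof.
have [->|y0] := eqVneq y 0; first by rewrite fnorm0 mulr0 /dotr big1 // => j _; rewrite mxE mulr0.
have ny : 0 < fnorm y by exact: fnorm_gt0.
have [/fnorm_eq0 ->|x0] := eqVneq (fnorm x) 0.
  by rewrite fnorm0 mul0r /dotr big1 // => j _; rewrite mxE mul0r.
have nx : 0 < fnorm x by rewrite lt_def x0 fnorm_ge0.
(* Cauchy-Schwarz is the nonnegativity of this square, divided by [2 * fnorm x * fnorm y]. *)
have := sqr_ge0 (fnorm (fnorm y *: x - fnorm x *: y)).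
rewrite fnorm_sqB !fnormZ dotrZl dotrZr !ger0_norm ?fnorm_ge0 // => h.
rewrite -(ler_pM2l (mulr_gt0 nx ny)); nra.
Qed.

Lemma fnormD x y : fnorm (x + y) <= fnorm x + fnorm y.
Proof.
rewrite -(@ler_pXn2r _ 2) ?nnegrE ?addr_ge0 ?fnorm_ge0 // fnorm_sqD sqrrD.
by have := dotr_le x y => h; lra.
Qed.

Lemma fnormB_le x y : `|fnorm x - fnorm y| <= fnorm (x - y).
Proof.
have h1 := fnormD (x - y) y; have h2 := fnormD (y - x) x.
rewrite !subrK in h1 h2; rewrite -opprB fnormN in h2.
by rewrite ler_norml; apply/andP; split; lra.
Qed.

Lemma dotr_norm_le x y : `|dotr x y| <= fnorm x * fnorm y.
Proof.
by rewrite ler_norml dotr_le andbT lerNl -dotrNl -(fnormN x) dotr_le.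
Qed.

(** The reflection in the hyperplane orthogonal to [e]. Being an additive isometric involution it
    preserves the measure by [isometry_lebesgue]; this takes the place of rotation invariance. *)
Definition reflection e x := x - (2 * dotr e x / dotr e e) *: e.

Lemma dotr_gt0 e : e != 0 -> 0 < dotr e e.
Proof. by move=> e0; rewrite dotrr exprn_gt0 // fnorm_gt0. Qed.

Lemma reflection_dot e x : e != 0 -> dotr e (reflection e x) = - dotr e x.
Proof.
move=> /dotr_gt0 e0; rewrite /reflection dotrDr dotrNr dotrZr -mulrA mulVf ?gt_eqF //.
by rewrite mulr1; ring.
Qed.

Lemma reflectionK e : e != 0 -> involutive (reflection e).
Proof.
move=> e0 x; rewrite {1}/reflection reflection_dot // /reflection.
by rewrite mulrN mulNr scaleNr opprK subrK.
Qed.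

Lemma reflectionB e x y : reflection e (x - y) = reflection e x - reflection e y.
Proof.
rewrite /reflection dotrDr dotrNr mulrBr mulrBl.
by apply/rowP => j; rewrite !mxE; ring.
Qed.

Lemma fnorm_reflection e x : e != 0 -> fnorm (reflection e x) = fnorm x.
Proof.
move=> e0; have := dotr_gt0 e0; rewrite dotrr => ee.
apply/eqP; rewrite -(@eqrXn2 _ 2) ?fnorm_ge0 // /reflection fnorm_sqB fnormZ dotrZr exprMn.
rewrite real_normK ?num_real // (dotrC x) dotrr; apply/eqP.
by field; rewrite gt_eqF // fnorm_gt0.
Qed.

Lemma reflection_id e x : dotr e x = 0 -> reflection e x = x.
Proof. by move=> h; rewrite /reflection h mulr0 mul0r scale0r subr0. Qed.

Lemma measurable_scalerV d (T : measurableType d) (c : T -> R) (g : T -> 'rV[R]_n) :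
  measurable_fun setT c -> measurable_fun setT g -> measurable_fun setT (fun x : T => c x *: g x).
Proof.
move=> mc mg; apply: measurable_fun_rV => i; rewrite /coord_rV.
by rewrite (_ : _ \o _ = (fun x : T => c x * g x 0 i)); [mfun | apply/funext => x; rewrite /= mxE].
Qed.

Lemma measurable_dotr e : measurable_fun setT (dotr e).
Proof.
by apply: measurable_sum => j; mfun.
Qed.

Lemma measurable_reflection e : measurable_fun setT (reflection e).
Proof.
have md := measurable_dotr e.
apply: measurable_subrV => //; apply: measurable_scalerV => //.
by apply: (measurable_funM (f := fun x => 2 * dotr e x)); mfun.
Qed.

End inner_product.

(** * The Riesz potential of an annular field *)

Section riesz_field.
Context {R : realType} (n : nat) (s : R).
Hypotheses (n0 : (0 < n)%N) (s0 : 0 < s) (s1 : s < 1).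
Let mu := borel_lebesgue R n.
Implicit Types (e w x y z : 'rV[R]_n).
Let kap := n%:R + s - 1.
Let nR1 : 1 <= n%:R :> R. Proof. by rewrite ler1n. Qed.
Let kap_gt0 : 0 < kap.
Proof. by rewrite /kap addrAC ltr_wpDl // subr_ge0. Qed.
Let kap_lt : kap < n%:R.
Proof. by rewrite /kap -addrA gtrDl subr_lt0. Qed.
Let nR0 : 0 < n%:R :> R. Proof. exact: lt_le_trans nR1. Qed.

Let powR1E (r : R) : 1 `^ r = 1. Proof. by rewrite powR1. Qed.

Lemma ae_subl (P : 'rV[R]_n -> Prop) a : {ae mu, forall x, P x} -> {ae mu, forall x, P (a - x)}.
Proof.
move=> [N [mN N0 sN]].
have mf : measurable_fun setT (fun x : 'rV[R]_n => a - x) by mfun.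
exists ((fun x => a - x) @^-1` N); split.
- by rewrite -[X in measurable X]setTI; exact: mf.
- rewrite -(setIT (_ @^-1` _)) -integral_indic //; last by rewrite -[X in measurable X]setTI; exact: mf.
  rewrite (@ge0_integral_subl R n (fun x => (\1_N x)%:E) a) //; last by apply/measurable_EFinP.
  by rewrite integral_indic // setIT.
- by move=> x /= h; apply: sN.
Qed.

(** With radii [sqrt n] and [2 sqrt n] the annulus contains the cube of the points whose coordinates
    all lie in []1, 2[], on which the positivity of [bump] is tested. It also stays away from the
    origin, which gives the linear bound [riesz_field_near]. *)
Definition annulus (z : 'rV[R]_n) : R := ind (n%:R < fnorm z ^+ 2) * ind (fnorm z ^+ 2 < 4 * n%:R).

Lemma measurable_annulus : measurable_fun setT annulus.
Proof. by rewrite /annulus; mfun. Qed.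

Lemma annulus_ge0 z : 0 <= annulus z.
Proof. by rewrite mulr_ge0 ?ind_ge0. Qed.

Lemma annulusP z : annulus z = 0 \/ [/\ annulus z = 1, 1 <= fnorm z & fnorm z < 2 * n%:R].
Proof.
rewrite /annulus /ind; case: ltP => h1; last by left; rewrite mul0r.
case: ltP => h2; last by left; rewrite mulr0.
right; split; first by rewrite mul1r.
- rewrite -(@ler_pXn2r _ 2) ?nnegrE ?fnorm_ge0 // expr1n; exact: le_trans (ltW h1).
- rewrite -(@ltr_pXn2r _ 2) ?nnegrE ?fnorm_ge0 ?mulr_ge0 ?(ltW nR0) //.
  by apply: (lt_le_trans h2); rewrite exprMn -natrX ler_pM2l // expr2 ler_peMr // ltW.
Qed.

Lemma annulus_dotr_le e z : `|dotr e z * annulus z| <= 2 * n%:R * fnorm e * ind (`|z| < 2 * n%:R).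
Proof.
have [->|[-> z1 z2]] := annulusP z.
  by rewrite mulr0 normr0 !mulr_ge0 ?ind_ge0 ?fnorm_ge0 ?(ltW nR0).
rewrite mulr1 /ind (le_lt_trans (norm_le_fnorm z) z2) mulr1 (le_trans (dotr_norm_le e z)) //.
by rewrite mulrC ler_wpM2r ?fnorm_ge0 // ltW.
Qed.

Lemma pot0E w : pot s 0 w = fnorm w `^ (- kap).
Proof.
rewrite /pot expr0n addr0 -powR_mulrn ?fnorm_ge0 // -powRrM; congr (_ `^ _); rewrite /kap.
by field.
Qed.

Definition head (r : R) (w : 'rV[R]_n) : R := ind (`|w| < r) * `|w| `^ (- kap).

Lemma head_ge0 r w : 0 <= head r w.
Proof. by rewrite mulr_ge0 ?ind_ge0 ?powR_ge0. Qed.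

Lemma head_integrable r : 0 < r -> mu.-integrable setT (EFin \o head r).
Proof.
move=> r0; apply: ge0_fin_integrable; [by rewrite /head; mfun | exact: head_ge0 |].
have [C _ hC] := kernel_head_le kap_gt0 kap_lt.
by apply: le_lt_trans (hC _ r0) _; rewrite ltry.
Qed.

(* The component along e of the Riesz potential of the field z |-> annulus z * z. *)
Definition riesz_field (e y : 'rV[R]_n) : R :=
  \int[mu]_z (pot s 0 (y - z) * (dotr e z * annulus z)).

Let mpot := @measurable_pot R n s 0.
Let mann := measurable_annulus.

Let pot_head y z e : `|pot s 0 (y - z) * (dotr e z * annulus z)| <=
  2 * n%:R * fnorm e * head (`|y| + 2 * n%:R) (y - z).
Proof.
rewrite normrM (ger0_norm (pot_ge0 _ _ _)) mulrC.
apply: (@le_trans _ _ (2 * n%:R * fnorm e * ind (`|z| < 2 * n%:R) * `|y - z| `^ (- kap))).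
  by apply: ler_pM => //; [exact: pot_ge0 | exact: annulus_dotr_le | exact: pot0_le].
rewrite -mulrA ler_wpM2l ?mulr_ge0 ?fnorm_ge0 ?(ltW nR0) // /head.
rewrite ler_wpM2r ?powR_ge0 // /ind; case: ltP => h; last by case: ifP.
by rewrite ifT // (le_lt_trans (ler_normB y z)) // ltrD2l.
Qed.

Let rad_gt0 (y : 'rV[R]_n) : 0 < `|y| + 2 * n%:R.
Proof. by rewrite ltr_wpDl // mulr_gt0. Qed.

Let measurable_field_integrand e y :
  measurable_fun setT (fun z : 'rV[R]_n => pot s 0 (y - z) * (dotr e z * annulus z)).
Proof. by have md := measurable_dotr e; mfun. Qed.

Lemma riesz_field_integrable e y :
  mu.-integrable setT (EFin \o (fun z => pot s 0 (y - z) * (dotr e z * annulus z))).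
Proof.
apply: (@integrable_le _ _ _ mu _ (fun z => 2 * n%:R * fnorm e * head (`|y| + 2 * n%:R) (y - z))) => //.
apply: (integrableZl measurableT (2 * n%:R * fnorm e) (f := EFin \o (fun z => head (`|y| + 2 * n%:R) (y - z)))).
exact/integrable_subl/head_integrable.
Qed.

Lemma riesz_fieldD e e' y : riesz_field (e + e') y = riesz_field e y + riesz_field e' y.
Proof.
rewrite /riesz_field -RintegralD //; try exact: riesz_field_integrable.
by apply: eq_Rintegral => z _; rewrite dotrDl; ring.
Qed.

Lemma riesz_fieldZ c e y : riesz_field (c *: e) y = c * riesz_field e y.
Proof.
rewrite /riesz_field -RintegralZl //; last exact: riesz_field_integrable.
by apply: eq_Rintegral => z _; rewrite dotrZl; ring.
Qed.

(** The reflection orthogonal to [e] fixes [y] and the annulus and changes the sign of [dotr e z],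
    so the integral equals its opposite. *)
Lemma riesz_field_orth e y : dotr e y = 0 -> riesz_field e y = 0.
Proof.
move=> ey; have [->|e0] := eqVneq e 0.
  by rewrite -(scale0r (0 : 'rV[R]_n)) riesz_fieldZ mul0r.
have h : riesz_field e y = - riesz_field e y.
  rewrite {1}/riesz_field -(isometry_Rintegral (measurable_reflection e) (reflectionB e)
    (reflectionK e0) (fun x => fnorm_reflection x e0)) //.
  rewrite -mulN1r /riesz_field -RintegralZl //; last exact: riesz_field_integrable.
  apply: eq_Rintegral => z _; rewrite reflection_dot // /annulus fnorm_reflection //.
  by rewrite /pot -{1}(reflection_id ey) -reflectionB fnorm_reflection //; ring.
lra.
Qed.

Definition bump y : R := riesz_field y y / fnorm y ^+ 2.

(** [e] splits into a multiple of [y] and a vector orthogonal to [y]; the latter contributes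
    nothing. *)
Lemma riesz_field_radial e y : riesz_field e y = bump y * dotr e y.
Proof.
have [->|y0] := eqVneq y 0.
  have d0 : dotr e 0 = 0 by rewrite /dotr big1 // => j _; rewrite mxE mulr0.
  by rewrite d0 mulr0 riesz_field_orth.
have ny : fnorm y ^+ 2 != 0 by rewrite expf_neq0 // gt_eqF // fnorm_gt0.
set c := dotr e y / fnorm y ^+ 2.
have -> : e = c *: y + (e - c *: y) by rewrite addrC subrK.
rewrite riesz_fieldD riesz_fieldZ (@riesz_field_orth (e - _)); last first.
  by rewrite dotrDl dotrNl dotrZl dotrr /c divfK // subrr.
by rewrite addr0 addrC subrK /bump /c; ring.
Qed.

Let pot_opp y z : pot s 0 (y - - z) = pot s 0 (y + z). Proof. by rewrite opprK. Qed.

Let fieldN_integrable e y :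
  mu.-integrable setT (EFin \o (fun z => pot s 0 (y + z) * (dotr e z * annulus z))).
Proof.
have := integrable_subl 0 (riesz_field_integrable (- e) y).
apply: eq_integrable => // z _ /=; congr EFin.
by rewrite sub0r pot_opp dotrNl dotrNr opprK /annulus fnormN.
Qed.

Let sym_integrable e y : mu.-integrable setT
  (EFin \o (fun z => (pot s 0 (y - z) - pot s 0 (y + z)) * (dotr e z * annulus z))).
Proof.
have := integrableB measurableT (riesz_field_integrable e y) (fieldN_integrable e y).
by apply: eq_integrable => // z _ /=; rewrite mulrBl EFinB.
Qed.

Let sym_measurable e y : measurable_fun setT
  (fun z => (pot s 0 (y - z) - pot s 0 (y + z)) * (dotr e z * annulus z)).
Proof. by have /integrableP[/measurable_EFinP] := sym_integrable e y. Qed.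

(** The average of [z] and [- z], under which the annular field is odd. The potential alone decays
    like [|y| ^ (1 - n - s)], which is not integrable at infinity; the difference that appears here
    gains one power, and its sign is that of [dotr y z] for [e = y]. *)
Lemma riesz_field_sym e y : riesz_field e y =
  2^-1 * \int[mu]_z ((pot s 0 (y - z) - pot s 0 (y + z)) * (dotr e z * annulus z)).
Proof.
have -> : \int[mu]_z ((pot s 0 (y - z) - pot s 0 (y + z)) * (dotr e z * annulus z)) =
    riesz_field e y - \int[mu]_z (pot s 0 (y + z) * (dotr e z * annulus z)).
  rewrite -(RintegralB measurableT (riesz_field_integrable e y) (fieldN_integrable e y)).
  by apply: eq_Rintegral => z _; rewrite mulrBl.
have -> : \int[mu]_z (pot s 0 (y + z) * (dotr e z * annulus z)) = - riesz_field e y.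
  rewrite -mulN1r -riesz_fieldZ scaleN1r /riesz_field -[RHS]Rintegral_opp //.
  apply: eq_Rintegral => z _; rewrite pot_opp dotrNl dotrNr opprK /annulus fnormN //.
by field.
Qed.

(** The bound [2 n] for the length of the field, times the volume of a cube that contains its
    support. *)
Let bound_const : R := 2 * n%:R * ((2 * n%:R) *+ 2) ^+ n.
Let bound_const_ge0 : 0 <= bound_const.
Proof. by rewrite !mulr_ge0 ?exprn_ge0 ?mulrn_wge0 ?mulr_ge0 ?(ltW nR0). Qed.

Let field_bound e y B : 0 <= B ->
  (forall z, annulus z = 1 -> 1 <= fnorm z -> fnorm z < 2 * n%:R -> `|pot s 0 (y - z) - pot s 0 (y + z)| <= B) ->
  `|riesz_field e y| <= B * fnorm e * bound_const.
Proof.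
move=> B0 hB; rewrite riesz_field_sym normrM gtr0_norm ?invr_gt0 //.
apply: (@le_trans _ _ `|\int[mu]_z ((pot s 0 (y - z) - pot s 0 (y + z)) * (dotr e z * annulus z))|).
  by rewrite ler_piMl // invf_le1 // ler1n.
have r0 : 0 < 2 * n%:R :> R by exact: mulr_gt0.
have ib : mu.-integrable setT (EFin \o (fun z : 'rV[R]_n => ind (`|z| < 2 * n%:R))).
  by apply: ge0_fin_integrable; [mfun | move=> z; exact: ind_ge0 | rewrite integral_norm_ball ?ltry].
have -> : B * fnorm e * bound_const =
    \int[mu]_z ((B * (2 * n%:R * fnorm e)) * ind (`|z| < 2 * n%:R)).
  rewrite RintegralZl // /Rintegral integral_norm_ball // /= /bound_const; ring.
apply: ler_norm_Rintegral; first exact: sym_measurable.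
  exact: (integrableZl measurableT (B * (2 * n%:R * fnorm e)) ib).
move=> z; rewrite normrM -mulrA; have [h|[h z1 z2]] := annulusP z.
  by rewrite h mulr0 normr0 mulr0 !mulr_ge0 ?ind_ge0 ?fnorm_ge0 ?(ltW nR0).
by apply: ler_pM => //; [exact: hB | exact: annulus_dotr_le].
Qed.

Let pot_lip m y z : 0 < m -> m <= fnorm (y - z) -> m <= fnorm (y + z) ->
  `|pot s 0 (y - z) - pot s 0 (y + z)| <=
  kap * m `^ (- (n%:R + s)) * `|fnorm (y - z) - fnorm (y + z)|.
Proof.
move=> m0 h1 h2; rewrite !pot0E.
have -> : - (n%:R + s) = - kap - 1 by rewrite /kap; ring.
exact: powR_lipschitz.
Qed.

Let diff_le_y (y z : 'rV[R]_n) : `|fnorm (y - z) - fnorm (y + z)| <= 2 * fnorm y.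
Proof.
rewrite -(fnormN (y - z)) opprB; apply: (le_trans (fnormB_le _ _)).
rewrite -fnormN (_ : - (z - y - (y + z)) = y + y); last by rewrite !opprD !opprK; apply/rowP => j; rewrite !mxE; ring.
by apply: (le_trans (fnormD _ _)); rewrite mulr2n mulrDl mul1r.
Qed.

Let diff_le_z (y z : 'rV[R]_n) : `|fnorm (y - z) - fnorm (y + z)| <= 2 * fnorm z.
Proof.
by rewrite -(fnormN (y - z)) opprB (addrC y); exact: diff_le_y.
Qed.

Lemma riesz_field_near : exists2 C, 0 <= C &
  forall e y, fnorm y <= 2^-1 -> `|riesz_field e y| <= C * fnorm e * fnorm y.
Proof.
pose C0 := kap * 2^-1 `^ (- (n%:R + s)) * 2.
have C00 : 0 <= C0 by rewrite !mulr_ge0 ?powR_ge0 // ltW.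
exists (C0 * bound_const); first by rewrite mulr_ge0.
move=> e y hy; have -> : C0 * bound_const * fnorm e * fnorm y = C0 * fnorm y * fnorm e * bound_const by ring.
apply: field_bound; first by rewrite mulr_ge0 ?fnorm_ge0.
(* [|z| >= 1] and [|y| <= 1/2] keep [y - z] and [y + z] at distance at least 1/2 from the origin. *)
move=> z _ z1 _; have z2 : 2^-1 + 2^-1 <= fnorm z by apply: le_trans z1; lra.
apply: (@le_trans _ _ (kap * 2^-1 `^ (- (n%:R + s)) * `|fnorm (y - z) - fnorm (y + z)|)).
  apply: pot_lip => //.
  - by have := fnormD (z - y) y; rewrite subrK -(fnormN (y - z)) opprB; lra.
  - by have := fnormD (z + y) (- y); rewrite addrK fnormN (addrC y); lra.
by rewrite /C0 -[leRHS]mulrA ler_wpM2l ?mulr_ge0 ?powR_ge0 // ltW.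
Qed.

Lemma powR_le_decay y : 1 <= fnorm y -> fnorm y `^ (- (n%:R + s)) <= decay s y.
Proof.
have ns : 0 <= n%:R + s by rewrite addr_ge0 // ltW.
move=> y1; rewrite /decay /ind; case: ltP => h.
  by rewrite mul0r addr0 -[leRHS](powR1E (- (n%:R + s))) powRN_anti.
rewrite mul1r add0r; apply: fnorm_powR_le => //.
by rewrite -normr_gt0 (lt_le_trans ltr01).
Qed.

(** For [|y| >= 4 n] one has [|z| <= |y| / 2] on the annulus, and the symmetric difference gains the
    missing power. In the bounded range that remains the local integrability of the potential
    suffices; there [6 n] bounds [|y - z|]. *)
Lemma riesz_field_far : exists2 C, 0 <= C &
  forall e y, 2^-1 <= fnorm y -> `|riesz_field e y| <= C * fnorm e * decay s y.
Proof.
have ns : 0 < n%:R + s by rewrite addr_gt0.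
have n4 : 1 <= 4 * n%:R :> R by rewrite (le_trans nR1) // ler_peMl ?ler1n // ltW.
pose C1 := kap * 2 `^ (n%:R + s) * (4 * n%:R) * bound_const.
pose C2 := 2 * n%:R * (\int[mu]_z head (6 * n%:R) z) / (4 * n%:R) `^ (- (n%:R + s)).
have C10 : 0 <= C1 by rewrite !mulr_ge0 ?powR_ge0 ?(ltW kap_gt0) ?(ltW nR0).
have I0 : 0 <= \int[mu]_z head (6 * n%:R) z by apply: Rintegral_ge0 => z _; exact: head_ge0.
have C20 : 0 <= C2 by rewrite !mulr_ge0 ?invr_ge0 ?powR_ge0 ?(ltW nR0).
exists (C1 + C2); first exact: addr_ge0.
move=> e y y2; have [yn|yn] := leP (4 * n%:R) (fnorm y).
  apply: (@le_trans _ _ (C1 * fnorm e * decay s y)); last first.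
    by rewrite ler_wpM2r ?decay_ge0 // ler_wpM2r ?fnorm_ge0 // lerDl.
  have y0 : 0 < fnorm y by rewrite (lt_le_trans _ y2) // invr_gt0.
  apply: (@le_trans _ _ (C1 * fnorm e * fnorm y `^ (- (n%:R + s)))); last first.
    by apply: ler_wpM2l; [rewrite mulr_ge0 ?fnorm_ge0 | apply: powR_le_decay; exact: le_trans yn].
  have -> : C1 * fnorm e * fnorm y `^ (- (n%:R + s)) =
      (kap * (fnorm y / 2) `^ (- (n%:R + s)) * (4 * n%:R)) * fnorm e * bound_const.
    rewrite powRM ?fnorm_ge0 ?invr_ge0 // powRV // opprK /C1; ring.
  apply: field_bound; first by rewrite !mulr_ge0 ?powR_ge0 ?(ltW kap_gt0) ?(ltW nR0).
  move=> z _ z1 z2.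
  apply: (@le_trans _ _ (kap * (fnorm y / 2) `^ (- (n%:R + s)) * `|fnorm (y - z) - fnorm (y + z)|)).
    apply: pot_lip => //; first by rewrite divr_gt0.
    - by have := fnormD (y - z) z; rewrite subrK; lra.
    - by have := fnormD (y + z) (- z); rewrite addrK fnormN; lra.
  rewrite ler_wpM2l ?mulr_ge0 ?powR_ge0 ?(ltW kap_gt0) //.
  by apply: (le_trans (diff_le_z y z)); lra.
apply: (@le_trans _ _ (C2 * fnorm e * decay s y)); last first.
  by rewrite ler_wpM2r ?decay_ge0 // ler_wpM2r ?fnorm_ge0 // lerDr.
have y6 : `|y| + 2 * n%:R <= 6 * n%:R by have := norm_le_fnorm y; lra.
have hi := head_integrable (rad_gt0 y).
have hi6 : mu.-integrable setT (EFin \o head (6 * n%:R)) by apply: head_integrable; rewrite mulr_gt0.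
have md : (4 * n%:R) `^ (- (n%:R + s)) <= decay s y.
  rewrite /decay /ind; case: ltP => h.
    by rewrite mul0r addr0 -[leRHS](powR1E (- (n%:R + s))) powRN_anti // ltW.
  rewrite mul1r add0r powRN_anti ?(lt_le_trans ltr01) ?(ltW ns) //.
  by apply: (le_trans (norm_le_fnorm y)); exact: ltW.
have p4 : 0 < (4 * n%:R) `^ (- (n%:R + s)) by rewrite powR_gt0 // mulr_gt0.
apply: (@le_trans _ _ (2 * n%:R * fnorm e * \int[mu]_z head (6 * n%:R) z)).
  have mh : measurable_fun setT (head (6 * n%:R)) by rewrite /head; mfun.
  rewrite -(Rintegral_subl y mh) -(@RintegralZl _ _ _ _ _ _ _ measurableT (integrable_subl y hi6)).
  apply: ler_norm_Rintegral => //.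
    apply: (integrableZl measurableT (2 * n%:R * fnorm e) (f := EFin \o (fun z => head (6 * n%:R) (y - z)))).
    exact/integrable_subl.
  move=> z; apply: (le_trans (pot_head y z e)).
  rewrite ler_wpM2l ?mulr_ge0 ?fnorm_ge0 ?(ltW nR0) // /head ler_wpM2r ?powR_ge0 // /ind.
  by case: ltP => h; [rewrite ifT // (lt_le_trans h) | case: ifP].
have -> : 2 * n%:R * fnorm e * (\int[mu]_z head (6 * n%:R) z) =
    C2 * fnorm e * (4 * n%:R) `^ (- (n%:R + s)) by rewrite /C2; field; rewrite gt_eqF.
by rewrite ler_wpM2l // mulr_ge0 ?fnorm_ge0.
Qed.

Lemma measurable_riesz_field e : measurable_fun setT (riesz_field e).
Proof.
apply: (@measurable_Rintegral_section _ _ _ _ _ mu (fun y z => pot s 0 (y - z) * (dotr e z * annulus z))).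
by have md := measurable_dotr e; mfun.
Qed.

Lemma measurable_bump : measurable_fun setT bump.
Proof.
have m1 : measurable_fun setT (fun y => riesz_field y y).
  apply: (@measurable_Rintegral_section _ _ _ _ _ mu (fun y z => pot s 0 (y - z) * (dotr y z * annulus z))).
  have md : measurable_fun setT (fun z : 'rV[R]_n * 'rV[R]_n => dotr z.1 z.2).
    by apply: measurable_sum => j; mfun.
  by mfun.
apply: measurable_funM => //.
rewrite (_ : (fun x => _) = (fun x => (fnorm x ^+ 2) `^ (-1))); first by mfun.
by apply/funext => x; rewrite powR_inv1 // sqr_ge0.
Qed.

(** Near 0 the division by [|y| ^ 2] is compensated by the linear bound on the field, taken at
    [e = y]; beyond radius 1/2 it costs only a constant. *)
Lemma bump_le : exists2 C, 0 <= C & forall y, `|bump y| <= C * decay s y.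
Proof.
have [C1 C10 h1] := riesz_field_near; have [C2 C20 h2] := riesz_field_far.
exists (C1 + C2 * 2); first by rewrite addr_ge0 // mulr_ge0.
move=> y; rewrite /bump; have [->|y0] := eqVneq y 0.
  by rewrite fnorm0 expr0n invr0 mulr0 normr0 mulr_ge0 ?decay_ge0 // addr_ge0 // mulr_ge0.
have fy : 0 < fnorm y by exact: fnorm_gt0.
rewrite normrM normfV (ger0_norm (sqr_ge0 _)) ler_pdivrMr ?exprn_gt0 //.
have [yh|yh] := leP (fnorm y) 2^-1.
  have y1 : `|y| < 1 by apply: (le_lt_trans (norm_le_fnorm y)); lra.
  rewrite (_ : decay s y = 1); last by rewrite /decay /ind y1 leNgt y1 /= mul0r addr0.
  rewrite mulr1; apply: (le_trans (h1 y y yh)).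
  by rewrite -mulrA -expr2 ler_wpM2r ?sqr_ge0 // lerDl mulr_ge0.
apply: (le_trans (h2 y y (ltW yh))).
have -> : (C1 + C2 * 2) * decay s y * fnorm y ^+ 2 = (C1 * fnorm y + C2 * (2 * fnorm y)) * fnorm y * decay s y by ring.
rewrite ler_wpM2r ?decay_ge0 // ler_wpM2r ?fnorm_ge0 //.
apply: (@le_trans _ _ (C2 * (2 * fnorm y))); last by rewrite lerDr mulr_ge0 ?fnorm_ge0.
by rewrite ler_peMr //; lra.
Qed.

Lemma bump_integrable : mu.-integrable setT (EFin \o bump).
Proof.
have [C _ hC] := bump_le; apply: integrable_le measurable_bump _ hC.
exact: (integrableZl measurableT C (decay_integrable n s0)).
Qed.

Let ae_regular y : {ae mu, forall z, y - z != 0 /\ y + z != 0}.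
Proof.
apply: filterS2 (ae_subl y (ae_neq0 n0)) (ae_subl (- y) (ae_neq0 n0)) => z h1 h2; split=> //.
by rewrite -oppr_eq0 opprD.
Qed.

Let pot_anti (a b : 'rV[R]_n) : a != 0 -> fnorm a ^+ 2 <= fnorm b ^+ 2 -> pot s 0 b <= pot s 0 a.
Proof.
move=> a0 ab; have fa := fnorm_gt0 a0.
have fab : fnorm a <= fnorm b by exact: fnorm_le_sq.
by rewrite !pot0E powRN_anti // ltW.
Qed.

(** Since [|y + z| ^ 2 - |y - z| ^ 2] is four times [dotr y z], both factors have the sign of
    [dotr y z]. The inequality is stated almost everywhere because [pot] is 0, not infinite, at the
    origin, which breaks its monotonicity at [z = y] and [z = - y]. *)
Let bump_integrand_ge0 y : {ae mu, forall z, 0 <= (pot s 0 (y - z) - pot s 0 (y + z)) * (dotr y z * annulus z)}.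
Proof.
apply: filterS (ae_regular y) => z [h1 h2]; rewrite mulrA mulr_ge0 ?annulus_ge0 //.
have [d0|d0] := leP 0 (dotr y z).
  by rewrite mulr_ge0 // subr_ge0 pot_anti // fnorm_sqB fnorm_sqD; lra.
by rewrite mulr_le0 ?(ltW d0) // subr_le0 pot_anti // fnorm_sqB fnorm_sqD; lra.
Qed.

Lemma bump_ge0 y : 0 <= bump y.
Proof.
rewrite /bump mulr_ge0 ?invr_ge0 ?sqr_ge0 // riesz_field_sym mulr_ge0 ?invr_ge0 //.
rewrite ae_Rintegral_norm; [exact: Rintegral_ge0 | exact: sym_measurable | exact: bump_integrand_ge0].
Qed.

Let mu_box_gt0 a b : a < b -> (0 < mu (@box_rV R n a b))%E.
Proof. by move=> ab; rewrite /mu borel_lebesgue_box ?lte_fin ?exprn_gt0 ?subr_gt0 // ltW. Qed.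

(** For [y] with coordinates in []0, 1[] and [z] with coordinates in []1, 2[] everything is strictly
    positive: [dotr y z > 0], [z] lies in the annulus, and [y - z] is nonzero and shorter than
    [y + z]. *)
Lemma integral_bump_gt0 : 0 < \int[mu]_y bump y.
Proof.
apply: (@Rintegral_gt0 _ _ _ mu bump (@box_rV R n 0 1)).
- exact: bump_integrable.
- by apply: aeW => y; exact: bump_ge0.
- exact: measurable_box.
- exact: mu_box_gt0.
move=> y hy; have y0 : y != 0.
  apply/eqP => y0; have := hy (Ordinal n0); rewrite y0 mxE ltxx //.
rewrite /bump divr_gt0 ?exprn_gt0 ?fnorm_gt0 // riesz_field_sym mulr_gt0 ?invr_gt0 //.
apply: (@Rintegral_gt0 _ _ _ mu _ (@box_rV R n 1 2)).
- exact: sym_integrable.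
- exact: bump_integrand_ge0.
- exact: measurable_box.
- by apply: mu_box_gt0; rewrite ltr1n.
move=> z hz.
have dp : 0 < dotr y z.
  rewrite /dotr (bigD1 (Ordinal n0)) //= ltr_wpDr //.
    apply: sumr_ge0 => j _; rewrite mulr_ge0 //.
      by have /andP[/ltW] := hy j.
    by have /andP[/ltW h _] := hz j; apply: le_trans h.
  have /andP[h1 _] := hy (Ordinal n0); have /andP[h2 _] := hz (Ordinal n0).
  by rewrite mulr_gt0 // (lt_trans ltr01).
have sumn (c : R) : \sum_(j < n) c = c * n%:R by rewrite sumr_const card_ord mulr_natr.
have ltsum (f g : 'I_n -> R) : (forall j, f j < g j) -> \sum_j f j < \sum_j g j.
  move=> fg; rewrite (bigD1 (Ordinal n0)) //= [ltRHS](bigD1 (Ordinal n0)) //=.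
  by rewrite ltr_leD // ler_sum // => j _; rewrite ltW.
have -> : annulus z = 1.
  rewrite /annulus fnorm_sq /ind ifT; last first.
    rewrite -[ltLHS]mul1r -sumn; apply: ltsum => j.
    by have /andP[h _] := hz j; rewrite expr_gt1 // (le_trans ler01) // ltW.
  rewrite ifT ?mul1r // -sumn; apply: ltsum => j.
  by have /andP[h1 h2] := hz j; nra.
rewrite mulr1 mulr_gt0 // subr_gt0 !pot0E.
have yz : y - z != 0.
  apply/eqP => h; have /andP[_ h1] := hy (Ordinal n0); have /andP[h2 _] := hz (Ordinal n0).
  have := congr1 (fun x : 'rV[R]_n => x 0 (Ordinal n0)) h; rewrite !mxE; lra.
have lt1 : fnorm (y - z) < fnorm (y + z).
  by rewrite -(@ltr_pXn2r _ 2) ?nnegrE ?fnorm_ge0 // fnorm_sqB fnorm_sqD; lra.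
have f0 := fnorm_gt0 yz.
rewrite !powRN ltf_pV2 ?posrE ?powR_gt0 ?(lt_trans f0 lt1) //.
by rewrite gt0_ltr_powR ?nnegrE ?fnorm_ge0 //.
Qed.

End riesz_field.

(** * Averages over dilations *)

Section dilations.
Context {R : realType} (n : nat).
Let mu := borel_lebesgue R n.

Lemma Rintegral_scale (h : 'rV[R]_n -> R) (c : R) : 0 < c -> mu.-integrable setT (EFin \o h) ->
  \int[mu]_x h (c *: x) = c^-1 ^+ n * \int[mu]_x h x.
Proof.
move=> c0 hi; have [mh _] := integrableP _ _ _ hi.
have sc (f : 'rV[R]_n -> \bar R) : measurable_fun setT f -> (forall x, 0 <= f x)%E ->
    (\int[mu]_x f (c *: x)%R = (c^-1 ^+ n)%:E * \int[mu]_x f x)%E.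
  move=> mf f0; have := @ge0_integral_rV_comb R n 0 c f (lt0r_neq0 c0) mf f0.
  by under eq_integral do rewrite add0r; rewrite gtr0_norm.
have fp := integrable_pos_fin_num measurableT hi; have fn := integrable_neg_fin_num measurableT hi.
rewrite /Rintegral integralE [X in _ = _ * fine X]integralE.
have -> : (\int[mu]_x (fun x => (h (c *: x)%R)%:E)^\+ x = (c^-1 ^+ n)%:E * \int[mu]_x (EFin \o h)^\+ x)%E.
  by rewrite -(sc _ (measurable_funepos mh)) //; apply: eq_integral => x _; rewrite !funeposE.
have -> : (\int[mu]_x (fun x => (h (c *: x)%R)%:E)^\- x = (c^-1 ^+ n)%:E * \int[mu]_x (EFin \o h)^\- x)%E.
  by rewrite -(sc _ (measurable_funeneg mh)) //; apply: eq_integral => x _; rewrite !funenegE.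
rewrite -muleBr //; first by rewrite fineM // fin_numB fp fn.
exact: fin_num_adde_defr.
Qed.

(** If the integral of [f] is infinite, its real value is 0 and the inequality holds in that case
    too. *)
Lemma norm_Rintegral_le d (T : measurableType d) (nu : {measure set T -> \bar R}) (f : T -> R) :
  measurable_fun setT f -> ((`|\int[nu]_x f x|)%:E <= \int[nu]_x (`|f x|)%:E)%E.
Proof.
move=> mf; apply: (@le_trans _ _ `|\int[nu]_x (f x)%:E|%E).
  by rewrite /Rintegral; case: (\int[nu]_x _)%E => [r| |] //=; rewrite normr0 leey.
by apply: (le_abse_integral nu measurableT); exact/measurable_EFinP.
Qed.

(* Substituting y = t z and integrating in t first leaves a power tail. *)
Lemma dilation_average (s s' c : R) (g : 'rV[R]_n -> R) x : (0 < n)%N -> 0 < c -> s' <= s -> s' < n%:R ->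
  measurable_fun setT g -> (forall y, 0 <= g y) ->
  (\int[lebesgue_measure]_t \int[mu]_z
     (ind (0 < t)%R * ind (t <= 1)%R * t `^ (s - 1) * (ind (`|z| < c)%R * g (x - t *: z)%R))%:E <=
   \int[mu]_y (c `^ (n%:R - s') / (n%:R - s') * (`|y| `^ (- (n%:R - s')) * g (x - y)%R))%:E)%E.
Proof.
move=> n0 c0 ss sn mg g0; have d0 : 0 < n%:R - s' by rewrite subr_gt0.
(* The integrand after [y = t z], with the Jacobian [t ^ - n]. *)
pose F (t : R) (y : 'rV[R]_n) := ind (0 < t) * ind (t <= 1) * t `^ (s - 1) * (t^-1 ^+ n) * (ind (t^-1 * `|y| < c) * g (x - y)).
have F0 t y : 0 <= F t y.
  rewrite /F; have [t0|t0] := ltP 0 t; last by rewrite /ind !mul0r.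
  by rewrite !mulr_ge0 ?ind_ge0 ?powR_ge0 // exprn_ge0 // invr_ge0 ltW.
(* For positive [t] the inverse is a power, hence measurable; the indicator removes the other
   [t]. *)
have minv : measurable_fun setT (fun t : R => ind (0 < t) * t^-1).
  rewrite (_ : (fun t : R => _) = (fun t : R => ind (0 < t) * t `^ (-1))); first by mfun.
  by apply/funext => t; rewrite /ind; case: ltP => h; rewrite ?mul0r ?mul1r // powR_inv1 // ltW.
have FE : (fun z : R * 'rV[R]_n => F z.1 z.2) = (fun z : R * 'rV[R]_n =>
    ind (0 < z.1) * ind (z.1 <= 1) * z.1 `^ (s - 1) * ((ind (0 < z.1) * z.1^-1) ^+ n) *
      (ind ((ind (0 < z.1) * z.1^-1) * `|z.2| < c) * g (x - z.2))).
  apply/funext => -[t y]; rewrite /F /ind /=; case: ltP => h; last by rewrite !mul0r.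
  by rewrite !mul1r.
have mF : measurable_fun setT (fun z : R * 'rV[R]_n => F z.1 z.2).
  rewrite FE.
  have m1 : measurable_fun setT (fun z : R * 'rV[R]_n => ind (0 < z.1) * z.1^-1).
    exact: (measurableT_comp minv measurable_fst).
  by mfun.
have step t : (\int[mu]_z (ind (0 < t)%R * ind (t <= 1)%R * t `^ (s - 1) * (ind (`|z| < c)%R * g (x - t *: z)%R))%:E =
    \int[mu]_y (F t y)%:E)%E.
  have [t0|t0] := ltP 0 t; last first.
    by apply: eq_integral => y _; rewrite /F (le_gtF t0) /ind !mul0r.
  pose h := fun y : 'rV[R]_n => (ind (0 < t) * ind (t <= 1) * t `^ (s - 1) * (ind (t^-1 * `|y| < c) * g (x - y)))%:E.
  have mh : measurable_fun setT h by rewrite /h; mfun.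
  have h0 y : (0 <= h y)%E by rewrite lee_fin !mulr_ge0 ?ind_ge0 ?powR_ge0.
  have := @ge0_integral_rV_comb R n 0 t h (lt0r_neq0 t0) mh h0.
  rewrite -/mu => e; transitivity (\int[mu]_z h (0 + t *: z)%R)%E.
    apply: eq_integral => z _; by rewrite /h t0 add0r normrZ gtr0_norm // mulKf // lt0r_neq0.
  rewrite e gtr0_norm // -ge0_integralZl_EFin //; last by rewrite exprn_ge0 // invr_ge0 ltW.
  by apply: eq_integral => y _; rewrite /h /F -EFinM; congr EFin; ring.
under eq_integral do rewrite step.
rewrite (tonelli lebesgue_measure mu) //; first last.
  exact/measurable_EFinP.
apply: ae_ge0_le_integral => //.
- by move=> y _; apply: integral_ge0 => t _; rewrite lee_fin.
- apply: (@measurable_integral_section _ _ _ _ _ lebesgue_measure (fun y t => (F t y)%:E)).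
    apply/measurable_EFinP; exact: (measurableT_comp mF (measurable_fun_pair measurable_snd measurable_fst)).
  by move=> y t; rewrite lee_fin.
- move=> y _; rewrite lee_fin !mulr_ge0 ?powR_ge0 ?invr_ge0 //; exact: ltW.
- by mfun.
apply: filterS (@ae_neq0 R n n0) => y y0 _.
have yp : 0 < `|y| by rewrite normr_gt0.
have b0 : 0 < `|y| / c by rewrite divr_gt0.
have := integral_power_tail b0 d0.
set J := (\int[_]_t _)%E => eJ.
have -> : (c `^ (n%:R - s') / (n%:R - s') * (`|y| `^ (- (n%:R - s')) * g (x - y)%R))%:E = (J * (g (x - y)%R)%:E)%E.
  rewrite eJ -EFinM powRM ?invr_ge0 ?(ltW c0) // powRV // opprK; congr EFin; ring.
rewrite /J -ge0_integralZr //; last first.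
- by rewrite lee_fin.
- by move=> t _; rewrite lee_fin mulr_ge0 ?ind_ge0 ?powR_ge0.
- by mfun.
apply: ge0_le_integral => //.
- by move=> t _; rewrite lee_fin.
- apply/measurable_EFinP; exact: (measurableT_comp mF (measurable_pair2 y)).
- by mfun.
move=> t _; rewrite -EFinM lee_fin /F /ind; case: (ltP 0 t) => t0; last by rewrite !mul0r !mulr_ge0 ?powR_ge0 //; case: ifP.
case: (leP t 1) => t1; last by rewrite mulr0 !mul0r !mulr_ge0 ?powR_ge0 //; case: ifP.
case: (ltP (t^-1 * `|y|) c) => h; last by rewrite mul0r mulr0 !mulr_ge0 ?powR_ge0 //; case: ifP.
rewrite ifT; last by rewrite ler_pdivrMr // -ler_pdivrMl // ltW.
rewrite !mul1r ler_wpM2r //.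
have -> : t `^ (s - 1) * t^-1 ^+ n = t `^ (s - 1 - n%:R).
  by rewrite [RHS]powRD ?(lt0r_neq0 t0) ?implybT // (powRN t n%:R) powR_mulrn ?exprVn // ltW.
(* As [t <= 1], the exponent [s] may be lowered to [s']; the tail over [t >= |y| / c] then has
   exponent [n - s']. *)
have -> : - (n%:R - s') - 1 = s' - 1 - n%:R by ring.
by apply: ger_powR; [rewrite t0 | lra].
Qed.

End dilations.

Lemma continuous_sumR (R : realType) (T : topologicalType) (I : Type) (r : seq I) (F : I -> T -> R) :
  (forall i, continuous (F i)) -> continuous (fun x => \sum_(i <- r) F i x).
Proof.
move=> cF; elim: r => [|i r IH].
  by rewrite (_ : (fun x => _) = cst 0); [exact: cst_continuous | apply/funext => x; rewrite big_nil].
rewrite (_ : (fun x => _) = (fun x => F i x + \sum_(j <- r) F j x)).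
  by move=> x; apply: cvgD; [exact: cF | exact: IH].
by apply/funext => x; rewrite big_cons.
Qed.

Lemma ge0_scaled_integralD_le (R : realType) d (T : measurableType d) (mu : {measure set T -> \bar R})
    (u1 u2 v : T -> R) c : 0 <= c ->
  measurable_fun setT u1 -> measurable_fun setT u2 -> measurable_fun setT v ->
  (forall y, 0 <= u1 y) -> (forall y, 0 <= u2 y) -> (forall y, 0 <= v y) ->
  {ae mu, forall y, c * (u1 y + u2 y) <= v y} ->
  (c%:E * (\int[mu]_y (u1 y)%:E + \int[mu]_y (u2 y)%:E) <= \int[mu]_y (v y)%:E)%E.
Proof.
move=> c0 m1 m2 mv p1 p2 pv h.
have M1 : measurable_fun setT (fun y => (u1 y)%:E) by exact/measurable_EFinP.
have M2 : measurable_fun setT (fun y => (u2 y)%:E) by exact/measurable_EFinP.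
have Mv : measurable_fun setT (fun y => (v y)%:E) by exact/measurable_EFinP.
have q1 y : setT y -> (0 <= (u1 y)%:E)%E by rewrite lee_fin.
have q2 y : setT y -> (0 <= (u2 y)%:E)%E by rewrite lee_fin.
rewrite -(ge0_integralD mu measurableT q1 M1 q2 M2).
have q3 y : setT y -> (0 <= (u1 y)%:E + (u2 y)%:E)%E by move=> _; rewrite -EFinD lee_fin addr_ge0.
have M3 : measurable_fun setT (fun y => (u1 y)%:E + (u2 y)%:E)%E by exact: emeasurable_funD.
rewrite -(ge0_integralZl_EFin mu measurableT q3 M3 c0).
apply: ae_ge0_le_integral => //.
- by move=> y _; rewrite -EFinD -EFinM lee_fin mulr_ge0 // addr_ge0.
- exact: emeasurable_funM.
- by move=> y _; rewrite lee_fin.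
- by apply: filterS h => y h _; rewrite -EFinD -EFinM lee_fin.
Qed.

(** * Pointwise control of a function by its fractional gradient *)

Section sobolev_representation.
Context {R : realType} (n : nat) (s : R).
Hypotheses (n0 : (0 < n)%N) (s0 : 0 < s) (s1 : s < 1).
Let mu := borel_lebesgue R n.
Let kap := n%:R + s - 1.
Let kap_gt0 : 0 < kap.
Proof. by rewrite /kap addrAC ltr_wpDl // subr_ge0 ler1n. Qed.
Definition unit_ind (t : R) : R := ind (0 < t) * ind (t <= 1).

Lemma unit_ind_ge0 t : 0 <= unit_ind t.
Proof. by rewrite mulr_ge0 ?ind_ge0. Qed.

Lemma integral_unit_derivative (F f : R -> R) : (forall t, is_derive t (1 : R) F (f t)) -> continuous f ->
  \int[lebesgue_measure]_t (unit_ind t * f t) = F 1 - F 0.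
Proof.
move=> dF cf; have dbl t : derivable F t 1 by have d := dF t; exact: ex_derive.
have cF : continuous F.
  by move=> t; apply: differentiable_continuous; apply/derivable1_diffP.
have mf : measurable_fun setT f by exact: continuous_measurable_fun.
have e : (\int[lebesgue_measure]_(t in `[0%R, 1%R]) (f t)%:E = (F 1)%:E - (F 0)%:E)%E.
  apply: continuous_FTC2 => //.
  - exact: continuous_subspaceT.
  - split; first by move=> t _; exact: dbl.
    + exact: (cvg_at_right_filter (cF 0)).
    + exact: (cvg_at_left_filter (cF 1)).
  - by move=> t _; rewrite derive1E; have d := dF t; exact: derive_val.
rewrite -[RHS]/(fine ((F 1)%:E - (F 0)%:E)%E) -e integral_mkcond /Rintegral; congr fine.
apply: ae_eq_integral => //.
- by rewrite /unit_ind; mfun.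
- by apply/(measurable_restrictT (EFin \o f)) => //; apply/measurable_EFinP; exact: measurable_funTS.
(* The indicators of []0, 1]] and of [[0, 1]] differ only at 0. *)
exists [set 0]; split => //; first exact: lebesgue_measure_set1.
move=> t /= h; apply: contrapT => t0; apply: h => _ /=.
rewrite patchE mem_setE in_itv /= /unit_ind /ind lt_def (introF eqP t0) /=.
by case: (0 <= t); case: (t <= 1); rewrite /= ?mulr0 ?mul0r ?mulr1 ?mul1r.
Qed.

Lemma dotr_edir j (z : 'rV[R]_n) : dotr (edir j) z = z 0 j.
Proof.
rewrite /dotr (bigD1 j) //= big1 ?addr0 => [|k kj]; first by rewrite mxE !eqxx mul1r.
by rewrite mxE eqxx /= (negbTE kj) mul0r.
Qed.

Lemma riesz_field_integral e : mu.-integrable setT (EFin \o riesz_field s e).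
Proof.
have [C1 C10 h1] := riesz_field_near n0 s0 s1; have [C2 C20 h2] := riesz_field_far n0 s0 s1.
apply: (@integrable_le _ _ _ mu _ (fun y : 'rV[R]_n => (C1 + C2) * fnorm e * decay s y)).
- exact: measurable_riesz_field.
- exact: (integrableZl measurableT ((C1 + C2) * fnorm e) (decay_integrable n s0)).
move=> y; have [yh|yh] := leP (fnorm y) 2^-1.
  have y1 : `|y| < 1 by apply: (le_lt_trans (norm_le_fnorm y)); lra.
  rewrite (_ : decay s y = 1); last by rewrite /decay /ind y1 leNgt y1 /= mul0r addr0.
  apply: (le_trans (h1 e y yh)); rewrite ler_pM ?mulr_ge0 ?fnorm_ge0 //; last lra.
  by rewrite ler_wpM2r ?fnorm_ge0 // lerDl.
apply: (le_trans (h2 e y (ltW yh))).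
by rewrite ler_wpM2r ?decay_ge0 // ler_wpM2r ?fnorm_ge0 // lerDr.
Qed.

Section representation.
Variables (f : 'rV[R]_n -> R) (df : 'I_n -> 'rV[R]_n -> R) (M rho : R).
Hypothesis hf : C1c f df M rho.
Let G j := Dop (rkern s 0 j) f.
Let hl := C1c_lipc hf.
Let mf : measurable_fun setT f := lipc_measurable hl.
Let mdf j : measurable_fun setT (df j).
Proof. by case: hf => _ cdf _ _ _; exact: continuous_rV_measurable. Qed.
Let mG j : measurable_fun setT (G j) := measurable_Dop (measurable_rkern s 0 j) mf.
Let df_le j x : `|df j x| <= M. Proof. by case: hf => _ _ _ _ hM; have [_] := hM x; exact. Qed.
Let M0 : 0 <= M. Proof. exact: le_trans (df_le (Ordinal n0) 0). Qed.

Let G_le : exists2 C, 0 <= C & forall j x, `|G j x| <= C.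
Proof.
have h j : exists C, forall x, `|G j x| <= C.
  have [C hC] := Dop_decay n0 s0 s1 (rkern_odd_kernel s0 0 j) hl.
  exists `|C| => x; apply: (le_trans (hC x)); apply: (le_trans (ler_wpM2r (decay_ge0 s x) (ler_norm C))).
  by rewrite ler_piMr // decay_le1 // ltW.
have [C hC] := choice h; exists (\sum_j C j).
  by apply: sumr_ge0 => j _; exact: le_trans (hC j 0).
move=> j x; apply: (le_trans (hC j x)); rewrite (bigD1 j) //= lerDl.
by apply: sumr_ge0 => k _; exact: le_trans (hC k 0).
Qed.

(** For [|y| >= r + |z|] the argument of [df j] has left the support; elsewhere [pot] is below the
    truncated kernel [head]. *)
Let df_pot_le j x t (y z : 'rV[R]_n) r : 0 < t -> rho + `|x| <= t * r ->
  `|df j (x - t *: (y + z)) * pot s 0 y| <= M * head s (r + `|z|) y.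
Proof.
move=> t0 hr; have [_ _ _ hz _] := hf; have [hy|hy] := ltP `|y| (r + `|z|).
  rewrite /head /ind hy mul1r normrM (ger0_norm (pot_ge0 _ _ _)).
  by rewrite ler_pM ?pot_ge0 // pot0_le.
rewrite (hz _ _).2 ?mul0r ?normr0; first by rewrite mulr_ge0 // head_ge0.
have h1 : rho + `|x| <= t * `|y + z|.
  apply: (le_trans hr); rewrite ler_pM2l //.
  by have := ler_normB (y + z) z; rewrite addrK => h; lra.
have := ler_normB x (x - t *: (y + z)); rewrite opprB addrC subrK normrZ (gtr0_norm t0) => h.
by have := le_trans h1 h; rewrite addrC lerD2l.
Qed.

Let measurable_scaled_arg (x : 'rV[R]_n) (t : R) : measurable_fun setT (fun y : 'rV[R]_n => x - t *: y).
Proof. by apply: measurable_subrV => //; apply: measurable_scalerV. Qed.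

Let coord_annulus_le j (z : 'rV[R]_n) : `|z 0 j * annulus z| <= 2 * n%:R * fnorm (edir j : 'rV[R]_n) * ind (`|z| < 2 * n%:R).
Proof. by have := annulus_dotr_le n0 (edir j) z; rewrite dotr_edir. Qed.

Let n2_gt0 : 0 < 2 * n%:R :> R. Proof. by rewrite mulr_gt0 // ltr0n. Qed.

Let iball : mu.-integrable setT (EFin \o (fun z : 'rV[R]_n => ind (`|z| < 2 * n%:R))).
Proof.
by apply: ge0_fin_integrable; [mfun | move=> z; exact: ind_ge0 | rewrite integral_norm_ball ?ltry].
Qed.

Let measurable_coord_annulus j : measurable_fun setT (fun z : 'rV[R]_n => z 0 j * annulus z).
Proof. by have mann := @measurable_annulus R n; mfun. Qed.

Let coord_annulus_integrable j : mu.-integrable setT (EFin \o (fun z : 'rV[R]_n => `|z 0 j * annulus z|)).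
Proof.
apply: (@integrable_le _ _ _ mu _ (fun z : 'rV[R]_n => 2 * n%:R * fnorm (edir j : 'rV[R]_n) * ind (`|z| < 2 * n%:R))).
- exact: (measurableT_comp (@normr_measurable _ setT)).
- exact: (integrableZl measurableT (2 * n%:R * fnorm (edir j : 'rV[R]_n)) iball).
- by move=> z; rewrite normr_id.
Qed.

Let annulus_gradient_integrable j x t :
  mu.-integrable setT (EFin \o (fun z : 'rV[R]_n => z 0 j * annulus z * G j (x - t *: z))).
Proof.
have [C C0 hC] := G_le.
apply: (@integrable_le _ _ _ mu _ (fun z : 'rV[R]_n => C * `|z 0 j * annulus z|)).
- apply: (measurable_funM (measurable_coord_annulus j)).
  exact: (measurableT_comp (mG j) (measurable_scaled_arg x t)).
- exact: (integrableZl measurableT C (coord_annulus_integrable j)).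
- by move=> z; rewrite normrM mulrC ler_wpM2r.
Qed.

Let field_product_integrable j x t :
  mu.-integrable setT (EFin \o (fun y : 'rV[R]_n => df j (x - t *: y) * riesz_field s (edir j) y)).
Proof.
apply: (@integrable_le _ _ _ mu _ (fun y : 'rV[R]_n => M * `|riesz_field s (edir j) y|)).
- apply: measurable_funM; last exact: measurable_riesz_field.
  by have mx := measurable_scaled_arg x t; exact: (measurableT_comp (mdf j) mx).
- have h : mu.-integrable setT (EFin \o (fun y => `|riesz_field s (edir j : 'rV[R]_n) y|)).
    have := integrable_abse (riesz_field_integral (edir j)).
    by apply: eq_integrable => // y _ /=.
  exact: (integrableZl measurableT M h).
- by move=> y; rewrite normrM ler_wpM2r.
Qed.

(** After Fubini the integral in [y] is a Riesz potential of [df j], so [riesz_gradient] applies.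
    The potential is homogeneous of degree [- kap] and the dilation has Jacobian [t ^ - n]; together
    they give [t ^ (kap - n) = t ^ (s - 1)], the weight from which [dilation_average] makes the
    kernel. *)
Let field_gradient j x t : 0 < t ->
  \int[mu]_y (df j (x - t *: y) * riesz_field s (edir j) y) =
  kap * t `^ (s - 1) * \int[mu]_z (z 0 j * annulus z * G j (x - t *: z)).
Proof.
move=> t0; have [r0 _ _ _ _] := hf; have mpot := @measurable_pot R n s 0.
have mann := @measurable_annulus R n; have mx := measurable_scaled_arg x t.
(* For [|y| >= r] the point [x - t *: y] lies outside the support of [f]. *)
set r := (rho + `|x|) / t.
have r_gt0 : 0 < r by rewrite divr_gt0 // ltr_wpDr.
have tr : rho + `|x| <= t * r by rewrite /r mulrC divfK // lt0r_neq0.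
have rn : 0 < r + 2 * n%:R by rewrite addr_gt0.
pose a (z : 'rV[R]_n) : R := `|z 0 j * annulus z|.
have a_le z : 0 <= a z <= 2 * n%:R * fnorm (edir j : 'rV[R]_n).
  rewrite normr_ge0; apply: (le_trans (coord_annulus_le j z)).
  by rewrite ler_piMr ?ind_le1 // mulr_ge0 ?fnorm_ge0 // ltW.
have ia := coord_annulus_integrable j.
have ih : mu.-integrable setT (EFin \o (fun w => M * head s (r + 2 * n%:R) w)).
  exact: (integrableZl measurableT M (head_integrable n0 s0 s1 rn)).
pose F (z y : 'rV[R]_n) := df j (x - t *: y) * (pot s 0 (y - z) * (z 0 j * annulus z)).
have mF : measurable_fun setT (fun p : 'rV[R]_n * 'rV[R]_n => F p.1 p.2).
  have m1 : measurable_fun setT (fun p : 'rV[R]_n * 'rV[R]_n => df j (x - t *: p.2)).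
    exact: (measurableT_comp (mdf j) (measurableT_comp mx measurable_snd)).
  by rewrite /F; mfun.
have Fle z y : `|F z y| <= a z * (M * head s (r + 2 * n%:R) (y - z)).
  rewrite /F mulrA normrM mulrC; have [az|[az _ z2]] := annulusP n0 z.
    by rewrite /a az !mulr0 normr0 !mul0r.
  rewrite ler_wpM2l // -{1}(subrK z y); apply: (le_trans (df_pot_le _ _ _ t0 tr)).
  have zn : `|z| <= 2 * n%:R by rewrite (le_trans (norm_le_fnorm z)) // ltW.
  rewrite ler_wpM2l // /head ler_wpM2r ?powR_ge0 // /ind; case: ltP => h; last by case: ifP.
  by rewrite ifT // (lt_le_trans h) // lerD2l.
transitivity (\int[mu]_y \int[mu]_z F z y).
  apply: eq_Rintegral => y _; rewrite /riesz_field -RintegralZl //; last exact: riesz_field_integrable.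
  by apply: eq_Rintegral => z _; rewrite dotr_edir.
have head0 (w : 'rV[R]_n) : 0 <= M * head s (r + 2 * n%:R) w by rewrite mulr_ge0 ?head_ge0.
rewrite -(Rfubini_convolution mF ia ih a_le head0 Fle) -/mu.
have iz := annulus_gradient_integrable j x t.
rewrite -(RintegralZl _ measurableT iz); apply: eq_Rintegral => z _.
pose h (v : 'rV[R]_n) := df j (x - t *: z - v) * pot s 0 v.
have mh : measurable_fun setT h.
  apply: measurable_funM => //; apply: (measurableT_comp (mdf j)).
  exact: (measurable_subrV (measurable_cst _) (@measurable_id _ _ setT)).
have hi : mu.-integrable setT (EFin \o h).
  have rz : 0 < rho + `|x - t *: z| by rewrite ltr_wpDr.
  apply: (@integrable_le _ _ _ mu _ (fun v : 'rV[R]_n => M * head s (rho + `|x - t *: z| + `|0 : 'rV[R]_n|) v)) => //.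
    rewrite normr0 addr0; exact: (integrableZl measurableT M (head_integrable n0 s0 s1 rz)).
  move=> v; rewrite /h.
  have := @df_pot_le j (x - t *: z) 1 v 0 (rho + `|x - t *: z|) ltr01.
  by rewrite addr0 scale1r mul1r; apply.
pose hw (w : 'rV[R]_n) := df j (x - t *: (w + z)) * pot s 0 w.
have mw : measurable_fun setT hw.
  have m1 : measurable_fun setT (fun w : 'rV[R]_n => df j (x - t *: (w + z))).
    by apply: (measurableT_comp (mdf j)); apply: (measurableT_comp mx); mfun.
  by rewrite /hw; mfun.
have iw : mu.-integrable setT (EFin \o hw).
  have rz : 0 < r + `|z| by rewrite ltr_wpDr.
  apply: (@integrable_le _ _ _ mu _ (fun w : 'rV[R]_n => M * head s (r + `|z|) w)) => //.
    exact: (integrableZl measurableT M (head_integrable n0 s0 s1 rz)).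
  by move=> w; exact: df_pot_le.
(* Homogeneity of the potential kernel under [w -> t w]. *)
have hwE w : hw w = t `^ kap * h (t *: w).
  rewrite /hw /h !(pot0E s) fnormZ (gtr0_norm t0) powRM ?fnorm_ge0 ?(ltW t0) //.
  rewrite scalerDr opprD addrCA addrC -/kap (powRN t kap) -addrA.
  by field; rewrite gt_eqF // powR_gt0.
have -> : \int[mu]_y F z y = (z 0 j * annulus z) * \int[mu]_w hw w.
  rewrite -(RintegralZl _ measurableT iw).
  rewrite -(@Rintegral_subr R n (fun w => z 0 j * annulus z * hw w) z); last by mfun.
  by apply: eq_Rintegral => y _; rewrite /F /hw subrK; ring.
have -> : \int[mu]_w hw w = t^-1 ^+ n * (t `^ kap * (kap * G j (x - t *: z))).
  rewrite -(riesz_gradient n0 s0 s1 j (x - t *: z) hf) -/mu -(RintegralZl _ measurableT hi).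
  rewrite -Rintegral_scale //; last exact: (integrableZl measurableT (t `^ kap) hi).
  by apply: eq_Rintegral => w _; rewrite hwE.
have -> : t `^ (s - 1) = t^-1 ^+ n * t `^ kap.
  have -> : s - 1 = - n%:R + kap by rewrite /kap; ring.
  by rewrite powRD ?(lt0r_neq0 t0) ?implybT // powRN powR_mulrn ?exprVn // ltW.
ring.
Qed.

Let mf_arg : measurable_fun setT (fun p : 'rV[R]_n * R => p.2 *: p.1).
Proof. exact: measurable_scalerV. Qed.

Let measurable_segment_integrand x : measurable_fun setT (fun p : 'rV[R]_n * R =>
  unit_ind p.2 * \sum_j (df j (x - p.2 *: p.1) * riesz_field s (edir j) p.1)).
Proof.
apply: measurable_funM; first by rewrite /unit_ind; mfun.
apply: measurable_sum => j; apply: measurable_funM.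
  by apply: (measurableT_comp (mdf j)); mfun.
exact: (measurableT_comp (measurable_riesz_field s (edir j)) measurable_fst).
Qed.

(* [f x - f (x - y)] is integrated along the segment, weighted by the bump. *)
Let segment_representation x :
  f x * (\int[mu]_y bump s y) - \int[mu]_y (bump s y * f (x - y)) =
  \int[lebesgue_measure]_t (unit_ind t * \int[mu]_y \sum_j (df j (x - t *: y) * riesz_field s (edir j) y)).
Proof.
have [_ cdf hd _ hM] := hf.
have f_le z : `|f z| <= M by have [] := hM z.
have ib := bump_integrable n0 s0 s1.
have [/measurable_EFinP mb _] := integrableP _ _ _ ib.
have iB1 : mu.-integrable setT (EFin \o (fun y => f x * bump s y)).
  exact: (integrableZl measurableT (f x) ib).
have mfx : measurable_fun setT (fun y : 'rV[R]_n => f (x - y)) by mfun.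
have iB2 : mu.-integrable setT (EFin \o (fun y => bump s y * f (x - y))).
  apply: (@integrable_le _ _ _ mu _ (fun y : 'rV[R]_n => M * bump s y)).
  - by mfun.
  - exact: (integrableZl measurableT M ib).
  - by move=> y; rewrite normrM mulrC (ger0_norm (bump_ge0 n0 s0 s1 y)) ler_wpM2r // bump_ge0.
rewrite -(RintegralZl _ measurableT ib) -(RintegralB measurableT iB1 iB2).
pose F (y : 'rV[R]_n) (t : R) := unit_ind t * \sum_j (df j (x - t *: y) * riesz_field s (edir j) y).
have mF : measurable_fun setT (fun p : 'rV[R]_n * R => F p.1 p.2) := measurable_segment_integrand x.
have iS : mu.-integrable setT (EFin \o (fun y => M * \sum_j `|riesz_field s (edir j) y|)).
  have h j : mu.-integrable setT (EFin \o (fun y => `|riesz_field s (edir j : 'rV[R]_n) y|)).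
    have := integrable_abse (riesz_field_integral (edir j)).
    by apply: eq_integrable => // y _ /=.
  exact: (integrableZl measurableT M (Rintegral_sum (index_enum 'I_n) h).1).
have iU : lebesgue_measure.-integrable setT (EFin \o unit_ind).
  apply: ge0_fin_integrable; [by rewrite /unit_ind; mfun | exact: unit_ind_ge0 |].
  apply: (@le_lt_trans _ _ (\int[lebesgue_measure]_t (\1_`[0%R, 1%R] t)%:E)%E).
    apply: ge0_le_integral => //.
    - by move=> t _; rewrite lee_fin unit_ind_ge0.
    - by rewrite /unit_ind; mfun.
    - exact/measurable_EFinP.
    move=> t _; rewrite lee_fin /unit_ind /ind indicE mem_setE in_itv /=.
    by case: (ltP 0 t) => h; case: (leP t 1) => h'; rewrite ?(ltW h) ?mulr0 ?mul0r ?mulr1 ?ler0n.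
  have e01 : lebesgue_measure (`[0%R, 1%R]%classic : set R) = 1%E.
    by rewrite lebesgue_measure_itv /= lte_fin ltr01 oppr0 adde0.
  by rewrite integral_indic // setIT [X in (X < _)%E]e01 ltry.
transitivity (\int[mu]_y \int[lebesgue_measure]_t F y t).
  apply: eq_Rintegral => y _.
  have dl (t : R) := C1c_is_derive_line x (- y) t hf.
  have cl : continuous (fun t : R => \sum_k (- y) 0 k * df k (x + t *: (- y))).
    apply: continuous_sumR => k t; apply: cvgMr.
    apply: (@continuous_comp _ _ _ (fun t : R => x + t *: - y) (df k)); last exact: cdf.
    by apply: cvgD; [exact: cvg_cst | apply: cvgZr_tmp; exact: cvg_id].
  have := integral_unit_derivative dl cl.
  rewrite scale1r scale0r addr0 => e.
  (* Along the segment the derivative of [f] is paired with [bump s y] times [y], whose [j]-th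
     component is [riesz_field s (edir j) y]. *)
  have -> : f x * bump s y - bump s y * f (x - y) = - bump s y * (f (x - y) - f x) by ring.
  rewrite -e -RintegralZl //.
    apply: eq_Rintegral => t _; rewrite /F [LHS]mulrCA; congr (_ * _); rewrite mulr_sumr.
    apply: eq_bigr => j _; rewrite riesz_field_radial // dotr_edir scalerN mxE; ring.
  apply: (@integrable_le _ _ _ lebesgue_measure _ (fun t : R => (n%:R * M * `|y|) * unit_ind t)).
  - apply: measurable_funM; first by rewrite /unit_ind; mfun.
    exact: continuous_measurable_fun.
  - exact: (integrableZl measurableT (n%:R * M * `|y|) iU).
  - move=> t; rewrite normrM (ger0_norm (unit_ind_ge0 t)) mulrC ler_wpM2r ?unit_ind_ge0 //.
    apply: (le_trans (ler_norm_sum _ _ _)).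
    apply: (@le_trans _ _ (\sum_(k < n) M * `|y|)); last by rewrite sumr_const card_ord -mulrA mulr_natl.
    by apply: ler_sum => k _; rewrite normrM mulrC ler_pM // mxE normrN rV_coord_le.
rewrite (@Rfubini R _ _ _ _ mu lebesgue_measure F _ _ mF iS iU).
  apply: eq_Rintegral => t _; rewrite /F RintegralZl //.
  by apply: (Rintegral_sum _ _).1 => j; exact: field_product_integrable.
move=> y t; rewrite /F normrM (ger0_norm (unit_ind_ge0 t)) mulrC ler_wpM2r ?unit_ind_ge0 //.
apply: (le_trans (ler_norm_sum _ _ _)); rewrite mulr_sumr; apply: ler_sum => j _.
by rewrite normrM ler_wpM2r.
Qed.

Let fnorm_edir j : fnorm (edir j : 'rV[R]_n) = 1.
Proof.
apply/eqP; rewrite -(@eqrXn2 _ 2) ?fnorm_ge0 //.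
by rewrite -dotrr dotr_edir mxE !eqxx expr1n.
Qed.

Let mGsum : measurable_fun setT (fun y => \sum_j `|G j y|).
Proof. by apply: measurable_sum => j; apply: (measurableT_comp (@normr_measurable _ setT)). Qed.

(** The classical derivatives of [f] disappear here: only the singular integrals [G j], sampled on
    the dilated annulus, remain. *)
Let dilation_le x t : ((`|unit_ind t * \int[mu]_y \sum_j (df j (x - t *: y) * riesz_field s (edir j) y)|)%:E <=
  \int[mu]_z (ind (0 < t)%R * ind (t <= 1)%R * t `^ (s - 1) *
    (ind (`|z| < 2 * n%:R)%R * (kap * (2 * n%:R) * \sum_j `|G j (x - t *: z)|)%R))%:E)%E.
Proof.
have [t0|t0] := leP t 0.
  by rewrite /unit_ind (le_gtF t0) /ind !mul0r normr0; apply: integral_ge0 => z _; rewrite lee_fin !mul0r.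
rewrite (Rintegral_sum (index_enum 'I_n) (fun j => field_product_integrable j x t)).2.
under eq_bigr => j _ do rewrite (field_gradient j x t0).
rewrite -mulr_sumr -(Rintegral_sum (index_enum 'I_n) (fun j => annulus_gradient_integrable j x t)).2.
have mx := measurable_scaled_arg x t.
have mS : measurable_fun setT (fun z : 'rV[R]_n => \sum_j (z 0 j * annulus z * G j (x - t *: z))).
  by apply: measurable_sum => j; apply: (measurable_funM (measurable_coord_annulus j));
    exact: (measurableT_comp (mG j) mx).
have c0 : 0 <= unit_ind t * (kap * t `^ (s - 1)).
  apply: mulr_ge0; [exact: unit_ind_ge0 | apply: mulr_ge0; [exact: ltW | exact: powR_ge0]].
rewrite [X in `|X|]mulrA normrM (ger0_norm c0) EFinM.
apply: (le_trans (lee_wpmul2l _ (norm_Rintegral_le mu mS))); first by rewrite lee_fin.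
have mSn : measurable_fun setT (fun z : 'rV[R]_n => `|\sum_j (z 0 j * annulus z * G j (x - t *: z))|).
  exact: (measurableT_comp (@normr_measurable _ setT)).
rewrite -ge0_integralZl_EFin //; last exact/measurable_EFinP.
have mGx : measurable_fun setT (fun z : 'rV[R]_n => \sum_j `|G j (x - t *: z)|).
  exact: (measurableT_comp mGsum mx).
apply: ge0_le_integral => //.
- by move=> z _; rewrite -EFinM lee_fin mulr_ge0.
- by mfun.
- by mfun.
move=> z _; rewrite -EFinM lee_fin.
apply: (@le_trans _ _ (unit_ind t * (kap * t `^ (s - 1)) * (2 * n%:R * ind (`|z| < 2 * n%:R) * \sum_j `|G j (x - t *: z)|))).
  rewrite ler_wpM2l // mulr_sumr; apply: (le_trans (ler_norm_sum _ _ _)); apply: ler_sum => j _.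
  by rewrite normrM ler_wpM2r // (le_trans (coord_annulus_le j z)) // fnorm_edir mulr1.
by rewrite le_eqVlt; apply/orP; left; apply/eqP; rewrite /unit_ind t0; ring.
Qed.

Let sobolev_bump x : ((`|f x| * \int[mu]_y bump s y)%:E <=
  \int[mu]_y (bump s y * `|f (x - y)%R|)%:E +
  \int[lebesgue_measure]_t \int[mu]_z (ind (0 < t)%R * ind (t <= 1)%R * t `^ (s - 1) *
    (ind (`|z| < 2 * n%:R)%R * (kap * (2 * n%:R) * \sum_j `|G j (x - t *: z)|)%R))%:E)%E.
Proof.
have b0 (y : 'rV[R]_n) : 0 <= bump s y by exact: bump_ge0.
have mb : measurable_fun setT (bump s : 'rV[R]_n -> R) by exact: measurable_bump.
rewrite -{1}(ger0_norm (ltW (integral_bump_gt0 n0 s0 s1))) -normrM.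
have -> : f x * (\int[mu]_y bump s y) = \int[mu]_y (bump s y * f (x - y)) +
    \int[lebesgue_measure]_t (unit_ind t * \int[mu]_y \sum_j (df j (x - t *: y) * riesz_field s (edir j) y)).
  by rewrite -segment_representation addrC subrK.
apply: (@le_trans _ _ (`|\int[mu]_y (bump s y * f (x - y))|%:E +
    `|\int[lebesgue_measure]_t (unit_ind t * \int[mu]_y \sum_j (df j (x - t *: y) * riesz_field s (edir j) y))|%:E)%E).
  by rewrite -EFinD lee_fin ler_normD.
apply: leeD.
  apply: (le_trans (norm_Rintegral_le mu _)); first by mfun.
  rewrite le_eqVlt; apply/orP; left; apply/eqP; apply: eq_integral => y _.
  by rewrite normrM ger0_norm.
have mT : measurable_fun setT (fun t : R =>
    unit_ind t * \int[mu]_y \sum_j (df j (x - t *: y) * riesz_field s (edir j) y)).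
  have mF : measurable_fun setT (fun p : R * 'rV[R]_n => \sum_j (df j (x - p.1 *: p.2) * riesz_field s (edir j) p.2)).
    apply: measurable_sum => j; apply: measurable_funM.
      apply: (measurableT_comp (mdf j)); apply: measurable_subrV => //.
      exact: measurable_scalerV.
    exact: (measurableT_comp (measurable_riesz_field s (edir j)) measurable_snd).
  apply: measurable_funM; first by rewrite /unit_ind; mfun.
  exact: (@measurable_Rintegral_section _ _ _ _ _ mu
    (fun (t : R) y => \sum_j (df j (x - t *: y) * riesz_field s (edir j) y)) mF).
apply: (le_trans (norm_Rintegral_le lebesgue_measure mT)).
apply: ge0_le_integral => //.
- by apply/measurable_EFinP; apply: (measurableT_comp (@normr_measurable _ setT)).
- apply: (@measurable_integral_section _ _ _ _ _ mu (fun (t : R) z => (ind (0 < t)%R * ind (t <= 1)%R * t `^ (s - 1) *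
    (ind (`|z| < 2 * n%:R)%R * (kap * (2 * n%:R) * \sum_j `|G j (x - t *: z)|)%R))%:E)).
    have m1 : measurable_fun setT (fun p : R * 'rV[R]_n => \sum_j `|G j (x - p.1 *: p.2)|).
      apply: (measurableT_comp mGsum); apply: measurable_subrV => //.
      exact: measurable_scalerV.
    by mfun.
  move=> t z; rewrite lee_fin.
  by rewrite !mulr_ge0 ?powR_ge0 ?ind_ge0 ?(ltW kap_gt0) ?(ltW n2_gt0) // sumr_ge0.
Qed.

Lemma sobolev_kernel_bound s' x : s' <= s -> s' < n%:R ->
  ((`|f x| * \int[mu]_y bump s y)%:E <=
   \int[mu]_y (bump s y * `|f (x - y)%R|)%:E +
   \int[mu]_y ((2 * n%:R) `^ (n%:R - s') / (n%:R - s') *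
     (`|y| `^ (- (n%:R - s')) * (kap * (2 * n%:R) * \sum_j `|G j (x - y)|))%R)%:E)%E.
Proof.
move=> ss sn; apply: (le_trans (sobolev_bump x)); apply: leeD => //.
apply: (@dilation_average R n s s' (2 * n%:R) (fun z => kap * (2 * n%:R) * \sum_j `|G j z|) x) => //.
- by mfun.
- by move=> y; rewrite !mulr_ge0 ?sumr_ge0 ?(ltW kap_gt0) ?(ltW n2_gt0).
Qed.

End representation.

(** For [|y| < 1] the kernel exceeds 1; beyond, its exponent [n - s'] is smaller than [n + s]. *)
Lemma decay_le_power s' (y : 'rV[R]_n) : y != 0 -> s' <= s -> 0 <= s' -> s' < n%:R -> decay s y <= `|y| `^ (- (n%:R - s')).
Proof.
move=> y0 ss s'0 sn; have yp : 0 < `|y| by rewrite normr_gt0.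
rewrite /decay /ind; case: ltP => h.
  have p1 : 1 `^ (- (n%:R - s')) = 1 :> R by rewrite powR1.
  by rewrite mul0r addr0 -[leLHS]p1 powRN_anti ?subr_ge0 // ltW.
by rewrite mul1r add0r; apply: ler_powR => //; lra.
Qed.

(** Obtained by dividing by the integral of [bump]; the convolution of [f] with [bump] is harmless
    because [decay] lies below the kernel. The freedom in [s'] lets the embedding reach every
    exponent between [p] and the critical one. *)
Lemma sobolev_pointwise s' : 0 < s' -> s' <= s -> s' < n%:R ->
  exists2 C : R, 0 <= C & forall f df M rho x, C1c f df M rho ->
    ((`|f x|)%:E <= \int[mu]_y (`|y| `^ (- (n%:R - s')) *
       (C * (`|f (x - y)| + \sum_j `|Dop (rkern s 0 j) f (x - y)|)))%:E)%E.
Proof.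
move=> s'0 ss sn; have [B B0 hB] := bump_le n0 s0 s1.
have n2 : 0 < 2 * n%:R :> R by rewrite mulr_gt0 // ltr0n.
set I := \int[mu]_y bump s y; have I0 : 0 < I by exact: integral_bump_gt0.
have d0 : 0 < n%:R - s' by rewrite subr_gt0.
pose D1 := (2 * n%:R) `^ (n%:R - s') / (n%:R - s').
have D10 : 0 <= D1 by rewrite divr_ge0 ?powR_ge0 // ltW.
pose D2 := kap * (2 * n%:R).
have D20 : 0 <= D2 by rewrite mulr_ge0 // ltW.
have Iv0 : 0 <= I^-1 by rewrite invr_ge0 ltW.
have BD0 : 0 <= B + D1 * D2 by rewrite addr_ge0 // mulr_ge0.
exists ((B + D1 * D2) / I); first by rewrite mulr_ge0.
move=> f df M rho x hf.
have hl := C1c_lipc hf; have mf := lipc_measurable hl.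
have mG j : measurable_fun setT (Dop (rkern s 0 j) f) by apply: measurable_Dop => //; exact: measurable_rkern.
have mb : measurable_fun setT (bump s : 'rV[R]_n -> R) by exact: measurable_bump.
pose S (z : 'rV[R]_n) := \sum_j `|Dop (rkern s 0 j) f z|.
have mS : measurable_fun setT S.
  by apply: measurable_sum => j; apply: (measurableT_comp (@normr_measurable _ setT)).
have S0 y : 0 <= S y by exact: sumr_ge0.
have mfx : measurable_fun setT (fun y : 'rV[R]_n => f (x - y)) by mfun.
have mSx : measurable_fun setT (fun y : 'rV[R]_n => S (x - y)) by mfun.
pose K (y : 'rV[R]_n) := `|y| `^ (- (n%:R - s')).
have K0 y : 0 <= K y by exact: powR_ge0.
have mK : measurable_fun setT K by rewrite /K; mfun.
have b0 (y : 'rV[R]_n) : 0 <= bump s y by exact: bump_ge0.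
have -> : `|f x| = I^-1 * (`|f x| * I) by rewrite mulrCA mulVf ?mulr1 // gt_eqF.
rewrite EFinM; apply: (le_trans (lee_wpmul2l _ (sobolev_kernel_bound hf x ss sn))).
  by rewrite lee_fin.
have mnf : measurable_fun setT (fun y : 'rV[R]_n => `|f (x - y)|).
  exact: (measurableT_comp (@normr_measurable _ setT)).
apply: (@ge0_scaled_integralD_le _ _ _ mu (fun y => bump s y * `|f (x - y)|)
  (fun y => D1 * (K y * (D2 * S (x - y))))
  (fun y => K y * ((B + D1 * D2) / I * (`|f (x - y)| + S (x - y))))) => //.
- exact: measurable_funM.
- exact: (measurable_funM (measurable_cst D1) (measurable_funM mK (measurable_funM (measurable_cst D2) mSx))).
- exact: (measurable_funM mK (measurable_funM (measurable_cst _) (measurable_funD mnf mSx))).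
- by move=> y; exact: mulr_ge0.
- by move=> y; exact: (mulr_ge0 D10 (mulr_ge0 (K0 y) (mulr_ge0 D20 (S0 _)))).
- by move=> y; exact: (mulr_ge0 (K0 y) (mulr_ge0 (mulr_ge0 BD0 Iv0) (addr_ge0 (normr_ge0 _) (S0 _)))).
apply: filterS (@ae_neq0 R n n0) => y y0.
have -> : K y * ((B + D1 * D2) / I * (`|f (x - y)| + S (x - y))) =
  I^-1 * ((B * K y) * `|f (x - y)| + D1 * D2 * K y * `|f (x - y)| + B * K y * S (x - y)
    + D1 * D2 * K y * S (x - y)) by ring.
rewrite ler_wpM2l //; apply: lerD; last first.
  by rewrite le_eqVlt; apply/orP; left; apply/eqP; ring.
apply: ler_wpDr; first exact: (mulr_ge0 (mulr_ge0 B0 (K0 y)) (S0 _)).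
apply: ler_wpDr; first exact: (mulr_ge0 (mulr_ge0 (mulr_ge0 D10 D20) (K0 y)) (normr_ge0 _)).
rewrite ler_wpM2r //; apply: (le_trans (ler_norm _)); apply: (le_trans (hB y)).
by rewrite ler_wpM2l // decay_le_power // ltW.
Qed.

End sobolev_representation.

(** * The Sobolev embedding for test functions *)

Section sobolev_embedding.
Context {R : realType}.

Lemma powR_add_le (x y r : R) : 0 <= x -> 0 <= y -> 0 <= r -> (x + y) `^ r <= 2 `^ r * (x `^ r + y `^ r).
Proof.
move=> x0 y0 r0; wlog xy : x y x0 y0 / x <= y.
  move=> h; have [xy|/ltW yx] := leP x y; first exact: h.
  by rewrite addrC [X in _ * X]addrC; exact: h.
apply: (@le_trans _ _ ((2 * y) `^ r)).
  apply: ge0_ler_powR; rewrite ?nnegrE ?addr_ge0 ?mulr_ge0 //; lra.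
by rewrite powRM // ler_wpM2l ?powR_ge0 // lerDr powR_ge0.
Qed.

Lemma powR_sum_le (I : Type) (l : seq I) (r : R) : 0 < r -> exists2 K, 0 <= K &
  forall x : I -> R, (forall i, 0 <= x i) -> (\sum_(i <- l) x i) `^ r <= K * \sum_(i <- l) x i `^ r.
Proof.
move=> r0; elim: l => [|i l [K K0 IH]].
  by exists 1 => // x _; rewrite !big_nil mulr0 powR0 // gt_eqF.
exists (2 `^ r * (1 + K)); first by rewrite mulr_ge0 ?powR_ge0 ?addr_ge0.
move=> x x0; rewrite !big_cons.
have s0 : 0 <= \sum_(j <- l) x j by exact: sumr_ge0.
have t0 : 0 <= \sum_(j <- l) x j `^ r by apply: sumr_ge0 => j _; exact: powR_ge0.
apply: (le_trans (powR_add_le (x0 i) s0 (ltW r0))); rewrite -mulrA ler_wpM2l ?powR_ge0 //.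
apply: (le_trans (lerD (lexx _) (IH x x0))).
by have := powR_ge0 (x i) r; nra.
Qed.

(** Hardy-Littlewood-Sobolev dictates [s' = n (1 / p - 1 / q)]. When [s p < n], the inequality
    [s' <= s] says that [q] is at most critical; when [s p >= n], it follows from [s' < n / p <= s].
    For [q = p] the value [s' = 0] is not allowed, but there a hypothesis is the conclusion. *)
Lemma sobolev_embedding (n : nat) (s p q : R) A : (0 < n)%N -> 0 < s -> s < 1 -> 1 < p -> p <= q ->
  (s * p < n%:R -> q <= n%:R * p / (n%:R - s * p)) -> 0 <= A ->
  exists C : R, forall f df M rho, C1c f df M rho ->
    (\int[borel_lebesgue R n]_x (`|f x| `^ p)%:E <= A%:E)%E ->
    (forall j, \int[borel_lebesgue R n]_x (`|Dop (rkern s 0 j) f x| `^ p)%:E <= A%:E)%E ->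
    (\int[borel_lebesgue R n]_x (`|f x| `^ q)%:E <= C%:E)%E.
Proof.
move=> n0 s0 s1 p1 pq hq A0; have p0 : 0 < p by exact: lt_trans p1.
move: pq; rewrite le_eqVlt => /predU1P[<-|pq]; first by exists A.
have q0 : 0 < q by exact: lt_trans pq.
have nR : 0 < n%:R :> R by rewrite ltr0n.
set mu := borel_lebesgue R n.
pose s' := n%:R * (p^-1 - q^-1).
have qp : q^-1 < p^-1 by rewrite ltf_pV2 ?posrE.
have p1' : p^-1 < 1 by rewrite invf_lt1.
have qv : 0 < q^-1 by rewrite invr_gt0.
have s'0 : 0 < s' by rewrite mulr_gt0 // subr_gt0.
have s'n : s' < n%:R by rewrite -[ltRHS]mulr1 ltr_pM2l //; lra.
have ss : s' <= s.
  have [sp|sp] := ltP (s * p) n%:R; last first.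
    have : n%:R * p^-1 <= s by rewrite ler_pdivrMr.
    apply: le_trans; rewrite ler_pM2l //; lra.
  have d0 : 0 < n%:R - s * p by rewrite subr_gt0.
  have : (n%:R * p / (n%:R - s * p))^-1 <= q^-1.
    by rewrite lef_pV2 ?posrE ?hq // divr_gt0 // mulr_gt0.
  rewrite invf_div => h.
  have -> : s = n%:R * (p^-1 - (n%:R - s * p) / (n%:R * p)) by field; rewrite !gt_eqF.
  by rewrite ler_pM2l // lerD2l lerN2.
have [C C0 hC] := sobolev_pointwise n0 s0 s1 s'0 ss s'n.
have [K K0 hK] := @powR_sum_le (option 'I_n) (index_enum (option 'I_n)) p p0.
have a0 : 0 < n%:R - s' by rewrite subr_gt0.
have an : n%:R - s' < n%:R by rewrite ltrBlDr ltrDl.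
have qE : q^-1 = p^-1 - 1 + (n%:R - s') / n%:R by rewrite /s'; field; rewrite !gt_eqF.
have B0 : 0 <= C `^ p * K * (A *+ n.+1) by rewrite !mulr_ge0 ?powR_ge0 // mulrn_wge0.
have [D hD] := hardy_littlewood_sobolev a0 an p1 q0 qE B0.
exists D => f df M rho hf fA GA.
have hl := C1c_lipc hf; have mf := lipc_measurable hl.
have mG j : measurable_fun setT (Dop (rkern s 0 j) f) by apply: measurable_Dop => //; exact: measurable_rkern.
(* The function and its [n] singular integrals as one family; hence the factor [n + 1] in [B0]. *)
pose u (i : option 'I_n) (y : 'rV[R]_n) : R := if i is Some j then `|Dop (rkern s 0 j) f y| else `|f y|.
have u0 i y : 0 <= u i y by case: i => [j|] /=.
have mu_ i : measurable_fun setT (u i) by case: i => [j|]; exact: (measurableT_comp (@normr_measurable _ setT)).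
have uA i : (\int[mu]_y (u i y `^ p)%:E <= A%:E)%E.
  by case: i => [j|]; [exact: (GA j) | exact: fA].
have uE y : \sum_i u i y = `|f y| + \sum_j `|Dop (rkern s 0 j) f y|.
  rewrite (bigD1 None) //=; congr (_ + _).
  rewrite (reindex_omap (@Some 'I_n) id) //=; last by case.
  by apply: eq_bigl => j; rewrite eqxx.
have ms : measurable_fun setT (fun y => \sum_i u i y) by exact: measurable_sum.
have ss0 y : 0 <= \sum_i u i y by exact: sumr_ge0.
apply: (hD (fun y => C * \sum_i u i y) (fun y => `|f y|)) => //.
- by mfun.
- by move=> y; rewrite mulr_ge0.
- exact: (measurableT_comp (@normr_measurable _ setT)).
- apply: (@le_trans _ _ (\int[mu]_y ((C `^ p * K)%:E * \sum_i (u i y `^ p)%:E))%E).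
    apply: ge0_le_integral => //.
    - by move=> y _; rewrite lee_fin powR_ge0.
    - by mfun.
    - apply: emeasurable_funM => //; apply: emeasurable_sum => i.
      by have := mu_ i => m; mfun.
    move=> y _; rewrite powRM // sumEFin -EFinM lee_fin -mulrA ler_wpM2l ?powR_ge0 //.
    exact: hK.
  rewrite ge0_integralZl_EFin //; last first.
  - by rewrite mulr_ge0 ?powR_ge0.
  - by apply: emeasurable_sum => i; have := mu_ i => m; mfun.
  - by move=> y _; apply: sume_ge0 => i _; rewrite lee_fin powR_ge0.
  rewrite [leRHS]EFinM; apply: lee_wpmul2l; first by rewrite lee_fin mulr_ge0 ?powR_ge0.
  rewrite ge0_integral_sum //; last first.
  - by move=> i y _; rewrite lee_fin powR_ge0.
  - by move=> i; have := mu_ i => m; mfun.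
  apply: (@le_trans _ _ (\sum_(i : option 'I_n) A%:E)%E); first exact: lee_sum.
  by rewrite sumEFin sumr_const card_option card_ord.
- by move=> x; have := hC f df M rho x hf; under eq_integral do rewrite -uE.
Qed.

End sobolev_embedding.

(** * Sequences of integrals that tend to zero *)

Section vanishing_sequences.
Context {d : measure_display} {T : measurableType d} {R : realType}.
Variable mu : {measure set T -> \bar R}.

(** One-sided because it is applied to nonnegative integrals; infinite initial terms are
    tolerated. *)
Definition vanishing (b : nat -> \bar R) := forall e : R, 0 < e -> exists J, forall j, (J <= j)%N -> (b j < e%:E)%E.

Lemma vanishing_squeeze (b c : nat -> \bar R) : vanishing c -> (forall j, (b j <= c j)%E) -> vanishing b.
Proof.
by move=> hc bc e e0; have [J hJ] := hc e e0; exists J => j /hJ; exact: le_lt_trans.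
Qed.

Lemma vanishingD (b c : nat -> \bar R) : vanishing b -> vanishing c -> vanishing (fun j => b j + c j)%E.
Proof.
move=> hb hc e e0; have e2 : 0 < e / 2 by rewrite divr_gt0.
have [J hJ] := hb _ e2; have [K hK] := hc _ e2; exists (maxn J K) => j; rewrite geq_max => /andP[/hJ h1 /hK h2].
by rewrite [e]splitr EFinD lteD.
Qed.

Lemma vanishingZ (b : nat -> \bar R) (k : R) : 0 <= k -> vanishing b -> vanishing (fun j => k%:E * b j)%E.
Proof.
rewrite le_eqVlt => /predU1P[<-|k0] hb e e0; first by exists 0%N => j _; rewrite mul0e lte_fin.
have [J hJ] := hb (e / k) (divr_gt0 e0 k0); exists J => j /hJ h.
have -> : e%:E = (k%:E * (e / k)%:E)%E by rewrite -EFinM mulrC divfK // gt_eqF.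
by rewrite lte_pmul2l ?lte_fin.
Qed.

(** Along indices whose integrals are below [2 ^ - (k + 1)] the series of the functions has finite
    integral. It therefore converges almost everywhere, and its terms tend to 0. *)
Lemma vanishing_subsequence (f : nat -> T -> R) : (forall j, measurable_fun setT (f j)) ->
  (forall j x, 0 <= f j x) -> vanishing (fun j => \int[mu]_x (f j x)%:E)%E ->
  exists2 phi : nat -> nat, (forall k, (k <= phi k)%N) & {ae mu, forall x, f (phi k) x @[k --> \oo] --> 0}.
Proof.
move=> mf f0 hv.
have h k : exists j, (k <= j)%N /\ (\int[mu]_x (f j x)%:E <= (2^-1 ^+ k.+1)%:E)%E.
  have p2 : 0 < 2^-1 ^+ k.+1 :> R by rewrite exprn_gt0.
  have [J hJ] := hv _ p2; exists (maxn k J).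
  by split; [exact: leq_maxl | apply/ltW/hJ; exact: leq_maxr].
have [phi hphi] := choice h; exists phi; first by move=> k; have [] := hphi k.
have I : (\int[mu]_x (\sum_(0 <= k <oo) (f (phi k) x)%:E) < +oo)%E.
  rewrite integral_nneseries //; last 2 first.
  - by move=> k; exact/measurable_EFinP.
  - by move=> k x _; rewrite lee_fin.
  apply: (@le_lt_trans _ _ (\sum_(0 <= k <oo) (2^-1 ^+ k.+1)%:E)%E).
    apply: lee_nneseries => [k _ _|k _]; first by apply: integral_ge0 => x _; rewrite lee_fin.
    by have [] := hphi k.
  have e : (fun n : nat => \sum_(0 <= k < n) (2^-1 ^+ k.+1 : R)%:E)%E = (fun n => (1 - 2^-1 ^+ n : R)%:E).
    apply/funext; elim => [|n IH]; first by rewrite big_geq // expr0 subrr.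
    by rewrite big_nat_recr //= IH -EFinD; congr EFin; rewrite exprS; field.
  have : (lim ((fun n => (1 - 2^-1 ^+ n : R)%:E) @ \oo) <= 1%:E)%E.
    apply: lime_le; last by near=> n; rewrite lee_fin gerBl exprn_ge0.
    by rewrite -e; apply: is_cvg_nneseries => k _ _; rewrite lee_fin exprn_ge0.
  by rewrite -e => le1; apply: (le_lt_trans le1); rewrite ltry.
have mS : measurable_fun setT (fun x => \sum_(0 <= k <oo) (f (phi k) x)%:E)%E.
  apply: ge0_emeasurable_sum => k; first by move=> x _ _; rewrite lee_fin.
  by move=> _; exact/measurable_EFinP.
have iS : mu.-integrable setT (fun x => \sum_(0 <= k <oo) (f (phi k) x)%:E)%E.
  apply/integrableP; split => //; under eq_integral => x _.
    rewrite gee0_abs; last by apply: nneseries_ge0 => k _ _; rewrite lee_fin.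
    over.
  exact: I.
apply: filterS (integrable_ae measurableT iS) => x /(_ Logic.I) fin.
set S := (\sum_(0 <= k <oo) (f (phi k) x)%:E)%E in fin.
have Sb m : \sum_(0 <= k < m) f (phi k) x <= fine S.
  rewrite -lee_fin fineK // -sumEFin.
  by apply: nneseries_lim_ge => k _ _; rewrite lee_fin.
apply: cvg_series_cvg_0; apply: nondecreasing_is_cvgn.
  by apply/nondecreasing_seqP => m; rewrite /series /= big_nat_recr //= lerDl.
by exists (fine S) => _ [m _ <-]; exact: Sb.
Unshelve. all: by end_near. Qed.

(** A substitute for Hölder's inequality: for [a >= 0] and [r > 0], [a <= r + r ^ (1 - p) * a ^ p].
    The first term is integrated against [psi], the second uses the bound [C]. *)
Lemma vanishing_product (w : nat -> T -> R) (psi : T -> R) (p C : R) : 1 <= p -> 0 <= C ->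
  (forall j, measurable_fun setT (w j)) -> mu.-integrable setT (EFin \o psi) ->
  (forall x, `|psi x| <= C) -> vanishing (fun j => \int[mu]_x (`|w j x| `^ p)%:E)%E ->
  vanishing (fun j => \int[mu]_x (`|w j x * psi x|)%:E)%E.
Proof.
move=> p1 C0 mw ip pC hv e e0; have [mp ip'] := integrableP _ _ _ ip.
have {}mp : measurable_fun setT psi by exact/measurable_EFinP.
have mpa : measurable_fun setT (fun x => (`|psi x|)%:E).
  by apply/measurable_EFinP; exact: (measurableT_comp (@normr_measurable _ setT)).
set B := (\int[mu]_x (`|psi x|)%:E)%E.
have B0 : (0 <= B)%E by apply: integral_ge0 => x _; rewrite lee_fin.
have Bf : B \is a fin_num by rewrite ge0_fin_numE.
(* Makes [r * B] smaller than [e / 2]; the 1 added guards against [B = 0]. *)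
pose r := e / 2 / (fine B + 1).
have B1 : 0 < fine B + 1 by rewrite ltr_wpDl // fine_ge0.
have r0 : 0 < r by rewrite !divr_gt0.
have k0 : 0 <= C * r `^ (1 - p) by rewrite mulr_ge0 ?powR_ge0.
have e2 : 0 < e / 2 by rewrite divr_gt0.
have [J hJ] := vanishingZ k0 hv e2; exists J => j /hJ h.
have mwp : measurable_fun setT (fun x => (`|w j x| `^ p)%:E).
  by have := mw j => m; mfun; exact: (measurableT_comp (@normr_measurable _ setT)).
have pt a : 0 <= a -> a <= r + r `^ (1 - p) * a `^ p.
  move=> a0; have [ar|ra] := leP a r; first by rewrite (le_trans ar) // lerDl mulr_ge0 ?powR_ge0.
  have ap : 0 < a by exact: lt_trans ra.
  rewrite (le_trans (_ : a <= r `^ (1 - p) * a `^ p)) // ?lerDr ?(ltW r0) //.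
  have -> : 1 - p = - (p - 1) by ring.
  rewrite powRN mulrC ler_pdivlMr ?powR_gt0 //.
  have -> : a `^ p = a * a `^ (p - 1) by rewrite -{2}(powRr1 a0) -powRD ?(gt_eqF ap) ?implybT // addrC subrK.
  by rewrite ler_wpM2l // ge0_ler_powR ?nnegrE ?subr_ge0 // ltW.
apply: (@le_lt_trans _ _ (r%:E * B + (C * r `^ (1 - p))%:E * \int[mu]_x (`|w j x| `^ p)%:E)%E).
  rewrite /B -!ge0_integralZl_EFin ?(ltW r0) //; try by move=> x _; rewrite lee_fin ?powR_ge0.
  rewrite -ge0_integralD //; last 4 first.
  - by move=> x _; rewrite -EFinM lee_fin mulr_ge0 // ltW.
  - exact: emeasurable_funM.
  - by move=> x _; rewrite -EFinM lee_fin mulr_ge0 ?powR_ge0.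
  - exact: emeasurable_funM.
  apply: ge0_le_integral => //.
  - by apply/measurable_EFinP; apply: (measurableT_comp (@normr_measurable _ setT)); exact: measurable_funM.
  - by apply: emeasurable_funD; exact: emeasurable_funM.
  move=> x _; rewrite -!EFinM -EFinD lee_fin normrM.
  apply: (le_trans (ler_wpM2r (normr_ge0 (psi x)) (pt _ (normr_ge0 (w j x))))).
  rewrite mulrDl lerD2l -mulrA (mulrC C) -mulrA ler_wpM2l ?powR_ge0 // mulrC ler_wpM2r ?powR_ge0 //.
rewrite [e]splitr EFinD lteD //.
rewrite -(fineK Bf) -EFinM lte_fin /r mulrAC ltr_pdivrMr // ltr_pM2l //.
by rewrite ltrDl.
Qed.

End vanishing_sequences.

(** * Closability of the singular operators *)

Section closability.
Context {R : realType} (n : nat).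
Let mu := borel_lebesgue R n.
Implicit Types (f g : 'rV[R]_n -> R).

Definition lipschitz_compact f := exists M rho, lipc f M rho.

Lemma min_lipc f g M1 r1 M2 r2 : lipc f M1 r1 -> lipc g M2 r2 -> (forall x, 0 <= f x) -> (forall x, 0 <= g x) ->
  lipc (fun x => Num.min (f x) (g x)) (M1 + M2) (Num.max r1 r2).
Proof.
move=> [r10 f1 f2 f3] [r20 g1 g2 g3] f0 g0.
have M10 : 0 <= M1 by exact: le_trans (f1 0).
have M20 : 0 <= M2 by exact: le_trans (g1 0).
split.
- by rewrite lt_max r10.
- move=> x; rewrite ger0_norm ?le_min ?f0 ?g0 //; apply: ler_wpDr => //.
  by rewrite ge_min (le_trans (ler_norm _) (f1 x)).
- move=> x y; have := f2 x y; have := g2 x y; set e := `|x - y|; rewrite !ler_norml => /andP[a1 a2] /andP[b1 b2].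
  have e0 : 0 <= e by exact: normr_ge0.
  have h1 : 0 <= M1 * e by exact: mulr_ge0.
  have h2 : 0 <= M2 * e by exact: mulr_ge0.
  by rewrite mulrDl /Num.min; case: ltP => c1; case: ltP => c2; apply/andP; split; lra.
- move=> x; rewrite ge_max => /andP[/f3 -> /g3 ->].
  by rewrite minxx.
Qed.

Lemma scale_lipc f M r c : lipc f M r -> 0 <= c -> lipc (fun x => c * f x) (c * M) r.
Proof.
move=> [r0 f1 f2 f3] c0; split => //.
- by move=> x; rewrite normrM ger0_norm // ler_wpM2l.
- by move=> x y; rewrite -mulrBr normrM ger0_norm // -mulrA ler_wpM2l.
- by move=> x /f3 ->; rewrite mulr0.
Qed.

(** Weights that localise to bounded sets: [H] itself may fail to be integrable where [H * tent m]
    is integrable by hypothesis. The sets where the tents are positive exhaust the space. *)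
Definition tent (m : nat) (x : 'rV[R]_n) : R := Num.max 0 (m.+1%:R - `|x|).

Lemma tent_ge0 m x : 0 <= tent m x. Proof. by rewrite le_max lexx. Qed.

Lemma tent_lipc m : lipc (tent m) (m.+1%:R + 1) m.+1%:R.
Proof.
have m1 : 0 < m.+1%:R :> R by rewrite ltr0n.
split => //.
- move=> x; rewrite ger0_norm ?tent_ge0 // /tent /Num.max.
  by have := normr_ge0 x; case: ltP => h; lra.
- move=> x y; have := ler_dist_dist x y; rewrite ler_norml => /andP[a1 a2].
  have h : 0 <= m.+1%:R * `|x - y| by rewrite mulr_ge0 // ltW.
  have h' := normr_ge0 (x - y).
  rewrite mulrDl mul1r ler_norml /tent /Num.max.
  by case: ltP => c1; case: ltP => c2; apply/andP; split; lra.
- by move=> x h; apply/max_idPl; rewrite subr_le0.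
Qed.

Lemma dist_min_le (a b c d : R) : `|Num.min a b - Num.min c d| <= `|a - c| + `|b - d|.
Proof.
have h1 := ler_norm (a - c); have h2 := ler_norm (b - d); have h3 := ler_norm (c - a); have h4 := ler_norm (d - b).
have h5 := normr_ge0 (a - c); have h6 := normr_ge0 (b - d); rewrite (distrC c) in h3; rewrite (distrC d) in h4.
by rewrite ler_norml /Num.min; case: ltP => ?; case: ltP => ?; apply/andP; split; lra.
Qed.

Lemma dist_max0_le (a c : R) : `|Num.max 0 a - Num.max 0 c| <= `|a - c|.
Proof.
have h1 := ler_norm (a - c); have h3 := ler_norm (c - a); have h5 := normr_ge0 (a - c); rewrite (distrC c) in h3.
by rewrite ler_norml /Num.max; case: ltP => ?; case: ltP => ?; apply/andP; split; lra.
Qed.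

Lemma half_tent_lipc i a m : lipc (fun x => Num.min (Num.min (Num.max 0 (x 0 i - a)) 1) (tent m x)) (m.+1%:R + 2) m.+1%:R.
Proof.
have m1 : 0 < m.+1%:R :> R by rewrite ltr0n.
have [_ t1 t2 t3] := tent_lipc m.
have c0 (x : 'rV[R]_n) : 0 <= Num.min (Num.max 0 (x 0 i - a)) 1 by rewrite le_min ler01 le_max lexx.
split => //.
- move=> x; rewrite ger0_norm; last by rewrite le_min; apply/andP; split; [exact: c0 | exact: tent_ge0].
  by rewrite (@le_trans _ _ 1) ?ge_min ?lexx ?orbT //; lra.
- move=> x y; apply: (le_trans (dist_min_le _ _ _ _)).
  have h1 := dist_min_le (Num.max 0 (x 0 i - a)) 1 (Num.max 0 (y 0 i - a)) 1.
  have h2 := dist_max0_le (x 0 i - a) (y 0 i - a).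
  have := rV_coord_le (x - y) i; rewrite !mxE => h3; have h4 := t2 x y.
  rewrite (_ : x 0 i - a - (y 0 i - a) = x 0 i - y 0 i) in h2; last by ring.
  by rewrite subrr normr0 addr0 in h1; lra.
- by move=> x /t3 ->; rewrite min_r.
Qed.

(** A half-space [a < x 0 i] is a countable union of sets of the generating form: the positive part
    of [x 0 i - a] is capped at height 1, then its minimum with the tents is taken. *)
Lemma lipc_generates (A : set 'rV[R]_n) : measurable A ->
  <<s [set B | exists f M r, [/\ lipc f M r, forall x, 0 <= f x & B = [set x | 0 < f x]]] >> A.
Proof.
set G := [set B | _]; move=> mA.
suff : g_sigma_preimage (@coord_rV R n) `<=` <<s G >> by apply.
apply: smallest_sub; first exact: smallest_sigma_algebra.
move=> B; rewrite -bigcup_seq/= => -[i _ [C mC <-]]; rewrite setTI.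
suff h : measurable_fun setT (fun x : g_sigma_algebraType G => coord_rV i x).
  by have := h measurableT C mC; rewrite setTI.
apply: (measurability _ (RGenOInfty.measurableE R)) => _ [_ [a ->] <-].
have -> : setT `&` coord_rV i @^-1` `]a, +oo[%classic =
    \bigcup_m [set x : 'rV[R]_n | 0 < Num.min (Num.min (Num.max 0 (x 0 i - a)) 1) (tent m x)].
  rewrite setTI; apply/seteqP; split => x /=.
    rewrite in_itv /= andbT => ax; have [m hm] : exists m : nat, `|x| < m.+1%:R.
      exists (Num.trunc `|x|); exact: truncnS_gt.
    by exists m => //=; rewrite !lt_min !lt_max ltr01 !subr_gt0 [a < _]ax hm !orbT.
  by move=> [m _] /=; rewrite !lt_min !lt_max ltxx /= subr_gt0 in_itv /= andbT => /andP[/andP[]].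
apply: bigcup_measurable => m _; apply: sub_sigma_algebra.
exists (fun x : 'rV[R]_n => Num.min (Num.min (Num.max 0 (x 0 i - a)) 1) (tent m x)), (m.+1%:R + 2), m.+1%:R.
split => //; first exact: half_tent_lipc.
move=> x; rewrite le_min tent_ge0 andbT le_min ler01 andbT le_max lexx //.
Qed.

(* The sets {0 < f} with f Lipschitz of compact support form a pi-system
   generating the Borel sets. *)
Lemma lipc_orthogonal_le0 (H : 'rV[R]_n -> R) : measurable_fun setT H ->
  (forall f M r, lipc f M r -> mu.-integrable setT (EFin \o (fun x => H x * f x)) /\ \int[mu]_x (H x * f x) = 0) ->
  mu.-negligible [set x | 0 < H x].
Proof.
move=> mH hH.
have mti m : measurable_fun setT (tent m) := lipc_measurable (tent_lipc m).
have hT m := hH _ _ _ (tent_lipc m).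
have mprod m (A : set 'rV[R]_n) : measurable A -> measurable_fun setT (fun x => \1_A x * (H x * tent m x) : R).
  by move=> mA; apply: measurable_funM => //; exact: measurable_funM.
have ind01 (A : set 'rV[R]_n) x : 0 <= (\1_A x : R) <= 1 by rewrite indicE; case: (x \in A); rewrite ?lexx ler01.
have iprod m (A : set 'rV[R]_n) : measurable A -> mu.-integrable setT (EFin \o (fun x => \1_A x * (H x * tent m x))).
  move=> mA; apply: (@integrable_le _ _ _ mu _ (fun x => `|H x * tent m x|)) => //; first exact: mprod.
    by have := integrable_abse (hT m).1; apply: eq_integrable.
  by move=> x; have /andP[h0 h1] := ind01 A x; rewrite normrM ger0_norm // ler_piMl.
have key m (A : set 'rV[R]_n) : measurable A -> \int[mu]_x (\1_A x * (H x * tent m x)) = 0.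
  (* The sets on which the integral of [H * tent m] vanishes form a Dynkin class; that the whole
     space belongs to it is the hypothesis for the test function [tent m]. *)
  move=> mA; pose D := [set B : set 'rV[R]_n | measurable B /\ \int[mu]_x (\1_B x * (H x * tent m x)) = 0].
  suff : D A by case.
  pose G := [set B : set 'rV[R]_n | exists f M r, [/\ lipc f M r, forall x, 0 <= f x & B = [set x | 0 < f x]]].
  suff : <<s G >> `<=` D by apply; exact: lipc_generates.
  apply: (@lambda_system_subset _ G) => //.
  - move=> B1 B2 [f1 [M1 [r1 [h1 p1 ->]]]] [f2 [M2 [r2 [h2 p2 ->]]]].
    exists (fun x => Num.min (f1 x) (f2 x)), (M1 + M2), (Num.max r1 r2); split; first exact: min_lipc.
      by move=> x; rewrite le_min p1 p2.
    by apply/seteqP; split => x /=; rewrite lt_min => /andP.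
  - split => //.
    + split => //; rewrite -[RHS](hT m).2; apply: eq_Rintegral => x _.
      by rewrite indicE in_setT mul1r.
    + move=> B C CB [mB zB] [mC zC]; split; first exact: measurableD.
      have -> : \int[mu]_x (\1_(B `\` C) x * (H x * tent m x)) =
          \int[mu]_x (\1_B x * (H x * tent m x) - \1_C x * (H x * tent m x)).
        apply: eq_Rintegral => x _; rewrite -mulrBl; congr (_ * _); rewrite !indicE in_setD.
        case: (boolP (x \in C)) => xC; last by rewrite andbT subr0.
        by rewrite (_ : x \in B) ?subrr //; rewrite inE; apply: CB; rewrite -inE.
      by rewrite RintegralB ?zB ?zC ?subrr //; exact: iprod.
    + move=> F ndF hF; split; first by apply: bigcup_measurable => k _; have [] := hF k.
      have mU : measurable (\bigcup_k F k) by apply: bigcup_measurable => k _; have [] := hF k.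
      have cv := @Rintegral_cvg _ _ _ mu (fun k x => \1_(F k) x * (H x * tent m x))
        (fun x => \1_(\bigcup_k F k) x * (H x * tent m x)) (fun x => `|H x * tent m x|).
      have := cvg_lim (@Rhausdorff R) (cv _ _ _ _ _).
      rewrite (_ : (fun k => \int[mu]_x (\1_(F k) x * (H x * tent m x))) = cst 0); last first.
        by apply/funext => k; have [_] := hF k.
      rewrite lim_cst // => <- //.
      * by move=> k; apply: mprod; have [] := hF k.
      * exact: mprod.
      * apply: aeW => x; apply: cvgMl.
        have [[k _ xk]|nx] := pselect ((\bigcup_k F k) x).
          rewrite (_ : \1_(\bigcup_k F k) x = 1); last by rewrite indicE mem_set //; exists k.
          apply: cvg_near_cst; exists k => // l /= kl; rewrite indicE mem_set //.
          by have /subsetPset := ndF _ _ kl; apply.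
        rewrite (_ : \1_(\bigcup_k F k) x = 0); last by rewrite indicE memNset.
        apply: cvg_near_cst; apply: nearW => l; rewrite indicE memNset // => xl; apply: nx; by exists l.
      * by have := integrable_abse (hT m).1; apply: eq_integrable.
      * by apply: aeW => x k; have /andP[h0 h1] := ind01 (F k) x; rewrite normrM ger0_norm // ler_piMl.
  - move=> _ [f [M [r [hf f0 ->]]]].
    have mf := lipc_measurable hf.
    have mB : measurable [set x | 0 < f x].
      by rewrite -[X in measurable X]setTI; have := mf measurableT _ (measurable_itv `]0, +oo[);
        rewrite (_ : f @^-1` _ = [set x | 0 < f x]) //; apply/seteqP; split => x /=; rewrite in_itv /= andbT.
    split => //.
    (* These Lipschitz functions increase to [tent m] on the set where [f] is positive and vanish
       off it. Each is admissible against [H], which puts that set into [D]. *)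
    pose g (k : nat) x := Num.min (k%:R * f x) (tent m x).
    have kf0 (k : nat) x : 0 <= k%:R * f x by rewrite mulr_ge0.
    have hg k := min_lipc (scale_lipc hf (ler0n R k)) (tent_lipc m) (kf0 k) (tent_ge0 m).
    have cv := @Rintegral_cvg _ _ _ mu (fun k x => H x * g k x)
        (fun x => \1_[set x | 0 < f x] x * (H x * tent m x)) (fun x => `|H x * tent m x|).
    have := cvg_lim (@Rhausdorff R) (cv _ _ _ _ _).
    rewrite (_ : (fun k => \int[mu]_x (H x * g k x)) = cst 0); last first.
      by apply/funext => k; have [_] := hH _ _ _ (hg k).
    rewrite lim_cst // => <- //.
    + by move=> k; apply: measurable_funM => //; exact: lipc_measurable (hg k).
    + exact: mprod.
    + apply: aeW => x; rewrite mulrCA; apply: cvgMr.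
      have [fx|fx] := ltP 0 (f x); last first.
        have f00 : f x = 0 by apply/eqP; rewrite eq_le fx f0.
        rewrite indicE memNset ?mul0r; last by rewrite /= f00 ltxx.
        by apply: cvg_near_cst; apply: nearW => k; rewrite /g f00 mulr0 min_l // tent_ge0.
      rewrite indicE mem_set // mul1r; apply: cvg_near_cst.
      exists (Num.trunc (tent m x / f x)).+1 => // k /= hk; rewrite /g min_r //.
      rewrite -ler_pdivrMr //; apply: ltW; apply: (lt_le_trans (truncnS_gt _)).
      by rewrite ler_nat.
    + by have := integrable_abse (hT m).1; apply: eq_integrable.
    + apply: aeW => x k; rewrite !normrM ler_wpM2l // !ger0_norm ?tent_ge0 ?le_min ?kf0 ?tent_ge0 //.
      by rewrite ge_min lexx orbT.
have mP : measurable [set x | 0 < H x].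
  by rewrite -[X in measurable X]setTI; have := mH measurableT _ (measurable_itv `]0, +oo[);
    rewrite (_ : H @^-1` _ = [set x | 0 < H x]) //; apply/seteqP; split => x /=; rewrite in_itv /= andbT.
have mT m : measurable [set x | 0 < tent m x].
  by rewrite -[X in measurable X]setTI; have := mti m measurableT _ (measurable_itv `]0, +oo[);
    rewrite (_ : tent m @^-1` _ = [set x | 0 < tent m x]) //; apply/seteqP; split => x /=; rewrite in_itv /= andbT.
have z m : mu ([set x | 0 < H x] `&` [set x | 0 < tent m x]) = 0%E.
  apply/eqP; rewrite eq_le measure_ge0 andbT leNgt; apply/negP => pos.
  have := key m _ mP.
  apply/eqP; rewrite gt_eqF //; apply: (Rintegral_gt0 (iprod m _ mP) _ (measurableI _ _ mP (mT m)) pos).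
    apply: aeW => x; rewrite indicE; case: (boolP (x \in _)) => hx; last by rewrite mul0r.
    by rewrite mul1r mulr_ge0 ?tent_ge0 // ltW //; move: hx; rewrite inE.
  by move=> x [h1 h2]; rewrite indicE mem_set // mul1r mulr_gt0.
have -> : [set x | 0 < H x] = \bigcup_m ([set x | 0 < H x] `&` [set x | 0 < tent m x]).
  apply/seteqP; split => x /=; last by move=> [m _ []].
  move=> hx; exists (Num.trunc `|x|) => //; split => //=.
  by rewrite lt_max ltxx /= subr_gt0 truncnS_gt.
apply: negligible_bigcup => m; exists ([set x | 0 < H x] `&` [set x | 0 < tent m x]); split => //.
  exact: measurableI.
exact: z.
Qed.

Lemma lipc_orthogonal_ae0 (H : 'rV[R]_n -> R) : measurable_fun setT H ->
  (forall f M r, lipc f M r -> mu.-integrable setT (EFin \o (fun x => H x * f x)) /\ \int[mu]_x (H x * f x) = 0) ->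
  {ae mu, forall x, H x = 0}.
Proof.
move=> mH hH; have n1 := lipc_orthogonal_le0 mH hH.
have n2 : mu.-negligible [set x | 0 < - H x].
  apply: lipc_orthogonal_le0; first by mfun.
  move=> f M r hf; have [h1 h2] := hH f M r hf; split.
    have := integrableZl measurableT (-1) h1; apply: eq_integrable => // x _ /=.
    by rewrite -EFinM; congr EFin; ring.
  under eq_Rintegral do rewrite mulNr -mulN1r.
  by rewrite RintegralZl // h2 mulr0.
apply: negligibleS (negligibleU n1 n2) => x /= /eqP; rewrite neq_lt => /orP[h|h]; last by left.
by right; rewrite oppr_gt0.
Qed.

(** [Dop K f] has no compact support in general, but by [Dop_decay] it is bounded and integrable,
    which is what [vanishing_product] asks of the function paired with [w j]. *)
Lemma Dop_closable (s p : R) K (w : nat -> 'rV[R]_n -> R) (h : 'rV[R]_n -> R) : (0 < n)%N -> 0 < s -> s < 1 ->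
  1 <= p -> odd_kernel s K -> (forall j, lipschitz_compact (w j)) -> measurable_fun setT h ->
  vanishing (fun j => \int[mu]_x (`|w j x| `^ p)%:E)%E ->
  vanishing (fun j => \int[mu]_x (`|Dop K (w j) x - h x| `^ p)%:E)%E ->
  {ae mu, forall x, h x = 0}.
Proof.
move=> n0 s0 s1 p1 hK hw mh v1 v2; apply: lipc_orthogonal_ae0 => // f M r hf.
have mK : measurable_fun setT K by case: hK.
have mw j : measurable_fun setT (w j) by have [? [? hj]] := hw j; exact: lipc_measurable hj.
have mDw j : measurable_fun setT (Dop K (w j)) by exact: measurable_Dop.
have mf := lipc_measurable hf; have mDf : measurable_fun setT (Dop K f) by exact: measurable_Dop.
have [_ fM _ _] := hf; have M0 : 0 <= M by exact: le_trans (fM 0).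
have fi := lipc_integrable hf.
have bnd (g : 'rV[R]_n -> R) C : measurable_fun setT g -> (forall x, `|g x| <= C * decay s x) ->
    mu.-integrable setT (EFin \o g).
  by move=> mg hg; apply: integrable_le mg (integrableZl measurableT C (decay_integrable n s0)) hg.
have decayC (g : 'rV[R]_n -> R) C : (forall x, `|g x| <= C * decay s x) -> 0 <= C /\ forall x, `|g x| <= C.
  move=> hg; have C0 : 0 <= C.
    have := le_trans (normr_ge0 _) (hg 0); rewrite (_ : decay s (0 : 'rV[R]_n) = 1) ?mulr1 //.
    by rewrite /decay normr0 /ind ltr01 ler10 mul0r addr0.
  by split=> // x; apply: (le_trans (hg x)); rewrite ler_piMr // decay_le1 // ltW.
have [C hC] := Dop_decay n0 s0 s1 hK hf; have [C0 hC'] := decayC _ _ hC.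
have Dfi := bnd _ _ mDf hC.
have md j : measurable_fun setT (fun x => Dop K (w j) x - h x) by mfun.
have u1 := vanishing_product p1 C0 mw Dfi hC' v1.
have u2 := vanishing_product p1 M0 md fi fM v2.
have iE j : mu.-integrable setT (EFin \o (fun x => Dop K (w j) x * f x)).
  have [M' [r' hj]] := hw j; have [C' hC1] := Dop_decay n0 s0 s1 hK hj; have [C'0 hC2] := decayC _ _ hC1.
  apply: (@integrable_le _ _ _ mu _ (fun x => C' * `|f x|)); first by mfun.
    have h2 : mu.-integrable setT (EFin \o (fun x => `|f x|)).
      by have := integrable_abse fi; apply: eq_integrable.
    exact: (integrableZl measurableT C' h2).
  by move=> x; rewrite normrM ler_wpM2r.
have iF j : (\int[mu]_x (`|(Dop K (w j) x - h x) * f x|)%:E < +oo)%E ->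
    mu.-integrable setT (EFin \o (fun x => (Dop K (w j) x - h x) * f x)).
  by move=> fin; apply/integrableP; split => //; apply/measurable_EFinP; mfun.
have ih : mu.-integrable setT (EFin \o (fun x => h x * f x)).
  (* One index at which the pairing with the error is finite suffices for the integrability of
     [h * f]. *)
  have [J hJ] := u2 1 ltr01; have h1 := iF J (lt_trans (hJ J (leqnn J)) (ltry _)).
  have := integrableB measurableT (iE J) h1; apply: eq_integrable => // x _ /=.
  by rewrite -EFinB; congr EFin; ring.
split => //; apply/eqP; rewrite -normr_le0; apply/ler_addgt0Pr => e e0; rewrite add0r.
have e2 : 0 < e / 2 by rewrite divr_gt0.
have [J1 hJ1] := u1 _ e2; have [J2 hJ2] := u2 _ e2; pose j := maxn J1 J2.
have h1 := hJ1 j (leq_maxl _ _); have h2 := hJ2 j (leq_maxr _ _).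
have iFj := iF j (lt_trans h2 (ltry _)).
have [M' [r' hj]] := hw j.
have -> : \int[mu]_x (h x * f x) = (- (\int[mu]_x (w j x * Dop K f x))) - \int[mu]_x ((Dop K (w j) x - h x) * f x).
  rewrite -(Dop_duality n0 s0 s1 hK hj hf) -RintegralB //.
  by apply: eq_Rintegral => x _; ring.
have mwD : measurable_fun setT (fun x => w j x * Dop K f x) by have := mw j => m; mfun.
have mdf : measurable_fun setT (fun x => (Dop K (w j) x - h x) * f x) by mfun.
have g1 := le_lt_trans (norm_Rintegral_le mu mwD) h1; have g2 := le_lt_trans (norm_Rintegral_le mu mdf) h2.
rewrite !lte_fin in g1 g2.
apply: (le_trans (ler_normB _ _)); rewrite normrN.
by rewrite [e]splitr; apply: lerD; exact: ltW.
Qed.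

End closability.

(** * Positivity of Gamma, and the normalising constant *)

Section gamma.
Context {R : realType}.

(** The inequality [x / b <= expR (x / b)] raised to the power [b]. *)
Lemma expR_ge_power (b x : R) : 0 < b -> 0 <= x -> x `^ b <= b `^ b * expR x.
Proof.
move=> b0 x0; have -> : expR x = expR (x / b) `^ b.
  by rewrite /powR gt_eqF ?expR_gt0 // expRK mulrC divfK // gt_eqF.
rewrite -powRM ?expR_ge0 ?(ltW b0) //; apply: ge0_ler_powR; rewrite ?nnegrE ?mulr_ge0 ?expR_ge0 ?(ltW b0) //.
rewrite mulrC -ler_pdivrMr //; apply: le_trans (expR_ge1Dx _); by rewrite lerDr.
Qed.

Lemma integral_power_head (a : R) : 0 < a ->
  (\int[lebesgue_measure]_x (ind (0 < x)%R * ind (x < 1)%R * x `^ (a - 1))%:E < +oo)%E.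
Proof.
move=> a0; have e1 : lebesgue_measure (`]0%R, 1%R[%classic : set R) = 1%E.
  by rewrite lebesgue_measure_itv /= lte_fin ltr01 oppr0 adde0.
have [a1|a1] := leP 1 a.
  apply: (@le_lt_trans _ _ (\int[lebesgue_measure]_x (\1_`]0%R, 1%R[ x)%:E)%E).
    apply: ge0_le_integral => //.
    - by move=> x _; rewrite lee_fin !mulr_ge0 ?ind_ge0 ?powR_ge0.
    - by mfun.
    - exact/measurable_EFinP.
    move=> x _; rewrite lee_fin indicE mem_setE in_itv /= /ind.
    case: (ltP 0 x) => x0; last by rewrite !mul0r ler0n.
    case: (ltP x 1) => x1; last by rewrite mulr0 mul0r ler0n.
    rewrite !mul1r /= -[leRHS](powRr0 x); apply: ger_powR; first by rewrite x0 ltW.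
    by rewrite subr_ge0.
  by rewrite integral_indic // setIT [X in (X < _)%E]e1 ltry.
(* For exponents below 1 the integral is a power kernel in dimension 1. Row vectors of length 0
   carry a Dirac mass, so the first coordinate is the only variable left. *)
have h : (\int[borel_lebesgue R 1]_y (ind (`|y| < 1)%R * `|y| `^ (- (1 - a)))%:E < +oo)%E.
  by apply: kernel_head_lt_pinfty; lra.
rewrite (@ge0_integral_rVS R 0 (fun y => (ind (`|y| < 1)%R * `|y| `^ (- (1 - a)))%:E)) in h; last 2 first.
- by mfun.
- by move=> y; rewrite lee_fin mulr_ge0 ?ind_ge0 ?powR_ge0.
apply: le_lt_trans h; apply: ge0_le_integral => //.
- by move=> x _; rewrite lee_fin !mulr_ge0 ?ind_ge0 ?powR_ge0.
- by mfun.
- apply: (@measurable_integral_section _ _ _ _ _ (borel_lebesgue R 0)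
    (fun (t : R) x => (ind (`|cons_rV (t, x)| < 1)%R * `|cons_rV (t, x)| `^ (- (1 - a)))%:E)).
    have mc : measurable_fun setT (fun z : R * 'rV[R]_0 => cons_rV (z.1, z.2)).
      by have := @measurable_cons_rV R 0; rewrite (_ : @cons_rV R 0 = fun z => cons_rV (z.1, z.2)) //; apply/funext => -[].
    by mfun.
  by move=> t x; rewrite lee_fin mulr_ge0 ?ind_ge0 ?powR_ge0.
move=> t _; pose F (x : 'rV[R]_0) := (ind (`|cons_rV (t, x)| < 1) * `|cons_rV (t, x)| `^ (- (1 - a)))%:E.
have mF : measurable_fun setT F.
  have mc : measurable_fun setT (fun x : 'rV[R]_0 => cons_rV (t, x)).
    by apply: (measurableT_comp (@measurable_cons_rV R 0)); exact: measurable_fun_pair.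
  by rewrite /F; mfun.
have -> : (\int[borel_lebesgue R 0]_x F x)%E = F 0.
  transitivity (\int[\d_(0%R : 'rV[R]_0)]_x F x)%E; first by [].
  by rewrite integral_dirac // diracE mem_set // mul1e.
rewrite /F lee_fin.
have -> : `|cons_rV (t, 0 : 'rV[R]_0)| = `|t|.
  apply/eqP; rewrite eq_le; apply/andP; split.
    apply: rV_norm_le => // i; have -> : i = lshift 0 (0 : 'I_1) by rewrite [i]ord1; apply: val_inj.
    by rewrite cons_rV_l.
  by have := rV_coord_le (cons_rV (t, 0 : 'rV[R]_0)) (lshift 0 (0 : 'I_1)); rewrite cons_rV_l.
rewrite /ind; case: (ltP 0 t) => t0; last by rewrite !mul0r mulr_ge0 ?powR_ge0 //; case: ifP.
by rewrite gtr0_norm // mul1r opprB.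
Qed.

(** [Gamma] is [fine] of an extended integral and would be 0 if that were infinite, so convergence
    has to come first: a power on []0, 1[], and [C * x ^ -2] from 1 on, by [expR_ge_power] with
    exponent [a + 1]. *)
Lemma Gamma_gt0 (a : R) : 0 < a -> 0 < Gamma a.
Proof.
move=> a0; rewrite /Gamma Rintegral_mkcond.
set D := `]0, +oo[%classic; set f := (fun x : R => x `^ (a - 1) * expR (- x)).
have mf : measurable_fun setT f.
  apply: measurable_funM; first by mfun.
  by apply: measurableT_comp => //; exact: measurable_funN.
have fE x : (f \_ D) x = ind (0 < x) * f x.
  by rewrite patchE mem_setE in_itv /= andbT /ind; case: ifP; rewrite ?mul1r ?mul0r.
have mfD : measurable_fun setT (f \_ D).
  by rewrite (_ : f \_ D = fun x => ind (0 < x) * f x); [mfun | apply/funext].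
have f0 x : 0 <= (f \_ D) x by rewrite fE mulr_ge0 ?ind_ge0 // mulr_ge0 ?powR_ge0 ?expR_ge0.
have e1 : lebesgue_measure (`]0%R, 1%R[%classic : set R) = 1%E.
  by rewrite lebesgue_measure_itv /= lte_fin ltr01 oppr0 adde0.
pose C := (a + 1) `^ (a + 1).
have C0 : 0 <= C by exact: powR_ge0.
pose h1 (x : R) := ind (0 < x) * ind (x < 1) * x `^ (a - 1).
pose h2 (x : R) := ind (1 <= x) * x `^ (- 1 - 1).
have ifD : lebesgue_measure.-integrable setT (EFin \o f \_ D).
  apply: ge0_fin_integrable => //.
  apply: (@le_lt_trans _ _ (\int[lebesgue_measure]_x ((h1 x)%:E + C%:E * (h2 x)%:E))%E).
    apply: ge0_le_integral => //.
    - by move=> x _; rewrite lee_fin.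
    - exact/measurable_EFinP.
    - by rewrite /h1 /h2; mfun.
    move=> x _; rewrite -EFinM -EFinD lee_fin fE /h1 /h2 /ind.
    case: (ltP 0 x) => x0; last first.
      rewrite !mul0r add0r mulr_ge0 // mulr_ge0 ?powR_ge0 //; case: ifP => //.
    have [x1|x1] := ltP x 1.
      rewrite !mul1r mul0r mulr0 addr0 /f ler_piMr ?powR_ge0 // -expR0 ler_expR; lra.
    rewrite mulr0 mul0r add0r !mul1r /f expRN.
    have -> : x `^ (a - 1) = x `^ (a + 1) * x `^ (- 1 - 1).
      by rewrite -powRD ?(gt_eqF x0) ?implybT //; congr (_ `^ _); ring.
    rewrite mulrAC ler_wpM2r ?powR_ge0 // ler_pdivrMr ?expR_gt0 //.
    by apply: expR_ge_power; lra.
  rewrite ge0_integralD //; last 4 first.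
  - by move=> x _; rewrite lee_fin !mulr_ge0 ?ind_ge0 ?powR_ge0.
  - by rewrite /h1; mfun.
  - by move=> x _; rewrite -EFinM lee_fin !mulr_ge0 ?ind_ge0 ?powR_ge0.
  - by rewrite /h2; mfun.
  rewrite lte_add_pinfty //; first exact: integral_power_head.
  rewrite ge0_integralZl_EFin //; last 2 first.
  - by move=> x _; rewrite lee_fin mulr_ge0 ?ind_ge0 ?powR_ge0.
  - by rewrite /h2; mfun.
  by rewrite (integral_power_tail (ltr01 : 0 < 1 :> R) (ltr01 : 0 < 1 :> R)) -EFinM ltry.
apply: (@Rintegral_gt0 R _ _ lebesgue_measure _ `]0%R, 1%R[%classic ifD) => //.
- exact: aeW.
- by rewrite [X in (_ < X)%E]e1 lte01.
move=> x /=; rewrite in_itv /= => /andP[x0 _].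
by rewrite fE /ind x0 mul1r mulr_gt0 ?powR_gt0 ?expR_gt0.
Qed.

(** Allows [Dop] to be recovered from [frac_grad]: the estimates are about the former, the
    definition of [Hsp] is about the latter. *)
Lemma c_frac_neq0 (n : nat) (s : R) : (0 < n)%N -> 0 < s -> s < 1 -> c_frac n s != 0.
Proof.
move=> n0 s0 s1; have k0 : 0 < n%:R + s - 1 by rewrite addrAC ltr_wpDl // subr_ge0 ler1n.
have s1' : 0 < 1 - s by rewrite subr_gt0.
rewrite /c_frac mulf_neq0 ?oppr_eq0 ?gt_eqF //.
by rewrite divr_gt0 ?Gamma_gt0 ?divr_gt0 // !mulr_gt0 ?powR_gt0 ?pi_gt0 ?Gamma_gt0 ?divr_gt0.
Qed.

End gamma.

(** * The principal value as an absolutely convergent integral *)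

Section fractional_gradient_formula.
Context {R : realType} (n : nat) (s : R).
Hypotheses (n0 : (0 < n)%N) (s0 : 0 < s) (s1 : s < 1).
Let mu := borel_lebesgue R n.

Lemma mem_eballC (x y : 'rV[R]_n) r : (y \in ~` eball x r) = (r <= fnorm (y - x)).
Proof.
apply/idP/idP => [/set_mem h'|hr]; first by rewrite leNgt; apply/negP => h''; exact: h' h''.
by apply/mem_set => h'; move: (h' : is_true (fnorm (y - x) < r)); rewrite ltNge hr.
Qed.

Let ind_mul_le (b : bool) (a : R) : `|ind b * a| <= `|a|.
Proof. by rewrite normrM ger0_norm ?ind_ge0 // ler_piMl ?ind_le1. Qed.

Let ind_cvg1 (u : nat -> R) (c a : R) : 0 < c -> u m @[m --> \oo] --> 0 -> ind (u m <= c) * a @[m --> \oo] --> a.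
Proof.
move=> c0 cu; apply: cvg_near_cst; near=> m; rewrite /ind ltW ?mul1r //.
by near: m; exact: cvgr_lt cu _ c0.
Unshelve. all: by end_near. Qed.

(** The full integrand is absolutely integrable, so the truncated integrals converge by dominated
    convergence along any sequence of positive radii tending to 0. At [y = x], which every
    truncation removes, the integrand is 0. *)
Lemma pv_Dop (f : 'rV[R]_n -> R) M rho j x : lipc f M rho ->
  pv x (fun y => (f x - f y) / fnorm (x - y) `^ (n%:R + s) * ((x - y) 0 j / fnorm (x - y))) =
  Dop (rkern s 0 j) f x.
Proof.
move=> hf; have mf := lipc_measurable hf; have mK := @measurable_rkern R n s 0 j.
set g := (fun y => _); pose h (y : 'rV[R]_n) := (f x - f y) * rkern s 0 j (x - y).
have gh : g = h.
  apply/funext => y; rewrite /g /h /rkern expr0n addr0.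
  have [->|yx] := eqVneq y x; first by rewrite !subrr !mul0r.
  have xy : x - y != 0 by rewrite subr_eq0 eq_sym.
  have fp := fnorm_gt0 xy.
  have -> : (fnorm (x - y) ^+ 2) `^ (- ((n%:R + s + 1) / 2)) = (fnorm (x - y) `^ (n%:R + s))^-1 * (fnorm (x - y))^-1.
    rewrite -powR_mulrn ?fnorm_ge0 // -powRrM.
    have -> : 2%:R * - ((n%:R + s + 1) / 2) = - (n%:R + s) + (- 1) :> R by field.
    by rewrite powRD ?(gt_eqF fp) ?implybT // powRN powR_inv1 ?fnorm_ge0.
  ring.
have mh : measurable_fun setT h.
  by apply: measurable_funM; [apply: measurable_funB => // | apply: (measurableT_comp mK); mfun].
have hi : mu.-integrable setT (EFin \o h).
  have := integrable_subl x (Dop_integrable n0 s0 s1 x (rkern_odd_kernel s0 0 j) hf).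
  by apply: eq_integrable => // y _ /=; rewrite subKr.
have hD : \int[mu]_y h y = Dop (rkern s 0 j) f x.
  rewrite /Dop -(Rintegral_subl x (measurable_Dop_integrand x mK mf)); apply: eq_Rintegral => y _.
  by rewrite /h subKr.
rewrite gh /pv; apply: cvg_lim; first exact: Rhausdorff.
(* The truncated integrals are taken for the completed measure; their integrands are Borel and
   integrable, so they may be computed with [borel_lebesgue]. *)
have trunc r : \int[leb R n]_(y in ~` eball x r) h y = \int[mu]_y (ind (r <= fnorm (y - x)) * h y).
  have E : h \_ (~` eball x r) = (fun y => ind (r <= fnorm (y - x)) * h y).
    by apply/funext => y; rewrite patchE mem_eballC /ind; case: ifP; rewrite ?mul1r ?mul0r.
  rewrite Rintegral_mkcond E /Rintegral; congr fine; apply: integral_leb.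
  apply: (@integrable_le _ _ _ mu _ (fun y => `|h y|)); first by mfun.
    by have := integrable_abse hi; apply: eq_integrable.
  by move=> y; exact: ind_mul_le.
rewrite (_ : (fun r => _) = (fun r => \int[mu]_y (ind (r <= fnorm (y - x)) * h y))); last by apply/funext.
apply/cvg_at_rightP => u [u0 ucv]; rewrite -hD.
apply: (@Rintegral_cvg _ _ _ mu _ _ (fun y => `|h y|)).
- by move=> m; mfun.
- exact: mh.
- apply: aeW => y; have [->|yx] := eqVneq y x.
    have h0 : h x = 0 by rewrite /h subrr mul0r.
    by rewrite h0; under eq_fun do rewrite mulr0; exact: cvg_cst.
  have fp : 0 < fnorm (y - x) by apply: fnorm_gt0; rewrite subr_eq0.
  exact: ind_cvg1.
- by have := integrable_abse hi; apply: eq_integrable.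
- by apply: aeW => y m; exact: ind_mul_le.
Qed.

Lemma frac_gradE m (u : 'rV[R]_n -> 'rV[R]_m) x i j : Cc_infty u ->
  frac_grad s u x i j = c_frac n s * Dop (rkern s 0 j) (fun z => u z 0 i) x.
Proof.
move=> hu; have [M [rho /C1c_lipc hf]] := Cc_infty_C1c i hu.
rewrite /frac_grad !mxE -(pv_Dop j x hf); congr (_ * pv _ _); apply/funext => y.
by rewrite !mxE.
Qed.

End fractional_gradient_formula.

(** * Integrals of nonnegative combinations *)

Section nonnegative_combinations.
Context {d} {T : measurableType d} {R : realType} (mu : {measure set T -> \bar R}).
Variables (u v w : T -> R) (a b : R).
Hypotheses (a0 : 0 <= a) (b0 : 0 <= b).
Hypotheses (mu' : measurable_fun setT u) (mv : measurable_fun setT v) (mw : measurable_fun setT w).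
Hypotheses (u0 : forall x, 0 <= u x) (v0 : forall x, 0 <= v x) (w0 : forall x, 0 <= w x).
Hypothesis le_comb : forall x, u x <= a * v x + b * w x.

Lemma ge0_integral_le_comb :
  (\int[mu]_x (u x)%:E <= a%:E * \int[mu]_x (v x)%:E + b%:E * \int[mu]_x (w x)%:E)%E.
Proof.
have mv' : measurable_fun setT (fun x => (v x)%:E) by exact/measurable_EFinP.
have mw' : measurable_fun setT (fun x => (w x)%:E) by exact/measurable_EFinP.
rewrite -!ge0_integralZl_EFin //; try by move=> x _; rewrite lee_fin.
rewrite -ge0_integralD //; last 4 first.
- by move=> x _; rewrite -EFinM lee_fin mulr_ge0.
- exact: emeasurable_funM.
- by move=> x _; rewrite -EFinM lee_fin mulr_ge0.
- exact: emeasurable_funM.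
apply: ge0_le_integral => //.
- by move=> x _; rewrite lee_fin.
- exact/measurable_EFinP.
- by apply: emeasurable_funD; exact: emeasurable_funM.
- by move=> x _; rewrite -!EFinM -EFinD lee_fin.
Qed.

Lemma ge0_integral_lt_pinfty_comb : (\int[mu]_x (v x)%:E < +oo)%E -> (\int[mu]_x (w x)%:E < +oo)%E ->
  (\int[mu]_x (u x)%:E < +oo)%E.
Proof.
move=> fv fw; apply: (le_lt_trans ge0_integral_le_comb).
by rewrite lte_add_pinfty // lte_mul_pinfty.
Qed.

End nonnegative_combinations.

(** * Frobenius norms of matrices *)

Section frobenius_norm.
Context {R : realType} {m k : nat}.
Implicit Types A B : 'M[R]_(m, k).

Lemma entry_le_fnorm A i j : `|A i j| <= fnorm A.
Proof.
rewrite -[leLHS]sqrtr_sqr /fnorm; apply: ler_wsqrtr; rewrite (bigD1 i) //= (bigD1 j) //= -addrA lerDl.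
by rewrite addr_ge0 ?sumr_ge0 // => [k' _|i' _]; rewrite ?sqr_ge0 // sumr_ge0 // => j' _; rewrite sqr_ge0.
Qed.

Lemma fnorm_le_sum A : fnorm A <= \sum_i \sum_j `|A i j|.
Proof.
have s0 i : 0 <= \sum_j `|A i j| by exact: sumr_ge0.
rewrite -[leRHS]ger0_norm ?sumr_ge0 // -[leRHS]sqrtr_sqr; apply: ler_wsqrtr.
have sq (I : finType) (x : I -> R) : (forall i, 0 <= x i) -> \sum_i x i ^+ 2 <= (\sum_i x i) ^+ 2.
  move=> x0; rewrite [leRHS]expr2 mulr_suml; apply: ler_sum => i _.
  by rewrite expr2 ler_wpM2l // (bigD1 i) //= lerDl sumr_ge0.
apply: (le_trans _ (sq _ _ s0)); apply: ler_sum => i _.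
apply: (le_trans _ (sq _ _ _)) => //; apply: ler_sum => j _.
by rewrite real_normK ?num_real.
Qed.

Lemma fnorm_le_const A (c : R) : 0 <= c -> (forall i j, `|A i j| <= c) -> fnorm A <= (m * k)%:R * c.
Proof.
move=> c0 h; apply: (le_trans (fnorm_le_sum A)).
apply: (@le_trans _ _ (\sum_(i < m) \sum_(j < k) c)).
  by apply: ler_sum => i _; apply: ler_sum => j _.
by rewrite !sumr_const !card_ord -mulrnA mulr_natl mulnC.
Qed.

Lemma fnormD_le A B : fnorm (A + B) <= (m * k)%:R * (fnorm A + fnorm B).
Proof.
apply: fnorm_le_const => [|i j]; first by rewrite addr_ge0 ?fnorm_ge0.
by rewrite !mxE (le_trans (ler_normD _ _)) // lerD ?entry_le_fnorm.
Qed.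

Lemma fnorm_scale (c : R) A : fnorm (c *: A) = `|c| * fnorm A.
Proof.
rewrite /fnorm -sqrtr_sqr -sqrtrM ?sqr_ge0 //; congr Num.sqrt; rewrite mulr_sumr.
apply: eq_bigr => i _; rewrite mulr_sumr; apply: eq_bigr => j _.
by rewrite mxE exprMn.
Qed.

Lemma fnormD_pow_le (q : R) : 0 <= q -> exists2 K, 0 <= K &
  forall A B, fnorm (A + B) `^ q <= K * (fnorm A `^ q + fnorm B `^ q).
Proof.
move=> q0; exists ((m * k)%:R `^ q * 2 `^ q); first by rewrite mulr_ge0 ?powR_ge0.
move=> A B; have h0 : 0 <= fnorm A + fnorm B by rewrite addr_ge0 ?fnorm_ge0.
apply: (@le_trans _ _ (((m * k)%:R * (fnorm A + fnorm B)) `^ q)).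
  by apply: ge0_ler_powR; rewrite ?nnegrE ?fnorm_ge0 ?mulr_ge0 // fnormD_le.
rewrite powRM // -mulrA ler_wpM2l ?powR_ge0 //.
by apply: powR_add_le; rewrite ?fnorm_ge0.
Qed.

End frobenius_norm.

(** * L^p norms as integrals of powers *)

Section Lebesgue_spaces.
Context {R : realType} {n : nat}.
Let L := leb R n.

Lemma Lp_norm_powR (p : R) m k (f : 'rV[R]_n -> 'M[R]_(m, k)) : 0 < p ->
  (Lp_norm p f `^ p = \int[L]_x (fnorm (f x) `^ p)%:E)%E.
Proof.
move=> p0; rewrite /Lp_norm poweR_Lnorm; last by rewrite gt_eqF.
apply: eq_integral => x _ /=.
by rewrite ger0_norm ?fnorm_ge0.
Qed.

Lemma in_LpP (p : R) m k (f : 'rV[R]_n -> 'M[R]_(m, k)) : 0 < p ->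
  in_Lp p f <-> (forall i j, measurable_fun [set: Leb_space R n] (fun x => f x i j)) /\
                (\int[L]_x (fnorm (f x) `^ p)%:E < +oo)%E.
Proof.
move=> p0; split=> -[mf h]; split => //; first by rewrite -Lp_norm_powR // poweR_lty.
by apply: (@lty_poweRy _ _ p); [rewrite gt_eqF | rewrite Lp_norm_powR].
Qed.

Lemma Lp_norm_vanishing (p : R) m k (f : nat -> 'rV[R]_n -> 'M[R]_(m, k)) : 0 < p ->
  (Lp_norm p (f j) @[j --> \oo] --> 0%E) -> vanishing (fun j => \int[L]_x (fnorm (f j x) `^ p)%:E)%E.
Proof.
move=> p0 /fine_cvgP[hfin hcv] e e0.
have d0 : 0 < e `^ p^-1 by exact: powR_gt0.
have [J1 _ h1] := hfin; have [J2 _ h2] := cvgr_lt _ hcv _ d0.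
exists (maxn J1 J2) => j; rewrite geq_max => /andP[j1 j2].
rewrite -Lp_norm_powR //; have := h1 j j1; have := h2 j j2 => /=.
have : (0 <= Lp_norm p (f j))%E by exact: Lnorm_ge0.
case: (Lp_norm p (f j)) => [r| |] //= r0 rlt _; rewrite lte_fin.
have -> : e = (e `^ p^-1) `^ p by rewrite -powRrM mulVf ?gt_eqF // powRr1 // ltW.
by rewrite gt0_ltr_powR ?nnegrE // ltW.
Qed.

Lemma measurable_fnorm_pow (p : R) m k (f : 'rV[R]_n -> 'M[R]_(m, k)) :
  (forall i j, measurable_fun [set: Leb_space R n] (fun x => f x i j)) ->
  measurable_fun [set: Leb_space R n] (fun x => fnorm (f x) `^ p).
Proof.
move=> mf; apply: (measurableT_comp (measurable_powR p)).
exact: measurable_fnorm mf.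
Qed.

Lemma in_Lp_add (p t : R) m k (f g : 'rV[R]_n -> 'M[R]_(m, k)) : 0 < p ->
  in_Lp p f -> in_Lp p g -> in_Lp p (fun x => f x + t *: g x).
Proof.
move=> p0 /(in_LpP _ p0)[mf If] /(in_LpP _ p0)[mg Ig]; apply: (in_LpP _ p0).2.
have mfg i j : measurable_fun [set: Leb_space R n] (fun x => (f x + t *: g x) i j).
  rewrite (_ : (fun x => _) = (fun x => f x i j + t * g x i j)); last by apply/funext => x; rewrite !mxE.
  exact: (measurable_funD (mf i j) (measurable_funM (measurable_cst t) (mg i j))).
split; first exact: mfg.
have [K K0 hK] := @fnormD_pow_le R m k p (ltW p0).
apply: (@ge0_integral_lt_pinfty_comb _ _ _ L _ _ _ K (K * `|t| `^ p) K0 _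
  (measurable_fnorm_pow p mfg) (measurable_fnorm_pow p mf) (measurable_fnorm_pow p mg) _ _ _ _ If Ig).
- by rewrite mulr_ge0 ?powR_ge0.
- by move=> x; exact: powR_ge0.
- by move=> x; exact: powR_ge0.
- by move=> x; exact: powR_ge0.
- move=> x; apply: (le_trans (hK _ _)).
  by rewrite fnorm_scale powRM ?fnorm_ge0 // mulrDr mulrA.
Qed.

(** [decay] is at most 1, so its [p]-th power lies below [decay] itself, which is integrable. *)
Lemma decay_in_Lp (s p : R) m k (f : 'rV[R]_n -> 'M[R]_(m, k)) : (0 < n)%N -> 0 < s -> 1 <= p ->
  (forall i j, measurable_fun [set: 'rV[R]_n] (fun x => f x i j)) ->
  (forall i j, exists C, forall x, `|f x i j| <= C * decay s x) -> in_Lp p f.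
Proof.
move=> n0 s0 p1 mf hf; have p0 : 0 < p by exact: lt_le_trans p1.
apply: (in_LpP _ p0).2; split; first by move=> i j; exact: measurable_fun_Leb.
have mF : measurable_fun [set: 'rV[R]_n] (fun x => fnorm (f x) `^ p).
  by apply: (measurableT_comp (measurable_powR p)); exact: measurable_fnorm.
rewrite ge0_integral_leb; first last.
- by move=> x; rewrite lee_fin powR_ge0.
- exact/measurable_EFinP.
have [C hC] : exists C, forall x, fnorm (f x) <= C * decay s x.
  have h i : exists C, forall x, \sum_j `|f x i j| <= C * decay s x.
    have [C hC] := choice (hf i); exists (\sum_j C j) => x.
    by rewrite mulr_suml; apply: ler_sum => j _; exact: hC.
  have [C hC] := choice h; exists (\sum_i C i) => x; apply: (le_trans (fnorm_le_sum _)).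
  by rewrite mulr_suml; apply: ler_sum => i _; exact: hC.
have [md dfin] := integrableP _ _ _ (decay_integrable n s0).
have {}md : measurable_fun [set: 'rV[R]_n] (decay s) by exact/measurable_EFinP.
have {}dfin : (\int[borel_lebesgue R n]_x (decay s x)%:E < +oo)%E.
  by move: dfin; under eq_integral do rewrite /= ger0_norm ?decay_ge0 //; exact.
apply: (@ge0_integral_lt_pinfty_comb _ _ _ (borel_lebesgue R n) _ _ _ (`|C| `^ p) 0 _ _ mF md md _ _ _ _ dfin dfin) => //.
- by move=> x; exact: powR_ge0.
- by move=> x; exact: decay_ge0.
- by move=> x; exact: decay_ge0.
move=> x; rewrite mul0r addr0.
apply: (@le_trans _ _ ((`|C| * decay s x) `^ p)).
  apply: ge0_ler_powR; rewrite ?nnegrE ?fnorm_ge0 ?mulr_ge0 ?decay_ge0 ?(ltW p0) //.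
  by apply: (le_trans (hC x)); rewrite ler_wpM2r ?decay_ge0 // ler_norm.
rewrite powRM ?decay_ge0 // ler_wpM2l ?powR_ge0 //.
have [->|d0] := eqVneq (decay s x) 0; first by rewrite powR0 // gt_eqF.
by apply: ge1r_powR => //; rewrite decay_le1 ?ltW // andbT lt_def d0 decay_ge0.
Qed.

End Lebesgue_spaces.

(** * Linear combinations of test functions *)

Section smooth_closure.
Context {R : realType} {n m : nat}.

Lemma Cc_infty_add (f g : 'rV[R]_n -> 'rV[R]_m) (c : R) : Cc_infty f -> Cc_infty g ->
  Cc_infty (fun x => f x + c *: g x).
Proof.
move=> [sf kf] [sg kg]; split.
  have e l : iter_partial l (fun x => f x + c *: g x) = (fun x => iter_partial l f x + c *: iter_partial l g x).
    elim: l => // i l IH; rewrite /= -/(iter_partial l _) IH; apply/funext => x.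
    have df := (sf l).2 i x; have dg := (sg l).2 i x.
    by rewrite -(deriveZ c dg) -(deriveD df (derivableZ dg)).
  move=> l; rewrite e; split.
    by move=> x; exact: (cvgD ((sf l).1 x) (cvgZl_tmp ((sg l).1 x))).
  move=> i x; have df := (sf l).2 i x; have dg := (sg l).2 i x.
  exact: (derivableD df (derivableZ dg)).
apply: (subclosed_compact _ (compactU kf kg)); first exact: closed_closure.
rewrite -closureU; apply: closure_subset => x /=.
have [->|fx] := eqVneq (f x) 0; last by left.
have [->|gx] := eqVneq (g x) 0; last by right.
by rewrite scaler0 addr0 eqxx.
Qed.

End smooth_closure.

(** * Perturbation of a Sobolev function by a test function *)

Section fractional_sobolev_space.
Context {R : realType} {n m : nat} (s p : R).
Hypotheses (n0 : (0 < n)%N) (s0 : 0 < s) (s1 : s < 1) (p1 : 1 < p).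
Let mu := borel_lebesgue R n.
Let L := leb R n.
Let p0 : 0 < p. Proof. exact: lt_trans p1. Qed.
Let c0 : c_frac n s != 0 :> R. Proof. exact: c_frac_neq0. Qed.
Implicit Types (u v : 'rV[R]_n -> 'rV[R]_m) (G : 'rV[R]_n -> 'M[R]_(m, n)).

Lemma Cc_infty_lipc v i : Cc_infty v -> lipschitz_compact (fun x => v x 0 i).
Proof. by move=> /(Cc_infty_C1c i)[M [rho /C1c_lipc h]]; exists (n%:R * M + M), rho. Qed.

Lemma Cc_infty_measurable v i : Cc_infty v -> measurable_fun setT (fun x => v x 0 i).
Proof. by move=> /(Cc_infty_lipc i)[M [rho /lipc_measurable]]. Qed.

Lemma frac_grad_measurable v i j : Cc_infty v -> measurable_fun setT (fun x => frac_grad s v x i j).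
Proof.
move=> hv; rewrite (_ : (fun x => _) = (fun x => c_frac n s * Dop (rkern s 0 j) (fun z => v z 0 i) x)).
  apply: measurable_funM => //; apply: measurable_Dop; first exact: measurable_rkern.
  exact: Cc_infty_measurable.
by apply/funext => x; rewrite frac_gradE.
Qed.

Lemma frac_grad_decay v i j : Cc_infty v -> exists C, forall x, `|frac_grad s v x i j| <= C * decay s x.
Proof.
move=> hv; have [M [rho hl]] := Cc_infty_lipc i hv.
have [C hC] := Dop_decay n0 s0 s1 (rkern_odd_kernel s0 0 j) hl.
exists (`|c_frac n s| * C) => x; rewrite frac_gradE // normrM -mulrA ler_wpM2l //.
Qed.

Lemma Cc_infty_decay v i : Cc_infty v -> exists C, forall x, `|v x 0 i| <= C * decay s x.
Proof.
move=> hv; have [M [rho [r0 vM _ vz]]] := Cc_infty_lipc i hv.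
have M0 : 0 <= M by exact: le_trans (vM 0).
have ns : 0 <= n%:R + s by rewrite addr_ge0 // ltW.
have m1 : 1 <= Num.max 1 rho by rewrite le_max lexx.
have m0 : 0 < Num.max 1 rho by exact: lt_le_trans m1.
(* A lower bound for [decay] on the support. *)
pose d := (Num.max 1 rho) `^ (- (n%:R + s)).
have d0 : 0 < d by exact: powR_gt0.
exists (M / d) => x; have [xr|rx] := ltP `|x| rho; last first.
  by rewrite vz // normr0 !mulr_ge0 ?decay_ge0 ?invr_ge0 ?(ltW d0).
apply: (le_trans (vM x)); rewrite -mulrA ler_peMr // mulrC ler_pdivlMr // mul1r.
rewrite /decay /ind; case: ltP => h.
  have p1' : 1 `^ (- (n%:R + s)) = 1 :> R by rewrite powR1.
  by rewrite mul0r addr0 -[leRHS]p1' powRN_anti.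
rewrite mul1r add0r powRN_anti ?(lt_le_trans ltr01) //.
by rewrite le_max (ltW xr) orbT.
Qed.

Lemma Cc_infty_in_Lp q v : 1 <= q -> Cc_infty v -> in_Lp q v.
Proof.
move=> q1 hv; apply: (decay_in_Lp n0 s0 q1) => i j; rewrite ord1.
  exact: Cc_infty_measurable.
exact: Cc_infty_decay.
Qed.

Lemma frac_grad_in_Lp q v : 1 <= q -> Cc_infty v -> in_Lp q (frac_grad s v).
Proof.
move=> q1 hv; apply: (decay_in_Lp n0 s0 q1) => i j.
  exact: frac_grad_measurable.
exact: frac_grad_decay.
Qed.

Lemma frac_grad_add u v t x : Cc_infty u -> Cc_infty v ->
  frac_grad s (fun z => u z + t *: v z) x = frac_grad s u x + t *: frac_grad s v x.
Proof.
move=> hu hv; apply/matrixP => i j; have huv := Cc_infty_add t hu hv.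
have [M [rho hl]] := Cc_infty_lipc i hu; have [M' [rho' hl']] := Cc_infty_lipc i hv.
rewrite (frac_gradE n0 s0 s1 x i j huv) [RHS]mxE [X in _ = _ + X]mxE.
have eu := frac_gradE n0 s0 s1 x i j hu; have ev := frac_gradE n0 s0 s1 x i j hv.
transitivity (c_frac n s * Dop (rkern s 0 j) (fun z => u z 0 i) x +
    t * (c_frac n s * Dop (rkern s 0 j) (fun z => v z 0 i) x)); last first.
  by apply: (congr2 +%R (esym eu)); exact: (congr1 (fun a => t * a) (esym ev)).
have hK := rkern_odd_kernel s0 0 j.
have htl : lipc (fun x => t * v x 0 i) (`|t| * M') rho'.
  have [r0 a1 a2 a3] := hl'; split => //.
  - by move=> z; rewrite normrM ler_wpM2l.
  - by move=> z y; rewrite -mulrBr normrM -mulrA ler_wpM2l.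
  - by move=> z /a3 ->; rewrite mulr0.
rewrite mulrCA -(DopZ n0 s0 s1 t x hK hl') -mulrDr -(DopD n0 s0 s1 x hK hl htl).
by congr (_ * Dop _ _ _); apply/funext => z; rewrite !mxE.
Qed.

(** The functions [u_ j + t v] approximate [u + t v], and in both norms the contribution of [v]
    cancels exactly, so the original convergence is inherited. *)
Lemma is_frac_grad_add u G v t : is_frac_grad s p u G -> Cc_infty v ->
  is_frac_grad s p (fun x => u x + t *: v x) (fun x => G x + t *: frac_grad s v x).
Proof.
move=> [GLp [u_ hu_ [cu cG]]] hv; split.
  exact: (in_Lp_add t p0 GLp (frac_grad_in_Lp (ltW p1) hv)).
exists (fun j x => u_ j x + t *: v x); first by move=> j; exact: Cc_infty_add.
split.
  rewrite (_ : (fun j => _) = (fun j => Lp_norm p (fun x => u_ j x - u x))) //.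
  apply/funext => j; congr Lp_norm; apply/funext => x.
  by rewrite opprD addrACA subrr addr0.
rewrite (_ : (fun j => _) = (fun j => Lp_norm p (fun x => frac_grad s (u_ j) x - G x))) //.
apply/funext => j; congr Lp_norm; apply/funext => x.
by rewrite frac_grad_add // opprD addrACA subrr addr0.
Qed.

Lemma Hsp_add u v t : Hsp s p u -> Cc_infty v -> Hsp s p (fun x => u x + t *: v x).
Proof.
move=> [uLp [G hG]] hv; split; last by exists (fun x => G x + t *: frac_grad s v x); exact: is_frac_grad_add.
exact: (in_Lp_add t p0 uLp (Cc_infty_in_Lp (ltW p1) hv)).
Qed.

Lemma Hsp_grad_is_frac_grad u : Hsp s p u -> is_frac_grad s p u (Hsp_grad s p u).
Proof. by move=> [_ [G hG]]; rewrite /Hsp_grad; exact: (xgetPex (fun=> 0) (ex_intro _ G hG)). Qed.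

End fractional_sobolev_space.

(** * Almost everywhere limits, Borel representatives and Fatou's lemma *)

Section vanishing_tools.
Context {R : realType}.

Lemma powR_cvg0 (x : nat -> R) q : 0 < q -> (forall k, 0 <= x k) ->
  x k `^ q @[k --> \oo] --> 0 -> x k @[k --> \oo] --> 0.
Proof.
move=> q0 x0 cx; apply/cvgrPdist_lt => e e0; have eq0 : 0 < e `^ q by exact: powR_gt0.
have [J _ hJ] := cvgr_lt _ cx _ eq0; exists J => // k /= /hJ h.
rewrite sub0r normrN ger0_norm //; rewrite ltNge; apply/negP => ex.
by move: h; rewrite ltNge => /negP; apply; apply: ge0_ler_powR; rewrite ?nnegrE ?(ltW q0) ?(ltW e0).
Qed.

Lemma vanishing_comb d (T : measurableType d) (mu : {measure set T -> \bar R}) (f g h : nat -> T -> R) (a b : R) :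
  0 <= a -> 0 <= b ->
  (forall j, measurable_fun setT (f j)) -> (forall j, measurable_fun setT (g j)) ->
  (forall j, measurable_fun setT (h j)) ->
  (forall j x, 0 <= f j x) -> (forall j x, 0 <= g j x) -> (forall j x, 0 <= h j x) ->
  (forall j x, f j x <= a * g j x + b * h j x) ->
  vanishing (fun j => \int[mu]_x (g j x)%:E)%E -> vanishing (fun j => \int[mu]_x (h j x)%:E)%E ->
  vanishing (fun j => \int[mu]_x (f j x)%:E)%E.
Proof.
move=> a0 b0 mf mg mh f0 g0 h0 fgh vg vh.
apply: (vanishing_squeeze (vanishingD (vanishingZ a0 vg) (vanishingZ b0 vh))) => j.
exact: (ge0_integral_le_comb mu a0 b0 (mf j) (mg j) (mh j) (f0 j) (g0 j) (h0 j) (fgh j)).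
Qed.

Lemma powR_dist_cvg d (T : measurableType d) (mu : {measure set T -> \bar R}) (f : nat -> T -> R) (g : T -> R) q :
  0 < q -> (forall j, measurable_fun setT (f j)) -> measurable_fun setT g ->
  vanishing (fun j => \int[mu]_x (`|f j x - g x| `^ q)%:E)%E ->
  exists2 phi : nat -> nat, (forall k, (k <= phi k)%N) & {ae mu, forall x, f (phi k) x @[k --> \oo] --> g x}.
Proof.
move=> q0 mf mg hv.
have mfg j : measurable_fun setT (fun x => `|f j x - g x| `^ q).
  apply: (measurableT_comp (measurable_powR q)); apply: (measurableT_comp (@normr_measurable _ setT)).
  exact: measurable_funB.
have [phi hphi hae] := vanishing_subsequence mfg (fun j x => powR_ge0 _ _) hv.
exists phi => //; apply: filterS hae => x hx; apply/subr_cvg0.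
by apply: norm_cvg0; apply: (powR_cvg0 q0 _ hx).
Qed.

(** The limit [h] is only Lebesgue measurable, whereas closability rests on Fubini for Borel
    functions. The upper limit of an almost everywhere convergent subsequence of Borel functions is
    Borel and agrees with [h] almost everywhere. *)
Lemma borel_representative n (D : nat -> 'rV[R]_n -> R) (h : 'rV[R]_n -> R) q : 0 < q ->
  (forall j, measurable_fun [set: 'rV[R]_n] (D j)) -> measurable_fun [set: Leb_space R n] h ->
  vanishing (fun j => \int[leb R n]_x (`|D j x - h x| `^ q)%:E)%E ->
  exists2 h' : 'rV[R]_n -> R, measurable_fun [set: 'rV[R]_n] h' & {ae leb R n, forall x, h x = h' x}.
Proof.
move=> q0 mD mh hv.
have [phi _ hae] := powR_dist_cvg q0 (fun j => measurable_fun_Leb (mD j)) mh hv.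
exists (fun x => fine (limn_esup (fun k => (D (phi k) x)%:E))).
  apply: measurableT_comp; first exact: fine_measurable.
  apply: (measurable_fun_limn_esup (f := fun k x => (D (phi k) x)%:E)) => k.
  exact/measurable_EFinP.
apply: filterS hae => x hx.
have hx' : (D (phi k) x)%:E @[k --> \oo] --> (h x)%:E by apply: cvg_EFin; [exact: nearW | exact: hx].
by rewrite (cvg_limn_einf_sup hx').2.
Qed.

End vanishing_tools.

Lemma powR_cvg (R : realType) (x : nat -> R) l q : 0 < q -> (forall k, 0 <= x k) ->
  x k @[k --> \oo] --> l -> x k `^ q @[k --> \oo] --> l `^ q.
Proof.
move=> q0 x0 cx.
have : 0 <= l.
  have <- : limn x = l by apply/cvg_lim.
  by apply: limr_ge; [apply/cvg_ex; exists l | exact: nearW].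
rewrite le_eqVlt => /predU1P[l0|l0].
  (* The limit 0 is treated by hand: the power need not be differentiable there. *)
  move: cx; rewrite -l0 powR0 ?gt_eqF // => cx; apply/cvgrPdist_lt => e e0.
  have er : 0 < e `^ q^-1 by exact: powR_gt0.
  have [J _ hJ] := cvgr_lt _ cx _ er; exists J => // k /= /hJ h.
  rewrite sub0r normrN ger0_norm ?powR_ge0 //.
  rewrite -[ltRHS](_ : (e `^ q^-1) `^ q = e); last by rewrite -powRrM mulVf ?gt_eqF // powRr1 // ltW.
  by apply: gt0_ltr_powR; rewrite ?nnegrE // ltW.
have dq : {for l, continuous (fun t : R => t `^ q)}.
  by apply: differentiable_continuous; apply/derivable1_diffP; have [] := is_derive1_powR q l0.
exact: (cvg_comp _ _ cx dq).
Qed.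

Lemma fatou_power (R : realType) d (T : measurableType d) (mu : {measure set T -> \bar R})
    (f : nat -> T -> R) (g : T -> R) (q C : R) (phi : nat -> nat) J : 0 < q ->
  (forall j, measurable_fun setT (f j)) -> measurable_fun setT g ->
  (forall k, (k <= phi k)%N) -> {ae mu, forall x, f (phi k) x @[k --> \oo] --> g x} ->
  (forall j, (J <= j)%N -> (\int[mu]_x (`|f j x| `^ q)%:E <= C%:E)%E) ->
  (\int[mu]_x (`|g x| `^ q)%:E <= C%:E)%E.
Proof.
move=> q0 mf mg hphi hae hC.
have mpow (h : T -> R) : measurable_fun setT h -> measurable_fun setT (fun x : T => (`|h x| `^ q)%:E).
  move=> mh; apply/measurable_EFinP; apply: (measurableT_comp (measurable_powR q)).
  exact: (measurableT_comp (@normr_measurable _ setT)).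
(* The shift by [J] makes the bound hold from the first term on, since [phi (k + J)] is at least
   [J]. *)
pose F k x := (`|f (phi (k + J)%N) x| `^ q)%:E.
have mF k : measurable_fun setT (F k) by exact: mpow.
have F0 k x : setT x -> (0 <= F k x)%E by move=> _; rewrite lee_fin powR_ge0.
have := fatou mu measurableT mF F0.
have -> : (\int[mu]_x limn_einf (F^~ x) = \int[mu]_x (`|g x| `^ q)%:E)%E.
  apply: ae_eq_integral; [exact: measurableT | | exact: mpow |].
    rewrite (_ : (fun x => _) = (fun x => - limn_esup (fun k => - F k x))%E); last first.
      apply/funext => x; have := limn_esupN (F^~ x); rewrite /comp => ->; rewrite oppeK //.
    apply: measurableT_comp; first exact: oppe_measurable.
    apply: (measurable_fun_limn_esup (f := fun k x => (- F k x)%E)) => k.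
    by apply: measurableT_comp (mF k); exact: oppe_measurable.
  apply: filterS hae => x hx _.
  have c1 : f (phi (k + J)%N) x @[k --> \oo] --> g x.
    by have := cvg_shiftn J (fun k => f (phi k) x) (nbhs (g x)) => /= ->.
  have c2 : `|f (phi (k + J)%N) x| `^ q @[k --> \oo] --> `|g x| `^ q.
    by apply: (powR_cvg q0) => [k|]; [exact: normr_ge0 | exact: cvg_norm].
  have c3 : F k x @[k --> \oo] --> (`|g x| `^ q)%:E by apply: cvg_EFin; [exact: nearW | exact: c2].
  by rewrite (cvg_limn_einf_sup c3).1.
move/le_trans; apply; rewrite limn_einf_lim; apply: lime_le; first exact: is_cvg_einfs.
apply: nearW => k; apply: (@le_trans _ _ (\int[mu]_x F k x)%E).
  by apply: ereal_inf_lbound; exists k => /=.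
by apply: hC; apply: leq_trans (hphi _); exact: leq_addl.
Qed.

(** * Consequences of almost everywhere statements *)

Section almost_everywhere_tools.
Context d (T : measurableType d) (R : realType) (mu : {measure set T -> \bar R}).

Lemma ae_imp (P Q : T -> Prop) : (forall x, P x -> Q x) ->
  {ae mu, forall x, P x} -> {ae mu, forall x, Q x}.
Proof. by move=> PQ; exact: filterS. Qed.

Lemma ae_imp2 (P Q S : T -> Prop) : (forall x, P x -> Q x -> S x) ->
  {ae mu, forall x, P x} -> {ae mu, forall x, Q x} -> {ae mu, forall x, S x}.
Proof. by move=> PQ; exact: filterS2. Qed.

End almost_everywhere_tools.

(** * Uniqueness of the fractional gradient, and the embedding of the Sobolev space *)

Section fractional_sobolev_theory.
Context {R : realType} {n m : nat} (s p : R).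
Hypotheses (n0 : (0 < n)%N) (s0 : 0 < s) (s1 : s < 1) (p1 : 1 < p).
Local Notation mu := (borel_lebesgue R n).
Local Notation L := (leb R n).
Let p0 : 0 < p. Proof. exact: lt_trans p1. Qed.
Let p0' : 0 <= p. Proof. exact: ltW. Qed.
Let c0 : c_frac n s != 0 :> R. Proof. exact: c_frac_neq0. Qed.
Implicit Types (u v : 'rV[R]_n -> 'rV[R]_m) (G : 'rV[R]_n -> 'M[R]_(m, n)).

Let measurable_diff_pow m' k (f g : 'rV[R]_n -> 'M[R]_(m', k)) :
  (forall i j, measurable_fun [set: Leb_space R n] (fun x => f x i j)) ->
  (forall i j, measurable_fun [set: Leb_space R n] (fun x => g x i j)) ->
  measurable_fun [set: Leb_space R n] (fun x => fnorm (f x - g x) `^ p).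
Proof.
move=> mf mg; apply: measurable_fnorm_pow => i j.
rewrite (_ : (fun x => _) = (fun x => f x i j - g x i j)); last by apply/funext => x; rewrite !mxE.
exact: (measurable_funB (mf i j) (mg i j)).
Qed.

Let Leb_entry v i j : Cc_infty v -> measurable_fun [set: Leb_space R n] (fun x => v x i j).
Proof. by move=> hv; rewrite (ord1 i); exact: measurable_fun_Leb (Cc_infty_measurable j hv). Qed.

Let Cc_entry v i j : Cc_infty v -> measurable_fun [set: 'rV[R]_n] (fun x => v x i j).
Proof. by move=> hv; rewrite (ord1 i); exact: Cc_infty_measurable. Qed.

Let Leb_frac v i j : Cc_infty v -> measurable_fun [set: Leb_space R n] (fun x => frac_grad s v x i j).
Proof. by move=> hv; exact: measurable_fun_Leb (frac_grad_measurable n0 s0 s1 i j hv). Qed.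

Let Dop_frac_grad v i j x : Cc_infty v ->
  Dop (rkern s 0 j) (fun z => v z 0 i) x = (c_frac n s)^-1 * frac_grad s v x i j.
Proof. by move=> hv; rewrite (frac_gradE n0 s0 s1 x i j hv) mulKf. Qed.

Let dist_pow_le (a b c d q : R) : 0 <= q -> `|c| <= a -> `|d| <= b ->
  `|c - d| `^ q <= 2 `^ q * a `^ q + 2 `^ q * b `^ q.
Proof.
move=> q0 ca db; have a0 : 0 <= a by exact: le_trans ca. have b0 : 0 <= b by exact: le_trans db.
rewrite -mulrDr; apply: le_trans (powR_add_le a0 b0 q0).
apply: ge0_ler_powR; rewrite ?nnegrE ?addr_ge0 //.
by rewrite (le_trans (ler_normB _ _)) // lerD.
Qed.

(** Closability is applied to each entry of the difference of two approximating sequences. The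
    result identifies the representative chosen at [u + t v] with the one at [u] plus [t] times the
    gradient of [v]. *)
Lemma is_frac_grad_unique u G1 G2 : in_Lp p u -> is_frac_grad s p u G1 -> is_frac_grad s p u G2 ->
  {ae leb R n, forall x, G1 x = G2 x}.
Proof.
move=> /(in_LpP _ p0)[mu_ _] [/(in_LpP _ p0)[mG1 _] [u1 hu1 [cu1 cG1]]] [/(in_LpP _ p0)[mG2 _] [u2 hu2 [cu2 cG2]]].
have {cu1} vu1 := Lp_norm_vanishing p0 cu1; have {cu2} vu2 := Lp_norm_vanishing p0 cu2.
have {cG1} vG1 := Lp_norm_vanishing p0 cG1; have {cG2} vG2 := Lp_norm_vanishing p0 cG2.
pose W j x := u1 j x + (-1) *: u2 j x.
have hW j : Cc_infty (W j) by exact: Cc_infty_add (hu1 j) (hu2 j).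
suff h i k : {ae L, forall x, (G1 x - G2 x) i k = 0}.
  have H : {ae L, forall x, forall i k, (G1 x - G2 x) i k = 0}.
    by apply: filter_forall => i; apply: filter_forall => k; exact: h.
  apply: negligibleS H => x /= nx hx; apply: nx; apply/subr0_eq/matrixP => i k.
  by rewrite hx mxE.
pose w j x := W j x 0 i.
pose D j x := Dop (rkern s 0 k) (w j) x.
(* Divided by the constant of [frac_grad], so that [h] is the limit of the singular integrals [D j]
   themselves. *)
pose h x := (c_frac n s)^-1 * (G1 x - G2 x) i k.
have mw j : measurable_fun setT (w j) by exact: Cc_infty_measurable.
have mD j : measurable_fun setT (D j) by apply: measurable_Dop => //; exact: measurable_rkern.
have mh : measurable_fun [set: Leb_space R n] h.
  rewrite (_ : h = (fun x => (c_frac n s)^-1 * (G1 x i k - G2 x i k))); last by apply/funext => x; rewrite /h !mxE.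
  exact: (measurable_funM (measurable_cst _) (measurable_funB (mG1 i k) (mG2 i k))).
have tp : 0 <= 2 `^ p :> R by exact: powR_ge0.
have vw : vanishing (fun j => \int[L]_x (`|w j x| `^ p)%:E)%E.
  apply: (@vanishing_comb _ _ _ L (fun j x => `|w j x| `^ p) (fun j x => fnorm (u1 j x - u x) `^ p)
    (fun j x => fnorm (u2 j x - u x) `^ p) (2 `^ p) (2 `^ p) tp tp _ _ _ _ _ _ _ vu1 vu2).
  - move=> j; apply: (measurableT_comp (measurable_powR p)); apply: (measurableT_comp (@normr_measurable _ setT)).
    exact: measurable_fun_Leb (mw j).
  - move=> j; exact: (measurable_diff_pow (fun i' j' => Leb_entry i' j' (hu1 j)) mu_).
  - move=> j; exact: (measurable_diff_pow (fun i' j' => Leb_entry i' j' (hu2 j)) mu_).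
  - by move=> j x; exact: powR_ge0.
  - by move=> j x; exact: powR_ge0.
  - by move=> j x; exact: powR_ge0.
  - move=> j x; have -> : w j x = (u1 j x - u x) 0 i - (u2 j x - u x) 0 i by rewrite /w /W !mxE; ring.
    by apply: dist_pow_le => //; exact: entry_le_fnorm.
have vD : vanishing (fun j => \int[L]_x (`|D j x - h x| `^ p)%:E)%E.
  have cp : 0 <= `|(c_frac n s)^-1| `^ p * 2 `^ p by rewrite mulr_ge0 ?powR_ge0.
  apply: (@vanishing_comb _ _ _ L (fun j x => `|D j x - h x| `^ p) (fun j x => fnorm (frac_grad s (u1 j) x - G1 x) `^ p)
    (fun j x => fnorm (frac_grad s (u2 j) x - G2 x) `^ p) _ _ cp cp _ _ _ _ _ _ _ vG1 vG2).
  - move=> j; apply: (measurableT_comp (measurable_powR p)); apply: (measurableT_comp (@normr_measurable _ setT)).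
    exact: (measurable_funB (measurable_fun_Leb (mD j)) mh).
  - move=> j; exact: (measurable_diff_pow (fun i' j' => Leb_frac i' j' (hu1 j)) mG1).
  - move=> j; exact: (measurable_diff_pow (fun i' j' => Leb_frac i' j' (hu2 j)) mG2).
  - by move=> j x; exact: powR_ge0.
  - by move=> j x; exact: powR_ge0.
  - by move=> j x; exact: powR_ge0.
  - move=> j x.
    have -> : D j x - h x = (c_frac n s)^-1 * ((frac_grad s (u1 j) x - G1 x) i k - (frac_grad s (u2 j) x - G2 x) i k).
      rewrite /D Dop_frac_grad // /h /W (frac_grad_add n0 s0 s1 (-1) x (hu1 j) (hu2 j)) -mulrBr; congr (_ * _).
      by move: (frac_grad s (u1 j) x) (frac_grad s (u2 j) x) => A B; rewrite !mxE; ring.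
    rewrite normrM powRM // -!mulrA -mulrDr ler_wpM2l ?powR_ge0 //.
    by apply: dist_pow_le => //; exact: entry_le_fnorm.
have [h' mh' hh'] := borel_representative p0 mD mh vD.
have v1 : vanishing (fun j => \int[mu]_x (`|w j x| `^ p)%:E)%E.
  apply: (vanishing_squeeze vw) => j.
  have mwj : measurable_fun setT (fun x => (`|w j x| `^ p)%:E).
    apply/measurable_EFinP; apply: (measurableT_comp (measurable_powR p)).
    exact: (measurableT_comp (@normr_measurable _ setT)).
  by rewrite (ge0_integral_leb mwj) // => x; rewrite lee_fin powR_ge0.
have v2 : vanishing (fun j => \int[mu]_x (`|D j x - h' x| `^ p)%:E)%E.
  apply: (vanishing_squeeze vD) => j.
  have mDh : measurable_fun setT (fun x => (`|D j x - h' x| `^ p)%:E).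
    apply/measurable_EFinP; apply: (measurableT_comp (measurable_powR p)).
    apply: (measurableT_comp (@normr_measurable _ setT)); exact: measurable_funB.
  rewrite -(ge0_integral_leb mDh); last by move=> x; rewrite lee_fin powR_ge0.
  rewrite le_eqVlt; apply/orP; left; apply/eqP; apply: ae_eq_integral.
  - exact: measurableT.
  - exact: measurable_fun_Leb mDh.
  - apply/measurable_EFinP; apply: (measurableT_comp (measurable_powR p)).
    apply: (measurableT_comp (@normr_measurable _ setT)).
    exact: (measurable_funB (measurable_fun_Leb (mD j)) mh).
  - by apply: ae_imp hh' => x e _; rewrite e.
have z := Dop_closable n0 s0 s1 (ltW p1) (rkern_odd_kernel s0 0 k) (fun j => Cc_infty_lipc i (hW j)) mh' v1 v2.
apply: ae_imp2 hh' (ae_borel_leb z) => x e1 e2.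
have : h x = 0 by rewrite e1 e2.
by rewrite /h => /eqP; rewrite mulf_eq0 invr_eq0 (negbTE c0) /= => /eqP.
Qed.

(** From some index on, the approximating test functions and their gradients are bounded in L^p,
    hence the functions are bounded in L^q by [sobolev_embedding]. Fatou's lemma carries this bound
    to [u] along an almost everywhere convergent subsequence. *)
Lemma Hsp_embedding u q : Hsp s p u -> p <= q ->
  (s * p < n%:R -> q <= n%:R * p / (n%:R - s * p)) ->
  (\int[leb R n]_x (fnorm (u x) `^ q)%:E < +oo)%E.
Proof.
move=> [/(in_LpP _ p0)[mu_ Iu] [G [/(in_LpP _ p0)[mG IG] [u1 hu1 [cu cG]]]]] pq hq.
have q0 : 0 < q by exact: lt_le_trans pq.
have {cu} vu := Lp_norm_vanishing p0 cu; have {cG} vG := Lp_norm_vanishing p0 cG.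
have tp : 0 <= 2 `^ p :> R by exact: powR_ge0.
have mpow r (f : 'rV[R]_n -> R) : measurable_fun setT f -> measurable_fun setT (fun x => (`|f x| `^ r)%:E).
  move=> mf; apply/measurable_EFinP; apply: (measurableT_comp (measurable_powR r)).
  exact: (measurableT_comp (@normr_measurable _ setT)).
(* For arbitrary matrix sizes, so as to serve both the functions and their gradients; from the index
   [J] on, the integral of the [p]-th power of the distance to the limit is below 1. *)
have entry_bound m' k (f : nat -> 'rV[R]_n -> 'M[R]_(m', k)) (g : 'rV[R]_n -> 'M[R]_(m', k)) i j :
    (forall l i j, measurable_fun setT (fun x => f l x i j)) ->
    (forall i j, measurable_fun [set: Leb_space R n] (fun x => g x i j)) ->
    vanishing (fun l => \int[L]_x (fnorm (f l x - g x) `^ p)%:E)%E ->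
    (\int[L]_x (fnorm (g x) `^ p)%:E < +oo)%E ->
    exists2 A : R, 0 <= A & exists J, forall l, (J <= l)%N -> (\int[mu]_x (`|f l x i j| `^ p)%:E <= A%:E)%E.
  move=> mf mg vf Ig; set B := (\int[L]_x (fnorm (g x) `^ p)%:E)%E in Ig.
  have B0 : (0 <= B)%E by apply: integral_ge0 => x _; rewrite lee_fin powR_ge0.
  have Bf : B \is a fin_num by rewrite ge0_fin_numE.
  have [J hJ] := vf 1 ltr01.
  exists (2 `^ p * 1 + 2 `^ p * fine B); first by rewrite addr_ge0 ?mulr_ge0 ?fine_ge0.
  exists J => l /hJ h.
  rewrite -(ge0_integral_leb (mpow p _ (mf l i j))); last by move=> x; rewrite lee_fin powR_ge0.
  have mL : measurable_fun [set: Leb_space R n] (fun x => (`|f l x i j| `^ p)%:E) by exact: measurable_fun_Leb (mpow p _ (mf l i j)).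
  have md : measurable_fun [set: Leb_space R n] (fun x => fnorm (f l x - g x) `^ p).
    apply: measurable_fnorm_pow => i' j'.
    rewrite (_ : (fun x => _) = (fun x => f l x i' j' - g x i' j')); last by apply/funext => x; rewrite !mxE.
    exact: (measurable_funB (measurable_fun_Leb (mf l i' j')) (mg i' j')).
  have mgp := measurable_fnorm_pow p mg.
  have pos1 (x : Leb_space R n) : 0 <= fnorm (f l x - g x) `^ p by exact: powR_ge0.
  have pos2 (x : Leb_space R n) : 0 <= fnorm (g x) `^ p by exact: powR_ge0.
  apply: (@le_trans _ _ ((2 `^ p)%:E * \int[L]_x (fnorm (f l x - g x) `^ p)%:E + (2 `^ p)%:E * B)%E); last first.
    rewrite EFinD; apply: leeD; rewrite EFinM; first by apply: lee_wpmul2l; [rewrite lee_fin | exact: ltW].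
    by rewrite fineK.
  apply: (ge0_integral_le_comb _ tp tp _ md mgp _ pos1 pos2).
  - by move/measurable_EFinP : mL.
  - by move=> x; exact: powR_ge0.
  move=> x; have -> : f l x i j = (f l x - g x) i j - (- g x) i j by rewrite !mxE; ring.
  by apply: dist_pow_le => //; [exact: entry_le_fnorm | rewrite mxE normrN; exact: entry_le_fnorm].
have comp_bound i : (\int[L]_x (`|u x 0 i| `^ q)%:E < +oo)%E.
  have [A A0 [J hJ]] := entry_bound 1 m u1 u 0 i (fun l i j => Cc_entry i j (hu1 l)) mu_ vu Iu.
  have hG k : exists A', 0 <= A' /\ exists J', forall l, (J' <= l)%N ->
      (\int[mu]_x (`|frac_grad s (u1 l) x i k| `^ p)%:E <= A'%:E)%E.
    have [A' h1 h2] := entry_bound m n (fun l => frac_grad s (u1 l)) G i k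
      (fun l i j => frac_grad_measurable n0 s0 s1 i j (hu1 l)) mG vG IG.
    by exists A'.
  have [A' hA'] := choice hG.
  have [J' hJ'] := choice (fun k => (hA' k).2).
  pose c := `|(c_frac n s)^-1| `^ p.
  have cc0 : 0 <= c by exact: powR_ge0.
  (* One bound for the component and for all its singular integrals, as [sobolev_embedding] asks;
     the factor [c] undoes the constant in [frac_grad]. *)
  pose B := A + \sum_k c * A' k.
  have S0 : 0 <= \sum_k c * A' k by apply: sumr_ge0 => k _; rewrite mulr_ge0 // (hA' k).1.
  have B0 : 0 <= B by rewrite addr_ge0.
  have [C hC] := sobolev_embedding n0 s0 s1 p1 pq hq B0.
  pose J0 := maxn J (\max_k J' k).
  have bnd l : (J0 <= l)%N -> (\int[mu]_x (`|u1 l x 0 i| `^ q)%:E <= C%:E)%E.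
    rewrite geq_max => /andP[Jl J'l]; have [M [rho hf]] := Cc_infty_C1c i (hu1 l).
    apply: (hC _ _ _ _ hf).
      by apply: (le_trans (hJ l Jl)); rewrite lee_fin lerDl.
    move=> k; have kl : (J' k <= l)%N by apply: leq_trans J'l; exact: leq_bigmax.
    apply: (@le_trans _ _ (c * A' k)%:E); last first.
      rewrite lee_fin /B (bigD1 k) //= addrCA lerDl addr_ge0 //.
      by apply: sumr_ge0 => k' _; rewrite mulr_ge0 // (hA' k').1.
    have mfr := mpow p _ (frac_grad_measurable n0 s0 s1 i k (hu1 l)).
    rewrite EFinM; apply: le_trans (lee_wpmul2l _ (hJ' k l kl)); last by rewrite lee_fin.
    rewrite -(ge0_integralZl_EFin mu measurableT (fun x _ => powR_ge0 _ _ : (0 <= (_ `^ _)%:E)%E) mfr cc0).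
    rewrite le_eqVlt; apply/orP; left; apply/eqP; apply: eq_integral => x _.
    by rewrite Dop_frac_grad // normrM powRM // EFinM.
  have vi : vanishing (fun l => \int[L]_x (`|u1 l x 0 i - u x 0 i| `^ p)%:E)%E.
    have z0 : 0 <= 0 :> R by [].
    have md l := measurable_diff_pow (fun i' j' => Leb_entry i' j' (hu1 l)) mu_.
    apply: (@vanishing_comb _ _ _ L (fun l x => `|u1 l x 0 i - u x 0 i| `^ p) (fun l x => fnorm (u1 l x - u x) `^ p)
      (fun l x => fnorm (u1 l x - u x) `^ p) 1 0 ler01 z0 _ md md _ _ _ _ vu vu).
    - move=> l; apply: (measurableT_comp (measurable_powR p)); apply: (measurableT_comp (@normr_measurable _ setT)).
      exact: (measurable_funB (Leb_entry 0 i (hu1 l)) (mu_ 0 i)).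
    - by move=> l x; exact: powR_ge0.
    - by move=> l x; exact: powR_ge0.
    - by move=> l x; exact: powR_ge0.
    - move=> l x; rewrite mul1r mul0r addr0; apply: ge0_ler_powR; rewrite ?nnegrE ?fnorm_ge0 //.
      by have := entry_le_fnorm (u1 l x - u x) 0 i; rewrite !mxE.
  have [phi hphi hae] := powR_dist_cvg p0 (fun l => Leb_entry 0 i (hu1 l)) (mu_ 0 i) vi.
  apply: (@le_lt_trans _ _ C%:E); last exact: ltry.
  apply: (fatou_power (J := J0) q0 (fun l => Leb_entry 0 i (hu1 l)) (mu_ 0 i) hphi hae) => j Jj.
  rewrite ge0_integral_leb; [exact: bnd | exact: mpow (Cc_infty_measurable i (hu1 j)) |].
  by move=> x; rewrite lee_fin powR_ge0.
have [K K0 hK] := @powR_sum_le R 'I_m (index_enum 'I_m) q q0.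
have mcomp i : measurable_fun [set: Leb_space R n] (fun x => (`|u x 0 i| `^ q)%:E).
  apply/measurable_EFinP; apply: (measurableT_comp (measurable_powR q)).
  exact: (measurableT_comp (@normr_measurable _ setT) (mu_ 0 i)).
have comp0 i (x : Leb_space R n) : setT x -> (0 <= (`|u x 0 i| `^ q)%:E)%E by move=> _; rewrite lee_fin powR_ge0.
apply: (@le_lt_trans _ _ (\int[L]_x (K%:E * \sum_i (`|u x 0 i| `^ q)%:E))%E).
  apply: ge0_le_integral.
  - exact: measurableT.
  - by move=> x _; rewrite lee_fin powR_ge0.
  - by apply/measurable_EFinP; exact: measurable_fnorm_pow.
  - by apply: emeasurable_funM; [exact: measurable_cst | exact: emeasurable_sum].
  move=> x _; rewrite sumEFin -EFinM lee_fin.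
  apply: (le_trans _ (hK (fun i => `|u x 0 i|) (fun i => normr_ge0 _))).
  apply: ge0_ler_powR; rewrite ?nnegrE ?fnorm_ge0 ?(ltW q0) ?sumr_ge0 //.
  by have := fnorm_le_sum (u x); rewrite big_ord1.
rewrite ge0_integralZl_EFin; first last.
- exact: K0.
- exact: emeasurable_sum.
- by move=> x _; rewrite sumEFin lee_fin sumr_ge0 // => i _; exact: powR_ge0.
- exact: measurableT.
rewrite lte_mul_pinfty //.
rewrite ge0_integral_sum; [| exact: measurableT | exact: mcomp | exact: comp0].
by apply: lte_sum_pinfty => i _; exact: comp_bound.
Qed.

End fractional_sobolev_theory.

(** * Derivatives of functions of a vector and a matrix *)

Section product_derivative.
Context {R : realType} {a b c d : nat}.
Implicit Types (f : 'M[R]_(a, b) * 'M[R]_(c, d) -> R) (z w : 'M[R]_(a, b) * 'M[R]_(c, d)).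

Lemma linear_matrix_expansion a' b' (h : 'M[R]_(a', b') -> R) (v : 'M[R]_(a', b')) :
  {morph h : x y / x + y} -> (forall t x, h (t *: x) = t * h x) ->
  h v = \sum_i \sum_j h (delta_mx i j) * v i j.
Proof.
move=> hD hZ; have h0 : h 0 = 0 by have := hZ 0 0; rewrite scale0r mul0r.
rewrite {1}(matrix_sum_delta v) (big_morph h hD h0); apply: eq_bigr => i _.
rewrite (big_morph h hD h0); apply: eq_bigr => j _.
by rewrite hZ mulrC.
Qed.

Lemma derive_fst f z v : 'D_(v, 0) f z = 'D_v (fun y => f (y, z.2)) z.1.
Proof.
rewrite /derive.
suff -> : (fun h : R => h^-1 *: ((f \o shift z) (h *: (v, 0)) - f z)) =
    (fun h : R => h^-1 *: (((fun y => f (y, z.2)) \o shift z.1) (h *: v) - f (z.1, z.2))) by [].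
apply/funext => t; case: z => z1 z2 /=.
rewrite -[t *: (v, 0) + _]/(t *: v + z1, t *: 0 + z2); by rewrite scaler0 add0r.
Qed.

Lemma derive_snd f z v : 'D_(0, v) f z = 'D_v (fun y => f (z.1, y)) z.2.
Proof.
rewrite /derive.
suff -> : (fun h : R => h^-1 *: ((f \o shift z) (h *: (0, v)) - f z)) =
    (fun h : R => h^-1 *: (((fun y => f (z.1, y)) \o shift z.2) (h *: v) - f (z.1, z.2))) by [].
apply/funext => t; case: z => z1 z2 /=.
rewrite -[t *: (0, v) + _]/(t *: 0 + z1, t *: v + z2); by rewrite scaler0 add0r.
Qed.

(** The differential is linear, so the direction splits into its two blocks, and each block into
    matrix units. *)
Lemma derive_prod f z w : differentiable f z ->
  'D_w f z = fdot (gradient (fun y => f (y, z.2)) z.1) w.1 +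
             fdot (gradient (fun y => f (z.1, y)) z.2) w.2.
Proof.
move=> df; rewrite deriveE //.
have -> : w = (w.1, 0) + (0, w.2) by case: w => v A; rewrite /=; congr (_, _); rewrite ?addr0 ?add0r.
rewrite linearD /= addr0 add0r; congr (_ + _).
  rewrite (linear_matrix_expansion (h := fun y => 'd f z (y, 0))).
  - apply: eq_bigr => i _; apply: eq_bigr => j _; rewrite mxE -deriveE //.
    by rewrite derive_fst.
  - move=> x y; rewrite -linearD; congr ('d f z _); congr (_, _); by rewrite addr0.
  - by move=> t x; rewrite -[RHS]/(t *: _) -linearZ; congr ('d f z _); congr (_, _); rewrite scaler0.
rewrite (linear_matrix_expansion (h := fun y => 'd f z (0, y))).
- apply: eq_bigr => i _; apply: eq_bigr => j _; rewrite mxE -deriveE //.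
  by rewrite derive_snd.
- move=> x y; rewrite -linearD; congr ('d f z _); congr (_, _); by rewrite addr0.
- by move=> t x; rewrite -[RHS]/(t *: _) -linearZ; congr ('d f z _); congr (_, _); rewrite scaler0.
Qed.

Lemma fdot_le_fnorm a' b' (B A : 'M[R]_(a', b')) M : (forall i j, `|A i j| <= M) ->
  `|fdot B A| <= (a' * b')%:R * M * fnorm B.
Proof.
move=> hM; apply: (le_trans (ler_norm_sum _ _ _)).
apply: (@le_trans _ _ (\sum_(i < a') \sum_(j < b') M * fnorm B)).
  apply: ler_sum => i _; apply: (le_trans (ler_norm_sum _ _ _)); apply: ler_sum => j _.
  rewrite normrM mulrC; apply: ler_pM => //; exact: entry_le_fnorm.
by rewrite big_const_ord iter_addr_0 big_const_ord iter_addr_0 -mulrnA [(b' * a')%N]mulnC -mulrA mulr_natl.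
Qed.

End product_derivative.

(** * Increments along a direction *)

Section directional_increment.
Context {R : realType} {n : nat}.
Variable f : 'rV[R]_n -> 'M[R]_n -> R.
Hypothesis f_C1 : C1 (fun z : 'rV[R]_n * 'M[R]_n => f z.1 z.2).
Implicit Types (y v : 'rV[R]_n) (F A : 'M[R]_n).

Definition dir_derivative y F v A : R :=
  fdot (gradient (f y) F) A + fdot (gradient (f^~ F) y) v.

Lemma is_derive_dir y F v A (t : R) :
  is_derive t 1 (fun r => f (y + r *: v) (F + r *: A))
    (dir_derivative (y + t *: v) (F + t *: A) v A).
Proof.
pose h (z : 'rV[R]_n * 'M[R]_n) := f z.1 z.2.
have dh : differentiable h ((y, F) + t *: (v, A)) by exact: f_C1.1.
apply: (@is_derive_line _ _ h (y, F) (v, A)).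
split; first exact: diff_derivable.
by rewrite (derive_prod (v, A) dh) /dir_derivative addrC.
Qed.

(** The mean value theorem on the segment, with the growth bound evaluated at an intermediate
    parameter [r]. That parameter varies with the arguments, so the application has to bound the
    result uniformly in [r]. The number [n + n * n] counts the entries of [v] and [A]. *)
Lemma increment_le y F v A (M C a : R) (alpha p : R) (t : R) : 0 <= a -> 0 <= C -> 0 <= M ->
  (forall y' F', `|f y' F'| + fnorm (gradient (f^~ F') y') + fnorm (gradient (f y') F') <=
     a + C * (fnorm y' `^ alpha + fnorm F' `^ p)) ->
  (forall i, `|v 0 i| <= M) -> (forall i j, `|A i j| <= M) ->
  exists2 r, 0 <= r <= 1 & `|f (y + t *: v) (F + t *: A) - f y F| <= `|t| * ((n + n * n)%:R * M *
    (a + C * (fnorm (y + r *: (t *: v)) `^ alpha + fnorm (F + r *: (t *: A)) `^ p))).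
Proof.
move=> a0 C0 M0 hg hv hA.
pose g (r : R) := f (y + r *: (t *: v)) (F + r *: (t *: A)).
have dg r : is_derive r (1 : R) g _ := is_derive_dir y F (t *: v) (t *: A) r.
have cg : continuous g by move=> r; apply: differentiable_continuous; apply/derivable1_diffP; have [] := dg r.
have [r r01 e] := @MVT_segment R g _ 0 1 ler01 (fun r _ => dg r) (continuous_subspaceT cg).
exists r; first by move: r01; rewrite in_itv.
move: e; rewrite /g !scale1r !scale0r !addr0 subr0 mulr1 => ->.
set y' := y + _; set F' := F + _.
have -> : dir_derivative y' F' (t *: v) (t *: A) = t * dir_derivative y' F' v A.
  rewrite /dir_derivative mulrDr /fdot !mulr_sumr; congr (_ + _); apply: eq_bigr => i _;
    rewrite mulr_sumr; apply: eq_bigr => j _; rewrite !mxE mulrCA //.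
rewrite normrM ler_wpM2l // (le_trans (ler_normD _ _)) //.
apply: (@le_trans _ _ ((n + n * n)%:R * M * (fnorm (gradient (f^~ F') y') + fnorm (gradient (f y') F')))); last first.
  rewrite ler_wpM2l ?mulr_ge0 //; apply: le_trans (hg y' F'); by rewrite -addrA lerDr.
rewrite mulrDr addrC; apply: lerD.
  have hv' i j : `|v i j| <= M by rewrite (ord1 i).
  apply: (le_trans (fdot_le_fnorm _ hv')).
  by rewrite ler_wpM2r ?fnorm_ge0 // ler_wpM2r // ler_nat mul1n leq_addr.
apply: (le_trans (fdot_le_fnorm _ hA)).
by rewrite ler_wpM2r ?fnorm_ge0 // ler_wpM2r // ler_nat leq_addl.
Qed.

End directional_increment.

(** * First variation of a family of integrals at a minimum *)

Section first_variation.
Context d (T : measurableType d) (R : realType) (mu : {measure set T -> \bar R}).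
Variables (E : R -> T -> R) (h dom : T -> R).
Hypotheses (mE : forall t, measurable_fun setT (E t))
  (idom : mu.-integrable setT (EFin \o dom)) (iE0 : mu.-integrable setT (EFin \o E 0))
  (E_lip : forall t x, `|t| <= 1 -> `|E t x - E 0 x| <= `|t| * dom x)
  (dE : forall x, is_derive (0 : R) (1 : R) (E^~ x) (h x))
  (E_min : forall t, `|t| <= 1 -> (\int[mu]_x (E 0 x)%:E <= \int[mu]_x (E t x)%:E)%E).

(** The sign [e = 1] or [e = -1] selects the side from which 0 is approached; all steps stay in the
    range [|t| <= 1] of the hypotheses. *)
Let step (e : R) k : R := e / k.+1%:R.
Let quot e k x := (step e k)^-1 * (E (step e k) x - E 0 x).

Let step_neq0 e k : `|e| = 1 -> step e k != 0.
Proof. by move=> e1; rewrite mulf_eq0 invr_eq0 pnatr_eq0 orbF -normr_eq0 e1 oner_eq0. Qed.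

Let step_le1 e k : `|e| = 1 -> `|step e k| <= 1.
Proof. by move=> e1; rewrite normrM e1 mul1r ger0_norm ?invf_le1 // ler1n. Qed.

Let quot_cvg e x : `|e| = 1 -> quot e k x @[k --> \oo] --> h x.
Proof.
move=> e1; have [de <-] := dE x.
have /cvgr_dnbhsP/(_ (step e)) := de.
have s0 : step e k @[k --> \oo] --> (0 : R).
  by rewrite -(mulr0 e); apply: cvgMr; exact: cvg_harmonic.
move=> /(_ (conj (fun k => step_neq0 k e1) s0)); apply: cvg_trans.
apply: near_eq_cvg; apply: nearW => k; rewrite /quot /=.
by rewrite addr0 [(step e k)%:A]mulr1.
Qed.

Let quot_le e k x : `|e| = 1 -> `|quot e k x| <= dom x.
Proof.
move=> e1; rewrite normrM normfV ler_pdivrMl ?normr_gt0 ?step_neq0 //.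
exact: (E_lip x (step_le1 k e1)).
Qed.

Let mquot e k : measurable_fun setT (quot e k).
Proof. exact: (measurable_funM (measurable_cst _) (measurable_funB (mE _) (mE _))). Qed.

Let n1 : `|1 : R| = 1. Proof. exact: normr1. Qed.
Let nN1 : `|-1 : R| = 1. Proof. by rewrite normrN normr1. Qed.

Lemma measurable_first_variation : measurable_fun setT h.
Proof.
by apply: (@measurable_fun_cvg _ _ _ _ (quot 1)) => [k|x _]; [exact: mquot | exact: quot_cvg].
Qed.

Let mh := measurable_first_variation.

Let ih : mu.-integrable setT (EFin \o h).
Proof.
apply: (integrable_le mh idom) => x.
have c : `|quot 1 k x| @[k --> \oo] --> `|h x| by apply: cvg_norm; exact: quot_cvg.
rewrite -(cvg_lim _ c) //; apply: limr_le; first by apply/cvg_ex; exists `|h x|.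
by apply: nearW => k; exact: quot_le.
Qed.

Let iE t : `|t| <= 1 -> mu.-integrable setT (EFin \o E t).
Proof.
move=> t1; have i2 : mu.-integrable setT (EFin \o (fun x => `|E 0 x| + dom x)).
  rewrite (_ : _ \o _ = (fun x => (abse \o (EFin \o E 0)) x + (EFin \o dom) x)%E); last by apply/funext => x /=.
  by apply: (integrableD measurableT _ idom); exact: integrable_abse.
apply: (integrable_le (mE t) i2) => x.
rewrite -[E t x](subrK (E 0 x)) addrC (le_trans (ler_normD _ _)) // lerD2l.
apply: (le_trans (E_lip x t1)); rewrite ler_piMl //.
by have := E_lip x (_ : `|1| <= 1); rewrite n1 lexx mul1r => /(_ isT); apply: le_trans.
Qed.

(** Multiplied by [e], the difference quotients of the integral are nonnegative at a minimum, and so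
    is the limit. The two signs together force the limit to be 0. *)
Let variation_sign e : `|e| = 1 -> 0 <= e * \int[mu]_x h x.
Proof.
move=> e1.
have aec : {ae mu, forall x, quot e k x @[k --> \oo] --> h x} by apply: aeW => x; exact: quot_cvg.
have aed : {ae mu, forall x, forall k, `|quot e k x| <= dom x} by apply: aeW => x k; exact: quot_le.
have c := Rintegral_cvg (mquot e) mh aec idom aed.
have {}c : e * \int[mu]_x quot e k x @[k --> \oo] --> e * \int[mu]_x h x by exact: cvgMr.
rewrite -(cvg_lim _ c) //; apply: limr_ge; first by apply/cvg_ex; exists (e * \int[mu]_x h x).
apply: nearW => k.
have i1 := iE (step_le1 k e1); have i01 := iE0.
have -> : \int[mu]_x quot e k x = (step e k)^-1 * (\int[mu]_x E (step e k) x - \int[mu]_x E 0 x).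
  rewrite /quot -(RintegralB measurableT i1 i01) -(RintegralZl _ measurableT) //.
  exact: (integrableB measurableT i1 i01).
have -> : e * ((step e k)^-1 * (\int[mu]_x E (step e k) x - \int[mu]_x E 0 x)) =
    k.+1%:R * (\int[mu]_x E (step e k) x - \int[mu]_x E 0 x).
  rewrite mulrA; congr (_ * _); rewrite /step invfM invrK mulrA divff ?mul1r //.
  by rewrite -normr_eq0 e1 oner_eq0.
rewrite mulr_ge0 // subr_ge0 /Rintegral fine_le ?integrable_fin_num //.
exact: (E_min (step_le1 k e1)).
Qed.

Lemma first_variation_eq0 : (\int[mu]_x (h x)%:E = 0)%E.
Proof.
have h1 := variation_sign n1; have h2 := variation_sign nN1.
have z : \int[mu]_x h x = 0 by lra.
have e : (\int[mu]_x (h x)%:E = (\int[mu]_x h x)%:E)%E.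
  by rewrite /Rintegral fineK // (integrable_fin_num measurableT ih).
by rewrite e z.
Qed.

End first_variation.

(** * Measurability and regularity of integrands *)

Section integrands.
Context {R : realType}.

(** The vector and the matrix are packed into one row vector, to which [measurable_caratheodory]
    applies. *)
Lemma measurable_caratheodory_pair d (T : measurableType d) a b c (F : T -> 'rV[R]_a -> 'M[R]_(b, c) -> R)
    (w : T -> 'rV[R]_a) (G : T -> 'M[R]_(b, c)) :
  (forall y A, measurable_fun setT (fun x => F x y A)) ->
  (forall x, continuous (fun z : 'rV[R]_a * 'M[R]_(b, c) => F x z.1 z.2)) ->
  (forall i, measurable_fun setT (fun x => w x 0 i)) ->
  (forall i j, measurable_fun setT (fun x => G x i j)) ->
  measurable_fun setT (fun x => F x (w x) (G x)).
Proof.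
move=> mF cF mw mG.
pose S (y : 'rV[R]_(a + b * c)) : 'rV[R]_a * 'M[R]_(b, c) := (lsubmx y, vec_mx (rsubmx y)).
(* Both sides carry sup norms and [S] only rearranges entries, so balls go into balls of the same
   radius. *)
have cS : continuous S.
  move=> y A /nbhs_ballP[e e0 hA]; apply/nbhs_ballP; exists e => // y' h; apply: hA.
  by case: h => _ h; split; split=> // i j; rewrite !mxE; exact: h.
rewrite (_ : (fun x => _) = (fun x => F x (S (row_mx (w x) (mxvec (G x)))).1
    (S (row_mx (w x) (mxvec (G x)))).2)); last first.
  by apply/funext => x; rewrite /S /= row_mxKl row_mxKr mxvecK.
apply: (@measurable_caratheodory R d T (a + b * c) (fun x y => F x (S y).1 (S y).2)
  (fun x => row_mx (w x) (mxvec (G x)))).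
- by move=> v; exact: mF.
- by move=> x y; apply: (cvg_comp S (fun z => F x z.1 z.2)); [exact: cS | exact: cF].
- move=> i; rewrite -(splitK i); case: (fintype.split i) => k /=.
    by under eq_fun do rewrite row_mxEl; exact: mw.
  case/mxvec_indexP : k => i' j'.
  by under eq_fun do rewrite row_mxEr mxvecE; exact: mG.
Qed.

Lemma C1_cst (V : normedModType R) (k : R) : C1 (fun _ : V => k).
Proof.
split; first by move=> z; exact: differentiable_cst.
move=> v; rewrite (_ : 'D_v _ = fun=> 0); first exact: cst_continuous.
by apply/funext => z; exact: derive_cst.
Qed.

Lemma gradient_cst m k (c : R) (A : 'M[R]_(m, k)) : gradient (fun=> c) A = 0.
Proof. by apply/matrixP => i j; rewrite !mxE derive_cst. Qed.

End integrands.

(** * Repair of the integrand on a null set *)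

Section regular_integrand.
Context {R : realType} {n : nat}.
Variables (W : 'rV[R]_n -> 'rV[R]_n -> 'M[R]_n -> R) (a : 'rV[R]_n -> R) (alpha c p : R).

Definition regular_at (V : 'rV[R]_n -> 'M[R]_n -> R) (b : R) :=
  C1 (fun z : 'rV[R]_n * 'M[R]_n => V z.1 z.2) /\
  forall y F, `|V y F| + fnorm (gradient (V^~ F) y) + fnorm (gradient (V y) F) <=
    b + c * (fnorm y `^ alpha + fnorm F `^ p).

(** The hypotheses on [W] hold almost everywhere, while the first variation asks for derivatives at
    every point. Setting [W] to 0 on the exceptional set provides them, and completeness of the
    measure preserves measurability. The absolute value of [a] keeps the growth bound nonnegative on
    that set. *)
Lemma regular_representative : 0 < c ->
  (forall y F, measurable_fun [set: Leb_space R n] (fun x => W x y F)) ->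
  {ae leb R n, forall x, regular_at (W x) (a x)} ->
  exists V, [/\ forall y F, measurable_fun [set: Leb_space R n] (fun x => V x y F),
    forall x, regular_at (V x) `|a x| & {ae leb R n, forall x, W x = V x}].
Proof.
move=> c0 mW hW; pose V x y F := if `[< regular_at (W x) (a x) >] then W x y F else 0.
have WV : {ae leb R n, forall x, W x = V x}.
  apply: ae_imp hW => x hx; apply/funext => y; apply/funext => F; rewrite /V.
  by case: asboolP.
exists V; split; [| | exact: WV].
  move=> y F; apply: ae_eq_measurable_Leb (mW y F).
  by apply: ae_imp WV => x ->.
move=> x; rewrite /V; case: asboolP => [[h1 h2]|_].
  split=> // y F; apply: (le_trans (h2 y F)); rewrite lerD2r; exact: ler_norm.
split=> [|y F]; first exact: C1_cst.
have z m k : fnorm (0 : 'M[R]_(m, k)) = 0 by rewrite -(scale0r (0 : 'M[R]_(m, k))) fnorm_scale normr0 mul0r.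
rewrite !gradient_cst normr0 !z !addr0 addr_ge0 // mulr_ge0 ?(ltW c0) //.
by apply: addr_ge0; exact: powR_ge0.
Qed.

End regular_integrand.

(** * Vanishing of the first variation of the energy *)

Section vanishing_variation.
Context {R : realType} {n : nat}.
Variables (V : 'rV[R]_n -> 'rV[R]_n -> 'M[R]_n -> R) (a : 'rV[R]_n -> R) (alpha c p M : R).
Variables (u v : 'rV[R]_n -> 'rV[R]_n) (G A : 'rV[R]_n -> 'M[R]_n).
Local Notation L := (leb R n).
Local Notation Leb := (Leb_space R n).
Hypotheses (alpha0 : 0 <= alpha) (c0 : 0 < c) (p0 : 0 <= p) (M0 : 0 <= M).
Hypothesis ia : L.-integrable [set: Leb] (EFin \o a).
Hypothesis mV : forall y F, measurable_fun [set: Leb] (fun x => V x y F).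
Hypothesis rV : forall x, regular_at alpha c p (V x) `|a x|.
Hypotheses (mu_ : forall i j, measurable_fun [set: Leb] (fun x => u x i j))
  (mv_ : forall i j, measurable_fun [set: Leb] (fun x => v x i j))
  (mG_ : forall i j, measurable_fun [set: Leb] (fun x => G x i j))
  (mA_ : forall i j, measurable_fun [set: Leb] (fun x => A x i j)).
Hypotheses (Iu : (\int[L]_x (fnorm (u x) `^ alpha)%:E < +oo)%E)
  (Iv : (\int[L]_x (fnorm (v x) `^ alpha)%:E < +oo)%E)
  (IG : (\int[L]_x (fnorm (G x) `^ p)%:E < +oo)%E)
  (IA : (\int[L]_x (fnorm (A x) `^ p)%:E < +oo)%E).
Hypotheses (vM : forall x i, `|v x 0 i| <= M) (AM : forall x i j, `|A x i j| <= M).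

Definition perturbed_integrand (t : R) (x : 'rV[R]_n) : R := V x (u x + t *: v x) (G x + t *: A x).
Local Notation E := perturbed_integrand.

Lemma measurable_perturbed_integrand t : measurable_fun [set: Leb] (E t).
Proof.
apply: (@measurable_caratheodory_pair R _ Leb n n n V (fun x => u x + t *: v x) (fun x => G x + t *: A x)).
- exact: mV.
- by move=> x z; apply: differentiable_continuous; exact: (rV x).1.1.
- move=> i; rewrite (_ : (fun x => _) = (fun x => u x 0 i + t * v x 0 i)); last by apply/funext => x; rewrite !mxE.
  exact: (measurable_funD (mu_ 0 i) (measurable_funM (measurable_cst _) (mv_ 0 i))).
- move=> i j; rewrite (_ : (fun x => _) = (fun x => G x i j + t * A x i j)); last by apply/funext => x; rewrite !mxE.
  exact: (measurable_funD (mG_ i j) (measurable_funM (measurable_cst _) (mA_ i j))).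
Qed.

Let intD (f g : 'rV[R]_n -> R) : L.-integrable [set: Leb] (EFin \o f) -> L.-integrable [set: Leb] (EFin \o g) ->
  L.-integrable [set: Leb] (EFin \o (fun x => f x + g x)).
Proof. by move=> i1 i2; exact: (integrableD measurableT i1 i2). Qed.

Let intZ (k : R) (f : 'rV[R]_n -> R) : L.-integrable [set: Leb] (EFin \o f) ->
  L.-integrable [set: Leb] (EFin \o (fun x => k * f x)).
Proof. by move=> i1; exact: (integrableZl measurableT k i1). Qed.

Let intp m k q (f : 'rV[R]_n -> 'M[R]_(m, k)) :
  (forall i j, measurable_fun [set: Leb] (fun x => f x i j)) ->
  (\int[L]_x (fnorm (f x) `^ q)%:E < +oo)%E ->
  L.-integrable [set: Leb] (EFin \o (fun x => fnorm (f x) `^ q)).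
Proof.
move=> mf fi; apply/integrableP; split; first by apply/measurable_EFinP; exact: measurable_fnorm_pow.
rewrite (_ : (fun x : Leb => _) = (fun x : Leb => (fnorm (f x) `^ q)%:E)) //.
by apply/funext => x /=; rewrite ger0_norm // powR_ge0.
Qed.

Let dE x : is_derive (0 : R) (1 : R) (E^~ x) (dir_derivative (V x) (u x) (G x) (v x) (A x)).
Proof. by have := is_derive_dir (rV x).1 (u x) (G x) (v x) (A x) 0; rewrite !scale0r !addr0. Qed.

Lemma measurable_dir_derivative :
  measurable_fun [set: Leb] (fun x => dir_derivative (V x) (u x) (G x) (v x) (A x)).
Proof. exact: (measurable_first_variation measurable_perturbed_integrand dE). Qed.

Lemma variation_eq0 :
  (forall t, `|t| <= 1 -> (\int[L]_x (E 0 x)%:E <= \int[L]_x (E t x)%:E)%E) ->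
  (\int[L]_x (dir_derivative (V x) (u x) (G x) (v x) (A x))%:E = 0)%E.
Proof.
move=> Emin.
have [K1 K10 hK1] := @fnormD_pow_le R 1 n alpha alpha0.
have [K2 K20 hK2] := @fnormD_pow_le R n n p p0.
(* Dominates the growth bound at every [u + r t v], [G + r t A] with [|r t| <= 1]; [K1] and [K2] are
   the constants of the quasi-triangle inequality for powers of norms. *)
pose b x := `|a x| + c * (K1 * (fnorm (u x) `^ alpha + fnorm (v x) `^ alpha) +
                          K2 * (fnorm (G x) `^ p + fnorm (A x) `^ p)).
pose dom x := (n + n * n)%:R * M * b x.
have iabs : L.-integrable [set: Leb] (EFin \o (fun x => `|a x|)) by exact: (integrable_abse ia).
have iu := intp mu_ Iu; have iv := intp mv_ Iv; have iG := intp mG_ IG; have iA := intp mA_ IA.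
have idom : L.-integrable [set: Leb] (EFin \o dom).
  exact: (intZ _ (intD iabs (intZ c (intD (intZ K1 (intD iu iv)) (intZ K2 (intD iG iA)))))).
have E0 x : E 0 x = V x (u x) (G x) by rewrite /perturbed_integrand !scale0r !addr0.
apply: (@first_variation_eq0 _ Leb R L E _ dom measurable_perturbed_integrand idom _ _ dE Emin).
- have i0 := intD iabs (intZ c (intD iu iG)).
  apply: (integrable_le (measurable_perturbed_integrand 0) i0) => x.
  rewrite E0; apply: le_trans ((rV x).2 _ _); rewrite -addrA lerDl addr_ge0 //; exact: fnorm_ge0.
- move=> t x t1; rewrite E0.
  have [r /andP[r0 r1] h] := increment_le (rV x).1 (u x) (G x) t (normr_ge0 (a x)) (ltW c0) M0 (rV x).2 (vM x) (AM x).
  apply: (le_trans h); rewrite ler_wpM2l // /dom ler_wpM2l ?mulr_ge0 //.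
  have rt : `|r| * `|t| <= 1 by rewrite mulr_ile1 // ger0_norm.
  have shrink m k (B : 'M[R]_(m, k)) q : 0 <= q -> fnorm (r *: (t *: B)) `^ q <= fnorm B `^ q.
    move=> q0; apply: ge0_ler_powR; rewrite ?nnegrE ?fnorm_ge0 //.
    by rewrite !fnorm_scale mulrA ler_piMl ?fnorm_ge0.
  rewrite lerD2l ler_wpM2l ?(ltW c0) //; apply: lerD.
    by apply: (le_trans (hK1 _ _)); rewrite ler_wpM2l // lerD2l shrink.
  by apply: (le_trans (hK2 _ _)); rewrite ler_wpM2l // lerD2l shrink.
Qed.

End vanishing_variation.

(** * The Euler-Lagrange system *)

Lemma decay_bounded (R : realType) n m k (s : R) (f : 'rV[R]_n -> 'M[R]_(m, k)) : 0 < s ->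
  (forall i j, exists C, forall x, `|f x i j| <= C * decay s x) ->
  exists2 M, 0 <= M & forall x i j, `|f x i j| <= M.
Proof.
move=> s0 hf; have /choice[C hC] : forall ij : 'I_m * 'I_k, exists C, forall x, `|f x ij.1 ij.2| <= C * decay s x.
  by move=> ij; exact: hf.
exists (\sum_ij `|C ij|); first exact: sumr_ge0.
move=> x i j; apply: (le_trans (hC (i, j) x)); apply: (@le_trans _ _ `|C (i, j)|).
  apply: (le_trans (ler_norm _)); rewrite normrM ler_piMr // ger0_norm ?decay_ge0 //; exact: decay_le1.
by rewrite (bigD1 (i, j)) //= lerDl sumr_ge0.
Qed.

Theorem theorem6p2 (R : realType) (n : nat) (hn : (0 < n)%N)
  (s p : R) (hs0 : 0 < s) (hs1 : s < 1) (hp : 1 < p)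
  (Omega : set 'rV[R]_n) (hOo : open Omega) (hOb : bounded_set Omega)
  (W : 'rV[R]_n -> 'rV[R]_n -> 'M[R]_n -> R)
  (W_meas : forall (u : 'rV[R]_n) (F : 'M[R]_n),
     measurable_fun [set: Leb_space R n] (fun x => W x u F))
  (W_C1 : {ae leb R n, forall x : 'rV[R]_n,
     C1 (fun z : 'rV[R]_n * 'M[R]_n => W x z.1 z.2)})
  (W_growth : exists (a : 'rV[R]_n -> R) (alpha c : R),
     [/\ (leb R n).-integrable [set: Leb_space R n] (EFin \o a),
         p <= alpha,
         s * p < n%:R -> alpha <= n%:R * p / (n%:R - s * p),
         0 < c &
         {ae leb R n, forall x : 'rV[R]_n, forall (u : 'rV[R]_n) (F : 'M[R]_n),
           `|W x u F| + fnorm (dW_du W x u F) + fnorm (dW_dF W x u F)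
           <= a x + c * (fnorm u `^ alpha + fnorm F `^ p)}])
  (g : 'rV[R]_n -> 'rV[R]_n) (hg : Hsp s p g)
  (u : 'rV[R]_n -> 'rV[R]_n) (hu : minimizer s p Omega g W u) :
  weak_solution s p Omega g W u.
Proof.
have s0 := hs0; have p0 : 0 < p by exact: lt_trans hp.
have [a [alpha [c [ia palpha halpha c0 growth]]]] := W_growth.
have alpha0 : 0 < alpha by exact: lt_le_trans palpha.
have [[Hu ug] umin] := hu.
split; first by split.
move=> v hv v0; pose G := Hsp_grad s p u; pose A := frac_grad s v.
have hG : is_frac_grad s p u G by exact: Hsp_grad_is_frac_grad.
have [mu_ _] := (in_LpP _ p0).1 Hu.1.
have [mG_ IG] := (in_LpP _ p0).1 hG.1.
have [mA_ IA] := (in_LpP _ p0).1 (frac_grad_in_Lp hn hs0 hs1 (ltW hp) hv).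
have alpha1 : 1 <= alpha by exact: le_trans (ltW hp) palpha.
have [mv_ Iv] := (in_LpP _ alpha0).1 (Cc_infty_in_Lp hn hs0 alpha1 hv).
have Iu := Hsp_embedding hn hs0 hs1 hp Hu palpha halpha.
have [M1 M10 vM] : exists2 M, 0 <= M & forall x i j, `|v x i j| <= M.
  apply: (decay_bounded hs0) => i j; rewrite (ord1 i); exact: (Cc_infty_decay hs0 j hv).
have [M2 M20 AM] : exists2 M, 0 <= M & forall x i j, `|A x i j| <= M.
  by apply: (decay_bounded hs0) => i j; exact: (frac_grad_decay hn hs0 hs1 i j hv).
have reg : {ae leb R n, forall x, regular_at alpha c p (W x) (a x)}.
  by apply: ae_imp2 W_C1 growth => x h1 h2; split.
have [V [mV rV WV]] := regular_representative c0 W_meas reg.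
have M0 : 0 <= Num.max M1 M2 by rewrite le_max M10.
have vM' x i : `|v x 0 i| <= Num.max M1 M2 by rewrite le_max vM.
have AM' x i j : `|A x i j| <= Num.max M1 M2 by rewrite le_max AM orbT.
have mE t : measurable_fun [set: Leb_space R n] (perturbed_integrand V u v G A t).
  exact: (measurable_perturbed_integrand mV rV mu_ mv_ mG_ mA_).
(* The gradient chosen at [u + t v] agrees almost everywhere with [G + t A] by uniqueness, and [W]
   with its regular version [V]. *)
have energyE t : energy s p W (fun x => u x + t *: v x) =
    (\int[leb R n]_x (perturbed_integrand V u v G A t x)%:E)%E.
  have Hw : Hsp s p (fun x => u x + t *: v x) by exact: Hsp_add.
  have hw := Hsp_grad_is_frac_grad Hw.
  have hw' := is_frac_grad_add hn hs0 hs1 hp t hG hv.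
  have eqE : {ae leb R n, forall x, perturbed_integrand V u v G A t x =
      W x (u x + t *: v x) (Hsp_grad s p (fun x => u x + t *: v x) x)}.
    apply: ae_imp2 WV (is_frac_grad_unique hn hs0 hs1 hp Hw.1 hw hw') => x e1 e2.
    by rewrite /perturbed_integrand e1 e2.
  apply: ae_eq_integral.
  - exact: measurableT.
  - by apply/measurable_EFinP; exact: ae_eq_measurable_Leb eqE (mE t).
  - by apply/measurable_EFinP; exact: mE.
  - by apply: ae_imp eqE => x e _; rewrite e.
have Emin t : `|t| <= 1 -> (\int[leb R n]_x (perturbed_integrand V u v G A 0 x)%:E <=
    \int[leb R n]_x (perturbed_integrand V u v G A t x)%:E)%E.
  move=> _; rewrite -!energyE.
  have -> : (fun x => u x + 0 *: v x) = u by apply/funext => x; rewrite scale0r addr0.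
  (* Adding [t v] preserves the exterior condition, since [v] vanishes off [Omega]. *)
  apply: umin; split; first exact: Hsp_add.
  by apply: ae_imp ug => x ux hx; rewrite (ux hx) (v0 x hx) scaler0 addr0.
have := variation_eq0 (ltW alpha0) c0 (ltW p0) M0 ia mV rV mu_ mv_ mG_ mA_ Iu Iv IG IA vM' AM' Emin.
have mh := measurable_dir_derivative mV rV mu_ mv_ mG_ mA_.
have eqh : {ae leb R n, forall x, dir_derivative (V x) (u x) (G x) (v x) (A x) =
    fdot (dW_dF W x (u x) (G x)) (A x) + fdot (dW_du W x (u x) (G x)) (v x)}.
  by apply: ae_imp WV => x e; rewrite /dir_derivative /dW_dF /dW_du e.
move=> <-; apply: ae_eq_integral.
- exact: measurableT.
- by apply/measurable_EFinP; exact: ae_eq_measurable_Leb eqh mh.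
- by apply/measurable_EFinP; exact: mh.
- by apply: ae_imp eqh => x e _; rewrite e.
Qed.
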